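(* Let $b_1,b_2:[0,1]\to\mathbb{R}^4$ be maps each of whose coordinate functions is a polynomial in $t$, such that $\Pi_t=\mathrm{span}(b_1(t),b_2(t))$ is a two-dimensional subspace of $\mathbb{R}^4$ for every $t\in[0,1]$. Let $P_t:\mathbb{R}^4\to\Pi_t$ be the orthogonal projection onto $\Pi_t$. Assume that for every linear subspace $\pi$ of $\mathbb{R}^4$ one has $\dim P_t(\pi)=\min(\dim\pi,2)$ for all but finitely many $t\in[0,1]$. Then there exists a constant $\epsilon>0$, depending only on the family $(P_t)_{t\in[0,1]}$, such that for every Borel set $A\subset\mathbb{R}^4$ with $\dim_H A=2$ one has $\dim_H P_t(A)>1+\epsilon$ for almost every $t\in[0,1]$.
   Context: $\dim_H$ denotes Hausdorff dimension, and $\dim$ of a linear subspace is its linear dimension. ''Almost every $t$'' is with respect to Lebesgue measure on $[0,1]$. The finite exceptional set of $t$ in the hypothesis may depend on the subspace $\pi$. *)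

(* Defs.v *)
From HB Require Import structures.
From mathcomp Require Import all_boot all_order all_algebra.
From mathcomp Require Import all_classical all_reals all_analysis.

Set Implicit Arguments.
Unset Strict Implicit.
Unset Printing Implicit Defensive.

Import Order.TTheory GRing.Theory Num.Theory.
Import numFieldNormedType.Exports.

Local Open Scope classical_set_scope.
Local Open Scope ring_scope.

(* Vectors of R^n are row vectors, linear subspaces are row spaces of matrices
   (so their dimension is \rank), and linear maps act by right multiplication. *)

Definition polynomial_on (R : realType) (D : set R) (f : R -> R) : Prop :=
  exists p : {poly R}, forall t, D t -> f t = p.[t].

(* The real counterpart of [proj_ortho], which the library provides only over
   a numClosedFieldType. *)
Definition orthoproj (R : realType) (m n : nat) (U : 'M[R]_(m, n)) : 'M[R]_n :=
  proj_mx <<U>>%MS (orthomx idfun 1%:M U).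

(* The library's norm on matrices is the sup norm; Hausdorff measures are
   taken here with respect to the Euclidean metric. *)
Definition enorm (R : realType) (n : nat) (v : 'rV[R]_n) : R :=
  Num.sqrt (\sum_i v 0 i ^+ 2).

(* [diam set0] is [-oo]; the empty set is discarded from the sums below. *)
Definition diam (R : realType) (n : nat) (E : set 'rV[R]_n) : \bar R :=
  ereal_sup [set (enorm (x - y))%:E | x in E & y in E].

(* A nonempty set contributes [diam ^ s], with [0 ^ 0 = 1], so that for [s = 0]
   this counts the nonempty sets of the cover. *)
Definition hausdorff_premeasure (R : realType) (n : nat) (s delta : R)
    (A : set 'rV[R]_n) : \bar R :=
  ereal_inf [set (\sum_(k <oo | F k != set0) poweR (diam (F k)) s)%E
            | F in [set F : (set 'rV[R]_n)^nat |
                     A `<=` \bigcup_k F k /\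
                     forall k, (diam (F k) <= delta%:E)%E]].

Definition hausdorff_measure (R : realType) (n : nat) (s : R)
    (A : set 'rV[R]_n) : \bar R :=
  ereal_sup [set hausdorff_premeasure s delta A
            | delta in [set delta : R | 0 < delta]].

Definition hausdorff_dim (R : realType) (n : nat) (A : set 'rV[R]_n) : \bar R :=
  ereal_inf [set s%:E | s in [set s : R | 0 <= s /\
                                hausdorff_measure s A = 0%E]].

Definition borel_set (T : topologicalType) (A : set T) : Prop :=
  <<s [set U : set T | open U] >> A.

(* Main.v *)
(* Let B_t be the 4 x 2 matrix with columns b1(t), b2(t); since x B_t only depends
   on the projection of x, it suffices to bound the dimension of A B_t below.
   Suppose that it is at most 1 + e for t in a set of positive measure, pick a
   random point x of A with a Frostman law of exponent 2 - e, and measure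
   discretised vectors at scale 2^-k by their entropy, in units of k ln 2.

   For two generic directions a, b put X = x B_a, Y = x B_b; then x B_t is, up to
   an invertible map, X + Y phi_t with phi_t rational in t.  All of X, Y and
   X + Y phi_t have entropy about 1 and (X, Y) has entropy about 2.  By
   submodularity X + Y psi still has entropy about 1 for psi a sum of boundedly
   many phi_{t_i}.  Let (X', Y') be a copy of (X, Y) conditioned on X' + Y' psi
   and X + Y psi being equal, so that u + v psi is about 0 with (u, v) the
   difference of the two pairs.  By transversality a Wronskian-like polynomial
   W(x, y, z) does not vanish identically, whence v phi_t' takes two separated
   directions among the t_i; for given (u, v) with v not small few tuples (t_i)
   satisfy the relation.  Hence, for some tuple, (X, Y) and (X', Y') are mostly
   close at scale 2^(-k/4), so that (X, Y) has too small an entropy at that scale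
   for the Frostman condition.

   All losses are powers of the mass 2^(-e k), which is why e can be chosen before
   the scale.  Borel sets are analytic, which replaces A by a decreasing sequence
   of subsets of large dyadic content that behaves like a compact set; so the
   exceptional directions are met at finitely many scales, where they lie in few
   dyadic intervals. *)
Require Import Defs.
From HB Require Import structures.
From mathcomp Require Import all_boot all_order all_algebra.
From mathcomp Require Import all_classical all_reals all_analysis.
From mathcomp Require Import perm ring lra zify.

Set Implicit Arguments.
Unset Strict Implicit.
Unset Printing Implicit Defensive.

Import Order.TTheory GRing.Theory Num.Theory.
Import numFieldNormedType.Exports.

Local Open Scope classical_set_scope.
Local Open Scope ring_scope.

(** * Entropy on finite probability spaces *)

(** Why a sum of several maps [phi] has to be used. Let X and Y have about 2^k cells each. The
    coupled law of (X, Y) and (X', Y') has entropy about 3k, so the relation u + v psi = 0 must be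
    shown to have far fewer than 2^(3k) solutions with v not small, out of 2^(4k) quadruples of
    cells. If one direction t varied and |v| were at least 2^-j, a given quadruple could satisfy the
    relation for about 2^j of the 2^k directions, leaving 2^(3k + j) solutions: too many. If two
    summands vary, at which v phi' has transversal directions, both parameters are pinned down and
    2^(2k + 2j) solutions are left. Taking j = k/4 makes this 2^(5k/2); the deficit k/2 forces v to
    be small with probability close to 1. One further direction o occurs in no sum: its map [phi]
    bounds the entropy of differences of copies of Y, which the sumset inequality requires. The set
    of points with few images depends on the direction. As the tuples have a length fixed by the
    family, averaging yields a tuple whose sets meet in a mass that is a fixed power of 2^(-e k). *)

Section entropy.
Variable R : realType.

Lemma ln_le_sub1 (x : R) : 0 < x -> ln x <= x - 1.
Proof.
move=> x0; rewrite -{1}(subrK 1 x) addrC; apply: le_ln1Dx.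
by rewrite ltrBDl subrr.
Qed.

Section basic.
Variables (W : finType) (p : W -> R).
Hypothesis p_ge0 : forall w, 0 <= p w.

(** The probability that [f] takes the value it has at [w]. Laws enter only through this function on
    the sample space, so the type of values may be infinite; [ent] is then Shannon entropy with
    natural logarithms. *)
Definition cls (T : eqType) (f : W -> T) (w : W) : R :=
  \sum_(w' | f w' == f w) p w'.

Definition ent (T : eqType) (f : W -> T) : R :=
  - \sum_w p w * ln (cls f w).

Lemma cls_ge (T : eqType) (f : W -> T) w : p w <= cls f w.
Proof. by rewrite /cls (bigD1 w) //= lerDl sumr_ge0. Qed.

Lemma cls_ge0 (T : eqType) (f : W -> T) w : 0 <= cls f w.
Proof. exact: sumr_ge0. Qed.

Lemma cls_gt0 (T : eqType) (f : W -> T) w : p w != 0 -> 0 < cls f w.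
Proof.
by move=> h; apply: lt_le_trans (cls_ge f w); rewrite lt_def h p_ge0.
Qed.

Lemma cls_eq (T : eqType) (f : W -> T) w w' : f w = f w' -> cls f w = cls f w'.
Proof. by rewrite /cls => ->. Qed.

Lemma cls_le (T T' : eqType) (f : W -> T) (g : W -> T') w :
  (forall w', p w' != 0 -> f w' = f w -> g w' = g w) -> cls f w <= cls g w.
Proof.
move=> h; rewrite /cls big_mkcond [leRHS]big_mkcond; apply: ler_sum => w' _.
have [->|pw] := eqVneq (p w') 0; first by rewrite !if_same.
by case: (f w' =P f w) => [/(h _ pw) ->|_]; rewrite ?eqxx //; case: ifP.
Qed.

(** Each fibre of [f] has total weight at most 1 under [p w / cls f w], so that the sum counts
    values. Sums over values are written in this way throughout. *)
Lemma sum_div_cls (T : eqType) (f : W -> T) (S : pred W) (l : seq T) :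
  (forall w, S w -> p w != 0 -> f w \in l) ->
  \sum_(w | S w) p w / cls f w <= (size l)%:R.
Proof.
move=> h.
apply: (@le_trans _ _ (\sum_(t <- l) \sum_(w | f w == t) p w / cls f w)).
  rewrite (exchange_big_dep xpredT) //= [leRHS](bigID S) /=.
  rewrite -[leLHS]addr0 lerD //.
    apply: ler_sum => w Sw; have [->|pw] := eqVneq (p w) 0.
      by rewrite mul0r sumr_ge0 // => *; rewrite mul0r.
    have fl := h w Sw pw; rewrite -big_filter.
    rewrite (big_rem (f w)) /=; last by rewrite mem_filter eqxx.
    by rewrite lerDl sumr_ge0 // => *; rewrite divr_ge0 ?cls_ge0.
  by rewrite sumr_ge0 // => *; rewrite sumr_ge0 // => *; rewrite divr_ge0 ?cls_ge0.
apply: (@le_trans _ _ (\sum_(t <- l) 1)); last first.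
  by rewrite big_const_seq count_predT iter_addr addr0.
apply: ler_sum => t _.
rewrite (eq_bigr (fun w => p w / \sum_(w' | f w' == t) p w')); last first.
  by move=> w /eqP <-.
rewrite -mulr_suml; set s := \sum_(_ | _) _.
have [->|s0] := eqVneq s 0; first by rewrite mul0r ler01.
by rewrite divff.
Qed.

(** The left side is the mass of the trial law that gives every value of [(f, g)] the weight of its
    [f]-fibre; divided by [n] it is admissible in Gibbs' inequality. After exchanging the sums, each
    [w'] counts the values of [g] on its own fibre. *)
Lemma sum_cond_cls (T T' : eqType) (f : W -> T) (g : W -> T') (n : nat)
    (S : pred W) :
  (forall w, S w -> p w != 0 -> exists2 l : seq T', (size l <= n)%N &
     forall w', S w' -> p w' != 0 -> f w' = f w -> g w' \in l) ->
  \sum_(w | S w) p w / cls (fun v => (f v, g v)) w * cls f w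
    <= n%:R * \sum_w p w.
Proof.
move=> h.
under eq_bigr do rewrite mulr_sumr.
rewrite (exchange_big_dep xpredT) //= mulr_sumr; apply: ler_sum => w' _.
rewrite -mulr_suml mulrC [leRHS]mulrC; apply: ler_wpM2l => //.
case: (pickP (fun w => [&& S w, p w != 0 & f w == f w'])) => [v|noS]; last first.
  rewrite big1 ?ler0n // => w /andP[Sw fw].
  have := noS w; rewrite Sw (eq_sym (f w)) fw andbT /=.
  by move/negbFE/eqP => ->; rewrite mul0r.
case/and3P => Sv pv /eqP fv; have [l sl hl] := h v Sv pv.
apply: (@le_trans _ _ (size (map (pair (f v)) l))%:R); last first.
  by rewrite size_map ler_nat.
apply: sum_div_cls => w /andP[Sw /eqP fw] pw.
have fwv : f w = f v by rewrite -fw fv.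
by rewrite fwv; apply: map_f; apply: hl.
Qed.

Hypothesis p_sum1 : \sum_w p w = 1.

Lemma cls_le1 (T : eqType) (f : W -> T) w : cls f w <= 1.
Proof.
rewrite -p_sum1 /cls [leRHS](bigID (fun w' => f w' == f w)) /= lerDl.
exact: sumr_ge0.
Qed.

(** When [q] is constant on the fibres of [f], it is a trial law on the values of [f], and the
    second hypothesis says that its mass is at most 1. The inequality is [ln y <= y - 1] at
    [y = q w / cls f w], averaged. *)
Lemma ent_gibbs (T : eqType) (f : W -> T) (q : W -> R) :
  (forall w, p w != 0 -> 0 < q w) ->
  \sum_w p w / cls f w * q w <= 1 ->
  ent f <= - \sum_w p w * ln (q w).
Proof.
move=> q0 h; rewrite /ent lerN2 -subr_ge0 -sumrB.
apply: (@le_trans _ _ (\sum_w p w - \sum_w p w / cls f w * q w)).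
  by rewrite p_sum1 subr_ge0.
rewrite -sumrB; apply: ler_sum => w _; rewrite -mulrBr.
have [->|pw] := eqVneq (p w) 0; first by rewrite !mul0r subrr.
rewrite -mulrA -{1}[p w]mulr1 -mulrBr; apply: ler_wpM2l => //.
have c0 := cls_gt0 f pw.
have := @ln_le_sub1 (q w / cls f w) (divr_gt0 (q0 w pw) c0).
rewrite lnM ?posrE ?invr_gt0 ?q0 // lnV ?posrE // mulrC; lra.
Qed.

Lemma ent_mono (T T' : eqType) (f : W -> T) (g : W -> T') :
  (forall w w', p w != 0 -> p w' != 0 -> f w' = f w -> g w' = g w) ->
  ent g <= ent f.
Proof.
move=> h; rewrite /ent lerN2; apply: ler_sum => w _.
have [->|pw] := eqVneq (p w) 0; first by rewrite !mul0r.
apply: ler_wpM2l => //; rewrite ler_ln ?posrE ?cls_gt0 //.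
by apply: cls_le => w' pw'; apply: h.
Qed.

Lemma ent_ge (T : eqType) (f : W -> T) (a : R) : 0 < a ->
  (forall w, p w != 0 -> cls f w <= a) -> - ln a <= ent f.
Proof.
move=> a0 h; rewrite /ent lerN2 -[ln a]mul1r -p_sum1 mulr_suml.
apply: ler_sum => w _; have [->|pw] := eqVneq (p w) 0; first by rewrite !mul0r.
by apply: ler_wpM2l => //; rewrite ler_ln ?posrE ?cls_gt0 // h.
Qed.

Lemma sum_p_le1 (S : pred W) : \sum_(w | S w) p w <= 1.
Proof.
by rewrite -p_sum1 [leRHS](bigID S) /= lerDl; apply: sumr_ge0.
Qed.

(* Gibbs' inequality against the mixture, with weights 1/2, of two conditional
   laws of [g] given [f] supported on [S] and on its complement. *)
Lemma ent_split (T T' : eqType) (f : W -> T) (g : W -> T') (n m : nat)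
    (S : pred W) : (0 < n)%N -> (0 < m)%N ->
  (forall w, S w -> p w != 0 -> exists2 l : seq T', (size l <= n)%N &
     forall w', S w' -> p w' != 0 -> f w' = f w -> g w' \in l) ->
  (forall w, ~~ S w -> p w != 0 -> exists2 l : seq T', (size l <= m)%N &
     forall w', ~~ S w' -> p w' != 0 -> f w' = f w -> g w' \in l) ->
  ent (fun w => (f w, g w)) <= ent f + ln 2 +
    (\sum_(w | S w) p w) * ln n%:R + (\sum_(w | ~~ S w) p w) * ln m%:R.
Proof.
move=> n0 m0 hn hm.
pose q w := cls f w / (2 * (if S w then n else m)%:R).
have d0 w : 0 < (2 * (if S w then n else m)%:R) :> R.
  by rewrite mulr_gt0 // ltr0n; case: (S w).
have q0 w : p w != 0 -> 0 < q w.
  by move=> pw; rewrite divr_gt0 ?cls_gt0.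
apply: le_trans (ent_gibbs q0 _) _.
  rewrite (bigID S) /=.
  rewrite [X in X + _ <= _](_ : _ = (\sum_(w | S w)
    p w / cls (fun v => (f v, g v)) w * cls f w) / (2 * n%:R)); last first.
    by rewrite mulr_suml; apply: eq_bigr => w Sw; rewrite /q Sw !mulrA.
  rewrite [X in _ + X <= _](_ : _ = (\sum_(w | ~~ S w)
    p w / cls (fun v => (f v, g v)) w * cls f w) / (2 * m%:R)); last first.
    by rewrite mulr_suml; apply: eq_bigr => w /negbTE Sw; rewrite /q Sw !mulrA.
  have h1 := sum_cond_cls hn; have h2 := sum_cond_cls hm.
  rewrite !p_sum1 !mulr1 in h1 h2.
  have half (x y : R) : x <= y -> 0 < y -> x / (2 * y) <= 2^-1.
    by move=> xy y0; rewrite ler_pdivrMr ?mulr_gt0 // mulrA mulVf ?mul1r.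
  apply: le_trans (lerD (half _ _ h1 _) (half _ _ h2 _)) _; rewrite ?ltr0n //.
  lra.
have -> : - \sum_w p w * ln (q w) =
   \sum_w (- (p w * ln (cls f w)) + p w * ln 2 +
     p w * ln (if S w then n else m)%:R).
  rewrite -sumrN; apply: eq_bigr => w _.
  have [->|pw] := eqVneq (p w) 0; first by rewrite !mul0r oppr0 !addr0.
  rewrite /q lnM ?posrE ?invr_gt0 ?d0 ?cls_gt0 // lnV ?posrE // lnM ?posrE //;
    last by rewrite ltr0n; case: (S w).
  ring.
rewrite big_split big_split /= -/(ent f) sumrN -/(ent f).
rewrite -mulr_suml p_sum1 mul1r -[leRHS]addrA lerD2l.
rewrite (bigID S) /= !mulr_suml.
by apply: lerD; apply: ler_sum => w; [move=> ->|move/negbTE => ->].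
Qed.

(** Gibbs' inequality with the trial law that is uniform on [n] values given [f]. *)
Lemma ent_cond_le (T T' : eqType) (f : W -> T) (g : W -> T') (n : nat) :
  (0 < n)%N ->
  (forall w, p w != 0 -> exists2 l : seq T', (size l <= n)%N &
     forall w', p w' != 0 -> f w' = f w -> g w' \in l) ->
  ent (fun w => (f w, g w)) <= ent f + ln n%:R.
Proof.
move=> n0 h.
have q0 w : p w != 0 -> 0 < cls f w / n%:R.
  by move=> pw; rewrite divr_gt0 ?cls_gt0 ?ltr0n.
apply: le_trans (ent_gibbs q0 _) _.
  under eq_bigr do rewrite mulrA.
  rewrite -mulr_suml ler_pdivrMr ?ltr0n // mul1r.
  have := @sum_cond_cls _ _ f g n xpredT; rewrite p_sum1 mulr1; apply.
  by move=> w _ pw; have [l ? hl] := h w pw; exists l => // w' _; apply: hl.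
have -> : - \sum_w p w * ln (cls f w / n%:R) =
   \sum_w (- (p w * ln (cls f w)) + p w * ln n%:R).
  rewrite -sumrN; apply: eq_bigr => w _.
  have [->|pw] := eqVneq (p w) 0; first by rewrite !mul0r oppr0 !addr0.
  rewrite lnM ?posrE ?invr_gt0 ?ltr0n ?cls_gt0 // lnV ?posrE ?ltr0n //; ring.
by rewrite big_split /= sumrN -/(ent f) -mulr_suml p_sum1 mul1r.
Qed.

Lemma ent_const (T : eqType) (c : T) : ent (fun=> c) = 0.
Proof.
rewrite /ent big1 ?oppr0 // => w _.
rewrite /cls (eq_bigl xpredT) => [|w' /=]; last by rewrite eqxx.
by rewrite p_sum1 ln1 mulr0.
Qed.

Lemma ent_le_ln (T : eqType) (f : W -> T) (l : seq T) (n : nat) :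
  (0 < n)%N -> (size l <= n)%N ->
  (forall w, p w != 0 -> f w \in l) -> ent f <= ln n%:R.
Proof.
move=> n0 sl h; rewrite -[leRHS]add0r -(ent_const tt).
apply: (@le_trans _ _ (ent (fun w => (tt, f w)))).
  by apply: ent_mono => w w' _ _ [].
by apply: ent_cond_le => // w pw; exists l => // w' pw' _; apply: h.
Qed.

Lemma sum_cls_div (T : eqType) (f : W -> T) w0 :
  \sum_(w | f w == f w0) p w / cls f w <= 1.
Proof. by apply: (@sum_div_cls _ f _ [:: f w0]) => w /eqP -> _; rewrite inE. Qed.

(** Gibbs' inequality for the trial law that makes [a] and [b] independent given [c]. Its mass is
    computed by expanding both classes into sums over [w1] and [w2] and summing over [w] first. *)
Lemma ent_submod (T1 T2 T3 : eqType) (a : W -> T1) (b : W -> T2) (c : W -> T3) :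
  ent (fun w => (a w, b w, c w)) + ent c <=
  ent (fun w => (a w, c w)) + ent (fun w => (b w, c w)).
Proof.
pose ac w := (a w, c w); pose bc w := (b w, c w); pose abc w := (a w, b w, c w).
pose q w := cls ac w * cls bc w / cls c w.
have q0 w : p w != 0 -> 0 < q w by move=> pw; rewrite !(divr_gt0, mulr_gt0, cls_gt0).
have h : ent abc <= - \sum_w p w * ln (q w).
  apply: ent_gibbs => //.
  have E w : p w / cls abc w * q w = \sum_(w1 | ac w1 == ac w)
      \sum_(w2 | bc w2 == bc w) p w1 * p w2 / cls c w1 * (p w / cls abc w).
    rewrite /q /cls -/ac -/bc !mulr_suml mulr_sumr; apply: eq_bigr => w1.
    rewrite xpair_eqE => /andP[_ /eqP cw].
    rewrite mulr_sumr mulr_suml mulr_sumr; apply: eq_bigr => w2 _.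
    by rewrite cw; ring.
  under eq_bigr do rewrite E.
  rewrite (exchange_big_dep xpredT) //=.
  rewrite -p_sum1; apply: ler_sum => w1 _.
  rewrite (exchange_big_dep (fun w2 => c w2 == c w1)) /=; last first.
    move=> w w2; rewrite !xpair_eqE => /andP[_ /eqP ->] /andP[_ /eqP ->].
    by rewrite eqxx.
  have [->|pw1] := eqVneq (p w1) 0.
    by rewrite big1 // => *; rewrite big1 // => *; rewrite !mul0r.
  have c0 := cls_gt0 c pw1.
  apply: (@le_trans _ _ (\sum_(w2 | c w2 == c w1) p w1 * p w2 / cls c w1)).
    apply: ler_sum => w2 /eqP cw2.
    rewrite -mulr_sumr -[leRHS]mulr1; apply: ler_wpM2l.
      by rewrite !mulr_ge0 // invr_ge0 cls_ge0.
    (* All [w] compatible with [w1] and [w2] share one value of [abc], so their weights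
       [p w / cls abc w] add up to at most 1. *)
    case: (pickP (fun w => (ac w1 == ac w) && (bc w2 == bc w))) => [w0|no].
      move=> /andP[]; rewrite !xpair_eqE => /andP[/eqP e1 /eqP e2] /andP[/eqP e3 /eqP e4].
      apply: le_trans (sum_cls_div abc w0).
      rewrite [leRHS](bigID (fun w => (ac w1 == ac w) && (bc w2 == bc w))) /=.
      rewrite -[leLHS]addr0 lerD //; last first.
        by rewrite sumr_ge0 // => *; rewrite divr_ge0 ?cls_ge0.
      rewrite le_eqVlt; apply/orP; left; apply/eqP; apply: eq_bigl => w.
      rewrite !xpair_eqE e1 e2 e3 e4 -e1 -e2 -e3.
      rewrite (eq_sym (a w1)) (eq_sym (b w2)) (eq_sym (c w1)).
      by case: (a w == _); case: (b w == _); case: (c w == _).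
    by rewrite big_pred0 // ler01.
  rewrite -mulr_suml -mulr_sumr -/(cls c w1) mulfK //.
  by rewrite gt_eqF.
move: h; have -> : - \sum_w p w * ln (q w) = ent ac + ent bc - ent c.
  rewrite /ent opprK -!opprD -sumrN.
  rewrite [X in _ = X + _]opprD -!sumrN -!big_split /=; apply: eq_bigr => w _.
  have [->|pw] := eqVneq (p w) 0; first by rewrite !mul0r; lra.
  rewrite /q lnM ?posrE ?invr_gt0 ?mulr_gt0 ?cls_gt0 // lnV ?posrE ?cls_gt0 //.
  rewrite lnM ?posrE ?cls_gt0 //; ring.
by rewrite lerBrDr.
Qed.

Lemma ent_pair_le (T1 T2 : eqType) (a : W -> T1) (b : W -> T2) :
  ent (fun w => (a w, b w)) <= ent a + ent b.
Proof.
have := ent_submod a b (fun=> tt); rewrite ent_const addr0.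
have -> : ent (fun w => (a w, tt)) = ent a.
  by apply/le_anti/andP; split; apply: ent_mono => w w' _ _; [move=> ->|case].
have -> : ent (fun w => (b w, tt)) = ent b.
  by apply/le_anti/andP; split; apply: ent_mono => w w' _ _; [move=> ->|case].
by move=> h; apply: le_trans h; apply: ent_mono => w w' _ _ [-> ->].
Qed.

(** The form in which sumset estimates are used: [a] and [b] each nearly determine [c], and together
    they nearly determine [j]. Rounding prevents exact determination, hence the error terms. *)
Lemma ent_submod_approx (T1 T2 T3 T4 : eqType) (a : W -> T1) (b : W -> T2)
    (c : W -> T3) (j : W -> T4) (x1 x2 x3 : R) :
  ent (fun w => ((a w, b w), j w)) <= ent (fun w => (a w, b w)) + x1 ->
  ent (fun w => (a w, c w)) <= ent a + x2 ->
  ent (fun w => (b w, c w)) <= ent b + x3 ->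
  ent j + ent c <= ent a + ent b + (x1 + x2 + x3).
Proof.
move=> h1 h2 h3; have := ent_submod a b c.
have : ent (fun w => (a w, b w)) <= ent (fun w => (a w, b w, c w)).
  by apply: ent_mono => w w' _ _ [-> ->].
have : ent j <= ent (fun w => ((a w, b w), j w)).
  by apply: ent_mono => w w' _ _ [].
lra.
Qed.

End basic.

Section transfer.
Variables (W W' : finType) (p : W -> R) (p' : W' -> R) (h : W' -> W).
Hypothesis law : forall w, \sum_(w' | h w' == w) p' w' = p w.

Lemma cls_comp (T : eqType) (f : W -> T) w' : cls p' (f \o h) w' = cls p f (h w').
Proof.
rewrite /cls [RHS](eq_bigr (fun w => \sum_(w' | h w' == w) p' w')) //.
rewrite (exchange_big_dep xpredT) //= [RHS](bigID (fun v => f (h v) == f (h w'))) /=.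
rewrite [X in _ = _ + X]big1 ?addr0 => [|v hv]; last first.
  by rewrite big1 // => w /andP[/eqP hw /eqP hv']; rewrite hv' hw eqxx in hv.
apply: eq_bigr => v /eqP hv.
rewrite (big_pred1 (h v)) // => w; rewrite /= [RHS]eq_sym.
by case: (h v =P w) => [<-|]; rewrite ?hv ?eqxx ?andbF ?andbT.
Qed.

Lemma ent_comp (T : eqType) (f : W -> T) : ent p' (f \o h) = ent p f.
Proof.
rewrite /ent; congr (- _); under eq_bigr do rewrite cls_comp.
rewrite (partition_big h xpredT) //=; apply: eq_bigr => w _.
by rewrite -law mulr_suml; apply: eq_bigr => w' /eqP ->.
Qed.

End transfer.

Section coupling.
Variables (W1 W2 : finType) (p1 : W1 -> R) (p2 : W2 -> R).
Hypotheses (p1_ge0 : forall w, 0 <= p1 w) (p2_ge0 : forall w, 0 <= p2 w).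
Variables (T : eqType) (f1 : W1 -> T) (f2 : W2 -> T).
Hypothesis same_law : forall t,
  \sum_(w | f1 w == t) p1 w = \sum_(w | f2 w == t) p2 w.

(** The coupling of the two laws along a common value of [f1] and [f2], conditionally independent
    given that value. *)
Definition couple (w : W1 * W2) : R :=
  if f1 w.1 == f2 w.2 then p1 w.1 * p2 w.2 / cls p1 f1 w.1 else 0.

Lemma couple_ge0 w : 0 <= couple w.
Proof.
by rewrite /couple; case: ifP => // _; rewrite divr_ge0 ?mulr_ge0 ?cls_ge0.
Qed.

Lemma couple_eq w : couple w != 0 -> f1 w.1 = f2 w.2.
Proof. by rewrite /couple; case: (f1 _ =P f2 _) => // _ /eqP. Qed.

Lemma couple_law1 w : \sum_(v | v.1 == w) couple v = p1 w.
Proof.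
rewrite (eq_bigl (fun v => (v.1 == w) && true)); last by move=> v; rewrite andbT.
rewrite -(pair_big_dep (fun w1 => w1 == w) (fun _ _ => true)
  (fun w1 w2 => couple (w1, w2))) /=.
rewrite big_pred1_eq /couple /= -big_mkcond /= -mulr_suml -mulr_sumr.
rewrite (eq_bigl (fun i => f2 i == f1 w)); last by move=> i; rewrite eq_sym.
rewrite -same_law -/(cls p1 f1 w).
have [->|pw] := eqVneq (p1 w) 0; first by rewrite !mul0r.
by rewrite mulfK // gt_eqF // cls_gt0.
Qed.

Lemma couple_law2 w : \sum_(v | v.2 == w) couple v = p2 w.
Proof.
rewrite (eq_bigl (fun v => true && (v.2 == w))); last by move=> v.
rewrite -(pair_big_dep (fun=> true) (fun _ w2 => w2 == w)
  (fun w1 w2 => couple (w1, w2))) /=.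
under eq_bigr do rewrite big_pred1_eq.
rewrite /couple /= -big_mkcond /=.
under eq_bigr => i /eqP fi.
  rewrite /cls fi mulrAC mulrC; over.
rewrite -mulr_sumr -mulr_suml same_law.
have [->|pw] := eqVneq (p2 w) 0; first by rewrite !mul0r.
by rewrite divff ?mulr1 // gt_eqF // (cls_gt0 p2_ge0 f2 pw).
Qed.

Lemma couple_sum1 : \sum_w p1 w = 1 -> \sum_w couple w = 1.
Proof.
move=> <-; rewrite (partition_big fst xpredT) //=.
by apply: eq_bigr => w _; rewrite couple_law1.
Qed.

(** Given the common value the two sides are independent, so conditional entropies add; as [g1] and
    [g2] both determine that value, its entropy is counted once too often. *)
Lemma ent_couple (T1 T2 : eqType) (g1 : W1 -> T1) (g2 : W2 -> T2) :
  (forall w w', g1 w = g1 w' -> f1 w = f1 w') ->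
  (forall w w', g2 w = g2 w' -> f2 w = f2 w') ->
  ent couple (fun w => (g1 w.1, g2 w.2)) = ent p1 g1 + ent p2 g2 - ent p1 f1.
Proof.
move=> h1 h2.
rewrite -(ent_comp couple_law1 g1) -(ent_comp couple_law2 g2).
rewrite -(ent_comp couple_law1 f1) /ent opprK -opprD addrC -[RHS]opprB.
congr (- _); rewrite -big_split -sumrB /=; apply: eq_bigr => -[w1 w2] _.
have [->|cw] := eqVneq (couple (w1, w2)) 0; first by rewrite !mul0r; lra.
have /= f12 := couple_eq cw.
rewrite (cls_comp couple_law1) (cls_comp couple_law2) (cls_comp couple_law1) /=.
have p1w : p1 w1 != 0.
  by apply: contra cw => /eqP h; rewrite /couple /= h !mul0r if_same.
have p2w : p2 w2 != 0.
  by apply: contra cw => /eqP h; rewrite /couple /= h mulr0 mul0r if_same.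
have -> : cls couple (fun w => (g1 w.1, g2 w.2)) (w1, w2) =
    cls p1 g1 w1 * cls p2 g2 w2 / cls p1 f1 w1.
  rewrite {1}/cls.
  rewrite (eq_bigl (fun v => (g1 v.1 == g1 w1) && (g2 v.2 == g2 w2))); last first.
    by move=> v; rewrite xpair_eqE.
  rewrite -(pair_big_dep (fun v => g1 v == g1 w1) (fun _ v => g2 v == g2 w2)
    (fun v1 v2 => couple (v1, v2))) /=.
  set c := cls p1 f1 w1; rewrite [in RHS]/cls mulr_suml mulr_suml; apply: eq_bigr => v1 /eqP /h1 e1.
  rewrite mulr_sumr mulr_suml; apply: eq_bigr => v2 /eqP /h2 e2.
  by rewrite /couple /= e1 e2 f12 eqxx /c -(cls_eq p1 e1).
rewrite lnM ?posrE ?invr_gt0 ?mulr_gt0 ?cls_gt0 // lnV ?posrE ?cls_gt0 //.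
rewrite lnM ?posrE ?cls_gt0 //; ring.
Qed.

End coupling.
End entropy.

(** * Discretisation *)

Section disc.
Variable R : realType.

Lemma mx_coord_le (m n : nat) (A : 'M[R]_(m, n)) i j : `|A i j| <= `|A|.
Proof.
rewrite [leRHS]/Num.norm /= mx_normrE.
exact: (le_bigmax _ (fun ij : 'I_m * 'I_n => `|A ij.1 ij.2|) (i, j)).
Qed.

Lemma mx_norm_le (m n : nat) (A : 'M[R]_(m, n)) (c : R) : 0 <= c ->
  (forall i j, `|A i j| <= c) -> `|A| <= c.
Proof.
move=> c0 h; rewrite [leLHS]/Num.norm /= mx_normrE.
by apply: bigmax_le => // -[i j] _; apply: h.
Qed.

Lemma mx_norm_lt (m n : nat) (A : 'M[R]_(m, n)) (c : R) : 0 < c ->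
  (forall i j, `|A i j| < c) -> `|A| < c.
Proof.
move=> c0 h; rewrite [ltLHS]/Num.norm /= mx_normrE.
by apply: bigmax_lt => // -[i j] _; apply: h.
Qed.

Lemma norm_mulmx (m n p : nat) (A : 'M[R]_(m, n)) (B : 'M[R]_(n, p)) :
  `|A *m B| <= n%:R * (`|A| * `|B|).
Proof.
apply: mx_norm_le => [|i j]; first by rewrite !mulr_ge0.
rewrite mxE; apply: le_trans (ler_norm_sum _ _ _) _.
apply: (@le_trans _ _ (\sum_(k < n) `|A| * `|B|)).
  by apply: ler_sum => k _; rewrite normrM ler_pM // mx_coord_le.
by rewrite sumr_const card_ord mulr_natl.
Qed.

Definition disc (n : nat) (d : R) (v : 'rV[R]_n) : 'rV[int]_n :=
  \row_i Num.floor (v 0 i / d).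

Lemma abs_div_gt0 (x d : R) : 0 < d -> `|x / d| = `|x| / d.
Proof. by move=> d0; rewrite normf_div (gtr0_norm d0). Qed.

Lemma disc_eq_dist (n : nat) (d : R) (u v : 'rV[R]_n) : 0 < d ->
  disc d u = disc d v -> `|u - v| <= d.
Proof.
move=> d0 h; apply: mx_norm_le => [|i j]; first exact: ltW.
rewrite (ord1 i) !mxE.
have := congr1 (fun x : 'rV[int]_n => x 0 j) h; rewrite !mxE => e.
have e1 := floor_le (u 0 j / d); have e2 := floorD1_gt (u 0 j / d).
have e3 := floor_le (v 0 j / d); have e4 := floorD1_gt (v 0 j / d).
rewrite intrD mulr1z in e2; rewrite intrD mulr1z in e4; rewrite -e in e3 e4.
rewrite -[leRHS]mul1r -ler_pdivrMr // -(abs_div_gt0 _ d0) mulrBl ler_norml; lra.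
Qed.

(** Cell indices of points at distance [M * d] differ by at most [M + 1] in each coordinate, whence
    [2 * M + 3] offsets; the shift by [M.+1] makes them natural numbers. *)
Lemma disc_near (n : nat) (d : R) (M : nat) (u : 'rV[R]_n) : 0 < d ->
  exists2 l : seq 'rV[int]_n, size l = ((2 * M + 3) ^ n)%N &
    forall v, `|v - u| <= M%:R * d -> disc d v \in l.
Proof.
move=> d0.
exists [seq \row_i (disc d u 0 i + (f i)%:Z - M.+1%:Z)
   | f : {ffun 'I_n -> 'I_(2 * M + 3)}].
  by rewrite size_map -cardE card_ffun !card_ord.
move=> v vu.
have b i : 0 <= disc d v 0 i - disc d u 0 i + M.+1%:Z < (2 * M + 3)%N%:Z.
  have := le_trans (mx_coord_le (v - u) 0 i) vu; rewrite !mxE.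
  rewrite -ler_pdivrMr // -(abs_div_gt0 _ d0) mulrBl ler_norml.
  have e1 := floor_le (u 0 i / d); have e2 := floorD1_gt (u 0 i / d).
  have e3 := floor_le (v 0 i / d); have e4 := floorD1_gt (v 0 i / d).
  rewrite intrD mulr1z in e2; rewrite intrD mulr1z in e4.
  set a := Num.floor (u 0 i / d) in e1 e2 *.
  set c := Num.floor (v 0 i / d) in e3 e4 *.
  move=> /andP[h1 h2].
  have lt1 : ((a - c)%:~R < (M.+1)%:Z%:~R :> R).
    by rewrite intrB [M.+1%:Z%:~R](_ : _ = M%:R + 1) ?mulrS ?[1 + _]addrC //; lra.
  have lt2 : ((c - a)%:~R < (M.+1)%:Z%:~R :> R).
    by rewrite intrB [M.+1%:Z%:~R](_ : _ = M%:R + 1) ?mulrS ?[1 + _]addrC //; lra.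
  rewrite ltr_int in lt1; rewrite ltr_int in lt2; lia.
have b' i : (`|(disc d v 0 i - disc d u 0 i + M.+1%:Z)%R| < 2 * M + 3)%N.
  by have := b i; lia.
apply/mapP; exists [ffun i => Ordinal (b' i)]; first by rewrite mem_enum.
apply/rowP => i; rewrite [RHS]mxE ffunE /= gez0_abs; last by case/andP: (b i).
by ring.
Qed.

End disc.

Section discent.
Variables (R : realType) (W : finType) (p : W -> R).
Hypotheses (p_ge0 : forall w, 0 <= p w) (p_sum1 : \sum_w p w = 1).

(** Every approximate identity between rounded quantities is used through this bound: recording one
    more quantity that is known up to [M] cells costs a bounded entropy. *)
Lemma ent_disc_cond (n : nat) (T : eqType) (f : W -> T) (g : W -> 'rV[R]_n)
    (d : R) (M : nat) : 0 < d ->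
  (forall w w', p w != 0 -> p w' != 0 -> f w' = f w -> `|g w' - g w| <= M%:R * d) ->
  ent p (fun w => (f w, disc d (g w))) <= ent p f + n%:R * ln (2 * M + 3)%:R.
Proof.
move=> d0 h.
have -> : n%:R * ln (2 * M + 3)%:R = ln (((2 * M + 3) ^ n)%N%:R) :> R.
  by rewrite natrX lnXn ?mulr_natl // ltr0n addn_gt0 orbT.
apply: ent_cond_le => // [|w pw]; first by rewrite expn_gt0 addn_gt0 orbT.
have [l sl hl] := disc_near M (g w) d0.
by exists l; rewrite ?sl // => w' pw' fw; apply/hl/h.
Qed.

Lemma ent_disc_le (n k : nat) (f : W -> 'rV[R]_k) (g : W -> 'rV[R]_n)
    (d : R) (M : nat) : 0 < d ->
  (forall w w', `|f w' - f w| <= d -> `|g w' - g w| <= M%:R * d) ->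
  ent p (fun w => disc d (g w)) <=
  ent p (fun w => disc d (f w)) + n%:R * ln (2 * M + 3)%:R.
Proof.
move=> d0 h; apply: le_trans (ent_disc_cond (f := fun w => disc d (f w)) (g := g) (M := M) d0 _).
  by apply: ent_mono => // w w' _ _; case.
by move=> w w' _ _ e; apply: h; apply: disc_eq_dist.
Qed.

End discent.

(** * Entropy of sums of linear images *)

Lemma ler_normD_le (R : numDomainType) (Z : normedZmodType R) (u v : Z) (a b : R) :
  `|u| <= a -> `|v| <= b -> `|u + v| <= a + b.
Proof. by move=> ua vb; apply: le_trans (ler_normD _ _) _; apply: lerD. Qed.

Lemma ler_normB_le (R : numDomainType) (Z : normedZmodType R) (u v : Z) (a b : R) :
  `|u| <= a -> `|v| <= b -> `|u - v| <= a + b.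
Proof. by move=> ua vb; apply: ler_normD_le; rewrite ?normrN. Qed.

Section triple.
Variables (R : realType) (V : finType) (q : V -> R).
Hypotheses (q_ge0 : forall v, 0 <= q v) (q_sum1 : \sum_v q v = 1).
Variables (X0 X1 X2 Y0 Y1 Y2 : V -> 'rV[R]_2) (d : R) (M : nat).
Variables (psi1 psi2 phi phi' : 'M[R]_2) (h c c1 c2 hxy : R).
Hypothesis d_gt0 : 0 < d.
Hypotheses (M1 : `|psi1| <= M%:R) (M2 : `|psi2| <= M%:R) (M' : `|phi'| <= M%:R)
  (M0 : `|phi| <= M%:R) (phiK : phi *m phi' = 1%:M).

Let D (g : V -> 'rV[R]_2) v := disc d (g v).

Hypothesis X01 : forall v, q v != 0 -> D X1 v = D X0 v.
Hypothesis X02 : forall v, q v != 0 -> D X2 v = D X0 v.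
Hypothesis HX : ent q (D X0) <= h.
Hypotheses (HY0 : ent q (D Y0) <= h) (HY1 : ent q (D Y1) <= h)
  (HY2 : ent q (D Y2) <= h).
Hypotheses (HP0 : ent q (fun v => (D X0 v, D Y0 v)) = hxy)
  (HP1 : ent q (fun v => (D X1 v, D Y1 v)) = hxy)
  (HP2 : ent q (fun v => (D X2 v, D Y2 v)) = hxy) (Hhxy : 2 * h - c <= hxy).
Hypothesis H3 : 3 * hxy - 2 * ent q (D X0) <=
  ent q (fun v => ((D X0 v, D Y0 v), (D X1 v, D Y1 v), (D X2 v, D Y2 v))).
Hypotheses (HZ0 : ent q (D (fun v => X0 v + Y0 v *m phi)) <= h)
  (HZ1 : ent q (D (fun v => X1 v + Y1 v *m phi)) <= h)
  (HZ2 : ent q (D (fun v => X2 v + Y2 v *m phi)) <= h).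
Hypotheses (HV1 : ent q (D (fun v => X1 v + Y1 v *m psi1)) <= h + c1)
  (HV2 : ent q (D (fun v => X2 v + Y2 v *m psi2)) <= h + c2).

(** Every error in this section is at most [(8 * M + 4) * d], so that one use of [condl] costs
    [l]. *)
Let l : R := 2%:R * ln (2 * (8 * M + 4) + 3)%:R.

Let mulM (y : 'rV[R]_2) (A : 'M[R]_2) (b : R) : `|A| <= M%:R -> `|y| <= b ->
  `|y *m A| <= 2 * b * M%:R.
Proof.
move=> hA hy; apply: le_trans (norm_mulmx _ _) _; rewrite -mulrA.
by apply: ler_wpM2l => //; apply: ler_pM.
Qed.

Let condl (T : eqType) (f : V -> T) (g : V -> 'rV[R]_2) :
  (forall w w', q w != 0 -> q w' != 0 -> f w' = f w ->
     `|g w' - g w| <= (8 * M%:R + 4) * d) ->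
  ent q (fun w => (f w, disc d (g w))) <= ent q f + l.
Proof.
move=> H; apply: ent_disc_cond => // w w' qw qw' fw.
by apply: le_trans (H _ _ qw qw' fw) _; rewrite natrD natrM.
Qed.

Let Dd (g : V -> 'rV[R]_2) w w' : D g w' = D g w -> `|g w' - g w| <= d.
Proof. exact: disc_eq_dist. Qed.

Let Ddb (g g' : V -> 'rV[R]_2) w w' : disc d (g w) = disc d (g' w') -> `|g w - g' w'| <= d.
Proof. exact: disc_eq_dist. Qed.

Let Md : 0 <= M%:R * d. Proof. by rewrite mulr_ge0 // ltW. Qed.

(** [H3] is what conditional independence of the three copies of Y given the cell of X yields. By
    submodularity, forgetting one copy loses at most [hxy - H(X0)]; there remains [2 * hxy - H(X0)],
    which is at least [3 * h - 2 * c]. *)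
Let pair_low (Xl Yl : V -> 'rV[R]_2) (T : eqType) (jj : V -> T) :
  ent q (fun v => (D Xl v, D Yl v)) = hxy ->
  (forall v, q v != 0 -> D Xl v = D X0 v) ->
  (forall w w', q w != 0 -> q w' != 0 ->
    (jj w', D Yl w', D X0 w') = (jj w, D Yl w, D X0 w) ->
    ((D X0 w', D Y0 w'), (D X1 w', D Y1 w'), (D X2 w', D Y2 w')) =
    ((D X0 w, D Y0 w), (D X1 w, D Y1 w), (D X2 w, D Y2 w))) ->
  3 * h - 2 * c <= ent q (fun v => (jj v, D X0 v)).
Proof.
move=> Hl Xl0 Hj.
have s : ent q (fun w => (jj w, D Yl w, D X0 w)) + ent q (D X0) <=
    ent q (fun w => (jj w, D X0 w)) + ent q (fun w => (D Yl w, D X0 w)).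
  exact: ent_submod.
have m1 : ent q (fun v => ((D X0 v, D Y0 v), (D X1 v, D Y1 v), (D X2 v, D Y2 v)))
    <= ent q (fun v => (jj v, D Yl v, D X0 v)).
  by apply: ent_mono => // w w' qw qw' e; apply: Hj.
have m2 : ent q (fun v => (D Yl v, D X0 v)) <= hxy.
  rewrite -Hl; apply: ent_mono => // w w' qw qw' [e1 e2].
  by rewrite e2 -!Xl0 // e1.
have t1 := H3; have t2 := HX; have t3 := Hhxy.
lra.
Qed.

Let U v := X0 v + Y1 v *m psi1 + Y2 v *m psi2.

(** As the three X agree up to rounding, [(X1 + Y1 psi1, Y2)] and [(X2 + Y2 psi2, Y1)] each
    determine [U]; together they recover [X0], [Y1] and [Y2], and submodularity applies. *)
Let HU : ent q (D U) <= h + c1 + c2 + 2 * c + 3 * l.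
Proof.
pose A v := (D (fun v => X1 v + Y1 v *m psi1) v, D Y2 v).
pose B v := (D (fun v => X2 v + Y2 v *m psi2) v, D Y1 v).
pose j v := (D Y1 v, D Y2 v).
have a1 : ent q (fun w => ((A w, B w), (j w, D X0 w))) <=
    ent q (fun w => (A w, B w)) + l.
  apply: (@le_trans _ _ (ent q (fun w => ((A w, B w), disc d (X0 w))))).
    by apply: ent_mono => // w w' qw qw' [f1 e1 f2 e2 e]; rewrite /A /B /j f1 f2 e1 e2 /D e.
  apply: condl => w w' qw qw' [/Dd /= e1 _ _ /Dd e2].
  have x1 := Ddb (esym (X01 qw)); have x2 := Ddb (esym (X01 qw')).
  have -> : X0 w' - X0 w = (X0 w' - X1 w') - (X0 w - X1 w) +
     ((X1 w' + Y1 w' *m psi1 - (X1 w + Y1 w *m psi1)) - (Y1 w' - Y1 w) *m psi1).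
    by rewrite mulmxBl; apply/rowP => i; rewrite !mxE; ring.
  apply: le_trans (ler_normD_le (ler_normB_le x2 x1) (ler_normB_le e1 (mulM M1 e2))) _.
  by have := Md; have := d_gt0; lra.
have a2 : ent q (fun w => (A w, D U w)) <= ent q A + l.
  apply: condl => w w' qw qw' [/Dd /= e1 /Dd e2].
  have x1 := Ddb (esym (X01 qw)); have x2 := Ddb (esym (X01 qw')).
  have -> : U w' - U w = (X0 w' - X1 w') - (X0 w - X1 w) +
     ((X1 w' + Y1 w' *m psi1 - (X1 w + Y1 w *m psi1)) + (Y2 w' - Y2 w) *m psi2).
    by rewrite mulmxBl; apply/rowP => i; rewrite !mxE; ring.
  apply: le_trans (ler_normD_le (ler_normB_le x2 x1) (ler_normD_le e1 (mulM M2 e2))) _.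
  by have := Md; have := d_gt0; lra.
have a3 : ent q (fun w => (B w, D U w)) <= ent q B + l.
  apply: condl => w w' qw qw' [/Dd /= e1 /Dd e2].
  have x1 := Ddb (esym (X02 qw)); have x2 := Ddb (esym (X02 qw')).
  have -> : U w' - U w = (X0 w' - X2 w') - (X0 w - X2 w) +
     ((X2 w' + Y2 w' *m psi2 - (X2 w + Y2 w *m psi2)) + (Y1 w' - Y1 w) *m psi1).
    by rewrite mulmxBl; apply/rowP => i; rewrite !mxE; ring.
  apply: le_trans (ler_normD_le (ler_normB_le x2 x1) (ler_normD_le e1 (mulM M1 e2))) _.
  by have := Md; have := d_gt0; lra.
have sub : ent q (fun w => (j w, D X0 w)) + ent q (D U) <=
    ent q A + ent q B + (l + l + l) by exact: ent_submod_approx a1 a2 a3.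
have pA : ent q A <= ent q (D (fun v => X1 v + Y1 v *m psi1)) + ent q (D Y2).
  exact: ent_pair_le.
have pB : ent q B <= ent q (D (fun v => X2 v + Y2 v *m psi2)) + ent q (D Y1).
  exact: ent_pair_le.
have L : 3 * h - 2 * c <= ent q (fun v => (j v, D X0 v)).
  apply: (pair_low HP0) => // w w' qw qw' [e1 e2 e3 e4].
  by rewrite (X01 qw) (X02 qw) (X01 qw') (X02 qw') e1 e2 e3 e4.
have t1 := HV1; have t2 := HV2; have t3 := HY1; have t4 := HY2.
lra.
Qed.

(** The difference [Y0 - Yi] is read off from [(Y0, Yi)], and also from the two quantities
    [X0 + Y0 phi] and [Xi + Yi phi]: subtracting them cancels the X, and [phi'] inverts [phi]. *)
Let HD (Xi Yi Xl Yl : V -> 'rV[R]_2) :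
  (forall v, q v != 0 -> D Xi v = D X0 v) ->
  (forall v, q v != 0 -> D Xl v = D X0 v) ->
  ent q (D Yi) <= h ->
  ent q (D (fun v => Xi v + Yi v *m phi)) <= h ->
  ent q (fun v => (D Xl v, D Yl v)) = hxy ->
  (forall w w', q w != 0 -> q w' != 0 ->
    (D Y0 w', D Yi w', D Yl w', D X0 w') = (D Y0 w, D Yi w, D Yl w, D X0 w) ->
    ((D X0 w', D Y0 w'), (D X1 w', D Y1 w'), (D X2 w', D Y2 w')) =
    ((D X0 w, D Y0 w), (D X1 w, D Y1 w), (D X2 w, D Y2 w))) ->
  ent q (D (fun v => Y0 v - Yi v)) <= h + 2 * c + 3 * l.
Proof.
move=> Xi0 Xl0 HYi HZi HPl Hj.
pose A v := (D (fun v => X0 v + Y0 v *m phi) v, D (fun v => Xi v + Yi v *m phi) v).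
pose B v := (D Y0 v, D Yi v).
have a1 : ent q (fun w => ((A w, B w), (B w, D X0 w))) <=
    ent q (fun w => (A w, B w)) + l.
  apply: (@le_trans _ _ (ent q (fun w => ((A w, B w), disc d (X0 w))))).
    by apply: ent_mono => // w w' qw qw' [f1 f2 e1 e2 e]; rewrite /A /B f1 f2 e1 e2 /D e.
  apply: condl => w w' qw qw' [/Dd /= e1 _ /Dd e2 _].
  have -> : X0 w' - X0 w =
     ((X0 w' + Y0 w' *m phi - (X0 w + Y0 w *m phi)) - (Y0 w' - Y0 w) *m phi).
    by rewrite mulmxBl; apply/rowP => i; rewrite !mxE; ring.
  apply: le_trans (ler_normB_le e1 (mulM M0 e2)) _.
  by have := Md; have := d_gt0; lra.
have a2 : ent q (fun w => (A w, D (fun v => Y0 v - Yi v) w)) <= ent q A + l.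
  apply: condl => w w' qw qw' [/Dd /= e1 /Dd /= e2].
  have x1 := Ddb (esym (Xi0 _ qw)); have x2 := Ddb (esym (Xi0 _ qw')).
  have -> : Y0 w' - Yi w' - (Y0 w - Yi w) =
    (((X0 w' + Y0 w' *m phi - (X0 w + Y0 w *m phi)) -
     (Xi w' + Yi w' *m phi - (Xi w + Yi w *m phi))) -
     ((X0 w' - Xi w') - (X0 w - Xi w))) *m phi'.
    rewrite -[LHS]mulmx1 -phiK mulmxA; congr (_ *m _).
    by rewrite !mulmxBl; apply/rowP => i; rewrite !mxE; ring.
  have e3 : `|((X0 w' + Y0 w' *m phi - (X0 w + Y0 w *m phi)) -
     (Xi w' + Yi w' *m phi - (Xi w + Yi w *m phi))) -
     ((X0 w' - Xi w') - (X0 w - Xi w))| <= 4 * d.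
    apply: le_trans (ler_normB_le (ler_normB_le e1 e2) (ler_normB_le x2 x1)) _.
    by have := d_gt0; lra.
  apply: le_trans (mulM M' e3) _; by have := Md; have := d_gt0; lra.
have a3 : ent q (fun w => (B w, D (fun v => Y0 v - Yi v) w)) <= ent q B + l.
  apply: condl => w w' qw qw' [/Dd /= e1 /Dd e2].
  have -> : Y0 w' - Yi w' - (Y0 w - Yi w) = (Y0 w' - Y0 w) - (Yi w' - Yi w).
    by apply/rowP => i; rewrite !mxE; ring.
  apply: le_trans (ler_normB_le e1 e2) _.
  by have := Md; have := d_gt0; lra.
have sub : ent q (fun w => (B w, D X0 w)) + ent q (D (fun v => Y0 v - Yi v)) <=
    ent q A + ent q B + (l + l + l) by exact: ent_submod_approx a1 a2 a3.
have pA : ent q A <= ent q (D (fun v => X0 v + Y0 v *m phi)) +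
   ent q (D (fun v => Xi v + Yi v *m phi)) by exact: ent_pair_le.
have pB : ent q B <= ent q (D Y0) + ent q (D Yi) by exact: ent_pair_le.
have L : 3 * h - 2 * c <= ent q (fun v => (B v, D X0 v)).
  exact: (pair_low HPl Xl0 Hj).
have t1 := HZ0; have t2 := HY0.
lra.
Qed.

(** The sum is a function of [(X0, Y0)], and also equals [U + (Y0 - Y1) psi1 + (Y0 - Y2) psi2]; both
    descriptions together recover the three copies. The loss [9 * c] consists of [2 * c] for each of
    [U], [Y0 - Y1], [Y0 - Y2], and of [3 * c] from the joint entropy; [13 * l] is [3 * l] for each
    of them and [4 * l] here. *)
Lemma triple_step :
  ent q (D (fun v => X0 v + Y0 v *m (psi1 + psi2))) <=
  h + c1 + c2 + 9 * c + 13 * l.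
Proof.
have HD1 : ent q (D (fun v => Y0 v - Y1 v)) <= h + 2 * c + 3 * l.
  apply: (@HD X1 Y1 X2 Y2) => // w w' qw qw' [e1 e2 e3 e4].
  by rewrite (X01 qw) (X02 qw) (X01 qw') (X02 qw') e1 e2 e3 e4.
have HD2 : ent q (D (fun v => Y0 v - Y2 v)) <= h + 2 * c + 3 * l.
  apply: (@HD X2 Y2 X1 Y1) => // w w' qw qw' [e1 e2 e3 e4].
  by rewrite (X01 qw) (X02 qw) (X01 qw') (X02 qw') e1 e2 e3 e4.
pose A v := (D X0 v, D Y0 v).
pose B v := (D (fun v => Y0 v - Y1 v) v, D (fun v => Y0 v - Y2 v) v, D U v).
pose v3 v := X0 v + Y0 v *m (psi1 + psi2).
pose j v := ((D X0 v, D Y0 v), (D X1 v, D Y1 v), (D X2 v, D Y2 v)).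
have a1 : ent q (fun w => ((A w, B w), j w)) <=
    ent q (fun w => (A w, B w)) + (l + l).
  pose E v := (A v, B v, disc d (Y1 v)).
  apply: (@le_trans _ _ (ent q (fun w => (E w, disc d (Y2 w))))).
    apply: ent_mono => // w w' qw qw' [e1 e2 f1 f2 f3 e3 e4].
    by rewrite /A /B /j f1 f2 f3 (X01 qw) (X02 qw) (X01 qw') (X02 qw') e1 e2 /D e3 e4.
  apply: (@le_trans _ _ (ent q E + l)).
    apply: condl => w w' qw qw' [_ /Dd e1 _ /Dd /= e2 _ _].
    have -> : Y2 w' - Y2 w = (Y0 w' - Y0 w) - (Y0 w' - Y2 w' - (Y0 w - Y2 w)).
      by apply/rowP => i; rewrite !mxE; ring.
    by apply: le_trans (ler_normB_le e1 e2) _; have := Md; have := d_gt0; lra.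
  rewrite addrA lerD2r; apply: condl => w w' qw qw' [_ /Dd e1 /Dd /= e2 _ _].
  have -> : Y1 w' - Y1 w = (Y0 w' - Y0 w) - (Y0 w' - Y1 w' - (Y0 w - Y1 w)).
    by apply/rowP => i; rewrite !mxE; ring.
  by apply: le_trans (ler_normB_le e1 e2) _; have := Md; have := d_gt0; lra.
have a2 : ent q (fun w => (A w, D v3 w)) <= ent q A + l.
  apply: condl => w w' qw qw' [/Dd e1 /Dd e2].
  have -> : v3 w' - v3 w = (X0 w' - X0 w) + ((Y0 w' - Y0 w) *m psi1 +
     (Y0 w' - Y0 w) *m psi2).
    by rewrite /v3 !mulmxBl !mulmxDr; apply/rowP => i; rewrite !mxE; ring.
  apply: le_trans (ler_normD_le e1 (ler_normD_le (mulM M1 e2) (mulM M2 e2))) _.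
  have := Md; have := d_gt0; lra.
have a3 : ent q (fun w => (B w, D v3 w)) <= ent q B + l.
  apply: condl => w w' qw qw' [/Dd /= e1 /Dd /= e2 /Dd e3].
  have -> : v3 w' - v3 w = (U w' - U w) +
     ((Y0 w' - Y1 w' - (Y0 w - Y1 w)) *m psi1 +
      (Y0 w' - Y2 w' - (Y0 w - Y2 w)) *m psi2).
    by rewrite /v3 /U !mulmxBl !mulmxDr; apply/rowP => i; rewrite !mxE; ring.
  apply: le_trans (ler_normD_le e3 (ler_normD_le (mulM M1 e1) (mulM M2 e2))) _.
  have := Md; have := d_gt0; lra.
have sub : ent q j + ent q (D v3) <=
    ent q A + ent q B + (l + l + l + l) .
  by have := ent_submod_approx q_ge0 q_sum1 a1 a2 a3; rewrite !addrA.
have pA : ent q A <= ent q (D X0) + ent q (D Y0) by exact: ent_pair_le.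
have pB : ent q B <= ent q (fun v => (D (fun v => Y0 v - Y1 v) v,
   D (fun v => Y0 v - Y2 v) v)) + ent q (D U) by exact: ent_pair_le.
have pC : ent q (fun v => (D (fun v => Y0 v - Y1 v) v,
   D (fun v => Y0 v - Y2 v) v)) <= ent q (D (fun v => Y0 v - Y1 v)) +
   ent q (D (fun v => Y0 v - Y2 v)) by exact: ent_pair_le.
have t1 := H3; have t2 := HU; have t3 := Hhxy; have t4 := HX; have t5 := HY0.
rewrite -/j in t1; rewrite -/v3; lra.
Qed.

End triple.

Section laws.
Variable R : realType.

Lemma law_push (W W' : finType) (p : W -> R) (p' : W' -> R) (f : W' -> W)
    (T : eqType) (g : W -> T) (t : T) :
  (forall w, \sum_(w' | f w' == w) p' w' = p w) ->
  \sum_(w' | g (f w') == t) p' w' = \sum_(w | g w == t) p w.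
Proof.
move=> law; rewrite (partition_big f (fun w => g w == t)) //=.
apply: eq_bigr => w gw; rewrite -law; apply: eq_bigl => w'.
by case: (f w' =P w) => [->|]; rewrite ?gw ?andbF.
Qed.

Lemma law_comp (W W' W'' : finType) (p : W -> R) (p' : W' -> R) (p'' : W'' -> R)
    (f : W' -> W) (g : W'' -> W') :
  (forall w, \sum_(w' | f w' == w) p' w' = p w) ->
  (forall w, \sum_(w' | g w' == w) p'' w' = p' w) ->
  forall w, \sum_(w' | f (g w') == w) p'' w' = p w.
Proof.
by move=> lf lg w; rewrite -lf; exact: (law_push f w lg).
Qed.

Lemma law_neq0 (W W' : finType) (p : W -> R) (p' : W' -> R) (f : W' -> W) :
  (forall w, 0 <= p' w) ->
  (forall w, \sum_(w' | f w' == w) p' w' = p w) ->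
  forall w', p' w' != 0 -> p (f w') != 0.
Proof.
move=> p0 law w'; apply: contra => /eqP; rewrite -law => /eqP.
rewrite psumr_eq0 // => /allP /(_ w').
by rewrite mem_index_enum eqxx => /(_ isT).
Qed.

End laws.

Lemma sum_step (R : realType) (W : finType) (p : W -> R) (X Y : W -> 'rV[R]_2)
    (d : R) (M : nat) (psi1 psi2 phi phi' : 'M[R]_2) (h c c1 c2 : R) :
  (forall w, 0 <= p w) -> \sum_w p w = 1 -> 0 < d ->
  `|psi1| <= M%:R -> `|psi2| <= M%:R -> `|phi'| <= M%:R -> `|phi| <= M%:R ->
  phi *m phi' = 1%:M ->
  ent p (fun w => disc d (X w)) <= h -> ent p (fun w => disc d (Y w)) <= h ->
  2 * h - c <= ent p (fun w => (disc d (X w), disc d (Y w))) ->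
  ent p (fun w => disc d (X w + Y w *m phi)) <= h ->
  ent p (fun w => disc d (X w + Y w *m psi1)) <= h + c1 ->
  ent p (fun w => disc d (X w + Y w *m psi2)) <= h + c2 ->
  ent p (fun w => disc d (X w + Y w *m (psi1 + psi2))) <=
    h + c1 + c2 + 9 * c + 13 * (2%:R * ln (2 * (8 * M + 4) + 3)%:R).
Proof.
move=> p0 p1 d0 M1 M2 M' M0 phiK hX hY hXY hZ hV1 hV2.
pose DX w := disc d (X w).
pose XY w := (disc d (X w), disc d (Y w)).
have sl2 t : \sum_(w | DX w == t) p w = \sum_(w | DX w == t) p w by [].
(* Three copies of (X, Y), conditionally independent given the cell of X: [q2] carries two of them,
   and [q3] couples a third one to the first along X. *)
pose q2 := couple p p DX DX.
have q20 : forall v, 0 <= q2 v by exact: couple_ge0.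
have l21 : forall w, \sum_(v | v.1 == w) q2 v = p w by exact: couple_law1.
have l22 : forall w, \sum_(v | v.2 == w) q2 v = p w by exact: couple_law2.
have sl3 t : \sum_(v | DX v.1 == t) q2 v = \sum_(w | DX w == t) p w.
  exact: (law_push DX t l21).
pose q3 := couple q2 p (fun v => DX v.1) DX.
have q30 : forall v, 0 <= q3 v by exact: couple_ge0.
have l31 : forall w, \sum_(v | v.1 == w) q3 v = q2 w by exact: couple_law1.
have k2 : forall w, \sum_(v | v.2 == w) q3 v = p w by exact: couple_law2.
have k0 : forall w, \sum_(v | v.1.1 == w) q3 v = p w.
  exact: (law_comp l21 l31).
have k1 : forall w, \sum_(v | v.1.2 == w) q3 v = p w.
  exact: (law_comp l22 l31).
have q31 : \sum_v q3 v = 1 by apply: couple_sum1 => //; exact: couple_sum1.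
have X02 v : q3 v != 0 -> DX v.2 = DX v.1.1.
  by move/couple_eq.
have X01 v : q3 v != 0 -> DX v.1.2 = DX v.1.1.
  by move/(law_neq0 q30 l31)/couple_eq.
apply: (le_trans _ (@triple_step R _ q3 q30 q31 (fun v => X v.1.1) (fun v => X v.1.2)
  (fun v => X v.2) (fun v => Y v.1.1) (fun v => Y v.1.2) (fun v => Y v.2) d M
  psi1 psi2 phi phi' h c c1 c2 (ent p XY) d0 M1 M2 M' M0 phiK X01 X02
  _ _ _ _ _ _ _ _ _ _ _ _ _ _)).
- by rewrite -(ent_comp k0).
- by have := ent_comp k0 DX => /= ->.
- by have := ent_comp k0 (fun w => disc d (Y w)) => /= ->.
- by have := ent_comp k1 (fun w => disc d (Y w)) => /= ->.
- by have := ent_comp k2 (fun w => disc d (Y w)) => /= ->.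
- exact: (ent_comp k0 XY).
- exact: (ent_comp k1 XY).
- exact: (ent_comp k2 XY).
- exact: hXY.
- have := ent_comp k0 DX => /= ->.
  have -> : ent q3 (fun v => ((DX v.1.1, disc d (Y v.1.1)),
     (DX v.1.2, disc d (Y v.1.2)), (DX v.2, disc d (Y v.2)))) =
     ent q2 (fun v => (XY v.1, XY v.2)) + ent p XY - ent q2 (fun v => DX v.1).
    by apply: (ent_couple q20 p0 sl3 (g1 := fun v => (XY v.1, XY v.2)) (g2 := XY));
       move=> w w'; [case|case].
  have -> : ent q2 (fun v => DX v.1) = ent p DX by exact: (ent_comp l21).
  have -> : ent q2 (fun v => (XY v.1, XY v.2)) = ent p XY + ent p XY - ent p DX.
    by apply: (ent_couple p0 p0 sl2 (g1 := XY) (g2 := XY)); move=> w w'; case.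
  lra.
- by have := ent_comp k0 (fun w => disc d (X w + Y w *m phi)) => /= ->.
- by have := ent_comp k1 (fun w => disc d (X w + Y w *m phi)) => /= ->.
- by have := ent_comp k2 (fun w => disc d (X w + Y w *m phi)) => /= ->.
- by have := ent_comp k1 (fun w => disc d (X w + Y w *m psi1)) => /= ->.
- by have := ent_comp k2 (fun w => disc d (X w + Y w *m psi2)) => /= ->.
Qed.

(** The new summand enters [sum_step] with error 0 and the partial sum with the accumulated error,
    so that the loss grows linearly in the number of summands instead of doubling. *)
Lemma ent_sum_maps (R : realType) (W : finType) (p : W -> R)
    (X Y : W -> 'rV[R]_2) (d : R) (M : nat) (phi phi' : 'M[R]_2) (h c K : R)
    (psi0 : 'M[R]_2) (s : seq 'M[R]_2) :
  let L := 9 * c + 13 * (2%:R * ln (2 * (8 * M + 4) + 3)%:R) in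
  (forall w, 0 <= p w) -> \sum_w p w = 1 -> 0 < d -> 0 <= c ->
  `|phi'| <= M%:R -> `|phi| <= M%:R -> phi *m phi' = 1%:M ->
  (size s).+1%:R * K <= M%:R ->
  ent p (fun w => disc d (X w)) <= h -> ent p (fun w => disc d (Y w)) <= h ->
  2 * h - c <= ent p (fun w => (disc d (X w), disc d (Y w))) ->
  ent p (fun w => disc d (X w + Y w *m phi)) <= h ->
  (forall psi, psi \in psi0 :: s -> `|psi| <= K /\
     ent p (fun w => disc d (X w + Y w *m psi)) <= h) ->
  ent p (fun w => disc d (X w + Y w *m (\sum_(psi <- psi0 :: s) psi))) <=
    h + (size s)%:R * L.
Proof.
move=> L p0 p1 d0 c0 M' M0 phiK sK hX hY hXY hZ.
elim: s psi0 sK => [|psi1 s IH] psi0 sK H.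
  by rewrite big_seq1 mul0r addr0; have [] := H psi0 (mem_head _ _).
rewrite big_cons.
have [K0 e0] := H psi0 (mem_head _ _).
have Kge0 : 0 <= K := le_trans (normr_ge0 _) K0.
have sK1 : (size s).+1%:R * K <= M%:R.
  by apply: le_trans sK; apply: ler_wpM2r => //; rewrite ler_nat.
have KM : K <= M%:R.
  by apply: le_trans sK; rewrite -{1}[K]mul1r; apply: ler_wpM2r; rewrite ?ler1n.
have e1 : ent p (fun w => disc d (X w + Y w *m (\sum_(psi <- psi1 :: s) psi))) <=
    h + (size s)%:R * L.
  by apply: IH => // psi hp; apply: H; rewrite inE hp orbT.
have n1 : `|\sum_(psi <- psi1 :: s) psi| <= M%:R.
  apply: le_trans (ler_norm_sum _ _ _) _; apply: le_trans sK1.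
  rewrite big_seq; apply: (@le_trans _ _ (\sum_(i <- psi1 :: s | i \in psi1 :: s) K)).
    apply: ler_sum => i hi.
    by have /H[] : i \in [:: psi0, psi1 & s] by rewrite inE hi orbT.
  by rewrite -big_seq big_const_seq count_predT iter_addr addr0 mulr_natl.
have := @sum_step R W p X Y d M psi0 _ phi phi' h c 0 ((size s)%:R * L)
  p0 p1 d0 (le_trans K0 KM) n1 M' M0 phiK hX hY hXY hZ.
rewrite addr0 => /(_ e0 e1) /le_trans; apply.
by rewrite /= -[(size s).+1%:R]natr1 mulrDl mul1r /L; lra.
Qed.

Section emb.
Variable R : realType.

Definition emb (n : nat) (a : 'rV[int]_n) : 'rV[R]_n := \row_i (a 0 i)%:~R.

Lemma disc_emb (n : nat) (a : 'rV[int]_n) : disc 1 (emb a) = a.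
Proof. by apply/rowP => i; rewrite !mxE divr1 intrKfloor. Qed.

Lemma emb_disc_dist (n : nat) (d : R) (u : 'rV[R]_n) : 0 < d ->
  `|u - d *: emb (disc d u)| <= d.
Proof.
move=> d0; apply: mx_norm_le => [|i j]; first exact: ltW.
rewrite (ord1 i) !mxE.
have e1 := floor_le (u 0 j / d); have e2 := floorD1_gt (u 0 j / d).
rewrite intrD mulr1z in e2; set f := _%:~R in e1 e2 *.
have -> : u 0 j - d * f = d * (u 0 j / d - f).
  by rewrite mulrBr mulrCA divff ?mulr1 // gt_eqF.
rewrite normrM (gtr0_norm d0).
by rewrite -[leRHS]mulr1 ler_pM2l // ler_norml; lra.
Qed.

End emb.

(* Conditional-entropy bookkeeping: [a] is one copy, [(z, t)] another one, and
   [cz] a coarsening of [z] that [a] determines up to [k1] values outside [S]. *)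
Lemma ent_coarse (R : realType) (V : finType) (q : V -> R)
    (Ta Tz Tc Tt : eqType) (a : V -> Ta) (z : V -> Tz) (cz : V -> Tc)
    (t : V -> Tt) (S : pred V) (m k1 k2 : nat) (P : R) :
  (forall v, 0 <= q v) -> \sum_v q v = 1 ->
  (0 < m)%N -> (0 < k1)%N -> (0 < k2)%N ->
  (forall v v', q v != 0 -> q v' != 0 -> z v' = z v -> cz v' = cz v) ->
  (exists2 l : seq Tc, (size l <= m)%N & forall v, q v != 0 -> cz v \in l) ->
  (forall v, ~~ S v -> q v != 0 -> exists2 l : seq Tc, (size l <= k1)%N &
     forall v', ~~ S v' -> q v' != 0 -> a v' = a v -> cz v' \in l) ->
  (forall v, q v != 0 -> exists2 l : seq Tt, (size l <= k2)%N &
     forall v', q v' != 0 -> a v' = a v -> z v' = z v -> t v' \in l) ->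
  \sum_(v | S v) q v <= P ->
  ent q (fun v => (a v, t v)) + ent q cz <=
    ent q a + ent q z + ln 2 + P * ln m%:R + ln k1%:R + ln k2%:R.
Proof.
move=> q0 q1 m0 k10 k20 zc [lm sm hm] near1 near2 HP.
have s1 : ent q (fun v => (a v, cz v)) <= ent q a + ln 2 +
    (\sum_(v | S v) q v) * ln m%:R + (\sum_(v | ~~ S v) q v) * ln k1%:R.
  apply: ent_split => // v _ qv.
  by exists lm => // v' _ qv' _; apply: hm.
have s2 : ent q (fun v => (a v, z v, cz v)) + ent q cz <=
    ent q (fun v => (a v, cz v)) + ent q (fun v => (z v, cz v)).
  exact: ent_submod.
have s2' : ent q (fun v => (z v, cz v)) <= ent q z.
  by apply: ent_mono => // v v' qv qv' e; rewrite e (zc _ _ qv qv' e).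
have s3 : ent q (fun v => ((a v, z v, cz v), t v)) <=
    ent q (fun v => (a v, z v, cz v)) + ln k2%:R.
  apply: ent_cond_le => // v qv; have [l sl hl] := near2 v qv.
  by exists l => // v' qv' [e1 e2 _]; apply: hl.
have s4 : ent q (fun v => (a v, t v)) <= ent q (fun v => ((a v, z v, cz v), t v)).
  by apply: ent_mono => // v v' _ _ [-> _ _ ->].
have lk1 : 0 <= ln k1%:R :> R by rewrite ln_ge0 // ler1n.
have lm0 : 0 <= ln m%:R :> R by rewrite ln_ge0 // ler1n.
have b1 : (\sum_(v | S v) q v) * ln m%:R <= P * ln m%:R by apply: ler_wpM2r.
have b2 : (\sum_(v | ~~ S v) q v) * ln k1%:R <= ln k1%:R.
  by rewrite -[leRHS]mul1r; apply: ler_wpM2r => //; apply: sum_p_le1.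
lra.
Qed.

(** * Two copies of (X, Y) coupled along X + Y psi *)

Section final.
Variables (R : realType) (W : finType) (p : W -> R) (X Y : W -> 'rV[R]_2).
Variables (d : R) (M mc : nat) (psi psi' : 'M[R]_2) (h c c' g : R).
Hypotheses (p_ge0 : forall w, 0 <= p w) (p_sum1 : \sum_w p w = 1) (d_gt0 : 0 < d).
Hypotheses (M_gt0 : (0 < M)%N) (mc_gt0 : (0 < mc)%N).
Hypotheses (psiM : `|psi| <= M%:R) (psi'M : `|psi'| <= M%:R)
  (psiK : psi *m psi' = 1%:M).
Variables (A1 A2 : seq 'rV[int]_2) (nf : nat)
  (lf : seq (('rV[int]_2 * 'rV[int]_2) * ('rV[int]_2 * 'rV[int]_2))).

Let DX w := disc d (X w).
Let DY w := disc d (Y w).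
Let XY w := (DX w, DY w).
Let DV w := disc d (X w + Y w *m psi).
Let e := @emb R 2.

Hypotheses (A1P : forall w, p w != 0 -> DX w \in A1)
  (A2P : forall w, p w != 0 -> DY w \in A2).
Hypotheses (A1h : ln (size A1)%:R <= h) (A2h : ln (size A2)%:R <= h).
Hypotheses (HXY : 2 * h - c <= ent p XY) (HV : ent p DV <= h + c').
Hypotheses (nf_gt0 : (0 < nf)%N) (lf_size : (size lf <= nf)%N)
  (nf_le : ln nf%:R <= 3 * h - g) (g_gt0 : 0 < g).
Hypothesis lfP : forall a a' b b', a \in A1 -> a' \in A1 -> b \in A2 -> b' \in A2 ->
  `|(e a' - e a) + (e b' - e b) *m psi| <= (4 * M + 3)%:R ->
  mc%:R < `|e b' - e b| -> ((a, b), (a', b')) \in lf.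

Let k1 := ((2 * (6 * M + 3) + 3) ^ 2)%N.
Let k2 := ((2 * ((4 * M + 3) * (2 * M)) + 3) ^ 2)%N.
Let P := (2 * c + c' + ln 2 + 2 * ln k2%:R) / g.
Let q := couple p p DV DV.
Let far (v : W * W) := mc%:R < `|e (DY v.2) - e (DY v.1)|.

Let q_ge0 v : 0 <= q v. Proof. exact: couple_ge0. Qed.
Let law1 w : \sum_(v | v.1 == w) q v = p w. Proof. exact: couple_law1. Qed.
Let law2 w : \sum_(v | v.2 == w) q v = p w. Proof. exact: couple_law2. Qed.
Let q_sum1 : \sum_v q v = 1. Proof. exact: couple_sum1. Qed.
Let q1 v : q v != 0 -> p v.1 != 0. Proof. exact: (law_neq0 q_ge0 law1). Qed.
Let q2 v : q v != 0 -> p v.2 != 0. Proof. exact: (law_neq0 q_ge0 law2). Qed.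

Let mulM2 (y : 'rV[R]_2) (A : 'M[R]_2) (b : R) : `|A| <= M%:R -> `|y| <= b ->
  `|y *m A| <= 2 * b * M%:R.
Proof.
move=> hA hy; apply: le_trans (norm_mulmx _ _) _; rewrite -mulrA.
by apply: ler_wpM2l => //; apply: ler_pM.
Qed.

(** In [4 * M + 3], one unit comes from the coupling, two from rounding the two X, and [4 * M] from
    rounding the two Y before [psi] is applied. *)
Let near_rel v : q v != 0 ->
  `|(e (DX v.2) - e (DX v.1)) + (e (DY v.2) - e (DY v.1)) *m psi|
     <= (4 * M + 3)%:R.
Proof.
move=> qv; have eV := couple_eq qv.
have dV : `|(X v.2 + Y v.2 *m psi) - (X v.1 + Y v.1 *m psi)| <= d.
  by apply: disc_eq_dist.
have x1 := emb_disc_dist (X v.1) d_gt0; have x2 := emb_disc_dist (X v.2) d_gt0.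
have y1 := emb_disc_dist (Y v.1) d_gt0; have y2 := emb_disc_dist (Y v.2) d_gt0.
have E : d *: ((e (DX v.2) - e (DX v.1)) + (e (DY v.2) - e (DY v.1)) *m psi) =
  ((X v.2 + Y v.2 *m psi) - (X v.1 + Y v.1 *m psi)) -
  ((X v.2 - d *: e (DX v.2)) - (X v.1 - d *: e (DX v.1))) -
  ((Y v.2 - d *: e (DY v.2)) - (Y v.1 - d *: e (DY v.1))) *m psi.
  rewrite !mulmxBl -!scalemxAl; apply/rowP => i; rewrite !mxE.
  by rewrite !big_ord_recl !big_ord0 !mxE; ring.
have : `|d *: ((e (DX v.2) - e (DX v.1)) + (e (DY v.2) - e (DY v.1)) *m psi)|
    <= d * (4 * M + 3)%:R.
  rewrite E; apply: le_trans (ler_normB_le (ler_normB_le dV (ler_normB_le x2 x1))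
    (mulM2 psiM (ler_normB_le y2 y1))) _.
  by rewrite natrD natrM; lra.
by rewrite normrZ (gtr0_norm d_gt0) ler_pM2l.
Qed.

Let suppW : exists w, p w != 0.
Proof.
apply/existsP; apply: contraT; rewrite negb_exists => /forallP H.
have : \sum_w p w = 0.
  by apply: big1 => w _; apply/eqP; have := H w; rewrite negbK.
by rewrite p_sum1 => /eqP; rewrite oner_eq0.
Qed.

Let sA1 : (0 < size A1)%N.
Proof. by case: suppW => w /A1P; case: A1. Qed.
Let sA2 : (0 < size A2)%N.
Proof. by case: suppW => w /A2P; case: A2. Qed.

Let M1 : 1 <= M%:R :> R. Proof. by rewrite ler1n. Qed.
Let mc1 : 1 <= mc%:R :> R. Proof. by rewrite ler1n. Qed.

Let box (u : 'rV[R]_2) : exists2 l : seq 'rV[int]_2, size l = k2 &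
  forall b, `|e b - u| <= ((4 * M + 3) * (2 * M))%:R -> b \in l.
Proof.
have [l sl hl] := disc_near ((4 * M + 3) * (2 * M)) u (ltr01 : 0 < 1 :> R).
exists l => // b hb; rewrite -(disc_emb R b); apply: hl.
by rewrite mulr1.
Qed.

Let Q1 : (4 * M + 3)%:R <= ((4 * M + 3) * (2 * M))%:R :> R.
Proof. by rewrite ler_nat leq_pmulr // muln_gt0. Qed.

Let lnk2 (m : nat) : (m <= (4 * M + 3) * (2 * M))%N ->
  2%:R * ln (2 * m + 3)%:R <= ln k2%:R :> R.
Proof.
move=> hm; rewrite /k2 natrX lnXn ?ltr0n ?addn_gt0 ?orbT //.
rewrite -[leRHS]mulr_natl; apply: ler_wpM2l => //.
by rewrite ler_ln ?posrE ?ltr0n ?addn_gt0 ?orbT // ler_nat leq_add2r leq_mul2l hm.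
Qed.

Let joint : 2 * ent p XY - ent p DV - ln k2%:R <=
  ent q (fun v => (XY v.1, XY v.2)).
Proof.
pose XV w := (XY w, DV w).
have E : ent q (fun v => (XV v.1, XV v.2)) = ent p XV + ent p XV - ent p DV.
  by apply: (ent_couple p_ge0 p_ge0 _ (g1 := XV) (g2 := XV)) => // w w' [].
have m1 : ent p XY <= ent p XV.
  by apply: ent_mono => // w w' _ _ /(congr1 fst).
have m2 : ent q (fun v => (XV v.1, XV v.2)) <=
    ent q (fun v => ((XY v.1, XY v.2), disc d (X v.1 + Y v.1 *m psi))).
  apply: ent_mono => // v v' qv qv' [e1 e2 e3 e4 e5].
  rewrite /XV -(couple_eq qv) -(couple_eq qv') /DV e5.
  by rewrite /XY e1 e2 e3 e4.
have m3 : ent q (fun v => ((XY v.1, XY v.2), disc d (X v.1 + Y v.1 *m psi))) <=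
    ent q (fun v => (XY v.1, XY v.2)) + 2%:R * ln (2 * (2 * M + 1) + 3)%:R.
  apply: ent_disc_cond => // v v' qv qv' [e1 e2 _ _].
  have -> : X v'.1 + Y v'.1 *m psi - (X v.1 + Y v.1 *m psi) =
    (X v'.1 - X v.1) + (Y v'.1 - Y v.1) *m psi.
    by rewrite mulmxBl; apply/rowP => i; rewrite !mxE; ring.
  apply: le_trans (ler_normD_le (disc_eq_dist d_gt0 e1)
    (mulM2 psiM (disc_eq_dist d_gt0 e2))) _.
  by rewrite natrD natrM; lra.
have := @lnk2 (2 * M + 1)%N; have -> : (2 * M + 1 <= (4 * M + 3) * (2 * M))%N.
  apply: (@leq_trans (4 * M + 3)); last by rewrite leq_pmulr // muln_gt0.
  by apply: leq_add => //; rewrite leq_mul2r orbT.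
move=> /(_ isT) m4; lra.
Qed.

Let lnk20 : 0 <= ln k2%:R :> R.
Proof. by rewrite ln_ge0 // ler1n expn_gt0 addn_gt0 orbT. Qed.

(** The pair of copies has entropy at least about [3 * h]. On the far event it takes at most [nf]
    values, whose logarithm is at most [3 * h - g]; elsewhere three of the four cells leave at most
    [k2] choices for the fourth, so that the logarithm is about [3 * h]. Hence the probability of
    the far event times [g] is at most the sum of the errors. *)
Let Pfar : \sum_(v | far v) q v <= P.
Proof.
have /choice[near Hn] : forall t : ('rV[int]_2 * 'rV[int]_2) * 'rV[int]_2,
    exists l : seq 'rV[int]_2, size l = k2 /\
    forall a', `|(e a' - e t.1.1) + (e t.2 - e t.1.2) *m psi| <= (4 * M + 3)%:R ->
      a' \in l.
  move=> t; have [l sl hl] := box (e t.1.1 - (e t.2 - e t.1.2) *m psi).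
  exists l; split => // a' ha; apply: hl; apply: le_trans Q1.
  by rewrite opprB addrA addrAC.
pose all := [seq ((t.1.1, t.1.2), (a', t.2)) |
   t <- [seq (ab, b) | ab <- [seq (a, b) | a <- A1, b <- A2], b <- A2],
   a' <- near t].
pose m := (size A1 * size A2 * size A2 * k2)%N.
have k20 : (0 < k2)%N by rewrite expn_gt0 addn_gt0 orbT.
have sall : size all = m.
  rewrite size_allpairs_dep (eq_map (g := fun=> k2)); last by move=> t; have [] := Hn t.
  by rewrite sumnE big_map big_const_seq count_predT iter_addn_0 !size_allpairs mulnC.
have m0 : (0 < m)%N by rewrite /m muln_gt0 k20 andbT muln_gt0 sA2 andbT muln_gt0 sA1 sA2.
have key : ent q (fun v => (tt, (XY v.1, XY v.2))) <= ent q (fun=> tt) + ln 2 +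
    (\sum_(v | far v) q v) * ln nf%:R + (\sum_(v | ~~ far v) q v) * ln m%:R.
  apply: ent_split => // v Sv qv.
    exists lf => // v' Sv' qv' _; apply: lfP => //; try exact: near_rel.
    - exact: A1P (q1 qv').
    - exact: A1P (q2 qv').
    - exact: A2P (q1 qv').
    - exact: A2P (q2 qv').
  exists all; rewrite ?sall // => v' Sv' qv' _.
  apply/allpairsPdep; exists ((DX v'.1, DY v'.1), DY v'.2), (DX v'.2).
  split => //.
    by apply: allpairs_f; [apply: allpairs_f; [exact: A1P (q1 qv')|
      exact: A2P (q1 qv')]|exact: A2P (q2 qv')].
  by have [_] := Hn ((DX v'.1, DY v'.1), DY v'.2); apply; apply: near_rel.
have := @ent_const _ _ q q_sum1 _ tt => ct; rewrite ct in key.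
have key2 : ent q (fun v => (XY v.1, XY v.2)) <=
    ent q (fun v => (tt, (XY v.1, XY v.2))).
  by apply: ent_mono => // v v' _ _ /(congr1 snd).
have mle : ln m%:R <= 3 * h + ln k2%:R.
  have p1 : 0 < (size A1)%:R :> R by rewrite ltr0n sA1.
  have p2 : 0 < (size A2)%:R :> R by rewrite ltr0n sA2.
  have p3 : 0 < k2%:R :> R by rewrite ltr0n k20.
  rewrite /m 3!natrM lnM ?posrE ?mulr_gt0 // lnM ?posrE ?mulr_gt0 //.
  rewrite lnM ?posrE //.
  by have := A1h; have := A2h; lra.
have tot : \sum_(v | far v) q v + \sum_(v | ~~ far v) q v = 1.
  by rewrite -q_sum1 [RHS](bigID far).
have n1 : 0 <= \sum_(v | far v) q v by apply: sumr_ge0.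
have n2 : 0 <= \sum_(v | ~~ far v) q v by apply: sumr_ge0.
have b1 := ler_wpM2l n1 nf_le; have b2 := ler_wpM2l n2 mle.
have j := joint; have t1 := HXY; have t2 := HV; have t3 := lnk20.
rewrite /P ler_pdivlMr //.
have b3 : (\sum_(v | ~~ far v) q v) * ln k2%:R <= ln k2%:R.
  by rewrite -[leRHS]mul1r ler_wpM2r // -tot lerDr.
have h3 : (\sum_(v | far v) q v) * h + (\sum_(v | ~~ far v) q v) * h = h.
  by rewrite -mulrDl tot mul1r.
lra.
Qed.

Let XYh : ent p DX <= h /\ ent p DY <= h.
Proof.
split.
  by apply: le_trans A1h; apply: (@ent_le_ln _ _ p _ _ _ _ A1).
by apply: le_trans A2h; apply: (@ent_le_ln _ _ p _ _ _ _ A2).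
Qed.

Let P_ge0 : 0 <= P.
Proof. by apply: le_trans Pfar; apply: sumr_ge0. Qed.

Let B := c + c' + ln 2 + P * h + ln k1%:R + 2 * ln k2%:R.

(** The first copy and the fine cell of [z] in the second copy determine the pair of copies. Off the
    far event each of the two also determines the coarse cell, whose entropy is therefore counted
    twice: it is at most about h + H(V) - H(XY), which is small. *)
Let finish (z : W -> 'rV[int]_2) (A : seq 'rV[int]_2) :
  (forall w, p w != 0 -> z w \in A) -> (0 < size A)%N -> ln (size A)%:R <= h ->
  ent p z <= h ->
  (forall v, q v != 0 -> ~~ far v ->
     `|e (z v.2) - e (z v.1)| <= (6 * M + 3)%:R * mc%:R) ->
  (forall w w', XY w = XY w' -> z w = z w') ->
  (forall v, q v != 0 -> exists2 l : seq ('rV[int]_2 * 'rV[int]_2), (size l <= k2)%N &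
     forall v', q v' != 0 -> XY v'.1 = XY v.1 -> z v'.2 = z v.2 -> XY v'.2 \in l) ->
  ent p (fun w => disc mc%:R (e (z w))) <= B.
Proof.
move=> zA sA hA hz nearz zXY other.
have mcp : 0 < mc%:R :> R by rewrite ltr0n.
have C : ent q (fun v => (XY v.1, XY v.2)) + ent q (fun v => disc mc%:R (e (z v.2)))
    <= ent q (fun v => XY v.1) + ent q (fun v => z v.2) + ln 2 +
       P * ln (size A)%:R + ln k1%:R + ln k2%:R.
  apply: (@ent_coarse R _ q _ _ _ _ _ _ _ _ far) => //.
  - by rewrite expn_gt0 addn_gt0 orbT.
  - by rewrite expn_gt0 addn_gt0 orbT.
  - by move=> v v' _ _ ->.
  - exists [seq disc mc%:R (e a) | a <- A]; first by rewrite size_map.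
    by move=> v qv; apply: map_f; apply: zA; apply: q2.
  - move=> v fv qv.
    have [l sl hl] := disc_near (6 * M + 3) (e (z v.1)) mcp.
    exists l; first by rewrite sl.
    move=> v' fv' qv' ev; apply: hl; rewrite -(zXY _ _ ev).
    exact: nearz.
have e1 : ent q (fun v => XY v.1) = ent p XY by exact: (ent_comp law1).
have e2 : ent q (fun v => z v.2) = ent p z by exact: (ent_comp law2).
have e3 : ent q (fun v => disc mc%:R (e (z v.2))) =
  ent p (fun w => disc mc%:R (e (z w))).
  exact: (ent_comp law2 (fun w => disc mc%:R (e (z w)))).
rewrite e1 e2 e3 in C.
have j := joint; have t1 := HXY; have t2 := HV.
have := ler_wpM2l P_ge0 hA => PA.
rewrite /B; lra.
Qed.

Lemma final_step :
  ent p (fun w => disc mc%:R (e (DX w))) <= B /\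
  ent p (fun w => disc mc%:R (e (DY w))) <= B.
Proof.
have [hX hY] := XYh.
split.
  apply: (finish A1P) => //.
  - move=> v qv; rewrite /far -leNgt => nv.
    have -> : e (DX v.2) - e (DX v.1) =
      (e (DX v.2) - e (DX v.1) + (e (DY v.2) - e (DY v.1)) *m psi) -
      (e (DY v.2) - e (DY v.1)) *m psi by rewrite addrK.
    apply: le_trans (ler_normB_le (near_rel qv) (mulM2 psiM nv)) _.
    have -> : (6 * M + 3)%:R = 6 * M%:R + 3 :> R by rewrite natrD natrM.
    have -> : (4 * M + 3)%:R = 4 * M%:R + 3 :> R by rewrite natrD natrM.
    have m1 := M1; have m2 := mc1.
    have : (4 * M%:R + 3) * 1 <= (4 * M%:R + 3) * mc%:R :> R.
      by apply: ler_wpM2l => //; lra.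
    lra.
  - by move=> w w' [].
  - move=> v qv.
    have [l sl hl] := box (e (DY v.1) - (e (DX v.2) - e (DX v.1)) *m psi').
    exists [seq (DX v.2, b) | b <- l]; first by rewrite size_map sl.
    move=> v' qv' [e1 e2] e3; apply/mapP; exists (DY v'.2); last first.
      by rewrite /XY; congr (_, _).
    apply: hl.
    have r := near_rel qv'.
    have -> : e (DY v'.2) - (e (DY v.1) - (e (DX v.2) - e (DX v.1)) *m psi') =
      ((e (DX v'.2) - e (DX v'.1)) + (e (DY v'.2) - e (DY v'.1)) *m psi) *m psi'.
      rewrite [RHS]mulmxDl -mulmxA psiK mulmx1 [DX v'.2]e3 [DX v'.1]e1 [DY v'.1]e2.
      by apply/rowP => i; rewrite !mxE; ring.
    apply: le_trans (mulM2 psi'M r) _.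
    by rewrite !natrM; lra.
apply: (finish A2P) => //.
- move=> v qv; rewrite /far -leNgt => nv; apply: le_trans nv _.
  rewrite -{1}[mc%:R]mul1r; apply: ler_wpM2r => //.
  by rewrite ler1n addn_gt0 orbT.
- by move=> w w' [].
- move=> v qv.
  have [l sl hl] := box (e (DX v.1) - (e (DY v.2) - e (DY v.1)) *m psi).
  exists [seq (a, DY v.2) | a <- l]; first by rewrite size_map sl.
  move=> v' qv' [e1 e2] e3; apply/mapP; exists (DX v'.2); last first.
    by rewrite /XY; congr (_, _).
  apply: hl; apply: le_trans Q1.
  have r := near_rel qv'.
  have -> : e (DX v'.2) - (e (DX v.1) - (e (DY v.2) - e (DY v.1)) *m psi) =
    ((e (DX v'.2) - e (DX v'.1)) + (e (DY v'.2) - e (DY v'.1)) *m psi).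
    rewrite [DY v'.2]e3 [DX v'.1]e1 [DY v'.1]e2.
    by apply/rowP => i; rewrite !mxE; ring.
  exact: r.
Qed.

End final.

(** * Polynomials that are small at many points *)

Section sublevel.
Variable R : realType.

(* Peeling off one root at a time: [p - p(t)] is [(X - t) q], and [q] is at most
   [2 lam / th] at the other points. *)
Lemma poly_sup_of_points (th lam : R) (ts : seq R) (p : {poly R}) :
  0 < th -> th <= 1 -> (size p <= size ts)%N ->
  pairwise (fun x y => th <= `|x - y|) ts ->
  (forall t, t \in ts -> 0 <= t <= 1 /\ `|p.[t]| <= lam) ->
  forall tau, 0 <= tau <= 1 -> 0 <= lam ->
  `|p.[tau]| <= lam * (3 / th) ^+ size ts.
Proof.
move=> th0 th1; have i1 : 1 <= th^-1 by rewrite invf_ge1.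
elim: ts p lam => [|t ts IH] p lam sp sep H tau tau01 l0.
  rewrite leqn0 size_poly_eq0 in sp; rewrite (eqP sp) horner0 normr0 expr0 mulr1.
  exact: l0.
have [t01 pt] := H t (mem_head _ _).
have /factor_theorem[q qE] : root (p - (p.[t])%:P) t.
  by rewrite /root hornerD hornerN hornerC subrr.
have pE : p = (p.[t])%:P + q * ('X - t%:P) by rewrite -qE addrC subrK.
have sq : (size q <= size ts)%N.
  have [->|q0] := eqVneq q 0; first by rewrite size_poly0.
  have : (size (p - (p.[t])%:P)%R <= (size ts).+1)%N.
    apply: leq_trans (size_polyD _ _) _; rewrite geq_max sp size_polyN.
    by apply: leq_trans (size_polyC_leq1 _) _.
  by rewrite qE size_Mmonic ?monicXsubC // size_XsubC addn2 ltnS.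
move: sep; rewrite /= => /andP[/allP st sep].
have q_le : forall x, x \in ts -> 0 <= x <= 1 /\ `|q.[x]| <= 2 * lam / th.
  move=> x xts; have [x01 px] : 0 <= x <= 1 /\ `|p.[x]| <= lam by apply: H; rewrite inE xts orbT.
  split=> //; have := st x xts; rewrite /= distrC => sx.
  have e : `|q.[x]| * `|x - t| <= 2 * lam.
    rewrite -normrM (_ : q.[x] * (x - t) = p.[x] - p.[t]).
      by have := ler_normB_le px pt; lra.
    by rewrite [in RHS]pE !hornerE; ring.
  rewrite ler_pdivlMr //; apply: le_trans e.
  by apply: ler_wpM2l.
have l2 : 0 <= 2 * lam / th by rewrite divr_ge0 ?mulr_ge0 // ltW.
have := IH q _ sq sep q_le tau tau01 l2; set b := (3 / th) ^+ size ts => qtau.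
have b1 : 1 <= b by rewrite exprn_ege1 //; lra.
rewrite pE !hornerE exprS -/b.
have tt : `|tau - t| <= 1 by rewrite ler_norml; lra.
have : `|q.[tau] * (tau - t)| <= 2 * lam / th * b.
  by rewrite normrM -[leRHS]mulr1; apply: ler_pM.
move=> h; apply: le_trans (ler_normD_le pt h) _.
have : lam <= lam * (b / th).
  rewrite -{1}[lam]mulr1; apply: ler_wpM2l => //.
  by rewrite -[1]mulr1; apply: ler_pM.
have -> : lam * (3 / th * b) = lam * (b / th) + 2 * lam / th * b by ring.
by rewrite lerD2r.
Qed.

Variables (T : finType) (tt : T -> R) (N : R).
Hypothesis tt01 : forall j, 0 <= tt j <= 1.
Hypothesis spacing : forall c L, 0 <= L ->
  #|[set j | `|tt j - c| <= L]%SET|%:R <= 2 * L * N + 2.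

Lemma separated_or_covered (th : R) (n : nat) (S : {set T}) :
  (exists ts : seq T, [/\ size ts = n, {subset ts <= S} &
     pairwise (fun x y => th <= `|tt x - tt y|) ts]) \/
  (exists2 cs : seq T, (size cs <= n)%N &
     forall j, j \in S -> exists2 c, c \in cs & `|tt j - tt c| < th).
Proof.
elim: n S => [|n IH] S; first by left; exists [::].
have [->|[x xS]] := set_0Vmem S.
  by right; exists [::] => // j; rewrite inE.
case: (IH (S :\: [set j | `|tt j - tt x| < th]%SET)) => [[ts [sz sub sep]]|[cs sz cov]].
  left; exists (x :: ts); split; rewrite /= ?sz //.
    move=> y; rewrite inE => /orP[/eqP ->//|/sub]; by rewrite inE => /andP[].
  rewrite sep andbT; apply/allP => y /sub; rewrite !inE => /andP[].
  by rewrite -leNgt distrC.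
right; exists (x :: cs) => // j jS.
case: (ltP `|tt j - tt x| th) => h; first by exists x; rewrite ?mem_head.
have [|c ccs jc] := cov j; first by rewrite !inE jS -leNgt h.
by exists c => //; rewrite inE ccs orbT.
Qed.

(** If the sublevel set contained [n] points separated by [th], then [poly_sup_of_points] would give
    at most [c / 2] at [tau]: the factor [(th / 3) ^+ n] cancels its constant. Otherwise [n]
    intervals of radius [th] cover the set. *)
Lemma sublevel_count (th c : R) (n : nat) (p : {poly R}) (tau : R) :
  0 < th -> th <= 1 -> 0 < c -> (size p <= n)%N -> 0 <= tau <= 1 ->
  c <= `|p.[tau]| -> 0 <= N ->
  #|[set j | `|p.[tt j]| <= c / 2 * (th / 3) ^+ n]%SET|%:R <=
    n%:R * (2 * th * N + 2).
Proof.
move=> th0 th1 c0 sp tau01 hc N0; set S := [set j | _]%SET.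
case: (separated_or_covered th n S) => [[ts [sz sub sep]]|[cs sz cov]].
  suff : c <= c / 2 by lra.
  apply: le_trans hc _.
  have := @poly_sup_of_points th (c / 2 * (th / 3) ^+ n) (map tt ts) p th0 th1.
  rewrite size_map sz pairwise_map => /(_ sp sep) H.
  have {}H := H _ tau tau01 _.
  apply: le_trans (H _ _) _.
  - by move=> _ /mapP[j /sub jS ->]; split=> //; rewrite inE in jS.
  - by rewrite mulr_ge0 ?exprn_ge0 ?divr_ge0 // ltW.
  by rewrite -mulrA -exprMn mulf_div [3 * th]mulrC divff ?expr1n ?mulr1 // mulf_neq0 // gt_eqF.
apply: (@le_trans _ _ (\sum_(c <- cs) #|[set j | `|tt j - tt c| <= th]%SET|%:R)).
  rewrite -natr_sum ler_nat.
  apply: (@leq_trans #|(\bigcup_(c <- cs) [set j | `|tt j - tt c| <= th])%SET|).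
    apply: subset_leq_card; apply/fintype.subsetP => j jS.
    have [x xcs jx] := cov j jS.
    by rewrite (big_rem x) //= finset.inE finset.inE ltW.
  elim: (cs) => [|x s IH]; first by rewrite !big_nil cards0.
  by rewrite !big_cons; apply: leq_trans (leq_card_setU _ _) _; rewrite leq_add2l.
apply: (@le_trans _ _ (\sum_(c <- cs) (2 * th * N + 2))).
  by apply: ler_sum => x _; apply: spacing; apply: ltW.
rewrite big_const_seq count_predT iter_addr addr0 -[leLHS]mulr_natl.
apply: ler_wpM2r; last by rewrite ler_nat.
by rewrite addr_ge0 // !mulr_ge0 // ltW.
Qed.

End sublevel.

(** Stated over a ring because it is applied to vectors of polynomials as well as to vectors of
    numbers. *)
Definition wedge (S : pzRingType) (u v : 'rV[S]_2) : S :=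
  u 0 0 * v 0 1 - u 0 1 * v 0 0.

Section wedge.
Variable R : realType.

Lemma wedge_le (u v : 'rV[R]_2) : `|wedge u v| <= 2 * (`|u| * `|v|).
Proof.
have h i j : `|u 0 i * v 0 j| <= `|u| * `|v|.
  by rewrite normrM ler_pM ?mx_coord_le.
by rewrite /wedge; apply: le_trans (ler_normB_le (h 0 1) (h 1 0)) _; lra.
Qed.

Lemma wedge_combl (a b : R) (u v w : 'rV[R]_2) :
  wedge (a *: u + b *: v) w = a * wedge u w + b * wedge v w.
Proof. by rewrite /wedge !mxE; ring. Qed.

Lemma wedge_anti (u v : 'rV[R]_2) : wedge u v = - wedge v u.
Proof. by rewrite /wedge; ring. Qed.

Lemma wedge_self (u : 'rV[R]_2) : wedge u u = 0.
Proof. by rewrite /wedge; ring. Qed.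

(** Cramer's rule: wedging the combination with [r'] isolates [al], and wedging it with [r] isolates
    [be]. *)
Lemma transversal_small (al be K E mu : R) (r r' : 'rV[R]_2) :
  `|r| <= K -> `|r'| <= K -> 0 <= E -> mu <= `|wedge r r'| ->
  `|al *: r + be *: r'| <= E -> (`|al| + `|be|) * mu <= 4 * K * E.
Proof.
move=> rK rK' E0 hmu h.
have K0 : 0 <= K := le_trans (normr_ge0 _) rK.
have h1 : `|al| * mu <= 2 * (E * K).
  apply: (@le_trans _ _ `|wedge (al *: r + be *: r') r'|).
    rewrite wedge_combl wedge_self mulr0 addr0 normrM; exact: ler_wpM2l.
  apply: le_trans (wedge_le _ _) _; apply: ler_wpM2l => //; exact: ler_pM.
have h2 : `|be| * mu <= 2 * (E * K).
  apply: (@le_trans _ _ `|wedge (al *: r + be *: r') r|).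
    rewrite wedge_combl wedge_self mulr0 add0r normrM wedge_anti normrN.
    exact: ler_wpM2l.
  apply: le_trans (wedge_le _ _) _; apply: ler_wpM2l => //; exact: ler_pM.
lra.
Qed.

Variables (T : finType) (tt : T -> R) (N : R).
Hypothesis tt01 : forall j, 0 <= tt j <= 1.
Hypothesis spacing : forall c L, 0 <= L ->
  #|[set j | `|tt j - c| <= L]%SET|%:R <= 2 * L * N + 2.
Variables (a r : R -> 'rV[R]_2) (D : R -> R) (K mu Q rho : R) (m : nat).
Hypotheses (K1 : 1 <= K) (mu0 : 0 < mu) (rho0 : 0 < rho) (Q0 : 0 <= Q)
  (m0 : (0 < m)%N) (hm : 8 * K ^+ 2 <= mu * m%:R) (N0 : 0 <= N).
Hypothesis taylor : forall s s', 0 <= s <= 1 -> 0 <= s' <= 1 ->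
  `|D s' *: a s - D s *: a s' - (s - s') *: r s'| <= K * (s - s') ^+ 2.
Hypothesis rK : forall s, 0 <= s <= 1 -> `|r s| <= K.
Hypothesis DK : forall s, 0 <= s <= 1 -> `|D s| <= K.

(** Here [ga] models t -> v phi_t with numerator [a] and denominator [D], and [r] models a' D - a
    D', the numerator of its derivative; [taylor] is the second-order estimate for [ga] cleared of
    denominators. *)
Let ga s := (D s)^-1 *: a s.
Let Z := 16 * K ^+ 3 * Q / (rho * mu).

Let K0 : 0 < K. Proof. by apply: lt_le_trans K1. Qed.

Let diff_ga s s' : 0 <= s <= 1 -> 0 <= s' <= 1 -> D s != 0 -> D s' != 0 ->
  `|s - s'| <= m%:R^-1 ->
  `|ga s - ga s' - ((s - s') / (D s * D s')) *: r s'| <=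
     K / m%:R * `|(s - s') / (D s * D s')|.
Proof.
move=> s01 s01' Ds Ds' h.
have -> : ga s - ga s' - ((s - s') / (D s * D s')) *: r s' =
  (D s * D s')^-1 *: (D s' *: a s - D s *: a s' - (s - s') *: r s').
  rewrite /ga !scalerBr !scalerA; congr (_ *: _ - _ *: _ - _ *: _).
  - by rewrite invfM -mulrA mulVf ?mulr1.
  - by rewrite invfM mulrAC mulVf ?mul1r.
  - by rewrite mulrC.
rewrite normrZ normrM [leRHS]mulrCA [leRHS]mulrA mulrC; apply: ler_wpM2r => //.
apply: le_trans (taylor s01 s01') _.
have -> : (s - s') ^+ 2 = `|s - s'| * `|s - s'| by rewrite -expr2 real_normK ?num_real.
rewrite mulrCA; apply: ler_wpM2l => //; apply: ler_wpM2l => //; exact: ltW K0.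
Qed.

(** The difference of two solutions is a combination of [r s'] and [r t'], up to second-order terms
    that [hm] makes smaller than half of what transversality gives; so both coefficients are small,
    and with them both parameter differences. *)
Let close u (x y : T * T) :
  D (tt x.1) != 0 -> D (tt x.2) != 0 -> D (tt y.1) != 0 -> D (tt y.2) != 0 ->
  mu <= `|wedge (r (tt y.1)) (r (tt y.2))| ->
  `|tt x.1 - tt y.1| <= m%:R^-1 -> `|tt x.2 - tt y.2| <= m%:R^-1 ->
  `|u + rho *: (ga (tt x.1) + ga (tt x.2))| <= Q ->
  `|u + rho *: (ga (tt y.1) + ga (tt y.2))| <= Q ->
  `|tt x.1 - tt y.1| <= Z /\ `|tt x.2 - tt y.2| <= Z.
Proof.
set s := tt x.1; set t := tt x.2; set s' := tt y.1; set t' := tt y.2.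
move=> Ds Dt Ds' Dt' hmu hs ht h1 h2.
have s01 : 0 <= s <= 1 by apply: tt01.
have t01 : 0 <= t <= 1 by apply: tt01.
have s01' : 0 <= s' <= 1 by apply: tt01.
have t01' : 0 <= t' <= 1 by apply: tt01.
pose al := (s - s') / (D s * D s'); pose be := (t - t') / (D t * D t').
have e1 := diff_ga s01 s01' Ds Ds' hs; have e2 := diff_ga t01 t01' Dt Dt' ht.
have e3 : `|(ga s + ga t) - (ga s' + ga t')| <= 2 * Q / rho.
  rewrite ler_pdivlMr // -(gtr0_norm rho0) mulrC -normrZ.
  have -> : rho *: (ga s + ga t - (ga s' + ga t')) =
     (u + rho *: (ga s + ga t)) - (u + rho *: (ga s' + ga t')).
    by apply/rowP => i; rewrite !mxE; ring.
  by apply: le_trans (ler_normB_le h1 h2) _; lra.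
pose E := 2 * Q / rho + (K / m%:R * `|al| + K / m%:R * `|be|).
have e4 : `|al *: r s' + be *: r t'| <= E.
  have -> : al *: r s' + be *: r t' = ((ga s + ga t) - (ga s' + ga t')) -
    ((ga s - ga s' - al *: r s') + (ga t - ga t' - be *: r t')).
    by apply/rowP => i; rewrite !mxE; ring.
  by apply: ler_normB_le => //; apply: ler_normD_le.
have E0 : 0 <= E := le_trans (normr_ge0 _) e4.
have := transversal_small (rK s01') (rK t01') E0 hmu e4.
have mm0 : 0 < m%:R :> R by rewrite ltr0n.
have hm' : 4 * K * (K / m%:R) <= mu / 2.
  rewrite mulrA ler_pdivrMr //.
  by have := hm; rewrite expr2; lra.
have sg0 : 0 <= `|al| + `|be| by rewrite addr_ge0.
have hm2 := ler_wpM2r sg0 hm'.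
move=> h.
have sg : (`|al| + `|be|) <= 16 * K * Q / (rho * mu).
  rewrite ler_pdivlMr ?mulr_gt0 //.
  have : (`|al| + `|be|) * mu <= 16 * K * Q / rho.
    have -> : 16 * K * Q / rho = 16 * (K * Q / rho) by ring.
    have hE : 4 * K * E = 8 * (K * Q / rho) +
      4 * K * (K / m%:R) * (`|al| + `|be|) by rewrite /E; ring.
    rewrite hE in h.
    lra.
  by rewrite ler_pdivlMr // -[_ * mu * rho]mulrA [mu * rho]mulrC.
have fin (x1 x1' : R) (b : R) : 0 <= x1 <= 1 -> 0 <= x1' <= 1 -> D x1 != 0 ->
    D x1' != 0 -> 0 <= b ->
    `|(x1 - x1') / (D x1 * D x1')| + b <= 16 * K * Q / (rho * mu) ->
    `|x1 - x1'| <= Z.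
  move=> x01 x01' Dx Dx' b0 hb.
  have -> : x1 - x1' = (x1 - x1') / (D x1 * D x1') * (D x1 * D x1').
    by rewrite divfK // mulf_neq0.
  rewrite normrM /Z.
  have -> : 16 * K ^+ 3 * Q / (rho * mu) = 16 * K * Q / (rho * mu) * (K * K).
    by rewrite exprS expr2; ring.
  apply: ler_pM => //; first by lra.
  by rewrite normrM; apply: ler_pM => //; apply: DK.
split; first by apply: (fin _ _ `|be|).
by apply: (fin _ _ `|al|) => //; rewrite addrC.
Qed.

(** The unit interval is cut into blocks of length [1 / m], short enough for the linearisation to be
    dominated by the transversality [mu]. In each pair of blocks, one solution confines all others
    to a product of two intervals of radius [Z]. The parameter 1 falls into an extra block, hence
    [m.+1]. *)
Lemma pair_count (u : 'rV[R]_2) :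
  #|[set x : T * T | [&& D (tt x.1) != 0, D (tt x.2) != 0,
      mu <= `|wedge (r (tt x.1)) (r (tt x.2))| &
      `|u + rho *: (ga (tt x.1) + ga (tt x.2))| <= Q]]%SET|%:R <=
  (m.+1%:R ^+ 2) * (2 * Z * N + 2) ^+ 2.
Proof.
set S := [set x | _]%SET.
pose c j : 'I_m.+1 := inord `|Num.floor (tt j * m%:R)|%N.
have mm0 : 0 < m%:R :> R by rewrite ltr0n.
have cP j j' : c j = c j' -> `|tt j - tt j'| <= m%:R^-1.
  have fl i : 0 <= Num.floor (tt i * m%:R) <= m%:Z.
    have /andP[t0 t1] := tt01 i.
    rewrite floor_ge0 mulr_ge0 //=.
    have : (Num.floor (tt i * m%:R))%:~R <= m%:Z%:~R :> R.
      apply: le_trans (floor_le _) _.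
      by rewrite -[leRHS]mul1r; apply: ler_wpM2r.
    by rewrite ler_int.
  move=> /(congr1 (@nat_of_ord _)); have := fl j; have := fl j' => f1 f2.
  rewrite !inordK; try lia.
  move=> ef.
  have {}ef : Num.floor (tt j * m%:R) = Num.floor (tt j' * m%:R) by lia.
  have e1 := floor_le (tt j * m%:R); have e2 := floorD1_gt (tt j * m%:R).
  have e3 := floor_le (tt j' * m%:R); have e4 := floorD1_gt (tt j' * m%:R).
  rewrite intrD mulr1z in e2; rewrite intrD mulr1z in e4; rewrite -ef in e3 e4.
  rewrite -[leRHS]mul1r ler_pdivlMr // -(gtr0_norm mm0) -normrM mulrBl.
  rewrite ler_norml; lra.
have Z0 : 0 <= Z.
  by rewrite /Z divr_ge0 ?mulr_ge0 ?exprn_ge0 // ltW.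
have -> : #|S| = (\sum_(pq : 'I_m.+1 * 'I_m.+1)
    #|[set x in S | (c x.1, c x.2) == pq]%SET|)%N.
  rewrite -sum1_card (partition_big (fun x => (c x.1, c x.2)) xpredT) //=.
  apply: eq_bigr => pq _; rewrite -sum1_card; apply: eq_bigl => x.
  by rewrite !inE.
rewrite natr_sum.
apply: (@le_trans _ _ (\sum_(pq : 'I_m.+1 * 'I_m.+1) (2 * Z * N + 2) ^+ 2)).
  apply: ler_sum => pq _.
  have [->|[y]] := set_0Vmem [set x in S | (c x.1, c x.2) == pq]%SET.
    by rewrite cards0 exprn_ge0 //; have := mulr_ge0 Z0 N0; lra.
  rewrite !inE => /andP[/and4P[y1 y2 y3 y4] /eqP ypq].
  apply: (@le_trans _ _ #|finset.setX [set j | `|tt j - tt y.1| <= Z]%SET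
     [set j | `|tt j - tt y.2| <= Z]%SET|%:R).
    rewrite ler_nat; apply: subset_leq_card; apply/fintype.subsetP => x.
    rewrite !inE => /andP[/and4P[x1 x2 x3 x4]]; rewrite -ypq => /eqP[c1 c2].
    by have [-> ->] := close x1 x2 y1 y2 y3 (cP _ _ c1) (cP _ _ c2) x4 y4.
  rewrite cardsX natrM expr2; apply: ler_pM => //; exact: spacing.
rewrite sumr_const cardT -cardE card_prod card_ord.
by rewrite -[leLHS]mulr_natl natrM expr2.
Qed.

End wedge.

(** * Non-degeneracy of the family *)

Section contfun.
Variables (R : realType) (T : topologicalType).

Lemma cont_sum (I : Type) (s : seq I) (F : I -> T -> R) :
  (forall i, continuous (F i)) -> continuous (fun x => \sum_(i <- s) F i x).
Proof.
by move=> h; apply: continuous_big => //; apply: add_continuous.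
Qed.

Lemma cont_add (f g : T -> R) : continuous f -> continuous g ->
  continuous (fun x => f x + g x).
Proof. by move=> cf cg x; apply: continuousD; [apply: cf|apply: cg]. Qed.

Lemma cont_mul (f g : T -> R) : continuous f -> continuous g ->
  continuous (fun x => f x * g x).
Proof. by move=> cf cg x; apply: continuousM; [apply: cf|apply: cg]. Qed.

Lemma cont_opp (f : T -> R) : continuous f -> continuous (fun x => - f x).
Proof. by move=> cf x; apply: continuousN; apply: cf. Qed.

Lemma cont_cst (c : R) : continuous (fun _ : T => c).
Proof. by move=> x; apply: cvg_cst. Qed.

Lemma cont_norm (f : T -> R) : continuous f -> continuous (fun x => `|f x|).
Proof.
move=> cf x; apply: (@continuous_comp _ _ _ f (fun y : R => `|y|)); first exact: cf.
exact: norm_continuous.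
Qed.

Lemma cont_mulmx (n m : nat) (g : T -> 'rV[R]_n) (A : 'M[R]_(n, m)) j :
  (forall i, continuous (fun x => g x 0 i)) ->
  continuous (fun x => (g x *m A) 0 j).
Proof.
move=> h; rewrite (_ : (fun x => _) = (fun x => \sum_k g x 0 k * A k j)).
  by apply: cont_sum => k; apply: cont_mul => //; apply: cont_cst.
by apply/funext => x; rewrite mxE.
Qed.

Lemma cont_wedge (g h : T -> 'rV[R]_2) :
  (forall i, continuous (fun x => g x 0 i)) ->
  (forall i, continuous (fun x => h x 0 i)) ->
  continuous (fun x => wedge (g x) (h x)).
Proof.
move=> cg ch; apply: cont_add; first exact: cont_mul.
by apply: cont_opp; apply: cont_mul.
Qed.

End contfun.

(** The polynomial [h = p - c q] vanishes at [t] and satisfies the same relation. If it had finite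
    order m + 1 at [t], where [q] does not vanish, then [h' q] would have order m there and [h q']
    at least m + 1. *)
Lemma wronskian_eq0 (R : numFieldType) (p q : {poly R}) (t : R) :
  q.[t] != 0 -> p^`() * q = p * q^`() -> p = (p.[t] / q.[t]) *: q.
Proof.
move=> qt W; apply/eqP; rewrite -subr_eq0; set c := _ / _.
set h := p - c *: q; apply: contraT => h0.
have Wh : h^`() * q = h * q^`().
  by rewrite /h derivB derivZ !mulrBl W -!scalerAl [q^`() * q]mulrC.
have ht : h.[t] = 0 by rewrite /h !hornerE /c divfK ?subrr.
have [m [g gt hE]] := multiplicity_XsubC h t.
rewrite h0 /= in gt.
case: m => [|m] in hE.
  by rewrite hE expr0 mulr1 in ht; rewrite /root ht eqxx in gt.
have Xm : ('X - t%:P) ^+ m != 0 :> {poly R} by rewrite expf_neq0 // polyXsubC_eq0.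
have := Wh; rewrite hE derivM deriv_exp derivXsubC mul1r /= exprS.
move=> E; have {}E : (g^`() * ('X - t%:P) + g *+ m.+1) * q =
    g * ('X - t%:P) * q^`().
  apply: (mulIf Xm); move: E; rewrite -[g *+ _]mulr_natl.
  rewrite -[(('X - t%:P) ^+ m) *+ _]mulr_natl.
  set Y := ('X - t%:P) ^+ m; set Z := 'X - t%:P; set k := m.+1%:R => E.
  by apply: (etrans _ (etrans E _)); ring.
have := congr1 (fun p => p.[t]) E.
rewrite !hornerE subrr !mulr0 mul0r add0r hornerMn -mulr_natl => /eqP.
by rewrite !mulf_eq0 pnatr_eq0 /= (negbTE qt) orbF -/(root g t) (negbTE gt).
Qed.

(** Fixed nodes turn the nonvanishing of a polynomial into that of a finite sum, which depends
    continuously on its coefficients; this prepares the compactness arguments. *)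
Lemma poly_neq0_node (R : realType) (p : {poly R}) (n : nat) : (0 < n)%N ->
  (size p <= n)%N -> p != 0 ->
  exists i : 'I_n, p.[i%:R / n%:R] != 0.
Proof.
move=> n0 sp p0; apply/existsP; apply: contraT; rewrite negb_exists => /forallP h.
have := @max_poly_roots _ p [seq (nat_of_ord i)%:R / n%:R | i <- enum 'I_n] p0.
rewrite size_map size_enum_ord ltnNge sp /= => H; apply: H.
  by apply/allP => _ /mapP[i _ ->]; have := h i; rewrite negbK.
rewrite map_inj_uniq ?enum_uniq // => i j.
have nn : n%:R != 0 :> R by rewrite pnatr_eq0 -lt0n.
by move/(mulIf (invr_neq0 nn))/eqP; rewrite eqr_nat => /eqP; apply: val_inj.
Qed.

Section family.
Variables (R : realType) (Bp : 'M[{poly R}]_(4, 2)) (n : nat).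
Hypothesis n_gt0 : (0 < n)%N.
Hypothesis size_B : forall i j, (size (Bp i j) <= n)%N.

Definition ev (m k : nat) (t : R) (A : 'M[{poly R}]_(m, k)) : 'M[R]_(m, k) :=
  map_mx (horner_eval t) A.

Lemma ev_mul (m k l : nat) (t : R) (A : 'M[{poly R}]_(m, k))
    (A' : 'M[{poly R}]_(k, l)) : ev t (A *m A') = ev t A *m ev t A'.
Proof. exact: map_mxM. Qed.

Lemma ev_const (m k : nat) (t : R) (A : 'M[R]_(m, k)) :
  ev t (map_mx polyC A) = A.
Proof. by apply/matrixP => i j; rewrite !mxE /horner_eval hornerC. Qed.

(** Its zeros are the [t] at which the images of [x] and [y] under B_t are dependent: the rank
    hypothesis in polynomial form. *)
Definition pw (x y : 'rV[R]_4) : {poly R} :=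
  wedge (map_mx polyC x *m Bp) (map_mx polyC y *m Bp).

Lemma row_horner (k : nat) (u : 'rV[R]_4) (A : 'M[{poly R}]_(4, k)) t j :
  ((map_mx polyC u *m A) 0 j).[t] = (u *m ev t A) 0 j.
Proof. by rewrite -[in RHS](ev_const t u) -ev_mul [RHS]mxE. Qed.

Lemma pw_horner x y t : (pw x y).[t] = wedge (x *m ev t Bp) (y *m ev t Bp).
Proof. by rewrite /pw /wedge !hornerE !row_horner. Qed.

Lemma pwD x y z a : pw x (y + a *: z) = pw x y + a *: pw x z.
Proof.
by rewrite /pw map_mxD map_mxZ mulmxDl -scalemxAl /wedge !mxE -!mul_polyC; ring.
Qed.

Lemma pwZ a b x y : pw (a *: x) (b *: y) = (a * b) *: pw x y.
Proof.
by rewrite /pw !map_mxZ -!scalemxAl /wedge !mxE -!mul_polyC polyCM; ring.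
Qed.

Lemma pw_self x : pw x x = 0.
Proof. by rewrite /pw /wedge mulrC subrr. Qed.

Lemma size_row (x : 'rV[R]_4) j : (size ((map_mx polyC x *m Bp) 0 j)%R <= n)%N.
Proof.
rewrite mxE; apply: leq_trans (size_sum _ _ _) _.
apply/bigmax_leqP => k _; rewrite mxE mul_polyC.
exact: leq_trans (size_scale_leq _ _) (size_B _ _).
Qed.

Lemma size_wedge (m k : nat) (u v : 'rV[{poly R}]_2) :
  (forall j, (size (u 0 j)%R <= m)%N) -> (forall j, (size (v 0 j)%R <= k)%N) ->
  (size (wedge u v) <= m + k)%N.
Proof.
have sM (p q : {poly R}) : (size p <= m)%N -> (size q <= k)%N ->
    (size (p * q)%R <= m + k)%N.
  move=> pm qk; apply: leq_trans (size_polyMleq _ _) _.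
  by apply: leq_trans (leq_pred _) _; apply: leq_add.
move=> hu hv; apply: leq_trans (size_polyD _ _) _.
by rewrite geq_max size_polyN !sM.
Qed.

Lemma size_pw x y : (size (pw x y) <= n + n)%N.
Proof. by apply: size_wedge => j; apply: size_row. Qed.

(** The Wronskian of [pw x y] and [pw x z]. When [pw x y] is not zero, it vanishes identically only
    if [pw x z] is a constant multiple of [pw x y]. *)
Definition Wr (x y z : 'rV[R]_4) : {poly R} :=
  (pw x z)^`() * pw x y - pw x z * (pw x y)^`().

Lemma size_Wr x y z : (size (Wr x y z) <= 4 * n)%N.
Proof.
have sM (p q : {poly R}) : (size p <= n + n)%N -> (size q <= n + n)%N ->
    (size (p * q)%R <= 4 * n)%N.
  move=> ps qs; apply: leq_trans (size_polyMleq _ _) _.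
  by apply: leq_trans (leq_pred _) _; apply: leq_trans (leq_add ps qs) _; lia.
have sD (p : {poly R}) : (size p <= n + n)%N -> (size p^`() <= n + n)%N.
  by move=> sp; apply: leq_trans (size_poly _ _) _; apply: leq_trans (leq_pred _) sp.
apply: leq_trans (size_polyD _ _) _.
by rewrite geq_max size_polyN !sM ?sD ?size_pw.
Qed.

(* The moves of the Gram-Schmidt process. *)
Lemma Wr_shift x y z a b c : Wr x (y + a *: x) (z + b *: x + c *: (y + a *: x)) = Wr x y z.
Proof.
rewrite /Wr !pwD pw_self !scaler0 !addr0 [(_ + c *: _)^`()]derivD derivZ.
by rewrite -!mul_polyC; ring.
Qed.

Lemma Wr_scale x y z a b c :
  Wr (a *: x) (b *: y) (c *: z) = (a ^+ 2 * b * c) *: Wr x y z.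
Proof.
by rewrite /Wr !pwZ !derivZ -!mul_polyC expr2 !polyCM; ring.
Qed.

Hypothesis nondeg : forall x y : 'rV[R]_4,
  (forall a b, a *: x + b *: y = 0 -> a = 0 /\ b = 0) -> pw x y != 0.

Definition dot (x y : 'rV[R]_4) : R := \sum_i x 0 i * y 0 i.

Lemma dotC x y : dot x y = dot y x.
Proof. by apply: eq_bigr => i _; rewrite mulrC. Qed.

Lemma dotDr x y z a : dot x (y + a *: z) = dot x y + a * dot x z.
Proof.
rewrite /dot mulr_sumr -big_split /=; apply: eq_bigr => i _.
by rewrite !mxE; ring.
Qed.

Lemma dotZ a b x y : dot (a *: x) (b *: y) = a * b * dot x y.
Proof.
by rewrite /dot mulr_sumr; apply: eq_bigr => i _; rewrite !mxE; ring.
Qed.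

Lemma dot0r x : dot x 0 = 0.
Proof. by rewrite /dot big1 // => i _; rewrite mxE mulr0. Qed.

Lemma dot_ge0 x : 0 <= dot x x.
Proof. by apply: sumr_ge0 => i _; rewrite -expr2 sqr_ge0. Qed.

Lemma norm_le_dot x : `|x| <= Num.sqrt (dot x x).
Proof.
apply: mx_norm_le => [|i j]; first exact: sqrtr_ge0.
rewrite (ord1 i) -sqrtr_sqr ler_sqrt ?dot_ge0 // /dot (bigD1 j) //= -expr2 lerDl.
by apply: sumr_ge0 => k _; rewrite -expr2 sqr_ge0.
Qed.

Definition orthn (w : 'rV[R]_4 * 'rV[R]_4 * 'rV[R]_4) : Prop :=
  [/\ dot w.1.1 w.1.1 = 1, dot w.1.2 w.1.2 = 1, dot w.2 w.2 = 1 &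
    [/\ dot w.1.1 w.1.2 = 0, dot w.1.1 w.2 = 0 & dot w.1.2 w.2 = 0]].

(** A vanishing Wronskian gives [pw x z = c *: pw x y]. Then [pw] vanishes on the independent
    vectors [x] and [z - c y], against [nondeg]. *)
Lemma Wr_neq0 w : orthn w -> Wr w.1.1 w.1.2 w.2 != 0.
Proof.
case: w => [[x y] z] [/= xx yy zz [xy xz yz]].
have ind (u v : 'rV[R]_4) : dot u u = 1 -> dot u v = 0 -> dot v v != 0 ->
    forall a b, a *: u + b *: v = 0 -> a = 0 /\ b = 0.
  move=> uu uv vv a b E.
  have a0 : a = 0.
    have := congr1 (dot u) E; rewrite dotDr dot0r uv mulr0 addr0.
    by rewrite -[X in dot X _]scale1r dotZ uu mul1r mulr1.
  split=> //; have := congr1 (dot v) E; rewrite a0 scale0r dotDr dot0r add0r.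
  by move/eqP; rewrite mulf_eq0 (negbTE vv) orbF => /eqP.
have q0 : pw x y != 0 by apply: nondeg; apply: ind; rewrite ?yy ?oner_eq0.
apply/eqP => W0.
have [//|s2 qt] := @poly_neq0_node R (pw x y) (n + n) _ (size_pw x y) q0.
  by rewrite addn_gt0 n_gt0.
have WE : (pw x z)^`() * pw x y = pw x z * (pw x y)^`().
  by apply/eqP; rewrite -subr_eq0; apply/eqP.
have [c E] : exists c, pw x z = c *: pw x y.
  by eexists; apply: wronskian_eq0 qt WE.
have zc : pw x (z + (- c) *: y) = 0.
  by apply/eqP; rewrite pwD scaleNr subr_eq0; apply/eqP.
have xv : dot x (z + (- c) *: y) = 0 by rewrite dotDr xz xy mulr0 addr0.
have yv : dot y (z + (- c) *: y) = - c by rewrite dotDr yz yy mulr1 add0r.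
have zv : dot z (z + (- c) *: y) = 1.
  by rewrite dotDr zz [dot z y]dotC yz mulr0 addr0.
have vv : dot (z + (- c) *: y) (z + (- c) *: y) != 0.
  rewrite dotDr [dot _ z]dotC zv [dot _ y]dotC yv mulrNN -expr2.
  by rewrite gt_eqF // ltr_pwDl // sqr_ge0.
by have := nondeg (ind _ _ xx xv vv); rewrite zc eqxx.
Qed.

Let node (i : 'I_(4 * n)) : R := (i : nat)%:R / (4 * n)%:R.

Lemma node01 i : 0 <= node i <= 1.
Proof.
rewrite /node divr_ge0 //= ler_pdivrMr ?ltr0n ?muln_gt0 //.
by rewrite mul1r ler_nat ltnW.
Qed.

Let coordc (f : 'rV[R]_4 * 'rV[R]_4 * 'rV[R]_4 -> 'rV[R]_4) :
  continuous f -> forall i, continuous (fun w => f w 0 i).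
Proof.
move=> cf i w; apply: (@continuous_comp _ _ _ f (fun y : 'rV[R]_4 => y 0 i)).
  exact: cf.
exact: coord_continuous.
Qed.

Let c1 : continuous (fun w : 'rV[R]_4 * 'rV[R]_4 * 'rV[R]_4 => w.1.1).
Proof.
move=> w; apply: (@continuous_comp _ _ _ fst fst); first exact: cvg_fst.
exact: cvg_fst.
Qed.
Let c2 : continuous (fun w : 'rV[R]_4 * 'rV[R]_4 * 'rV[R]_4 => w.1.2).
Proof.
move=> w; apply: (@continuous_comp _ _ _ fst snd); first exact: cvg_fst.
exact: cvg_snd.
Qed.
Let c3 : continuous (fun w : 'rV[R]_4 * 'rV[R]_4 * 'rV[R]_4 => w.2).
Proof. by move=> w; exact: cvg_snd. Qed.

Lemma pw_deriv_horner x y t : ((pw x y)^`()).[t] =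
  wedge (x *m ev t (map_mx deriv Bp)) (y *m ev t Bp) +
  wedge (x *m ev t Bp) (y *m ev t (map_mx deriv Bp)).
Proof.
have dE (u : 'rV[R]_4) j : ((map_mx polyC u *m Bp) 0 j)^`() =
    (map_mx polyC u *m map_mx deriv Bp) 0 j.
  by rewrite !mxE raddf_sum; apply: eq_bigr => k _; rewrite /= !mxE !mul_polyC derivZ.
set rhs := (X in _ = X).
rewrite /pw /wedge derivB !derivM !dE !hornerE !row_horner /rhs /wedge; ring.
Qed.

Lemma orthn_closed : closed [set w | orthn w].
Proof.
have cd (f g : 'rV[R]_4 * 'rV[R]_4 * 'rV[R]_4 -> 'rV[R]_4) (c : R) :
   continuous f -> continuous g -> closed [set w | dot (f w) (g w) = c].
  move=> cf cg.
  apply: (@preimage_closed _ _ (fun w => dot (f w) (g w)) [set c]).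
    move=> w _; apply: cont_sum => i.
    by apply: cont_mul; apply: coordc.
  by apply: accessible_closed_set1; apply: hausdorff_accessible; apply: Rhausdorff.
rewrite (_ : [set w | _] =
  ([set w | dot w.1.1 w.1.1 = 1] `&` [set w | dot w.1.2 w.1.2 = 1] `&`
   [set w | dot w.2 w.2 = 1]) `&` ([set w | dot w.1.1 w.1.2 = 0] `&`
   [set w | dot w.1.1 w.2 = 0] `&` [set w | dot w.1.2 w.2 = 0])).
  by repeat apply: closedI; apply: cd.
by apply/seteqP; split=> w [] => [? ? ? [? ? ?]|[[? ?] ?] [[? ?] ?]].
Qed.

(** Compactness of the set of orthonormal triples. The supremum over [t] is replaced by the sum over
    the nodes, which is continuous in the triple and positive by [Wr_neq0]. *)
Lemma Wr_orthn_lower : exists2 c : R, 0 < c &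
  forall w, orthn w -> exists2 t, 0 <= t <= 1 & c <= `|(Wr w.1.1 w.1.2 w.2).[t]|.
Proof.
have n4 : (0 < 4 * n)%N by rewrite muln_gt0.
pose f (w : 'rV[R]_4 * 'rV[R]_4 * 'rV[R]_4) :=
  \sum_(i < 4 * n) `|(Wr w.1.1 w.1.2 w.2).[node i]|.
have cf : continuous f.
  apply: cont_sum => i; apply: cont_norm.
  rewrite (_ : (fun w => _) = (fun w : 'rV[R]_4 * 'rV[R]_4 * 'rV[R]_4 =>
     ((pw w.1.1 w.2)^`()).[node i] * (pw w.1.1 w.1.2).[node i] +
     - ((pw w.1.1 w.2).[node i] * ((pw w.1.1 w.1.2)^`()).[node i]))); last first.
    by apply/funext => w; rewrite /Wr !hornerE.
  have cw (g h : 'rV[R]_4 * 'rV[R]_4 * 'rV[R]_4 -> 'rV[R]_4) A A' :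
     continuous g -> continuous h ->
     continuous (fun w => wedge (g w *m A) (h w *m A')).
    by move=> cg ch; apply: cont_wedge => j; apply: cont_mulmx; apply: coordc.
  have cp (g h : 'rV[R]_4 * 'rV[R]_4 * 'rV[R]_4 -> 'rV[R]_4) :
     continuous g -> continuous h -> continuous (fun w => (pw (g w) (h w)).[node i]).
    move=> cg ch; rewrite (_ : (fun w => _) =
      (fun w => wedge (g w *m ev (node i) Bp) (h w *m ev (node i) Bp))).
      exact: cw.
    by apply/funext => w; rewrite pw_horner.
  have cdp (g h : 'rV[R]_4 * 'rV[R]_4 * 'rV[R]_4 -> 'rV[R]_4) :
     continuous g -> continuous h -> continuous (fun w => ((pw (g w) (h w))^`()).[node i]).
    move=> cg ch; rewrite (_ : (fun w => _) =
      (fun w => wedge (g w *m ev (node i) (map_mx deriv Bp)) (h w *m ev (node i) Bp) +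
       wedge (g w *m ev (node i) Bp) (h w *m ev (node i) (map_mx deriv Bp)))).
      by apply: cont_add; apply: cw.
    by apply/funext => w; rewrite pw_deriv_horner.
  apply: cont_add; first by apply: cont_mul; [apply: cdp|apply: cp].
  by apply: cont_opp; apply: cont_mul; [apply: cp|apply: cdp].
pose A := [set w : 'rV[R]_4 * 'rV[R]_4 * 'rV[R]_4 | orthn w].
have cA : compact A.
  pose U := [set x : 'rV[R]_4 | `|x| <= 1].
  have cU : compact U.
    apply: bounded_closed_compact; last first.
      apply: (@preimage_closed _ _ (fun x : 'rV[R]_4 => `|x|) [set r : R | r <= 1]).
        by move=> x _; exact: norm_continuous.
      exact: closed_le.
    exists 1; split; first exact: num_real.
    by move=> M M1 x /= /le_trans; apply; apply: ltW.
  apply: (subclosed_compact orthn_closed (compact_setX (compact_setX cU cU) cU)).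
  move=> w [e1 e2 e3 _]; split; first split; rewrite /U /=.
  - by apply: le_trans (norm_le_dot _) _; rewrite e1 sqrtr1.
  - by apply: le_trans (norm_le_dot _) _; rewrite e2 sqrtr1.
  - by apply: le_trans (norm_le_dot _) _; rewrite e3 sqrtr1.
have A0 : A !=set0.
  pose ei (k : 'I_4) : 'rV[R]_4 := delta_mx 0 k.
  have dd k l : dot (ei k) (ei l) = (k == l)%:R.
    rewrite /dot (bigD1 k) //= !mxE !eqxx mul1r big1 ?addr0.
      by rewrite eq_sym.
    by move=> i ik; rewrite !mxE (negbTE ik) andbF mul0r.
  by exists (ei 0, ei 1, ei 2%:R); split; rewrite /= ?dd //; split; rewrite dd.
have [w /set_mem Aw wmin] := compact_EVT_min A0 cA
  (continuous_subspaceT (fun x => cf x)).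
have fpos : 0 < f w.
  have [i hi] := poly_neq0_node n4 (size_Wr _ _ _) (Wr_neq0 Aw).
  rewrite /f (bigD1 i) //=; apply: ltr_pwDl; first by rewrite normr_gt0.
  exact: sumr_ge0.
exists (f w / (4 * n)%:R); first by rewrite divr_gt0 ?ltr0n.
move=> v Av; have := wmin v (mem_set Av).
case: (pickP (fun i => f w / (4 * n)%:R <= `|(Wr v.1.1 v.1.2 v.2).[node i]|)).
  by move=> i hi _; exists (node i) => //; apply: node01.
move=> no fwv; exfalso; move: fwv; rewrite leNgt => /negP; apply.
rewrite [ltRHS](_ : _ = \sum_(i < 4 * n) f w / (4 * n)%:R); last first.
  by rewrite sumr_const card_ord -[RHS]mulr_natl mulrC divfK // pnatr_eq0 -lt0n.
apply: ltr_sum => [|i _]; last by rewrite ltNge no.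
by apply/hasP; exists (Ordinal n4); rewrite ?mem_index_enum.
Qed.

End family.

(** * Coordinates attached to two directions *)

Section polybound.
Variable R : realType.

(** A bound on the coefficients, unlike one on the values, passes directly to products, derivatives
    and Taylor remainders. *)
Definition pb (m : nat) (K : R) (p : {poly R}) : Prop :=
  (size p <= m)%N /\ forall i, `|p`_i| <= K.

Lemma pb_ge0 m K p : pb m K p -> 0 <= K.
Proof. by case=> _ /(_ 0); apply: le_trans. Qed.

Lemma pbD m K L p q : pb m K p -> pb m L q -> pb m (K + L) (p + q).
Proof.
case=> sp hp [sq hq]; split.
  by apply: leq_trans (size_polyD _ _) _; rewrite geq_max sp.
by move=> i; rewrite coefD; apply: ler_normD_le.
Qed.

Lemma pbN m K p : pb m K p -> pb m K (- p).
Proof. by case=> sp hp; split=> [|i]; rewrite ?size_polyN // coefN normrN. Qed.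

Lemma pb_sum (I : Type) (s : seq I) m K (F : I -> {poly R}) :
  (forall i, pb m K (F i)) -> pb m ((size s)%:R * K) (\sum_(i <- s) F i).
Proof.
move=> h; elim: s => [|x s IH].
  by rewrite big_nil mul0r; split=> [|i]; rewrite ?size_poly0 // coef0 normr0.
by rewrite big_cons /= -natr1 mulrDl mul1r addrC; apply: pbD.
Qed.

Lemma pbZ m K c p : pb m K p -> pb m (`|c| * K) (c *: p).
Proof.
case=> sp hp; split=> [|i]; first exact: leq_trans (size_scale_leq _ _) sp.
by rewrite coefZ normrM ler_wpM2l.
Qed.

Lemma pbM m k K L p q : pb m K p -> pb k L q -> pb (m + k) (m%:R * (K * L)) (p * q).
Proof.
move=> bp bq; have K0 := pb_ge0 bp; have L0 := pb_ge0 bq.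
case: bp bq => sp hp [sq hq]; split.
  apply: leq_trans (size_polyMleq _ _) _.
  by apply: leq_trans (leq_pred _) _; apply: leq_add.
move=> i; rewrite coefM; apply: le_trans (ler_norm_sum _ _ _) _.
apply: (@le_trans _ _ (\sum_(j < i.+1 | (j < m)%N) K * L)).
  rewrite [leLHS](bigID (fun j : 'I_i.+1 => (j < m)%N)) /=.
  rewrite [X in _ + X <= _]big1 ?addr0 => [|j jm]; last first.
    by rewrite nth_default ?mul0r ?normr0 // (leq_trans sp) // leqNgt.
  by apply: ler_sum => j _; rewrite normrM ler_pM.
rewrite sumr_const -[leLHS]mulr_natl; apply: ler_wpM2r; first exact: mulr_ge0.
rewrite ler_nat cardE -(size_map val) -[leqRHS](size_iota 0).
apply: uniq_leq_size; first by rewrite map_inj_uniq ?enum_uniq //; exact: val_inj.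
by move=> _ /mapP[j jm ->]; move: jm; rewrite mem_enum mem_iota.
Qed.

Lemma pb_deriv m K p : pb m K p -> pb m (m%:R * K) p^`().
Proof.
move=> bp; have K0 := pb_ge0 bp; case: bp => sp hp; split.
  by apply: leq_trans (size_poly _ _) _; apply: leq_trans (leq_pred _) sp.
move=> i; rewrite coef_deriv; have [im|mi] := ltnP i.+1 m; last first.
  by rewrite nth_default ?mul0rn ?normr0 ?mulr_ge0 // (leq_trans sp).
by rewrite -[_ *+ i.+1]mulr_natl normrM normr_nat; apply: ler_pM => //; rewrite ler_nat ltnW.
Qed.

Lemma pb_horner m K p t : pb m K p -> 0 <= t <= 1 -> `|p.[t]| <= m%:R * K.
Proof.
case=> sp hp /andP[t0 t1]; rewrite (horner_coef_wide _ sp).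
apply: le_trans (ler_norm_sum _ _ _) _.
apply: (@le_trans _ _ (\sum_(i < m) K)); last first.
  by rewrite sumr_const card_ord -[leLHS]mulr_natl.
apply: ler_sum => i _; rewrite normrM -[leRHS]mulr1; apply: ler_pM => //.
by rewrite normrX (ger0_norm t0) exprn_ile1.
Qed.

Lemma expr_taylor (s s' : R) i : 0 <= s <= 1 -> 0 <= s' <= 1 ->
  `|s ^+ i - s' ^+ i - (s - s') * (s' ^+ i.-1 *+ i)| <= (i ^ 2)%:R * (s - s') ^+ 2.
Proof.
move=> /andP[s0 s1] /andP[s0' s1']; elim: i => [|i IH].
  by rewrite !expr0 subrr mulr0n mulr0 subrr normr0 mul0r.
have -> : s ^+ i.+1 - s' ^+ i.+1 - (s - s') * (s' ^+ i.+1.-1 *+ i.+1) =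
  s * (s ^+ i - s' ^+ i - (s - s') * (s' ^+ i.-1 *+ i)) +
  (s - s') ^+ 2 * (s' ^+ i.-1 *+ i).
  case: i {IH} => [|i] /=; rewrite ?expr0 ?expr1 ?mulr0n ?mulr1n; first ring.
  by rewrite -[_ *+ i.+2]mulr_natl -[_ *+ i.+1]mulr_natl -!natr1 !exprS; ring.
have h2 : 0 <= (s - s') ^+ 2 by exact: sqr_ge0.
apply: (@le_trans _ _ ((i ^ 2)%:R * (s - s') ^+ 2 + (s - s') ^+ 2 * i%:R)).
  apply: ler_normD_le.
    rewrite normrM -[leRHS]mul1r; apply: ler_pM => //.
    by rewrite (ger0_norm s0).
  rewrite normrM (ger0_norm h2); apply: ler_wpM2l => //.
  rewrite -[_ *+ i]mulr_natl normrM normr_nat -[leRHS]mulr1; apply: ler_wpM2l => //.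
  by rewrite normrX (ger0_norm s0') exprn_ile1.
rewrite [_ * i%:R]mulrC -mulrDl; apply: ler_wpM2r => //.
by rewrite -natrD ler_nat !expnS !expn0; lia.
Qed.

Lemma pb_taylor m K p (s s' : R) : pb m K p -> 0 <= s <= 1 -> 0 <= s' <= 1 ->
  `|p.[s] - p.[s'] - (s - s') * (p^`()).[s']| <= (m ^ 3)%:R * K * (s - s') ^+ 2.
Proof.
move=> bp s01 s01'; have K0 := pb_ge0 bp; case: bp => sp hp.
have -> : p.[s] - p.[s'] - (s - s') * (p^`()).[s'] =
  \sum_(i < m) p`_i * (s ^+ i - s' ^+ i - (s - s') * (s' ^+ i.-1 *+ i)).
  rewrite !(horner_coef_wide _ sp) (_ : (p^`()).[s'] = \sum_(i < m) p`_i * (s' ^+ i.-1 *+ i)).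
    rewrite mulr_sumr -!sumrB; apply: eq_bigr => i _; ring.
  have -> : p = \poly_(i < m) p`_i.
    apply/polyP => i; rewrite coef_poly; case: ltnP => // mi.
    by rewrite nth_default // (leq_trans sp).
  rewrite poly_def raddf_sum horner_sum; apply: eq_bigr => i _ /=.
  rewrite derivZ derivXn hornerZ hornerMn hornerXn; congr (_ * _).
  by rewrite -poly_def coef_poly ltn_ord.
apply: le_trans (ler_norm_sum _ _ _) _.
apply: (@le_trans _ _ (\sum_(i < m) K * ((m ^ 2)%:R * (s - s') ^+ 2))).
  apply: ler_sum => i _; rewrite normrM; apply: ler_pM => //.
  apply: le_trans (expr_taylor i s01 s01') _.
  apply: ler_wpM2r; first exact: sqr_ge0.
  by rewrite ler_nat leq_sqr ltnW.
rewrite sumr_const card_ord -[leLHS]mulr_natl [in leRHS]expnS natrM.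
by rewrite le_eqVlt; apply/orP; left; apply/eqP; ring.
Qed.

End polybound.

Section det2.
Variable S : comPzRingType.

Definition det2 (A : 'M[S]_2) : S := A 0 0 * A 1 1 - A 0 1 * A 1 0.

(** The adjugate of a 2 x 2 matrix. It allows the inverse of a polynomial matrix to be written as a
    polynomial matrix over a scalar denominator. *)
Definition adj2 (A : 'M[S]_2) : 'M[S]_2 :=
  \matrix_(i, j) (if i == j then A (rev_ord i) (rev_ord j) else - A i j).

Let r0 : rev_ord (0 : 'I_2) = 1. Proof. exact: val_inj. Qed.
Let r1 : rev_ord (1 : 'I_2) = 0. Proof. exact: val_inj. Qed.

Lemma ord2P (i : 'I_2) : (i = 0) + (i = 1).
Proof. by case: i => [[|[|//]] h]; [left|right]; apply: val_inj. Qed.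

Lemma mul_adj2 (A : 'M[S]_2) : A *m adj2 A = (det2 A)%:M.
Proof.
apply/matrixP => i j; rewrite !mxE big_ord_recl big_ord1 !mxE.
have -> : lift ord0 ord0 = 1 :> 'I_2 by exact: val_inj.
by case: (ord2P i) => ->; case: (ord2P j) => -> /=; rewrite /det2 ?r0 ?r1 /=; ring.
Qed.

Lemma adj2_mul (A : 'M[S]_2) : adj2 A *m A = (det2 A)%:M.
Proof.
apply/matrixP => i j; rewrite !mxE big_ord_recl big_ord1 !mxE.
have -> : lift ord0 ord0 = 1 :> 'I_2 by exact: val_inj.
by case: (ord2P i) => ->; case: (ord2P j) => -> /=; rewrite /det2 ?r0 ?r1 /=; ring.
Qed.

Lemma det2M (A B : 'M[S]_2) : det2 (A *m B) = det2 A * det2 B.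
Proof.
rewrite /det2 !mxE !big_ord_recl !big_ord0.
have -> : lift ord0 ord0 = 1 :> 'I_2 by exact: val_inj.
by ring.
Qed.

End det2.

Lemma det2E (S : comNzRingType) (A : 'M[S]_2) : \det A = det2 A.
Proof.
rewrite (expand_det_row _ 0) big_ord_recl big_ord1 /cofactor !det_mx11 !mxE /det2.
have -> : lift ord0 ord0 = 1 :> 'I_2 by exact: val_inj.
have -> : lift 1 0 = 0 :> 'I_2 by exact: val_inj.
have -> : ord0 = 0 :> 'I_2 by [].
by rewrite /= addn0 expr0 expr1; ring.
Qed.

Lemma norm_det_le (R : realType) (m : nat) (A : 'M[R]_m) (b : R) :
  (forall i j, `|A i j| <= b) -> `|\det A| <= (m`!)%:R * b ^+ m.
Proof.
move=> h; apply: le_trans (ler_norm_sum _ _ _) _.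
apply: (@le_trans _ _ (\sum_(s : 'S_m) b ^+ m)).
  apply: ler_sum => s _; rewrite normrM normrX normrN1 expr1n mul1r normr_prod.
  rewrite -[X in b ^+ X]card_ord -prodr_const; apply: ler_prod => i _.
  by rewrite normr_ge0 h.
by rewrite sumr_const card_Sn -[leLHS]mulr_natl.
Qed.

Section coords.
Variables (R : realType) (Bp : 'M[{poly R}]_(4, 2)) (n : nat) (CB : R).
Hypotheses (n_gt0 : (0 < n)%N) (CB1 : 1 <= CB).
Hypothesis pbB : forall i j, pb n CB (Bp i j).

Let be := n%:R * CB.
Let n1 : 1 <= n%:R :> R. Proof. by rewrite ler1n. Qed.
Let be1 : 1 <= be.
Proof. by rewrite -[1]mulr1; apply: ler_pM. Qed.

Lemma ev_entry (t : R) i j : 0 <= t <= 1 -> `|ev t Bp i j| <= be.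
Proof. by move=> t01; rewrite mxE; apply: pb_horner. Qed.

Lemma pb_sum_ord (m k : nat) (K : R) (F : 'I_k -> {poly R}) :
  (forall i, pb m K (F i)) -> pb m (k%:R * K) (\sum_i F i).
Proof.
move=> h; have := @pb_sum R 'I_k (index_enum 'I_k) m K F h.
by rewrite [index_enum _]unlock -enumT size_enum_ord.
Qed.

(** The matrix of x -> (x B_a, x B_b). When it is invertible, [M1] and [M2] recover x from these
    coordinates, and B_t = B_a Ft + B_b Gt. *)
Definition frame (a b : R) : 'M[R]_4 := row_mx (ev a Bp) (ev b Bp).
Definition M1 a b : 'M[R]_(2, 4) := usubmx (invmx (frame a b) : 'M[R]_(2 + 2, 4)).
Definition M2 a b : 'M[R]_(2, 4) := dsubmx (invmx (frame a b) : 'M[R]_(2 + 2, 4)).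
Definition Ft a b t : 'M[R]_2 := M1 a b *m ev t Bp.
Definition Gt a b t : 'M[R]_2 := M2 a b *m ev t Bp.

Section fixed_ab.
Variables a b : R.
Hypothesis dab : \det (frame a b) != 0.

Let M12 : col_mx (M1 a b) (M2 a b) = invmx (frame a b) :> 'M[R]_(2 + 2, 4).
Proof. exact: vsubmxK. Qed.

Let unitF : frame a b \in unitmx.
Proof. by rewrite unitmxE unitfE. Qed.

Lemma frame_inv : [/\ M1 a b *m ev a Bp = 1%:M, M1 a b *m ev b Bp = 0,
  M2 a b *m ev a Bp = 0 & M2 a b *m ev b Bp = 1%:M].
Proof.
have : col_mx (M1 a b) (M2 a b) *m row_mx (ev a Bp) (ev b Bp) = 1%:M :> 'M[R]_(2 + 2).
  by rewrite M12; apply: mulVmx.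
rewrite mul_col_row (scalar_mx_block 2 2) => /eq_block_mx[-> -> -> ->].
by [].
Qed.

Lemma frame_dec : ev a Bp *m M1 a b + ev b Bp *m M2 a b = 1%:M.
Proof. by rewrite -mul_row_col M12; apply: mulmxV. Qed.

Lemma ev_dec t : ev t Bp = ev a Bp *m Ft a b t + ev b Bp *m Gt a b t.
Proof. by rewrite /Ft /Gt !mulmxA -mulmxDl frame_dec mul1mx. Qed.

(** [frame t b] is [frame a b] times a block triangular matrix with diagonal blocks [Ft] and 1. Thus
    [Ft] is invertible as soon as [t] and [b] also form a frame. *)
Lemma det_frame_l t : \det (frame t b) = \det (frame a b) * det2 (Ft a b t).
Proof.
have -> : frame t b = frame a b *m (block_mx (Ft a b t) 0 (Gt a b t) 1%:M : 'M[R]_(2 + 2)).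
  have := mul_row_block (ev a Bp) (ev b Bp) (Ft a b t) 0 (Gt a b t) 1%:M.
  by rewrite !mulmx0 add0r mulmx1 -ev_dec => E; apply: esym.
by rewrite det_mulmx (det_lblock (n1 := 2) (n2 := 2)) det1 mulr1 det2E.
Qed.

Lemma det_frame_r t : \det (frame a t) = \det (frame a b) * det2 (Gt a b t).
Proof.
have -> : frame a t = frame a b *m (block_mx 1%:M (Ft a b t) 0 (Gt a b t) : 'M[R]_(2 + 2)).
  have := mul_row_block (ev a Bp) (ev b Bp) 1%:M (Ft a b t) 0 (Gt a b t).
  by rewrite !mulmx0 addr0 mulmx1 -ev_dec => E; apply: esym.
by rewrite det_mulmx (det_ublock (n1 := 2) (n2 := 2)) det1 mul1r det2E.
Qed.

End fixed_ab.

(** This is [Gt] times the inverse of [Ft], so that x B_t = (X + Y phi) Ft; [phi'] is its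
    inverse. *)
Definition phi a b t : 'M[R]_2 := (det2 (Ft a b t))^-1 *: (Gt a b t *m adj2 (Ft a b t)).
Definition phi' a b t : 'M[R]_2 := (det2 (Gt a b t))^-1 *: (Ft a b t *m adj2 (Gt a b t)).

Lemma phiK a b t : det2 (Ft a b t) != 0 -> det2 (Gt a b t) != 0 ->
  phi a b t *m phi' a b t = 1%:M.
Proof.
move=> dF dG; rewrite /phi /phi' -scalemxAl -scalemxAr scalerA.
rewrite mulmxA -(mulmxA (Gt a b t)) adj2_mul mul_mx_scalar -scalemxAl mul_adj2.
by rewrite scalerA scale_scalar_mx [(det2 (Ft a b t))^-1 * _]mulrC mulfVK // mulVf.
Qed.

Definition Fp a b := map_mx polyC (M1 a b) *m Bp.
Definition Gp a b := map_mx polyC (M2 a b) *m Bp.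
Definition Dp a b := det2 (Fp a b).
Definition ap a b (v : 'rV[R]_2) := map_mx polyC v *m Gp a b *m adj2 (Fp a b).
(** [ap / Dp] is t -> v phi_t, and [rp / Dp ^+ 2] is its derivative. *)
Definition rp a b (v : 'rV[R]_2) : 'rV[{poly R}]_2 :=
  \row_j ((ap a b v 0 j)^`() * Dp a b - ap a b v 0 j * (Dp a b)^`()).

Lemma ev_Fp a b t : ev t (Fp a b) = Ft a b t.
Proof. by rewrite ev_mul ev_const. Qed.

Lemma ev_Gp a b t : ev t (Gp a b) = Gt a b t.
Proof. by rewrite ev_mul ev_const. Qed.

Lemma ev_adj2 (A : 'M[{poly R}]_2) t : ev t (adj2 A) = adj2 (ev t A).
Proof.
by apply/matrixP => i j; rewrite !mxE /horner_eval; case: ifP; rewrite ?hornerN.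
Qed.

Lemma Dp_horner a b t : (Dp a b).[t] = det2 (Ft a b t).
Proof. by rewrite -ev_Fp /Dp /det2 !hornerE /ev !mxE. Qed.

Lemma ev_ap a b v t : ev t (ap a b v) = v *m Gt a b t *m adj2 (Ft a b t).
Proof. by rewrite /ap ev_mul ev_adj2 ev_Fp ev_mul ev_const ev_Gp. Qed.

Lemma phi_ap a b v t : v *m phi a b t = ((Dp a b).[t])^-1 *: ev t (ap a b v).
Proof. by rewrite /phi -scalemxAr ev_ap Dp_horner mulmxA. Qed.

Section bounds.
Variables (a b la : R).
Hypotheses (a01 : 0 <= a <= 1) (b01 : 0 <= b <= 1) (la0 : 0 < la) (la1 : la <= 1).
Hypothesis hab : la <= `|\det (frame a b)|.

Let dab : \det (frame a b) != 0.
Proof. by rewrite -normr_gt0; apply: lt_le_trans hab. Qed.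

Let il1 : 1 <= la^-1. Proof. by rewrite invf_ge1. Qed.

Lemma frame_entry s t i j : 0 <= s <= 1 -> 0 <= t <= 1 -> `|frame s t i j| <= be.
Proof. by move=> s01 t01; rewrite mxE; case: (fintype.split _) => k; apply: ev_entry. Qed.

Lemma det_frame_le s t : 0 <= s <= 1 -> 0 <= t <= 1 ->
  `|\det (frame s t)| <= 24 * be ^+ 4.
Proof.
move=> s01 t01; have := @norm_det_le R 4 (frame s t) be.
by apply=> i j; apply: frame_entry.
Qed.

(** The entries of the inverse are 3 x 3 minors, with six terms each, over a determinant of absolute
    value at least [la]. *)
Let Li := 6 * be ^+ 3 / la.

Lemma invframe_entry i j : `|invmx (frame a b) i j| <= Li.
Proof.
rewrite /invmx unitmxE unitfE dab !mxE normrM normfV mulrC /Li.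
apply: ler_pM => //; last by rewrite lef_pV2 // posrE ?normr_gt0.
rewrite /cofactor normrM normrX normrN1 expr1n mul1r.
have := @norm_det_le R 3 (row' j (col' i (frame a b))) be.
by apply=> k l; rewrite mxE mxE; apply: frame_entry.
Qed.

Let Li1 : 1 <= Li.
Proof.
rewrite /Li -[1]mulr1; apply: ler_pM => //.
by have := exprn_ege1 3 be1; lra.
Qed.

Lemma M1_entry i j : `|M1 a b i j| <= Li.
Proof. by rewrite mxE; apply: invframe_entry. Qed.

Lemma M2_entry i j : `|M2 a b i j| <= Li.
Proof. by rewrite mxE; apply: invframe_entry. Qed.

Let f := 4 * (Li * CB).

Let f1 : 1 <= f.
Proof. have : 1 * 1 <= Li * CB by apply: ler_pM. by rewrite /f; lra. Qed.

Let pb_coord (M : 'M[R]_(2, 4)) i j : (forall i j, `|M i j| <= Li) ->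
  pb n f ((map_mx polyC M *m Bp) i j).
Proof.
move=> h; rewrite mxE; apply: pb_sum_ord => k; rewrite mxE mul_polyC.
have [s1 h1] := pbZ (M i k) (pbB k j); split=> // l.
by apply: le_trans (h1 l) _; apply: ler_wpM2r => //; apply: le_trans CB1.
Qed.

Lemma pb_Fp i j : pb n f (Fp a b i j).
Proof. by apply: pb_coord => *; apply: M1_entry. Qed.

Lemma pb_Gp i j : pb n f (Gp a b i j).
Proof. by apply: pb_coord => *; apply: M2_entry. Qed.

Let A := 4 * (n%:R * f ^+ 2).

Let nf0 : 0 <= n%:R * f ^+ 2.
Proof. by rewrite mulr_ge0 // exprn_ge0 // (le_trans _ f1). Qed.

Let pb_weak m (K L : R) p : K <= L -> pb m K p -> pb m L p.
Proof. by move=> KL [s1 h1]; split=> // i; apply: le_trans KL. Qed.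

Lemma pb_Dp : pb (n + n) A (Dp a b).
Proof.
apply: (pb_weak (K := n%:R * (f * f) + n%:R * (f * f))).
  by rewrite /A -expr2; have := nf0; lra.
by apply: pbD; [|apply: pbN]; apply: pbM; apply: pb_Fp.
Qed.

Lemma pb_ap v j : `|v| <= 1 -> pb (n + n) A (ap a b v 0 j).
Proof.
move=> v1; rewrite /ap mxE; have f0 : 0 <= f by apply: le_trans f1.
apply: (pb_weak (K := 2%:R * (n%:R * (2%:R * f * f)))).
  by rewrite /A expr2; lra.
apply: pb_sum_ord => k; apply: pbM.
  rewrite mxE; apply: pb_sum_ord => l; rewrite mxE mul_polyC.
  apply: (pb_weak (K := `|v 0 l| * f)); last exact/pbZ/pb_Gp.
  rewrite -[leRHS]mul1r; apply: ler_wpM2r => //.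
  exact: le_trans (mx_coord_le _ _ _) v1.
rewrite mxE; case: ifP => _; first exact: pb_Fp.
exact/pbN/pb_Fp.
Qed.

(** One constant for the sup bounds and the Taylor remainder. The remainder is decisive: it consists
    of two products of a value, at most [2 * n * A], and a remainder with constant
    [(2 * n) ^ 3 * A]. *)
Let K5 := 32 * n%:R ^+ 4 * A ^+ 2.

Let A0 : 0 <= A. Proof. by rewrite /A mulr_ge0. Qed.
Let A1 : 1 <= A.
Proof.
rewrite /A; have : 1 <= n%:R * f ^+ 2; last by lra.
have f2 : 1 <= f ^+ 2 by apply: exprn_ege1; exact: f1.
by have := ler_pM ler01 ler01 n1 f2; rewrite mulr1.
Qed.

Let nn : (n + n)%:R = 2 * n%:R :> R. Proof. by rewrite natrD mulr2n mulrDl !mul1r. Qed.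

Let K50 : 0 <= K5.
Proof.
apply: mulr_ge0; last exact: exprn_ge0 A0.
by apply: mulr_ge0 => //; apply: exprn_ge0.
Qed.

Lemma Dp_bound t : 0 <= t <= 1 -> `|(Dp a b).[t]| <= K5.
Proof.
move=> t01; apply: le_trans (pb_horner pb_Dp t01) _; rewrite nn /K5.
have := ler_pM _ _ (exprn_ege1 3 n1) A1 => /(_ ler01 ler01); rewrite mulr1 => h.
have nA : 0 <= n%:R * A by rewrite mulr_ge0.
have := ler_wpM2l nA h.
have -> : n%:R * A * (n%:R ^+ 3 * A) = n%:R ^+ 4 * A ^+ 2 by ring.
by lra.
Qed.

Lemma rp_pb v j : `|v| <= 1 -> pb (4 * n) (8 * (n%:R ^+ 2 * A ^+ 2)) (rp a b v 0 j).
Proof.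
move=> v1; rewrite mxE; have pa := pb_ap j v1; have pD := pb_Dp.
have -> : (4 * n = (n + n) + (n + n))%N by rewrite !addnn -!mul2n mulnA.
apply: (pb_weak (K := (n + n)%:R * (((n + n)%:R * A) * A) +
   (n + n)%:R * (A * ((n + n)%:R * A)))).
  by rewrite nn le_eqVlt; apply/orP; left; apply/eqP; ring.
by apply: pbD; [|apply: pbN]; apply: pbM => //; apply: pb_deriv.
Qed.

Lemma rp_bound v t : `|v| <= 1 -> 0 <= t <= 1 -> `|ev t (rp a b v)| <= K5.
Proof.
move=> v1 t01; apply: mx_norm_le => [|i j].
  exact: K50.
rewrite (ord1 i) mxE; apply: le_trans (pb_horner (rp_pb j v1) t01) _.
rewrite natrM /K5.
have h : n%:R ^+ 3 * 1 <= n%:R ^+ 3 * n%:R :> R.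
  by apply: ler_wpM2l => //; rewrite exprn_ge0.
have A2 : 0 <= A ^+ 2 by rewrite exprn_ge0.
have := ler_wpM2r A2 h.
have -> : n%:R ^+ 3 * n%:R * A ^+ 2 = n%:R ^+ 4 * A ^+ 2 by ring.
have -> : n%:R ^+ 3 * 1 * A ^+ 2 = n%:R * (n%:R ^+ 2 * A ^+ 2) by ring.
lra.
Qed.

Lemma ap_taylor v s s' : `|v| <= 1 -> 0 <= s <= 1 -> 0 <= s' <= 1 ->
  `|(Dp a b).[s'] *: ev s (ap a b v) - (Dp a b).[s] *: ev s' (ap a b v) -
    (s - s') *: ev s' (rp a b v)| <= K5 * (s - s') ^+ 2.
Proof.
move=> v1 s01 s01'; apply: mx_norm_le => [|i j].
  by apply: mulr_ge0; [exact: K50|exact: sqr_ge0].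
have lin (x y z : R) (u u' w : 'rV[R]_2) :
    (x *: u - y *: u' - z *: w) 0 j = x * u 0 j - y * u' 0 j - z * w 0 j.
  by rewrite !mxE.
have evE (u : 'rV[{poly R}]_2) t : ev t u 0 j = (u 0 j).[t] by rewrite mxE.
have rpE : rp a b v 0 j = (ap a b v 0 j)^`() * Dp a b - ap a b v 0 j * (Dp a b)^`().
  by rewrite mxE.
rewrite (ord1 i) lin !evE rpE.
have tD := pb_taylor pb_Dp s01 s01'; have ta := pb_taylor (pb_ap j v1) s01 s01'.
have bD := pb_horner pb_Dp s01'; have ba := pb_horner (pb_ap j v1) s01'.
move: tD ta bD ba; move: (Dp a b) (ap a b v 0 j) => D al tD ta bD ba.
rewrite hornerD hornerN !hornerM.
have -> : D.[s'] * al.[s] - D.[s] * al.[s'] -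
   (s - s') * (al^`().[s'] * D.[s'] - al.[s'] * D^`().[s']) =
   D.[s'] * (al.[s] - al.[s'] - (s - s') * al^`().[s']) -
   al.[s'] * (D.[s] - D.[s'] - (s - s') * D^`().[s']) by ring.
have h2 := sqr_ge0 (s - s').
apply: (@le_trans _ _ ((2 * n%:R * A) * (((n + n) ^ 3)%:R * A * (s - s') ^+ 2) +
   (2 * n%:R * A) * (((n + n) ^ 3)%:R * A * (s - s') ^+ 2))).
  by rewrite -nn; apply: ler_normB_le; rewrite normrM; apply: ler_pM.
by rewrite natrX nn /K5 le_eqVlt; apply/orP; left; apply/eqP; ring.
Qed.

Let Kphi := 48 * be ^+ 4 / la * (n%:R * f) ^+ 2.

Let nf1 : 1 <= n%:R * f.
Proof. by have := ler_pM ler01 ler01 n1 f1; rewrite mulr1. Qed.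

Lemma Ft_bound t : 0 <= t <= 1 -> `|Ft a b t| <= n%:R * f.
Proof.
move=> t01; apply: mx_norm_le => [|i j]; first exact: le_trans nf1.
by rewrite -ev_Fp mxE; apply: pb_horner; first exact: pb_Fp.
Qed.

Lemma Gt_bound t : 0 <= t <= 1 -> `|Gt a b t| <= n%:R * f.
Proof.
move=> t01; apply: mx_norm_le => [|i j]; first exact: le_trans nf1.
by rewrite -ev_Gp mxE; apply: pb_horner; first exact: pb_Gp.
Qed.

Lemma adj2_norm (S : 'M[R]_2) : `|adj2 S| <= `|S|.
Proof.
apply: mx_norm_le => // i j; rewrite mxE.
by case: ifP => _; rewrite ?normrN mx_coord_le.
Qed.

Let det_inv (x d e : R) : la <= `|x| -> x = d * e -> `|d| <= 24 * be ^+ 4 ->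
  `|e|^-1 <= 24 * be ^+ 4 / la.
Proof.
move=> hx xE hd; have b4 : 0 < 24 * be ^+ 4.
  by rewrite mulr_gt0 // exprn_gt0 //; apply: lt_le_trans be1.
rewrite xE normrM in hx.
have e0 : 0 < `|e|.
  rewrite lt_def normr_ge0 andbT; apply: contraTneq hx => ->.
  by rewrite mulr0 -ltNge.
rewrite ler_pdivlMr // mulrC ler_pdivrMr //.
by apply: le_trans hx _; apply: ler_wpM2r.
Qed.

Lemma phi_bounds t : 0 <= t <= 1 -> la <= `|\det (frame t b)| ->
  [/\ det2 (Ft a b t) != 0, `|phi a b t| <= Kphi &
      `|(det2 (Ft a b t))^-1 *: adj2 (Ft a b t)| <= Kphi].
Proof.
move=> t01 ht; have dl := det_frame_l dab t.
have di := det_inv ht dl (det_frame_le a01 b01).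
have F0 : det2 (Ft a b t) != 0.
  by apply: contraTneq ht => e; rewrite dl e mulr0 normr0 -ltNge.
have aF := le_trans (adj2_norm _) (Ft_bound t01).
have b4 : 0 <= 24 * be ^+ 4 / la.
  apply: divr_ge0; last exact: ltW.
  by apply: mulr_ge0 => //; apply: exprn_ge0; exact: le_trans ler01 be1.
split => //.
  rewrite /phi normrZ normfV /Kphi.
  have -> : 48 * be ^+ 4 / la * (n%:R * f) ^+ 2 =
    24 * be ^+ 4 / la * (2%:R * (n%:R * f * (n%:R * f))) by ring.
  apply: ler_pM => //.
  apply: le_trans (norm_mulmx _ _) _; apply: ler_wpM2l => //.
  by apply: ler_pM => //; apply: Gt_bound.
rewrite normrZ normfV /Kphi.
have -> : 48 * be ^+ 4 / la * (n%:R * f) ^+ 2 =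
    24 * be ^+ 4 / la * ((n%:R * f) * (2 * (n%:R * f))) by ring.
apply: ler_pM => //; apply: le_trans aF _.
by rewrite -{1}[n%:R * f]mulr1; apply: ler_pM => //; have := nf1; lra.
Qed.

Lemma phi'_bounds t : 0 <= t <= 1 -> la <= `|\det (frame a t)| ->
  det2 (Gt a b t) != 0 /\ `|phi' a b t| <= Kphi.
Proof.
move=> t01 ht; have dl := det_frame_r dab t.
have di := det_inv ht dl (det_frame_le a01 b01).
have F0 : det2 (Gt a b t) != 0.
  by apply: contraTneq ht => e; rewrite dl e mulr0 normr0 -ltNge.
have aF := le_trans (adj2_norm _) (Gt_bound t01).
split => //.
rewrite /phi' normrZ normfV /Kphi.
have -> : 48 * be ^+ 4 / la * (n%:R * f) ^+ 2 =
    24 * be ^+ 4 / la * (2%:R * (n%:R * f * (n%:R * f))) by ring.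
apply: ler_pM => //.
apply: le_trans (norm_mulmx _ _) _; apply: ler_wpM2l => //.
by apply: ler_pM => //; apply: Ft_bound.
Qed.

Lemma coord_bound (x : 'rV[R]_4) :
  `|x| <= Kphi * (`|x *m ev a Bp| + `|x *m ev b Bp|).
Proof.
have xE : x = x *m ev a Bp *m M1 a b + x *m ev b Bp *m M2 a b.
  by rewrite -!mulmxA -mulmxDr frame_dec // mulmx1.
have m1 : `|M1 a b| <= Li by apply: mx_norm_le => [|i j]; [apply: le_trans Li1|apply: M1_entry].
have m2 : `|M2 a b| <= Li by apply: mx_norm_le => [|i j]; [apply: le_trans Li1|apply: M2_entry].
have b1 (y : 'rV[R]_2) (M : 'M[R]_(2, 4)) : `|M| <= Li -> `|y *m M| <= 2 * Li * `|y|.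
  move=> h; apply: le_trans (norm_mulmx _ _) _; rewrite -mulrA; apply: ler_wpM2l => //.
  by rewrite mulrC; apply: ler_wpM2r.
have -> : `|x| = `|x *m ev a Bp *m M1 a b + x *m ev b Bp *m M2 a b| by rewrite -xE.
apply: le_trans (ler_normD_le (b1 _ _ m1) (b1 _ _ m2)) _.
rewrite -mulrDr; apply: ler_wpM2r; first by rewrite addr_ge0.
have Lf : 2 * Li <= f.
  rewrite /f; have : Li * 1 <= Li * CB by apply: ler_wpM2l => //; apply: le_trans Li1.
  by have := Li1; lra.
apply: le_trans Lf _; rewrite /Kphi expr2.
have f0 : 0 <= f by apply: le_trans f1.
have b1' : 1 <= 48 * be ^+ 4 / la.
  have h48 : 1 <= 48 * be ^+ 4 by have := exprn_ege1 4 be1; lra.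
  by have := ler_pM ler01 ler01 h48 il1; rewrite mulr1.
have s1 : f <= n%:R * f by have := ler_wpM2r f0 n1; rewrite mul1r.
apply: le_trans s1 _; have nf0' := le_trans ler01 nf1.
have s2 := ler_pM ler01 ler01 b1' nf1; rewrite mulr1 in s2.
by have := ler_wpM2r nf0' s2; rewrite mul1r -mulrA.
Qed.

End bounds.
End coords.

Section wedge_alg.
Variable S : comPzRingType.

Lemma wedge_adj2 (e u : 'rV[S]_2) (F : 'M[S]_2) :
  wedge e (u *m adj2 F) = wedge (e *m F) u.
Proof.
rewrite /wedge /adj2 !mxE !big_ord_recl !big_ord0 !mxE /=.
have -> : lift ord0 ord0 = 1 :> 'I_2 by exact: val_inj.
have -> : rev_ord ord0 = 1 :> 'I_2 by exact: val_inj.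
have -> : rev_ord (1 : 'I_2) = 0 :> 'I_2 by exact: val_inj.
have -> : ord0 = 0 :> 'I_2 by [].
ring.
Qed.

Lemma wedge_mul (e u : 'rV[S]_2) (F : 'M[S]_2) :
  wedge (e *m F) (u *m F) = wedge e u * det2 F.
Proof.
rewrite /wedge /det2 !mxE !big_ord_recl !big_ord0.
have -> : lift ord0 ord0 = 1 :> 'I_2 by exact: val_inj.
have -> : ord0 = 0 :> 'I_2 by [].
ring.
Qed.
End wedge_alg.

(** * Uniform lower bounds for the derivative of v phi_t *)

Section rlower.
Variables (R : realType) (Bp : 'M[{poly R}]_(4, 2)) (n : nat) (CB : R).
Hypotheses (n_gt0 : (0 < n)%N) (CB1 : 1 <= CB).
Hypothesis pbB : forall i j, pb n CB (Bp i j).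
Hypothesis nondeg : forall x y : 'rV[R]_4,
  (forall a b, a *: x + b *: y = 0 -> a = 0 /\ b = 0) -> pw Bp x y != 0.

Let be := n%:R * CB.
Let be1 : 1 <= be.
Proof.
have n1 : 1 <= n%:R :> R by rewrite ler1n.
by have := ler_pM ler01 ler01 n1 CB1; rewrite mulr1.
Qed.

Let size_B i j : (size (Bp i j) <= n)%N.
Proof. by case: (pbB i j). Qed.

Lemma ev_norm t : 0 <= t <= 1 -> `|ev t Bp| <= be.
Proof.
move=> t01; apply: mx_norm_le => [|i j]; first exact: le_trans be1.
exact: ev_entry.
Qed.

Lemma mul_ev_norm (x : 'rV[R]_4) t : 0 <= t <= 1 -> `|x *m ev t Bp| <= 4 * be * `|x|.
Proof.
move=> t01; apply: le_trans (norm_mulmx _ _) _; rewrite -mulrA; apply: ler_wpM2l => //.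
by rewrite mulrC; apply: ler_wpM2r => //; apply: ev_norm.
Qed.

(** Links the coordinate-free [Wr] with the derivative of v phi_t. For [e M1] and [e' M1], which B_b
    annihilates, and [v M2], which B_a annihilates, the two polynomials [pw] are a multiple of [Dp]
    and the wedge of [e] with [ap]; their Wronskian contains [rp]. *)
Lemma Wr_rp a b (e e' v : 'rV[R]_2) :
  Wr Bp (e *m M1 Bp a b) (e' *m M1 Bp a b) (v *m M2 Bp a b) =
  wedge e e' *: wedge (map_mx polyC e) (rp Bp a b v).
Proof.
have E (u : 'rV[R]_2) (M : 'M[R]_(2, 4)) :
   map_mx polyC (u *m M) *m Bp = map_mx polyC u *m (map_mx polyC M *m Bp).
  by rewrite map_mxM mulmxA.
have p1 : pw Bp (e *m M1 Bp a b) (e' *m M1 Bp a b) = (wedge e e')%:P * Dp Bp a b.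
  rewrite /pw !E wedge_mul; congr (_ * _).
  by rewrite /wedge !mxE polyCB !polyCM.
have p2 : pw Bp (e *m M1 Bp a b) (v *m M2 Bp a b) =
    wedge (map_mx polyC e) (ap Bp a b v).
  by rewrite /pw !E /ap wedge_adj2.
rewrite /Wr p1 p2 -mul_polyC.
have rE j : rp Bp a b v 0 j = (ap Bp a b v 0 j)^`() * Dp Bp a b -
   ap Bp a b v 0 j * (Dp Bp a b)^`() by rewrite mxE.
have eE j : map_mx polyC e 0 j = (e 0 j)%:P by rewrite mxE.
rewrite /wedge !rE !eE -/(wedge e e').
move: (Dp Bp a b) (ap Bp a b v 0 0) (ap Bp a b v 0 1) (wedge e e') => D a0 a1 k.
rewrite derivB !derivM !derivC; ring.
Qed.

(** Gram-Schmidt reduces to the orthonormal case. The shifts leave [Wr] unchanged, and normalising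
    divides it by |x|^2 |y1| |z1|; each of these lengths is at least [l], whence the fourth
    power. *)
Lemma Wr_lower_gen : exists2 c : R, 0 < c & forall (x y z : 'rV[R]_4) (l : R),
  0 < l -> l <= `|x| -> (forall s, l <= `|y + s *: x|) ->
  (forall s s', l <= `|z + s *: x + s' *: y|) ->
  exists2 t, 0 <= t <= 1 & c * l ^+ 4 <= `|(Wr Bp x y z).[t]|.
Proof.
have [c c0 H] := Wr_orthn_lower n_gt0 size_B nondeg.
exists c => // x y z l l0 lx ly lz.
have nz (u : 'rV[R]_4) : l <= `|u| -> dot u u != 0.
  move=> lu; apply: contraTneq lu => e; rewrite -ltNge.
  by apply: le_lt_trans l0; have := norm_le_dot u; rewrite e sqrtr0.
have xx := nz x lx.
pose y1 := y + (- (dot x y / dot x x)) *: x.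
have yy : dot y1 y1 != 0 by apply: nz; apply: ly.
have xy : dot x y1 = 0 by rewrite /y1 dotDr mulNr divfK ?subrr.
pose z1 := z + (- (dot x z / dot x x)) *: x + (- (dot y1 z / dot y1 y1)) *: y1.
have lz1 : l <= `|z1|.
  rewrite /z1; move: (- (dot x z / _)) (- (dot y1 z / _)) => s s'.
  rewrite /y1; move: (- (dot x y / _)) => s''.
  have -> : z + s *: x + s' *: (y + s'' *: x) = z + (s + s' * s'') *: x + s' *: y.
    by rewrite scalerDr scalerA scalerDl !addrA addrAC.
  exact: lz.
have zz : dot z1 z1 != 0 by apply: nz.
have xz : dot x z1 = 0 by rewrite /z1 dotDr xy mulr0 addr0 dotDr mulNr divfK ?subrr.
have yz : dot y1 z1 = 0.
  rewrite /z1 dotDr [X in X + _](_ : _ = dot y1 z).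
    by rewrite mulNr divfK ?subrr.
  by rewrite dotDr [dot y1 x]dotC xy mulr0 addr0.
pose N (u : 'rV[R]_4) := Num.sqrt (dot u u).
have Npos u : l <= `|u| -> l <= N u /\ N u != 0.
  move=> lu; have h := le_trans lu (norm_le_dot u); split => //.
  by rewrite gt_eqF //; apply: lt_le_trans h.
have [lNx Nx] := Npos x lx.
have [lNy Ny] := Npos y1 (ly _).
have [lNz Nz] := Npos z1 lz1.
have unit1 u : N u != 0 -> dot ((N u)^-1 *: u) ((N u)^-1 *: u) = 1.
  move=> Nu; rewrite dotZ -(sqr_sqrtr (dot_ge0 u)) -/(N u) expr2 mulrACA.
  by rewrite mulVf // mulr1.
have O : orthn ((N x)^-1 *: x, (N y1)^-1 *: y1, (N z1)^-1 *: z1).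
  by split; rewrite /= ?unit1 //; split; rewrite dotZ ?xy ?xz ?yz mulr0.
have [t t01 ht] := H _ O.
exists t => //; move: ht; rewrite Wr_scale hornerZ.
have -> : Wr Bp x y1 z1 = Wr Bp x y z by exact: Wr_shift.
rewrite normrM => ht.
have key : c * (N x ^+ 2 * N y1 * N z1) <= `|(Wr Bp x y z).[t]|.
  have P : 0 < N x ^+ 2 * N y1 * N z1.
    apply: mulr_gt0; last exact: lt_le_trans lNz.
    by apply: mulr_gt0; [apply: exprn_gt0|]; [exact: lt_le_trans lNx|exact: lt_le_trans lNy].
  rewrite -ler_pdivlMr //; apply: le_trans ht _.
  rewrite mulrC; apply: ler_wpM2l => //.
  have -> : (N x)^-1 ^+ 2 * (N y1)^-1 * (N z1)^-1 = (N x ^+ 2 * N y1 * N z1)^-1.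
    by field; rewrite Nx Ny Nz.
  by rewrite normfV (gtr0_norm P).
apply: le_trans key; apply: ler_wpM2l; first exact: ltW.
rewrite -[4%N]/(2 + 1 + 1)%N !exprD !expr1.
have l0' := ltW l0.
apply: ler_pM => //; first by rewrite mulr_ge0 // exprn_ge0.
apply: ler_pM => //; first by rewrite exprn_ge0.
by rewrite lerXn2r // nnegrE // (le_trans l0').
Qed.

Lemma wedge_norm1 (e : 'rV[R]_2) : `|e| = 1 ->
  1 <= wedge e (\row_j (if j == 0 then - e 0 1 else e 0 0)) <= 2.
Proof.
move=> e1; rewrite /wedge !mxE /= mulrN opprK -!expr2.
have c0 := mx_coord_le e 0 0; have c1 := mx_coord_le e 0 1; rewrite e1 in c0 c1.
have s0 : e 0 0 ^+ 2 <= 1 by rewrite -real_normK ?num_real // exprn_ile1.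
have s1 : e 0 1 ^+ 2 <= 1 by rewrite -real_normK ?num_real // exprn_ile1.
apply/andP; split; last by lra.
have p0 := sqr_ge0 (e 0 0); have p1 := sqr_ge0 (e 0 1).
case: (ltP `|e 0 0| 1) => h0; last first.
  have : 1 <= e 0 0 ^+ 2 by rewrite -real_normK ?num_real // exprn_ege1.
  lra.
case: (ltP `|e 0 1| 1) => h1; last first.
  have : 1 <= e 0 1 ^+ 2 by rewrite -real_normK ?num_real // exprn_ege1.
  lra.
have : `|e| < 1; last by rewrite e1 ltxx.
by apply: mx_norm_lt => // i j; rewrite (ord1 i); case: (ord2P j) => ->.
Qed.

(** The constant is independent of [a] and [b], even for nearly singular frames. The three vectors
    have prescribed images under B_a or B_b, so boundedness of B alone keeps them away from the
    spans of one another. *)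
Lemma rp_lower : exists2 c : R, 0 < c & forall a b (e v : 'rV[R]_2),
  0 <= a <= 1 -> 0 <= b <= 1 -> \det (frame Bp a b) != 0 -> `|e| = 1 -> `|v| = 1 ->
  exists2 t, 0 <= t <= 1 &
    c <= `|(wedge (map_mx polyC e) (rp Bp a b v)).[t]|.
Proof.
have [c c0 H] := Wr_lower_gen.
pose l := (8 * be)^-1.
have b0 : 0 < be by apply: lt_le_trans be1.
have l0 : 0 < l by rewrite invr_gt0; apply: mulr_gt0.
exists (c * l ^+ 4 / 2); first by rewrite divr_gt0 // mulr_gt0 // exprn_gt0.
move=> a b e v a01 b01 dab e1 v1.
have [aa ab ba bb] := frame_inv dab.
pose e' : 'rV[R]_2 := \row_j (if j == 0 then - e 0 1 else e 0 0).
have /andP[k1 k2] := wedge_norm1 e1; rewrite -/e' in k1 k2.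
have low (u : 'rV[R]_4) t (q : R) : 0 <= t <= 1 -> 1 / 2 <= `|u *m ev t Bp| -> l <= `|u|.
  move=> t01 h; have := le_trans h (mul_ev_norm u t01) => h2.
  have b8 : 0 < 8 * be by apply: mulr_gt0.
  rewrite /l -[leLHS]mul1r ler_pdivrMr //.
  have -> : `|u| * (8 * be) = 2 * (4 * be * `|u|) by ring.
  move: (4 * be * `|u|) h2 => w h2; lra.
have hlf : 1 / 2 <= 1 :> R by lra.
have xa : (e *m M1 Bp a b) *m ev a Bp = e by rewrite -mulmxA aa mulmx1.
have ya : (e' *m M1 Bp a b) *m ev a Bp = e' by rewrite -mulmxA aa mulmx1.
have xb : (e *m M1 Bp a b) *m ev b Bp = 0 by rewrite -mulmxA ab mulmx0.
have yb : (e' *m M1 Bp a b) *m ev b Bp = 0 by rewrite -mulmxA ab mulmx0.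
have zb : (v *m M2 Bp a b) *m ev b Bp = v by rewrite -mulmxA bb mulmx1.
have [|||t t01 ht] := H (e *m M1 Bp a b) (e' *m M1 Bp a b) (v *m M2 Bp a b) l l0.
- by apply: (low _ a 0) => //; rewrite xa e1.
- move=> s; apply: (low _ a 0) => //.
  rewrite mulmxDl -scalemxAl xa ya.
  have : 1 <= 2 * (`|e| * `|e' + s *: e|).
    apply: le_trans (wedge_le _ _); apply: le_trans k1 _.
    have -> : wedge e (e' + s *: e) = wedge e e' by rewrite /wedge !mxE; ring.
    exact: ler_norm.
  by rewrite e1 mul1r; lra.
- move=> s s'; apply: (low _ b 0) => //.
  by rewrite !mulmxDl -!scalemxAl xb yb zb !scaler0 !addr0 v1.
exists t => //; move: ht; rewrite Wr_rp hornerZ normrM.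
have k0 : 0 <= wedge e e' by lra.
rewrite (ger0_norm k0) => ht.
have := ler_wpM2r (normr_ge0 (wedge (map_mx polyC e) (rp Bp a b v)).[t]) k2.
move=> h2; have h3 := le_trans ht h2.
by rewrite ler_pdivrMr // [_ * 2]mulrC.
Qed.

End rlower.

Lemma size_det (R : idomainType) (m n : nat) (A : 'M[{poly R}]_m) : (0 < m)%N ->
  (forall i j, (size (A i j) <= n)%N) -> (size (\det A)%R <= m * n)%N.
Proof.
move=> m0 h; apply: leq_trans (size_sum _ _ _) _; apply/bigmax_leqP => s _.
rewrite -signr_odd; set b := odd _; set Q := \prod_i _.
have -> : size ((-1) ^+ b * Q) = size Q.
  by case: b; rewrite ?expr1 ?expr0 ?mulN1r ?size_polyN ?mul1r.
apply: leq_trans (size_poly_prod_leq _ _) _.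
rewrite cardT size_enum_ord leq_subLR.
have h1 : (\sum_i size (A i (s i)) <= m * n)%N.
  apply: (@leq_trans (\sum_(i < m) n)); first by apply: leq_sum.
  by rewrite sum_nat_const card_ord.
by apply: (leq_trans (n := (m * n).+1)); rewrite ?ltnS // -add1n leq_add2r.
Qed.

Lemma rank_basis (F : fieldType) (m n r : nat) (A : 'M[F]_(m, n)) :
  \rank A = r -> exists K : 'M[F]_(r, n), row_free K /\ (A <= K)%MS.
Proof.
by move=> <-; exists (row_base A); rewrite row_base_free eq_row_base.
Qed.

(** * Invertible frames and transversal derivatives *)

Section frames.
Variables (R : realType) (Bp : 'M[{poly R}]_(4, 2)) (n : nat) (CB : R).
Hypotheses (n_gt0 : (0 < n)%N) (CB1 : 1 <= CB).
Hypothesis pbB : forall i j, pb n CB (Bp i j).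
Hypothesis nondeg : forall x y : 'rV[R]_4,
  (forall a b, a *: x + b *: y = 0 -> a = 0 /\ b = 0) -> pw Bp x y != 0.

Definition framep (b : R) : {poly R} :=
  \det (row_mx Bp (map_mx polyC (ev b Bp)) : 'M[{poly R}]_4).

Lemma framep_horner t b : (framep b).[t] = \det (frame Bp t b).
Proof.
rewrite /framep -[(\det _).[t]]/(horner_eval t (\det _)) -det_map_mx; congr (\det _).
apply: etrans (map_row_mx (horner_eval t) Bp (map_mx polyC (ev b Bp))) _.
by rewrite /frame; congr row_mx; exact: ev_const.
Qed.

Lemma size_framep b : (size (framep b) <= 4 * n)%N.
Proof.
apply: size_det => // i j; rewrite mxE; case: (fintype.split _) => k.
  by case: (pbB i k).
by rewrite mxE; apply: leq_trans (size_polyC_leq1 _) n_gt0.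
Qed.

(** If the determinant vanished for all [t], then for each [t] some nonzero vector of the kernel of
    B_b would be annihilated by B_t. This kernel is a plane; for a basis [x], [y] of it [pw x y]
    would vanish identically. *)
Lemma framep_neq0 b : \rank (ev b Bp) = 2%N -> framep b != 0.
Proof.
move=> rb.
have rk : \rank (kermx (ev b Bp)) = 2%N by rewrite mxrank_ker rb.
have [K' [K'0 K'K]] := rank_basis rk.
pose x := row 0 K'; pose y := row 1 K'.
have comb (u : 'rV[R]_2) : u *m K' = u 0 0 *: x + u 0 1 *: y.
  rewrite mulmx_sum_row big_ord_recl big_ord1.
  by have -> : lift ord0 ord0 = 1 :> 'I_2 by exact: val_inj.
have ind al be : al *: x + be *: y = 0 -> al = 0 /\ be = 0.
  move=> E; pose u : 'rV[R]_2 := \row_j (if j == 0 then al else be).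
  have : u *m K' = 0 by rewrite comb !mxE /= E.
  rewrite -[RHS](mul0mx _ K') => /(row_free_inj K'0) u0.
  by split; [move/rowP/(_ 0): u0|move/rowP/(_ 1): u0]; rewrite !mxE.
apply/negP => /eqP p0; suff pw0 : pw Bp x y = 0.
  by have := nondeg ind; rewrite pw0 eqxx.
apply/polyP => k; rewrite coef0.
have root_all t : (pw Bp x y).[t] = 0.
  have : \det (frame Bp t b) == 0 by rewrite -framep_horner p0 horner0.
  case/det0P => v v0 E.
  have E2 : row_mx (v *m ev t Bp) (v *m ev b Bp) = row_mx 0 0.
    by rewrite -mul_mx_row row_mx0; exact: E.
  have [vt vb] := eq_row_mx E2.
  have /submxP[u uE] : (v <= K')%MS.
    by apply: submx_trans K'K; apply/sub_kermxP.
  rewrite pw_horner; have u0 : u != 0 by apply: contraNneq v0 => u0; rewrite uE u0 mul0mx.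
  move: vt; rewrite uE comb mulmxDl -!scalemxAl.
  set X := x *m _; set Y := y *m _ => XY.
  have e1 : u 0 0 * wedge X Y = 0.
    have := congr1 (fun M => wedge M Y) XY; rewrite wedge_combl wedge_self mulr0 addr0 => ->.
    by rewrite /wedge !mxE !mul0r subr0.
  have e2 : u 0 1 * wedge X Y = 0.
    have := congr1 (fun M => wedge M X) XY; rewrite wedge_combl wedge_self mulr0 add0r => e.
    rewrite wedge_anti mulrN e /wedge !mxE !mul0r subrr oppr0 //.
  move/eqP: e1; rewrite mulf_eq0 => /orP[/eqP u00|/eqP //].
  move/eqP: e2; rewrite mulf_eq0 => /orP[/eqP u01|/eqP //].
  case/negP: u0; apply/eqP/rowP => i; rewrite mxE.
  by case: (ord2P i) => ->.
have [p0'|pn0] := eqVneq (pw Bp x y) 0; first by rewrite p0' coef0.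
have n2 : (0 < n + n)%N by rewrite addn_gt0 n_gt0.
have [i] := poly_neq0_node n2 (size_pw (fun i j => (pbB i j).1) x y) pn0.
by rewrite root_all eqxx.
Qed.

(** Compactness in [b], again with the supremum over [t] replaced by a continuous sum over nodes. *)
Lemma frame_lower : (forall b, 0 <= b <= 1 -> \rank (ev b Bp) = 2%N) ->
  exists2 c : R, 0 < c & forall b, 0 <= b <= 1 ->
    exists2 t, 0 <= t <= 1 & c <= `|\det (frame Bp t b)|.
Proof.
move=> rk; have n4 : (0 < 4 * n)%N by rewrite muln_gt0.
pose node (i : 'I_(4 * n)) : R := (i : nat)%:R / (4 * n)%:R.
have node01 i : 0 <= node i <= 1.
  rewrite /node divr_ge0 //= ler_pdivrMr ?ltr0n //.
  by rewrite mul1r ler_nat ltnW.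
pose g s : {poly R} := \det (row_mx (map_mx polyC (ev s Bp)) Bp : 'M[{poly R}]_4).
have gE s b : (g s).[b] = \det (frame Bp s b).
  rewrite /g -[(\det _).[b]]/(horner_eval b (\det _)) -det_map_mx; congr (\det _).
  apply: etrans (map_row_mx (horner_eval b) (map_mx polyC (ev s Bp)) Bp) _.
  by rewrite /frame; congr row_mx; exact: ev_const.
pose f (b : R) := \sum_(i < 4 * n) `|(g (node i)).[b]|.
have cf : continuous f.
  apply: cont_sum => i; apply: cont_norm; exact: continuous_horner.
have [b b01 bmin] := @EVT_min R f 0 1 ler01 (continuous_subspaceT (fun x => @cf x)).
have b01' : 0 <= b <= 1 by rewrite in_itv /= in b01.
have fpos : 0 < f b.
  have [i hi] := poly_neq0_node n4 (size_framep b) (framep_neq0 (rk b b01')).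
  rewrite /f (bigD1 i) //=; apply: ltr_pwDl; last exact: sumr_ge0.
  by rewrite normr_gt0 gE -framep_horner.
exists (f b / (4 * n)%:R); first by rewrite divr_gt0 ?ltr0n.
move=> v v01; have := bmin v; rewrite in_itv /= => /(_ v01).
case: (pickP (fun i => f b / (4 * n)%:R <= `|(g (node i)).[v]|)).
  by move=> i hi _; exists (node i) => //; rewrite -gE.
move=> no fwv; exfalso; move: fwv; rewrite leNgt => /negP; apply.
rewrite [ltRHS](_ : _ = \sum_(i < 4 * n) f b / (4 * n)%:R); last first.
  by rewrite sumr_const card_ord -[RHS]mulr_natl mulrC divfK // pnatr_eq0 -lt0n.
apply: ltr_sum => [|i _]; last by rewrite ltNge no.
by apply/hasP; exists (Ordinal n4); rewrite ?mem_index_enum.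
Qed.

(* Polynomials [wedge e r] small at many separated points would be small
   everywhere; so [r] takes two well-separated directions among the points. *)
Lemma two_directions (c1 th : R) (N : nat) (t : 'I_N -> R) a b (v : 'rV[R]_2) :
  0 < c1 -> 0 < th -> th <= 1 -> (4 * n <= N)%N ->
  (forall e : 'rV[R]_2, `|e| = 1 -> exists2 t, 0 <= t <= 1 &
    c1 <= `|(wedge (map_mx polyC e) (rp Bp a b v)).[t]|) ->
  (forall j, (size (rp Bp a b v 0 j)%R <= 4 * n)%N) ->
  (forall i, 0 <= t i <= 1) ->
  (forall i j, i != j -> th <= `|t i - t j|) ->
  exists i j, (c1 / 2 * (th / 3) ^+ N) ^+ 2 / 2 <=
    `|wedge (ev (t i) (rp Bp a b v)) (ev (t j) (rp Bp a b v))|.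
Proof.
move=> c10 th0 th1 nN low sr t01 sep; set la := c1 / 2 * (th / 3) ^+ N.
have la0 : 0 < la.
  by rewrite mulr_gt0 ?divr_gt0 // exprn_gt0 // divr_gt0.
have wE e s : (wedge (map_mx polyC e) (rp Bp a b v)).[s] = wedge e (ev s (rp Bp a b v)).
  rewrite /wedge hornerD hornerN !hornerM !mxE !hornerC.
  by rewrite /horner_eval.
have pick e : `|e| = 1 -> exists i, la <= `|wedge e (ev (t i) (rp Bp a b v))|.
  move=> e1; apply/existsP; apply: contraT; rewrite negb_exists => /forallP no.
  have [tau tau01 h] := low e e1.
  suff : c1 <= c1 / 2 by lra.
  apply: le_trans h _.
  have := @poly_sup_of_points R th la [seq t i | i <- enum 'I_N]
     (wedge (map_mx polyC e) (rp Bp a b v)) th0 th1.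
  rewrite size_map size_enum_ord => H.
  apply: le_trans (H _ _ _ tau tau01 (ltW la0)) _.
  - apply: leq_trans nN; apply: leq_trans (size_polyD _ _) _.
    rewrite size_polyN geq_max [map_mx polyC e 0 0]mxE [map_mx polyC e 0 1]mxE.
    rewrite !mul_polyC.
    by apply/andP; split; apply: leq_trans (size_scale_leq _ _) (sr _).
  - rewrite pairwise_map; have := enum_uniq 'I_N; rewrite uniq_pairwise.
    by apply: sub_pairwise => i j; apply: sep.
  - move=> _ /mapP[i _ ->]; split; first exact: t01.
    by rewrite wE ltW // ltNge; apply: no.
  rewrite /la -mulrA -exprMn mulf_div [3 * th]mulrC divff ?expr1n ?mulr1 //.
  by rewrite mulf_neq0 // gt_eqF.
have [i hi] : exists i, la <= `|wedge (\row_(j < 2) (1 : R)) (ev (t i) (rp Bp a b v))|.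
  apply: pick; apply/le_anti/andP; split.
    by apply: mx_norm_le => // k l; rewrite mxE normr1.
  by apply: le_trans (mx_coord_le _ 0 0); rewrite mxE normr1.
set ri := ev (t i) (rp Bp a b v) in hi.
have ri0 : la / 2 <= `|ri|.
  have := le_trans hi (wedge_le _ _).
  have -> : `|\row_(j < 2) (1 : R)| = 1.
    apply/le_anti/andP; split.
      by apply: mx_norm_le => // k l; rewrite mxE normr1.
    by apply: le_trans (mx_coord_le _ 0 0); rewrite mxE normr1.
  by rewrite mul1r; lra.
have rip : 0 < `|ri| by apply: lt_le_trans ri0; rewrite divr_gt0.
have [j hj] : exists j, la <= `|wedge (`|ri|^-1 *: ri) (ev (t j) (rp Bp a b v))|.
  by apply: pick; rewrite normrZ normfV normr_id mulVf // gt_eqF.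
exists i, j; rewrite -/ri; move: hj.
have -> : wedge (`|ri|^-1 *: ri) (ev (t j) (rp Bp a b v)) =
  `|ri|^-1 * wedge ri (ev (t j) (rp Bp a b v)).
  by rewrite /wedge !mxE; ring.
rewrite normrM normfV normr_id ler_pdivlMl // => h.
apply: le_trans h; rewrite expr2 mulrAC; apply: ler_wpM2r => //; exact: ltW.
Qed.

End frames.

(** * Averaging over tuples of directions *)

Lemma card_natr (R : pzSemiRingType) (U : finType) (Q : pred U) :
  #|[set x | Q x]%SET|%:R = \sum_x (Q x)%:R :> R.
Proof.
rewrite -natr_sum; congr (_%:R); rewrite cardsE -sum1_card big_mkcond.
by apply: eq_bigr => x _; rewrite unfold_in; case: (Q x).
Qed.

Section selection.
Variables (R : realType) (J T : finType).

Definition upd (tau : {ffun J -> T}) (i : J) (s : T) : {ffun J -> T} :=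
  [ffun j => if j == i then s else tau j].

Lemma updE tau i s j : upd tau i s j = if j == i then s else tau j.
Proof. by rewrite ffunE. Qed.

(* Resampling one coordinate: [(tau, s) |-> (upd tau i s, tau i)] is an
   involution. *)
Lemma sum_upd (i : J) (f : {ffun J -> T} -> R) :
  \sum_tau \sum_s f (upd tau i s) = #|T|%:R * \sum_tau f tau.
Proof.
pose h (x : {ffun J -> T} * T) := (upd x.1 i x.2, x.1 i).
have hK : cancel h h.
  move=> [tau s]; rewrite /h /= updE eqxx; congr (_, _).
  by apply/ffunP => j; rewrite !updE; case: eqP => [->|].
rewrite pair_big /= (reindex h) /=; last by exists h => x _; apply: hK.
rewrite (eq_bigr (fun x : {ffun J -> T} * T => f x.1)); last first.
  by move=> [tau s] _; congr f; apply/ffunP => j; rewrite !updE; case: eqP => [->|].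
rewrite -(pair_big xpredT xpredT (fun tau (_ : T) => f tau)) /= mulr_sumr.
by apply: eq_bigr => tau _; rewrite sumr_const -[LHS]mulr_natl.
Qed.

(** Fubini: a bound on the bad values of one coordinate, all others being frozen, bounds the
    proportion of bad tuples. *)
Lemma count_upd (i : J) (P : pred {ffun J -> T}) (q : R) :
  (forall tau, #|[set s | P (upd tau i s)]%SET|%:R <= q) ->
  #|T|%:R * #|[set tau | P tau]%SET|%:R <= q * #|T|%:R ^+ #|J|.
Proof.
move=> h.
rewrite (card_natr R) -(sum_upd i (fun tau => (P tau)%:R)).
apply: (@le_trans _ _ (\sum_(tau : {ffun J -> T}) q)).
  by apply: ler_sum => tau _; have := h tau; rewrite (card_natr R).
by rewrite sumr_const card_ffun -[leLHS]mulr_natl natrX mulrC.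
Qed.

Variables (W : finType) (nu : W -> R) (E : T -> {set W}) (ka : R).
Hypotheses (nu_ge0 : forall w, 0 <= nu w) (nu_sum1 : \sum_w nu w = 1).
Hypotheses (ka0 : 0 < ka) (ka1 : ka <= 1)
  (hE : forall t, ka <= \sum_(w in E t) nu w).
Hypothesis T0 : (0 < #|T|)%N.

Let n : R := #|T|%:R.
Let n0 : 0 < n. Proof. by rewrite ltr0n. Qed.
Let m := #|J|.

Definition Einter (tau : {ffun J -> T}) : {set W} := [set w | [forall j, w \in E (tau j)]]%SET.

(** The right side is the expectation of the m-th power of the number [Tw w] of sets [E t]
    containing [w]. This number has mean at least [ka * n], hence is at least half of that on a set
    of mass at least [ka / 2]. *)
Lemma sum_Einter :
  (ka / 2) ^+ m.+1 * n ^+ m <= \sum_tau \sum_(w in Einter tau) nu w.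
Proof.
pose Tw w : R := \sum_t (w \in E t)%:R.
have -> : \sum_tau \sum_(w in Einter tau) nu w = \sum_w nu w * Tw w ^+ m.
  under eq_bigr do rewrite big_mkcond.
  rewrite exchange_big /=; apply: eq_bigr => w _.
  rewrite -[m]/(#|J|) -prodr_const bigA_distr_bigA /= mulr_sumr.
  apply: eq_bigr => tau _; rewrite inE.
  case: (boolP [forall j, w \in E (tau j)]) => [/forallP h|].
    by rewrite big1 ?mulr1 // => j _; rewrite h.
  rewrite negb_forall => /existsP[j /negbTE hj].
  by rewrite (bigD1 j) //= hj mul0r mulr0.
have Twn w : Tw w <= n.
  apply: (@le_trans _ _ (\sum_(t : T) 1)); last by rewrite sumr_const cardT -cardE.
  by apply: ler_sum => t _; rewrite lern1 leq_b1.
have Tw0 w : 0 <= Tw w by apply: sumr_ge0.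
have tot : ka * n <= \sum_w nu w * Tw w.
  have -> : \sum_w nu w * Tw w = \sum_t \sum_(w in E t) nu w.
    under eq_bigr do rewrite mulr_sumr.
    rewrite exchange_big /=; apply: eq_bigr => t _; rewrite [RHS]big_mkcond.
    by apply: eq_bigr => w _; case: ifP => _; rewrite ?mulr1 ?mulr0.
  apply: (@le_trans _ _ (\sum_(t : T) ka)); last exact: ler_sum.
  by rewrite sumr_const cardT -cardE -[leRHS]mulr_natl mulrC.
pose big w := ka * n / 2 <= Tw w.
have hbig : ka / 2 <= \sum_(w | big w) nu w.
  rewrite -(ler_pM2r n0) mulr_suml.
  have s1 : \sum_(w | big w) nu w * Tw w <= \sum_(w | big w) nu w * n.
    by apply: ler_sum => w _; apply: ler_wpM2l.
  have s2 : \sum_(w | ~~ big w) nu w * Tw w <= ka * n / 2.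
    apply: (@le_trans _ _ (\sum_(w | ~~ big w) nu w * (ka * n / 2))).
      by apply: ler_sum => w; rewrite /big -ltNge => /ltW h; apply: ler_wpM2l.
    rewrite -mulr_suml -[leRHS]mul1r; apply: ler_wpM2r.
      by rewrite divr_ge0 // mulr_ge0 // ltW.
    by rewrite -nu_sum1 [leRHS](bigID big) /= lerDr sumr_ge0.
  move: tot; rewrite (bigID big) /=; lra.
rewrite [leRHS](bigID big) /= -[leLHS]addr0; apply: lerD; last first.
  by apply: sumr_ge0 => w _; rewrite mulr_ge0 // exprn_ge0.
apply: (@le_trans _ _ (\sum_(w | big w) nu w * (ka * n / 2) ^+ m)); last first.
  apply: ler_sum => w hw; apply: ler_wpM2l => //.
  by rewrite lerXn2r // nnegrE ?Tw0 // divr_ge0 // mulr_ge0 // ltW.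
have e1 : (ka * n / 2) ^+ m = (ka / 2) ^+ m * n ^+ m by rewrite mulrAC exprMn.
rewrite -mulr_suml exprS -mulrA -e1; apply: ler_wpM2r => //.
by rewrite exprn_ge0 // divr_ge0 // mulr_ge0 // ltW.
Qed.

(** All tuples together carry mass at least [2 * b * n ^+ m], the bad ones at most half of it. A
    penalty [b / (2 * Sa)] on [g] costs at most [b / 2 * n ^+ m] and the threshold [b / 4] half as
    much, so that some good tuple has mass above the penalised threshold. *)
Lemma selection (G : pred {ffun J -> T}) (g : {ffun J -> T} -> R) (Sa : R) :
  let b := (ka / 2) ^+ m.+1 / 2 in
  0 < Sa -> (forall tau, 0 <= g tau) ->
  #|[set tau | ~~ G tau]%SET|%:R <= b * n ^+ m ->
  \sum_(tau | G tau) g tau <= Sa * n ^+ m ->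
  exists2 tau, G tau & b / 4 <= \sum_(w in Einter tau) nu w /\
    g tau <= 2 * Sa / b.
Proof.
move=> b Sa0 g0 hbad hg.
have b0 : 0 < b by rewrite divr_gt0 // exprn_gt0 // divr_gt0.
pose NE tau := \sum_(w in Einter tau) nu w.
have NE1 tau : NE tau <= 1.
  by rewrite -nu_sum1 [leRHS](bigID (mem (Einter tau))) /= lerDl sumr_ge0.
have nm0 : 0 < n ^+ m by rewrite exprn_gt0.
have tot := sum_Einter; rewrite -/(NE _) in tot.
have badN : \sum_(tau | ~~ G tau) NE tau <= b * n ^+ m.
  apply: le_trans hbad.
  apply: (@le_trans _ _ (\sum_(tau | ~~ G tau) 1)); first by apply: ler_sum.
  by rewrite sumr_const cardsE.
have cardG : \sum_(tau : {ffun J -> T} | G tau) (1 : R) <= n ^+ m.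
  apply: (@le_trans _ _ (\sum_(tau : {ffun J -> T}) 1)).
    by rewrite [leRHS](bigID G) /= lerDl sumr_ge0.
  by rewrite sumr_const card_ffun natrX.
suff [tau Gtau htau] : exists2 tau, G tau &
    b / (2 * Sa) * g tau + b / 4 <= NE tau.
  exists tau => //; split.
    apply: le_trans htau; rewrite lerDr mulr_ge0 // ltW // divr_gt0 // mulr_gt0 //.
  have h : b / (2 * Sa) * g tau <= 1 by have := NE1 tau; lra.
  rewrite ler_pdivlMr //; move: h; rewrite mulrAC ler_pdivrMr ?mulr_gt0 //.
  by rewrite mul1r mulrC.
apply/exists_inP; apply: contraT; rewrite negb_exists => /forallP no.
have : \sum_(tau | G tau) NE tau <=
    \sum_(tau | G tau) (b / (2 * Sa) * g tau + b / 4 * 1).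
  apply: ler_sum => tau Gtau; have := no tau; rewrite Gtau /= -ltNge => /ltW.
  by rewrite mulr1.
rewrite big_split /= -!mulr_sumr => h.
have h1 : b / (2 * Sa) * (\sum_(tau | G tau) g tau) <= b / 2 * n ^+ m.
  have -> : b / 2 * n ^+ m = b / (2 * Sa) * (Sa * n ^+ m).
    by field; rewrite gt_eqF.
  by apply: ler_wpM2l => //; rewrite ltW // divr_gt0 // mulr_gt0.
have h2 : b / 4 * (\sum_(tau | G tau) (1 : R)) <= b / 4 * n ^+ m.
  by apply: ler_wpM2l => //; rewrite ltW // divr_gt0.
have h3 : \sum_tau NE tau = \sum_(tau | G tau) NE tau + \sum_(tau | ~~ G tau) NE tau.
  by rewrite (bigID G).
have h4 : (ka / 2) ^+ m.+1 * n ^+ m = 2 * (b * n ^+ m).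
  by rewrite /b; field.
have h5 : 0 < b * n ^+ m by rewrite mulr_gt0.
have h6 : 2 * (b * n ^+ m) <= \sum_tau NE tau by rewrite -h4; exact: tot.
have e1 : b / 2 * n ^+ m = (b * n ^+ m) / 2 by field.
have e2 : b / 4 * n ^+ m = (b * n ^+ m) / 4 by field.
rewrite e1 in h1; rewrite e2 in h2; lra.
Qed.

End selection.

(** The dependence on [la] is kept explicit and polynomial because [la] will tend to 0 with the
    scale, as a power of the mass. *)
Lemma coords_bounds (R : realType) (Bp : 'M[{poly R}]_(4, 2)) (n : nat) (CB : R) :
  (0 < n)%N -> 1 <= CB -> (forall i j, pb n CB (Bp i j)) ->
  exists2 C : R, 1 <= C & forall a b la, 0 <= a <= 1 -> 0 <= b <= 1 ->
    0 < la -> la <= 1 -> la <= `|\det (frame Bp a b)| ->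
    let K := C * la^-1 ^+ 4 in
    [/\ [/\ forall t, 0 <= t <= 1 -> `|(Dp Bp a b).[t]| <= K,
         forall (v : 'rV[R]_2) t, `|v| <= 1 -> 0 <= t <= 1 -> `|ev t (rp Bp a b v)| <= K &
         forall (v : 'rV[R]_2) s s', `|v| <= 1 -> 0 <= s <= 1 -> 0 <= s' <= 1 ->
           `|(Dp Bp a b).[s'] *: ev s (ap Bp a b v) -
             (Dp Bp a b).[s] *: ev s' (ap Bp a b v) -
             (s - s') *: ev s' (rp Bp a b v)| <= K * (s - s') ^+ 2],
        forall t, 0 <= t <= 1 -> la <= `|\det (frame Bp t b)| ->
          [/\ det2 (Ft Bp a b t) != 0, `|phi Bp a b t| <= K &
              `|(det2 (Ft Bp a b t))^-1 *: adj2 (Ft Bp a b t)| <= K],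
        forall t, 0 <= t <= 1 -> la <= `|\det (frame Bp a t)| ->
          det2 (Gt Bp a b t) != 0 /\ `|phi' Bp a b t| <= K &
        forall x : 'rV[R]_4, `|x| <= K * (`|x *m ev a Bp| + `|x *m ev b Bp|)].
Proof.
move=> n0 CB1 pbB.
pose be := n%:R * CB.
pose C5 := 32 * n%:R ^+ 4 * (4 * (n%:R * (4 * (6 * be ^+ 3 * CB)) ^+ 2)) ^+ 2.
pose Cp := 48 * be ^+ 4 * (n%:R * (4 * (6 * be ^+ 3 * CB))) ^+ 2.
have CB0 : 0 <= CB by apply: le_trans CB1.
have be0 : 0 <= be by rewrite mulr_ge0.
have C50 : 0 <= C5.
  apply: mulr_ge0; last exact: sqr_ge0.
  by apply: mulr_ge0 => //; apply: exprn_ge0.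
have Cp0 : 0 <= Cp.
  apply: mulr_ge0; last exact: sqr_ge0.
  by apply: mulr_ge0 => //; apply: exprn_ge0.
exists (1 + C5 + Cp); first by rewrite -addrA lerDl addr_ge0.
move=> a b la a01 b01 la0 la1 hab K.
have il1 : 1 <= la^-1 by rewrite invf_ge1.
have il0 : 0 <= la^-1 by apply: le_trans il1.
have l40 : 0 <= la^-1 ^+ 4 by apply: exprn_ge0.
have K5 : 32 * n%:R ^+ 4 * (4 * (n%:R * (4 * (6 * (n%:R * CB) ^+ 3 / la * CB)) ^+ 2)) ^+ 2 <= K.
  rewrite [leLHS](_ : _ = C5 * la^-1 ^+ 4); last by rewrite /C5 /be; ring.
  by apply: ler_wpM2r => //; lra.
have Kp : 48 * (n%:R * CB) ^+ 4 / la * (n%:R * (4 * (6 * (n%:R * CB) ^+ 3 / la * CB))) ^+ 2 <= K.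
  rewrite [leLHS](_ : _ = Cp * la^-1 ^+ 3); last by rewrite /Cp /be; ring.
  apply: (@le_trans _ _ (Cp * la^-1 ^+ 4)).
    by apply: ler_wpM2l => //; apply: ler_weXn2l.
  by apply: ler_wpM2r => //; lra.
have dab : \det (frame Bp a b) != 0 by rewrite -normr_gt0; apply: lt_le_trans hab.
split; first split.
- by move=> t t01; apply: le_trans K5; apply: Dp_bound.
- by move=> v t v1 t01; apply: le_trans K5; apply: rp_bound.
- move=> v s s' v1 s01 s01'; apply: le_trans (ap_taylor n0 CB1 pbB a01 b01 la0 la1 hab v1 s01 s01') _.
  by apply: ler_wpM2r => //; apply: sqr_ge0.
- move=> t t01 ht; have [h1 h2 h3] := phi_bounds n0 CB1 pbB a01 b01 la0 la1 hab t01 ht.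
  by split => //; apply: le_trans Kp.
- move=> t t01 ht; have [h1 h2] := phi'_bounds n0 CB1 pbB a01 b01 la0 la1 hab t01 ht.
  by split => //; apply: le_trans Kp.
- move=> x; apply: le_trans (coord_bound n0 CB1 pbB a01 b01 la0 la1 hab x) _.
  by apply: ler_wpM2r => //; rewrite addr_ge0.
Qed.

Lemma disc_values_size (R : realType) (W : finType) (S : {set W}) (k : nat)
    (f : W -> 'rV[R]_k) (lab : W -> nat) (q M : nat) (d : R) : 0 < d ->
  (forall w, w \in S -> (lab w < q)%N) ->
  (forall w w', w \in S -> w' \in S -> lab w = lab w' -> `|f w - f w'| <= M%:R * d) ->
  exists2 A : seq 'rV[int]_k, (size A <= q * (2 * M + 3) ^ k)%N &
    forall w, w \in S -> disc d (f w) \in A.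
Proof.
move=> d0 hq hl.
have /choice[near Hn] : forall l, exists nl : seq 'rV[int]_k,
    size nl = ((2 * M + 3) ^ k)%N /\
    forall w, w \in S -> lab w = l -> disc d (f w) \in nl.
  move=> l.
  case: (pickP (fun w => (w \in S) && (lab w == l))) => [v /andP[vS /eqP vl]|no].
    have [nl snl hn] := disc_near M (f v) d0.
    exists nl; split => // w wS wl; apply: hn; apply: hl => //.
    by rewrite wl vl.
  have [nl snl _] := disc_near M (0 : 'rV[R]_k) d0.
  by exists nl; split => // w wS wl; have := no w; rewrite wS wl eqxx.
exists (flatten [seq near l | l <- iota 0 q]).
  rewrite size_flatten /shape -map_comp (eq_map (g := fun=> ((2 * M + 3) ^ k)%N)).
    by rewrite sumnE big_map big_const_seq count_predT size_iota iter_addn_0 mulnC.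
  by move=> l /=; have [] := Hn l.
move=> w wS; apply/flattenP; exists (near (lab w)).
  by apply: map_f; rewrite mem_iota /= hq.
by have [_] := Hn (lab w); apply.
Qed.

(** A fibre of [z] meets a bounded number of cells of side [rho], each of [p]-mass at most [F / NE];
    a bound on all fibres bounds the entropy below. *)
Lemma ent_lower (R : realType) (W : finType) (p nu : W -> R) (k : nat)
    (pt : W -> 'rV[R]_k) (Z : eqType) (z : W -> Z) (M : nat) (rho F NE : R) :
  (forall w, 0 <= p w) -> \sum_w p w = 1 -> (forall w, 0 <= nu w) ->
  0 < rho -> 0 < NE -> 0 < F ->
  (forall w, p w <= nu w / NE) ->
  (forall c, \sum_(w | disc rho (pt w) == c) nu w <= F) ->
  (forall w w', p w != 0 -> p w' != 0 -> z w = z w' -> `|pt w - pt w'| <= M%:R * rho) ->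
  - ln (((2 * M + 3) ^ k)%N%:R * F / NE) <= ent p z.
Proof.
move=> p0 p1 nu0 rho0 NE0 F0 pnu hF hz; apply: ent_ge => //.
  by rewrite divr_gt0 // mulr_gt0 // ltr0n expn_gt0 addn_gt0 orbT.
move=> w pw; have [l sl hl] := disc_near M (pt w) rho0.
apply: (@le_trans _ _ (\sum_(c <- l) \sum_(v | disc rho (pt v) == c) nu v / NE)).
  rewrite /cls (exchange_big_dep xpredT) //= big_mkcond; apply: ler_sum => v _.
  have s0 : 0 <= \sum_(c <- l | disc rho (pt v) == c) nu v / NE.
    by apply: sumr_ge0 => c _; rewrite divr_ge0 // ltW.
  case: ifP => // /eqP zv; have [->//|pv] := eqVneq (p v) 0.
  apply: le_trans (pnu v) _.
  rewrite -big_filter (big_rem (disc rho (pt v))) /=.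
    by rewrite lerDl sumr_ge0 // => c _; rewrite divr_ge0 // ltW.
  rewrite mem_filter eqxx /=; apply: hl; exact: hz.
apply: (@le_trans _ _ (\sum_(c <- l) F / NE)).
  apply: ler_sum => c _; rewrite -mulr_suml; apply: ler_wpM2r => //.
  by rewrite invr_ge0 ltW.
by rewrite big_const_seq count_predT iter_addr addr0 -[leLHS]mulr_natl sl mulrA.
Qed.

(** Joins the two halves: the sum of the maps keeps entropy about [h], and the coupling along it
    then makes the coarse cells carry little entropy. [V] collects the rounding losses, [c'] is the
    loss of the sum and [P] bounds the probability of being far. *)
Lemma bootstrap (R : realType) (W : finType) (p : W -> R) (X Y : W -> 'rV[R]_2)
    (d : R) (M mc : nat) (phi phi' psi0 psi' : 'M[R]_2) (s : seq 'M[R]_2)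
    (h c g K V : R) (A1 A2 : seq 'rV[int]_2) (nf : nat)
    (lf : seq (('rV[int]_2 * 'rV[int]_2) * ('rV[int]_2 * 'rV[int]_2))) :
  let Psi := \sum_(psi <- psi0 :: s) psi in
  let e := @emb R 2 in
  let c' := (size s)%:R * (9 * c + V) in
  let P := (2 * c + c' + V) / g in
  (forall w, 0 <= p w) -> \sum_w p w = 1 -> 0 < d -> (0 < M)%N -> (0 < mc)%N ->
  0 <= c -> 0 < g ->
  `|phi| <= M%:R -> `|phi'| <= M%:R -> phi *m phi' = 1%:M ->
  (size s).+1%:R * K <= M%:R -> `|psi'| <= M%:R -> Psi *m psi' = 1%:M ->
  26 * ln (2 * (8 * M + 4) + 3)%:R + ln 2 +
    2 * ln ((2 * ((4 * M + 3) * (2 * M)) + 3) ^ 2)%N%:R +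
    ln ((2 * (6 * M + 3) + 3) ^ 2)%N%:R <= V ->
  (forall w, p w != 0 -> disc d (X w) \in A1) ->
  (forall w, p w != 0 -> disc d (Y w) \in A2) ->
  ln (size A1)%:R <= h -> ln (size A2)%:R <= h ->
  2 * h - c <= ent p (fun w => (disc d (X w), disc d (Y w))) ->
  ent p (fun w => disc d (X w + Y w *m phi)) <= h ->
  (forall psi, psi \in psi0 :: s -> `|psi| <= K /\
     ent p (fun w => disc d (X w + Y w *m psi)) <= h) ->
  (0 < nf)%N -> (size lf <= nf)%N -> ln nf%:R <= 3 * h - g ->
  (forall a a' b b', a \in A1 -> a' \in A1 -> b \in A2 -> b' \in A2 ->
    `|(e a' - e a) + (e b' - e b) *m Psi| <= (4 * M + 3)%:R ->
    mc%:R < `|e b' - e b| -> ((a, b), (a', b')) \in lf) ->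
  ent p (fun w => (disc mc%:R (e (disc d (X w))), disc mc%:R (e (disc d (Y w))))) <=
    2 * (c + c' + V + P * h).
Proof.
move=> Psi e c' P p0 p1 d0 M0 mc0 c0 g0 phiM phi'M phiK sK psi'M PsiK HV A1P A2P
  A1h A2h HXY Hphi Hs nf0 lfs lfh lfP.
set k1 := ((2 * (6 * M + 3) + 3) ^ 2)%N in HV.
set k2 := ((2 * ((4 * M + 3) * (2 * M)) + 3) ^ 2)%N in HV.
have [w pw] : exists w, p w != 0.
  apply/existsP; apply: contraT; rewrite negb_exists => /forallP H.
  have : \sum_w p w = 0.
    by apply: big1 => w _; apply/eqP; have := H w; rewrite negbK.
  by rewrite p1 => /eqP; rewrite oner_eq0.
have sA1 : (0 < size A1)%N by have := A1P w pw; case: A1 {A1P A1h lfP}.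
have sA2 : (0 < size A2)%N by have := A2P w pw; case: A2 {A2P A2h lfP}.
have hX : ent p (fun w => disc d (X w)) <= h.
  by apply: le_trans A1h; apply: (@ent_le_ln _ _ p _ _ _ _ A1).
have hY : ent p (fun w => disc d (Y w)) <= h.
  by apply: le_trans A2h; apply: (@ent_le_ln _ _ p _ _ _ _ A2).
have l1 : 0 <= ln k1%:R :> R by rewrite ln_ge0 // ler1n expn_gt0 addn_gt0 orbT.
have l2 : 0 <= ln k2%:R :> R by rewrite ln_ge0 // ler1n expn_gt0 addn_gt0 orbT.
have l3 : 0 <= ln (2 * (8 * M + 4) + 3)%:R :> R.
  by rewrite ln_ge0 // ler1n addn_gt0 orbT.
have l4 : 0 <= ln 2 :> R by rewrite ln_ge0 // ler1n.
have h0 : 0 <= h by apply: le_trans A1h; rewrite ln_ge0 // ler1n.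
have := ent_sum_maps p0 p1 d0 c0 phi'M phiM phiK sK hX hY HXY Hphi Hs.
set L := 9 * c + _ => hPsi.
have Lc : (size s)%:R * L <= c' by apply: ler_wpM2l => //; rewrite /L; lra.
have {}hPsi : ent p (fun w => disc d (X w + Y w *m Psi)) <= h + c' by lra.
have PsiM : `|Psi| <= M%:R.
  apply: le_trans (ler_norm_sum _ _ _) _; apply: le_trans sK.
  rewrite big_seq; apply: (@le_trans _ _ (\sum_(i <- psi0 :: s | i \in psi0 :: s) K)).
    by apply: ler_sum => i hi; have [] := Hs i hi.
  by rewrite -big_seq big_const_seq count_predT iter_addr addr0 mulr_natl.
have [] := @final_step R W p X Y d M mc Psi psi' h c c' g p0 p1 d0 M0 mc0 PsiM psi'M PsiK
  A1 A2 nf lf A1P A2P A1h A2h HXY hPsi nf0 lfs lfh g0 lfP.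
rewrite -/k1 -/k2 -/e => f1 f2.
have PP : (2 * c + c' + ln 2 + 2 * ln k2%:R) / g * h <= P * h.
  apply: ler_wpM2r => //; apply: ler_wpM2r; first by rewrite invr_ge0 ltW.
  by lra.
have pl := ent_pair_le p0 p1 (fun w => disc mc%:R (e (disc d (X w))))
  (fun w => disc mc%:R (e (disc d (Y w)))).
apply: le_trans pl _; apply: le_trans (lerD f1 f2) _.
lra.
Qed.

(** * Counting far quadruples over tuples of directions *)

Section farcount.
Variables (R : realType) (Bp : 'M[{poly R}]_(4, 2)) (n Nn : nat).
Variables (T : finType) (tt : T -> R) (N : R).
Hypothesis tt01 : forall j, 0 <= tt j <= 1.
Hypothesis spacing : forall c L, 0 <= L ->
  #|[set j | `|tt j - c| <= L]%SET|%:R <= 2 * L * N + 2.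
Hypothesis N0 : 0 <= N.
Let J : finType := ('I_3 + 'I_Nn)%type.
Let e := @emb R 2.

Variables (c1 th la mu K : R) (M mc mm : nat) (A : T -> seq 'rV[int]_2) (S : R).
Hypotheses (th0 : 0 < th) (th1 : th <= 1) (mu0 : 0 < mu) (K1 : 1 <= K)
  (mc0 : (0 < mc)%N) (mm0 : (0 < mm)%N) (hmm : 8 * K ^+ 2 <= mu * mm%:R)
  (nN : (4 * n <= Nn)%N) (c10 : 0 < c1) (la0 : 0 < la).
Hypothesis hmu : mu = (c1 / 2 * (th / 3) ^+ Nn) ^+ 2 / 2.
Hypothesis AS : forall t, (size (A t))%:R <= S.
Hypothesis rpl : forall a b (e v : 'rV[R]_2),
  0 <= a <= 1 -> 0 <= b <= 1 -> \det (frame Bp a b) != 0 -> `|e| = 1 -> `|v| = 1 ->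
  exists2 t, 0 <= t <= 1 & c1 <= `|(wedge (map_mx polyC e) (rp Bp a b v)).[t]|.
Hypothesis size_rp : forall a b (v : 'rV[R]_2) j, 0 <= a <= 1 -> 0 <= b <= 1 ->
  la <= `|\det (frame Bp a b)| -> `|v| <= 1 ->
  (size (rp Bp a b v 0 j)%R <= 4 * n)%N.
Hypothesis bounds : forall a b, 0 <= a <= 1 -> 0 <= b <= 1 ->
  la <= `|\det (frame Bp a b)| ->
  [/\ forall t, 0 <= t <= 1 -> `|(Dp Bp a b).[t]| <= K,
      forall (v : 'rV[R]_2) t, `|v| <= 1 -> 0 <= t <= 1 -> `|ev t (rp Bp a b v)| <= K &
      forall (v : 'rV[R]_2) s s', `|v| <= 1 -> 0 <= s <= 1 -> 0 <= s' <= 1 ->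
        `|(Dp Bp a b).[s'] *: ev s (ap Bp a b v) -
          (Dp Bp a b).[s] *: ev s' (ap Bp a b v) -
          (s - s') *: ev s' (rp Bp a b v)| <= K * (s - s') ^+ 2].
Hypothesis Dneq0 : forall a b t, 0 <= a <= 1 -> 0 <= b <= 1 -> 0 <= t <= 1 ->
  la <= `|\det (frame Bp a b)| -> la <= `|\det (frame Bp t b)| ->
  (Dp Bp a b).[t] != 0.

(** The coordinates a and b fix the frame, and o supplies the map [phi] used to bound differences of
    Y; the remaining [Nn] coordinates are the summands of [Psi_of]. *)
Definition ja : 'I_3 + 'I_Nn := inl 0.
Definition jb : 'I_3 + 'I_Nn := inl 1.
Definition jo : 'I_3 + 'I_Nn := inl 2%:R.

Notation tuple_T := {ffun 'I_3 + 'I_Nn -> T}.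

Definition Psi_of (tau : tuple_T) : 'M[R]_2 :=
  \sum_(i < Nn) phi Bp (tt (tau ja)) (tt (tau jb)) (tt (tau (inr i))).

Definition quads (tau : tuple_T) :=
  [seq (x, y) | x <- [seq (a, b) | a <- A (tau ja), b <- A (tau jb)],
                y <- [seq (a, b) | a <- A (tau ja), b <- A (tau jb)]].

Definition far_pair (tau : tuple_T)
    (x : ('rV[int]_2 * 'rV[int]_2) * ('rV[int]_2 * 'rV[int]_2)) :=
  (`|(e x.2.1 - e x.1.1) + (e x.2.2 - e x.1.2) *m Psi_of tau| <= (4 * M + 3)%:R) &&
  (mc%:R < `|e x.2.2 - e x.1.2|).

Definition tame (tau : tuple_T) :=
  [forall i, forall j, (i != j) ==>
     (th <= `|tt (tau i) - tt (tau j)|) &&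
     (la <= `|\det (frame Bp (tt (tau i)) (tt (tau j)))|)].

Let dirv (x : ('rV[int]_2 * 'rV[int]_2) * ('rV[int]_2 * 'rV[int]_2)) : 'rV[R]_2 :=
  `|e x.2.2 - e x.1.2|^-1 *: (e x.2.2 - e x.1.2).

(** The conditions under which [pair_count] applies at the coordinates [i] and [j]. They say nothing
    of separation or of the other frames, so these two coordinates can be resampled freely. *)
Let pairc (i j : 'I_Nn) (tau : tuple_T) x :=
  let a := tt (tau ja) in let b := tt (tau jb) in
  [&& la <= `|\det (frame Bp a b)|,
      (Dp Bp a b).[tt (tau (inr i))] != 0, (Dp Bp a b).[tt (tau (inr j))] != 0,
      mu <= `|wedge (ev (tt (tau (inr i))) (rp Bp a b (dirv x)))
                    (ev (tt (tau (inr j))) (rp Bp a b (dirv x)))| &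
      far_pair tau x].

Let dirv1 x : mc%:R < `|e x.2.2 - e x.1.2| -> `|dirv x| = 1.
Proof.
move=> h; rewrite normrZ normfV normr_id mulVf // gt_eqF //.
by apply: le_lt_trans h.
Qed.

Let tame_pair tau x : tame tau -> far_pair tau x ->
  exists i j, (i != j) && pairc i j tau x.
Proof.
move=> /forallP H fx; have /andP[_ hx] := fx.
have cond (i j : J) : i != j -> th <= `|tt (tau i) - tt (tau j)| /\
    la <= `|\det (frame Bp (tt (tau i)) (tt (tau j)))|.
  by move=> ij; have /forallP/(_ j) := H i; rewrite ij => /andP[].
have [_ hab] := cond ja jb isT.
have dab : \det (frame Bp (tt (tau ja)) (tt (tau jb))) != 0.
  by rewrite -normr_gt0; apply: lt_le_trans hab.
have v1 := dirv1 hx.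
have vle : `|dirv x| <= 1 by rewrite v1.
have [i [j hij]] := @two_directions R Bp n c1 th Nn (fun i => tt (tau (inr i)))
   (tt (tau ja)) (tt (tau jb)) (dirv x) c10 th0 th1 nN
   (fun e e1 => rpl (tt01 _) (tt01 _) dab e1 v1)
   (fun j => size_rp j (tt01 _) (tt01 _) hab vle) (fun i => tt01 _)
   (fun i j ij => (cond (inr i) (inr j) ij).1).
rewrite -hmu in hij; exists i, j; rewrite /pairc hab hij fx /= !andbT.
have -> : i != j.
  by apply: contraTneq hij => ->; rewrite wedge_self normr0 -ltNge.
have D0 k : (Dp Bp (tt (tau ja)) (tt (tau jb))).[tt (tau (inr k))] != 0.
  apply: Dneq0; try exact: tt01; first exact: hab.
  exact: (cond (inr k) jb isT).2.
by rewrite !D0.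
Qed.

Let Qc : R := (mm.+1%:R ^+ 2) *
  (2 * (16 * K ^+ 3 * (4 * M + 3)%:R / (mc%:R * mu)) * N + 2) ^+ 2.

Let Qc0 : 0 <= Qc.
Proof. by apply: mulr_ge0; apply: sqr_ge0. Qed.

(** With the other coordinates frozen, [u] collects their contribution and the condition becomes
    that of [pair_count], with [rho] the length of the difference of the Y cells. As [rho] exceeds
    [mc], the intervals are no longer than those for [mc]. *)
Let count_st (i j : 'I_Nn) (tau : tuple_T) x : i != j ->
  #|[set st : T * T | pairc i j (upd (upd tau (inr i) st.1) (inr j) st.2) x]%SET|%:R
    <= Qc.
Proof.
move=> ij; set a := tt (tau ja); set b := tt (tau jb).
case: (boolP (la <= `|\det (frame Bp a b)|)) => hab; last first.
  rewrite eq_card0 // => st; rewrite inE /pairc !updE /= -/a -/b.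
  by rewrite (negbTE hab).
case: (boolP (mc%:R < `|e x.2.2 - e x.1.2|)) => hx; last first.
  rewrite eq_card0 // => st; rewrite inE /pairc /far_pair (negbTE hx).
  by rewrite !andbF.
have a01 : 0 <= a <= 1 by apply: tt01.
have b01 : 0 <= b <= 1 by apply: tt01.
have [DK rK tay] := bounds a01 b01 hab.
have v1 := dirv1 hx; have vle : `|dirv x| <= 1 by rewrite v1.
set rho := `|e x.2.2 - e x.1.2| in hx *.
have rho0 : 0 < rho by apply: le_lt_trans hx.
pose u := (e x.2.1 - e x.1.1) + (e x.2.2 - e x.1.2) *m
   \sum_(l < Nn | (l != i) && (l != j)) phi Bp a b (tt (tau (inr l))).
have Q0 : 0 <= (4 * M + 3)%:R :> R by [].
have := @pair_count R T tt N tt01 spacing (fun s => ev s (ap Bp a b (dirv x)))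
  (fun s => ev s (rp Bp a b (dirv x))) (fun s => (Dp Bp a b).[s]) K mu
  (4 * M + 3)%:R rho mm K1 mu0 rho0 Q0 mm0 hmm N0
  (fun s s' => tay _ s s' vle) (fun s => rK _ s vle) DK u.
set S1 := [set _ | _]%SET; set Z1 := 16 * K ^+ 3 * _ / _ => H.
apply: le_trans (le_trans H _).
  rewrite ler_nat; apply: subset_leq_card; apply/fintype.subsetP => -[s t].
  rewrite !inE /pairc !updE /= -/a -/b.
  rewrite !eqxx (_ : (inr i == inr j :> J) = false); last by apply/negbTE.
  case/and5P => [_ -> -> -> /andP[hQ _]] /=.
  suff -> : u + rho *: (((Dp Bp a b).[tt s])^-1 *: ev (tt s) (ap Bp a b (dirv x)) +
       ((Dp Bp a b).[tt t])^-1 *: ev (tt t) (ap Bp a b (dirv x))) =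
     e x.2.1 - e x.1.1 + (e x.2.2 - e x.1.2) *m
       Psi_of (upd (upd tau (inr i) s) (inr j) t) by [].
  have -> : Psi_of (upd (upd tau (inr i) s) (inr j) t) =
     \sum_(l < Nn | (l != i) && (l != j)) phi Bp a b (tt (tau (inr l))) +
     (phi Bp a b (tt s) + phi Bp a b (tt t)).
    rewrite /Psi_of (bigD1 i) //= (bigD1 j) //=; last by rewrite eq_sym.
    rewrite !updE /= -/a -/b !eqxx (_ : (inr i == inr j :> J) = false); last exact/negbTE.
    rewrite [X in _ + (_ + X) = _](_ : _ = \sum_(l < Nn | (l != i) && (l != j)) phi Bp a b (tt (tau (inr l)))).
      by rewrite addrA addrC.
    apply: eq_bigr => l /andP[li lj].
    have -> // : upd (upd tau (inr i) s) (inr j) t (inr l) = tau (inr l).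
    rewrite updE; case: ifP => [/eqP[lE]|_]; first by rewrite lE eqxx in lj.
    by rewrite updE; case: ifP => [/eqP[lE]|_] //; rewrite lE eqxx in li.
  rewrite -!phi_ap mulmxDr addrA mulmxDr scalerDr; congr (_ + (_ + _)).
    by rewrite scalemxAl /dirv scalerA divff ?scale1r // gt_eqF.
  by rewrite scalemxAl /dirv scalerA divff ?scale1r // gt_eqF.
apply: ler_wpM2l; first exact: sqr_ge0.
have mcp : 0 < mc%:R :> R by rewrite ltr0n.
have Kp : 0 <= 16 * K ^+ 3 * (4 * M + 3)%:R.
  by apply: mulr_ge0 => //; apply: mulr_ge0 => //; apply: exprn_ge0; apply: le_trans K1.
have Z10 : 0 <= Z1 by rewrite /Z1 divr_ge0 // mulr_ge0 // ltW.
have ZZ : Z1 <= 16 * K ^+ 3 * (4 * M + 3)%:R / (mc%:R * mu).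
  rewrite /Z1; apply: ler_wpM2l => //.
  rewrite lef_pV2 ?posrE ?mulr_gt0 //; apply: ler_wpM2r; exact: ltW.
have ZN := ler_wpM2r N0 ZZ; have ZN0 := mulr_ge0 Z10 N0.
rewrite lerXn2r ?nnegrE //; lra.
Qed.

(** Double counting. A far quadruple of a tame tuple has two transversal coordinates; resampling
    them leaves [quads] unchanged, since it depends on a and b only, and at most [Qc] of the pairs
    of new values keep the relation. *)
Lemma far_count :
  #|T|%:R ^+ 2 * \sum_(tau : tuple_T | tame tau) (count (far_pair tau) (quads tau))%:R
    <= (Nn%:R ^+ 2 * (S ^+ 4 * Qc)) * #|T|%:R ^+ #|J|.
Proof.
have sq tau : (size (quads tau))%:R <= S ^+ 4.
  rewrite !size_allpairs !natrM (_ : S ^+ 4 = (S * S) * (S * S)); last by ring.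
  have sab : (size (A (tau ja)))%:R * (size (A (tau jb)))%:R <= S * S by apply: ler_pM.
  by apply: ler_pM => //; apply: mulr_ge0.
pose cnt i j (tau : tuple_T) : R := \sum_(x <- quads tau) (pairc i j tau x)%:R.
have cnt0 i j tau : 0 <= cnt i j tau by apply: sumr_ge0.
have tame_cnt tau : tame tau ->
    (count (far_pair tau) (quads tau))%:R <= \sum_i \sum_(j | i != j) cnt i j tau.
  move=> ht; rewrite -sum1_count big_mkcond /= natr_sum.
  have -> : \sum_i \sum_(j | i != j) cnt i j tau =
      \sum_(x <- quads tau) \sum_i \sum_(j | i != j) (pairc i j tau x)%:R.
    rewrite [RHS]exchange_big /=; apply: eq_bigr => i _.
    by rewrite [RHS]exchange_big.
  apply: ler_sum => x _.
  have S1 : 0 <= \sum_i \sum_(j | i != j) (pairc i j tau x)%:R :> R.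
    by apply: sumr_ge0 => i _; apply: sumr_ge0.
  case: ifP => // fx; have [i [j /andP[ij hij]]] := tame_pair ht fx.
  rewrite (bigD1 i) //= (bigD1 j) //= hij -addrA lerDl.
  by apply: addr_ge0; apply: sumr_ge0 => // k _; apply: sumr_ge0.
have resample i j : i != j ->
    #|T|%:R ^+ 2 * \sum_tau cnt i j tau <= S ^+ 4 * Qc * #|T|%:R ^+ #|J|.
  move=> ij; rewrite expr2 -mulrA -(sum_upd (inr j)) -(sum_upd (inr i)).
  rewrite -natrX -card_ffun -sumr_const mulr_sumr.
  have one (x : R) : x * 1 = x by rewrite mulr1.
  under [leRHS]eq_bigr do rewrite one.
  apply: ler_sum => tau _.
  have -> : \sum_s \sum_t cnt i j (upd (upd tau (inr i) s) (inr j) t) =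
      \sum_(x <- quads tau)
        #|[set st : T * T | pairc i j (upd (upd tau (inr i) st.1) (inr j) st.2) x]%SET|%:R.
    rewrite pair_big /=.
    transitivity (\sum_(st : T * T) \sum_(x <- quads tau)
        (pairc i j (upd (upd tau (inr i) st.1) (inr j) st.2) x)%:R : R).
      by apply: eq_bigr => st _; rewrite /cnt /quads !updE.
    rewrite exchange_big /=; apply: eq_bigr => x _.
    by rewrite (card_natr R).
  apply: (@le_trans _ _ (\sum_(x <- quads tau) Qc)).
    by apply: ler_sum => x _; apply: count_st.
  rewrite big_const_seq count_predT iter_addr_0 -[leLHS]mulr_natl.
  exact: ler_wpM2r (sq tau).
apply: (@le_trans _ _ (\sum_i \sum_(j | i != j) (#|T|%:R ^+ 2 * \sum_tau cnt i j tau))).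
  have -> : \sum_i \sum_(j | i != j) (#|T|%:R ^+ 2 * \sum_tau cnt i j tau) =
      #|T|%:R ^+ 2 * \sum_i \sum_(j | i != j) \sum_tau cnt i j tau.
    by rewrite mulr_sumr; apply: eq_bigr => i _; rewrite mulr_sumr.
  apply: ler_wpM2l; first exact: sqr_ge0.
  have -> : \sum_i \sum_(j | i != j) \sum_tau cnt i j tau =
      \sum_tau \sum_i \sum_(j | i != j) cnt i j tau.
    by rewrite [RHS]exchange_big /=; apply: eq_bigr => i _; rewrite [RHS]exchange_big.
  rewrite big_mkcond /=; apply: ler_sum => tau _.
  by case: ifP => [/tame_cnt//|_]; apply: sumr_ge0 => i _; apply: sumr_ge0.
set q := S ^+ 4 * Qc * _ in resample.
have q0 : 0 <= q.
  apply: mulr_ge0; last exact: exprn_ge0.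
  by apply: mulr_ge0 => //; rewrite (_ : 4 = 2 * 2)%N // exprM sqr_ge0.
apply: (@le_trans _ _ (\sum_(i < Nn) \sum_(j < Nn) q)).
  apply: ler_sum => i _; rewrite big_mkcond; apply: ler_sum => j _.
  by case: ifP => // /resample.
rewrite !sumr_const !card_ord -[leLHS]mulr_natl -[X in _ * X <= _]mulr_natl.
by rewrite /q !mulrA.
Qed.

End farcount.

(** For a fixed tuple, the few image cells bound the entropies above, and the Frostman condition at
    scale [d] gives (X, Y) entropy at least [2 * h - c]. The condition at scale [mc * d] bounds the
    coarse entropy below, so that [bootstrap] becomes an inequality between parameters. *)
Lemma tuple_bound (R : realType) (Bp : 'M[{poly R}]_(4, 2)) (Nn : nat)
    (a b o : R) (t : 'I_Nn -> R) (K : R) (M mc : nat) (psi' : 'M[R]_2)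
    (W : finType) (p nu : W -> R) (pt : W -> 'rV[R]_4) (d S h g V F1 F2 NE : R)
    (A : R -> seq 'rV[int]_2) (nf : nat)
    (lf : seq (('rV[int]_2 * 'rV[int]_2) * ('rV[int]_2 * 'rV[int]_2))) :
  let Psi := \sum_(i < Nn) phi Bp a b (t i) in
  let e := @emb R 2 in
  let c := 2 * h + ln (((2 * M + 3) ^ 4)%N%:R * F1 / NE) in
  let c' := (Nn.-1)%:R * (9 * c + V) in
  let P := (2 * c + c' + V) / g in
  (0 < Nn)%N -> \det (frame Bp a b) != 0 ->
  (forall s, s = o \/ (exists i, s = t i) ->
     [/\ det2 (Ft Bp a b s) != 0, `|phi Bp a b s| <= K &
         `|(det2 (Ft Bp a b s))^-1 *: adj2 (Ft Bp a b s)| <= K]) ->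
  det2 (Gt Bp a b o) != 0 -> `|phi' Bp a b o| <= K ->
  (forall x : 'rV[R]_4, `|x| <= K * (`|x *m ev a Bp| + `|x *m ev b Bp|)) ->
  6 * K <= M%:R -> Nn%:R * K <= M%:R -> `|psi'| <= M%:R -> Psi *m psi' = 1%:M ->
  (0 < M)%N -> (0 < mc)%N -> 0 < d -> 0 <= K ->
  (forall w, 0 <= p w) -> \sum_w p w = 1 -> (forall w, 0 <= nu w) ->
  0 < NE -> 0 < F1 -> 0 < F2 -> (forall w, p w <= nu w / NE) ->
  (forall z, \sum_(w | disc d (pt w) == z) nu w <= F1) ->
  (forall z, \sum_(w | disc (mc%:R * d) (pt w) == z) nu w <= F2) ->
  (forall s, [\/ s = a, s = b, s = o | exists i, s = t i] ->
     (forall w, p w != 0 -> disc d (pt w *m ev s Bp) \in A s) /\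
     (size (A s))%:R <= S) ->
  ln S + 2 * ln (2 * M + 3)%:R <= h ->
  26 * ln (2 * (8 * M + 4) + 3)%:R + ln 2 +
    2 * ln ((2 * ((4 * M + 3) * (2 * M)) + 3) ^ 2)%N%:R +
    ln ((2 * (6 * M + 3) + 3) ^ 2)%N%:R <= V ->
  0 <= c -> 0 < g ->
  (0 < nf)%N -> (size lf <= nf)%N -> ln nf%:R <= 3 * h - g ->
  (forall a1 a2 b1 b2, a1 \in A a -> a2 \in A a -> b1 \in A b -> b2 \in A b ->
    `|(e a2 - e a1) + (e b2 - e b1) *m Psi| <= (4 * M + 3)%:R ->
    mc%:R < `|e b2 - e b1| -> ((a1, b1), (a2, b2)) \in lf) ->
  - ln (((2 * M + 3) ^ 4)%N%:R * F2 / NE) <= 2 * (c + c' + V + P * h).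
Proof.
move=> Psi e c c' P Nn0 dab Hs dGo phi'o coord KM NnKM psi'M PsiK M0 mc0 d0 K0
  p0 p1 nu0 NE0 F10 F20 pnu hF1 hF2 HA hS HV c0 g0 nf0 lfs lfh lfP.
pose X w := pt w *m ev a Bp; pose Y w := pt w *m ev b Bp.
have [w0 pw0] : exists w, p w != 0.
  apply/existsP; apply: contraT; rewrite negb_exists => /forallP H.
  have : \sum_w p w = 0.
    by apply: big1 => w _; apply/eqP; have := H w; rewrite negbK.
  by rewrite p1 => /eqP; rewrite oner_eq0.
have lnM0 : 0 <= ln (2 * M + 3)%:R :> R by rewrite ln_ge0 // ler1n addn_gt0 orbT.
have sA s : [\/ s = a, s = b, s = o | exists i, s = t i] -> (0 < size (A s))%N.
  by move=> /HA[h1 _]; have := h1 _ pw0; case: (A s).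
have lnA s : [\/ s = a, s = b, s = o | exists i, s = t i] -> ln (size (A s))%:R <= ln S.
  move=> hs; have [_ h2] := HA s hs; rewrite ler_ln ?posrE ?ltr0n ?sA //.
  by apply: lt_le_trans h2; rewrite ltr0n sA.
have hXY w : X w - X w0 = (pt w - pt w0) *m ev a Bp by rewrite mulmxBl.
have entphi s : s = o \/ (exists i, s = t i) ->
    ent p (fun w => disc d (X w + Y w *m phi Bp a b s)) <= h.
  move=> hs; have [D0 _ iK] := Hs s hs.
  have hs' : [\/ s = a, s = b, s = o | exists i, s = t i].
    by case: hs => [->|hs]; [constructor 3|constructor 4].
  have [HA1 _] := HA s hs'.
  pose Fi := (det2 (Ft Bp a b s))^-1 *: adj2 (Ft Bp a b s).
  have FFi : Ft Bp a b s *m Fi = 1%:M.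
    by rewrite /Fi -scalemxAr mul_adj2 scale_scalar_mx mulVf.
  have E w : X w + Y w *m phi Bp a b s = pt w *m ev s Bp *m Fi.
    rewrite (ev_dec dab s) mulmxDr mulmxDl !(mulmxA (pt w)) -/(X w) -/(Y w).
    rewrite -(mulmxA (X w)) -(mulmxA (Y w)) FFi mulmx1.
    by rewrite /phi /Fi -[in RHS]scalemxAr.
  have := @ent_disc_le R W p p0 p1 2 2 (fun w => pt w *m ev s Bp)
    (fun w => X w + Y w *m phi Bp a b s) d M d0.
  have e1 : ent p (fun w => disc d (pt w *m ev s Bp)) <= ln S.
    have sz := sA s hs'; apply: le_trans (lnA s hs').
    by apply: (@ent_le_ln _ _ p _ _ _ _ (A s)).
  move=> H; apply: le_trans (H _) _; last by lra.
  move=> w w' hw; rewrite !E -mulmxBl; apply: le_trans (norm_mulmx _ _) _.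
  have := ler_pM (normr_ge0 _) (normr_ge0 _) hw iK; rewrite -/Fi => h2.
  have := ler_wpM2r (ltW d0) KM; have := mulr_ge0 K0 (ltW d0); lra.
have hs0 : forall psi, psi \in [seq phi Bp a b (t i) | i <- enum 'I_Nn] ->
    `|psi| <= K /\ ent p (fun w => disc d (X w + Y w *m psi)) <= h.
  move=> psi /mapP[i _ ->]; have ti : t i = o \/ exists j, t i = t j by right; exists i.
  by split; [have [] := Hs _ ti|apply: entphi].
have szs : size [seq phi Bp a b (t i) | i <- enum 'I_Nn] = Nn by rewrite size_map size_enum_ord.
have sums : \sum_(psi <- [seq phi Bp a b (t i) | i <- enum 'I_Nn]) psi = Psi.
  by rewrite big_map big_enum.
case: [seq phi Bp a b (t i) | i <- enum 'I_Nn] hs0 szs sums => [_ /= E|psi0 s hs0 szs sums].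
  by rewrite -E in Nn0.
have szs' : size s = Nn.-1 by rewrite -szs.
have po : o = o \/ exists i, o = t i by left.
have [Do phio _] := Hs o po.
have in1 : [\/ a = a, a = b, a = o | exists i, a = t i] by constructor 1.
have in2 : [\/ b = a, b = b, b = o | exists i, b = t i] by constructor 2.
have hp : ln S <= h by lra.
have KM1 : K <= M%:R by lra.
have ptd w w' r : 0 <= r -> `|X w - X w'| <= r -> `|Y w - Y w'| <= r ->
    `|pt w - pt w'| <= 2 * K * r.
  move=> r0 hx hy; apply: le_trans (coord _) _; rewrite !mulmxBl -/(X w) -/(X w') -/(Y w) -/(Y w').
  by have := ler_wpM2l K0 (lerD hx hy); lra.
have lowXY : 2 * h - c <= ent p (fun w => (disc d (X w), disc d (Y w))).
  have := @ent_lower R W p nu 4 pt _ (fun w => (disc d (X w), disc d (Y w))) M d F1 NE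
    p0 p1 nu0 d0 NE0 F10 pnu hF1.
  rewrite /c => H; apply: le_trans (H _); first by lra.
  move=> w w' _ _ E; have hx := disc_eq_dist d0 (congr1 fst E).
  have hy := disc_eq_dist d0 (congr1 snd E).
  apply: le_trans (ptd _ _ _ (ltW d0) hx hy) _.
  by apply: ler_wpM2r; [exact: ltW|lra].
have := @bootstrap R W p X Y d M mc (phi Bp a b o) (phi' Bp a b o) psi0 psi' s h c g K V
  (A a) (A b) nf lf p0 p1 d0 M0 mc0 c0 g0 (le_trans phio KM1) (le_trans phi'o KM1)
  (phiK Do dGo).
rewrite szs' prednK // sums => /(_ NnKM psi'M PsiK HV (HA _ in1).1 (HA _ in2).1).
move=> /(_ (le_trans (lnA _ in1) hp) (le_trans (lnA _ in2) hp) lowXY (entphi o po) hs0).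
move=> /(_ nf0 lfs lfh lfP); rewrite -/c' -/P; apply: le_trans.
have mcd0 : 0 < mc%:R * d by rewrite mulr_gt0 // ltr0n.
apply: (@ent_lower R W p nu 4 pt _ _ M (mc%:R * d) F2 NE) => // w w' _ _ E.
have mc1 : d <= mc%:R * d.
  have m1 : 1 <= mc%:R :> R by rewrite ler1n.
  by have := ler_wpM2r (ltW d0) m1; rewrite mul1r.
have cd (u v : 'rV[R]_2) : disc mc%:R (emb R (disc d u)) = disc mc%:R (emb R (disc d v)) ->
    `|u - v| <= 3 * (mc%:R * d).
  move=> /disc_eq_dist; rewrite ltr0n mc0 => /(_ isT) h1.
  have h2 := emb_disc_dist u d0; have h3 := emb_disc_dist v d0.
  have -> : u - v = (u - d *: emb R (disc d u)) - (v - d *: emb R (disc d v)) +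
      d *: (emb R (disc d u) - emb R (disc d v)).
    by rewrite scalerBr; move: (_ *: _) (_ *: emb _ (disc d v)) => x y; apply/rowP => j; rewrite !mxE; ring.
  apply: le_trans (ler_normD _ _) _; rewrite normrZ (gtr0_norm d0).
  have h4 := ler_normB (u - d *: emb R (disc d u)) (v - d *: emb R (disc d v)).
  have := ler_wpM2l (ltW d0) h1; lra.
have mcd1 : 0 <= 3 * (mc%:R * d) by rewrite mulr_ge0 // ltW.
have := ptd w w' _ mcd1 (cd _ _ (congr1 fst E)) (cd _ _ (congr1 snd E)).
move=> H; apply: le_trans H _.
by rewrite mulrA; apply: ler_wpM2r; [exact: ltW|lra].
Qed.

(** * Discarding degenerate tuples *)

Section core.
Variables (R : realType) (Bp : 'M[{poly R}]_(4, 2)) (n : nat) (CB : R).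
Hypotheses (n_gt0 : (0 < n)%N) (CB1 : 1 <= CB)
  (pbB : forall i j, pb n CB (Bp i j)).
Variables (T : finType) (tt : T -> R) (N : R).
Hypothesis tt01 : forall j, 0 <= tt j <= 1.
Hypothesis spacing : forall c L, 0 <= L ->
  #|[set j | `|tt j - c| <= L]%SET|%:R <= 2 * L * N + 2.
Hypothesis N0 : 0 <= N.
Variables (c0 th la : R).
Hypotheses (c00 : 0 < c0) (th0 : 0 < th) (th1 : th <= 1) (la0 : 0 < la).
Hypothesis hla : la <= c0 / 2 * (th / 3) ^+ (4 * n).
Hypothesis frl : forall b, 0 <= b <= 1 ->
  exists2 t, 0 <= t <= 1 & c0 <= `|\det (frame Bp t b)|.

Let la2 := 1 / 2 * (th / 3) ^+ (4 * n).
Let Nn := (4 * n).+1.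
Let J : finType := ('I_3 + 'I_Nn)%type.
Let jl : J := inr ord_max.
Notation ja := (ja Nn).
Notation jb := (jb Nn).

Definition Psi_init (tau : {ffun J -> T}) : 'M[R]_2 :=
  \sum_(i < Nn | i != ord_max) phi Bp (tt (tau ja)) (tt (tau jb)) (tt (tau (inr i))).

(** Ensures that the full sum Psi is invertible: Psi times [Ft] at the last parameter is
    [Psi_init Ft + Gt], which is polynomial in that parameter. *)
Definition last_ok (tau : {ffun J -> T}) :=
  (la <= `|\det (frame Bp (tt (tau ja)) (tt (tau jb)))|) ==>
  (la2 < `|det2 (Psi_init tau *m Ft Bp (tt (tau ja)) (tt (tau jb)) (tt (tau jl)) +
                 Gt Bp (tt (tau ja)) (tt (tau jb)) (tt (tau jl)))|).

Definition good_tuple (tau : {ffun J -> T}) := tame Bp tt th la tau && last_ok tau.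

(** One interval around another coordinate, for separation, and [4 * n] intervals for the sublevel
    set of a determinant of size at most [4 * n]. *)
Let q0 : R := (1 + 4 * n%:R) * (2 * th * N + 2).

Let thN0 : 0 <= 2 * th * N + 2.
Proof. by have := mulr_ge0 (ltW th0) N0; lra. Qed.

Let bad_pair (i j : J) (tau : {ffun J -> T}) := (i != j) &&
  ((`|tt (tau i) - tt (tau j)| < th) ||
   (`|\det (frame Bp (tt (tau i)) (tt (tau j)))| < la)).

Let n40 : (4 * n)%:R = 4 * n%:R :> R. Proof. by rewrite natrM. Qed.

Let q0E : q0 = (2 * th * N + 2) + (4 * n)%:R * (2 * th * N + 2).
Proof. by rewrite n40 /q0; ring. Qed.

Let bad_pair_count i j :
  #|T|%:R * #|[set tau | bad_pair i j tau]%SET|%:R <= q0 * #|T|%:R ^+ #|J|.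
Proof.
apply: (count_upd (i := i)) => tau.
have q00 : 0 <= q0 by rewrite q0E; apply: addr_ge0 => //; apply: mulr_ge0.
have [->|ij] := eqVneq i j.
  by rewrite eq_card0 // => s; rewrite inE /bad_pair eqxx.
set b := tt (tau j); have b01 : 0 <= b <= 1 by apply: tt01.
have [t t01 ht] := frl b01.
have := sublevel_count tt01 spacing th0 th1 c00 (size_framep n_gt0 pbB b) t01.
rewrite framep_horner => /(_ ht N0); set S1 := [set j | _]%SET => h1.
have := spacing b (ltW th0); set S2 := [set j | _]%SET => h2.
rewrite q0E; apply: le_trans (lerD h2 h1); rewrite -natrD ler_nat.
apply: leq_trans (leq_card_setU S2 S1); apply: subset_leq_card.
apply/fintype.subsetP => s; rewrite !inE /bad_pair !updE eqxx ij /= eq_sym (negbTE ij) -/b.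
case/orP => [/ltW -> //|h]; apply/orP; right.
by rewrite framep_horner; apply: le_trans hla; apply: ltW.
Qed.

Let bad_last_count :
  #|T|%:R * #|[set tau | ~~ last_ok tau]%SET|%:R <= q0 * #|T|%:R ^+ #|J|.
Proof.
apply: (count_upd (i := jl)) => tau.
have q00 : 0 <= q0 by rewrite q0E; apply: addr_ge0 => //; apply: mulr_ge0.
set a := tt (tau ja); set b := tt (tau jb).
have updl s : [/\ tt (upd tau jl s ja) = a, tt (upd tau jl s jb) = b,
    tt (upd tau jl s jl) = tt s & Psi_init (upd tau jl s) = Psi_init tau].
  rewrite /Psi_init !updE /= eqxx; split => //.
  by apply: eq_bigr => i im; rewrite updE ifN.
case: (boolP (la <= `|\det (frame Bp a b)|)) => hab; last first.
  rewrite eq_card0 // => s; rewrite inE /last_ok.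
  by have [-> -> _ _] := updl s; rewrite (negbTE hab).
have a01 : 0 <= a <= 1 by apply: tt01.
have b01 : 0 <= b <= 1 by apply: tt01.
have dab : \det (frame Bp a b) != 0 by rewrite -normr_gt0; apply: lt_le_trans hab.
pose Q := map_mx polyC (Psi_init tau) *m Fp Bp a b + Gp Bp a b.
have evQ t : ev t Q = Psi_init tau *m Ft Bp a b t + Gt Bp a b t.
  by rewrite -ev_Fp -ev_Gp -[X in X *m _](ev_const t (Psi_init tau)) -ev_mul; exact: map_mxD.
have hQ t : (det2 Q).[t] = det2 (Psi_init tau *m Ft Bp a b t + Gt Bp a b t).
  rewrite -evQ; move: Q {evQ} => Q; by rewrite /det2 !hornerE /ev !mxE.
have sQ : (size (det2 Q)%R <= 4 * n)%N.
  have pF i j := pb_Fp CB1 pbB a01 b01 la0 hab i j.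
  have pG i j := pb_Gp CB1 pbB a01 b01 la0 hab i j.
  have sz i j : (size (Q i j)%R <= n)%N.
    rewrite mxE; apply: leq_trans (size_polyD _ _) _; rewrite geq_max.
    apply/andP; split; last by case: (pG i j).
    rewrite mxE; apply: leq_trans (size_sum _ _ _) _; apply/bigmax_leqP => k _.
    rewrite mxE mul_polyC; apply: leq_trans (size_scale_leq _ _) _.
    by case: (pF k j).
  have szM (x y : {poly R}) : (size x <= n)%N -> (size y <= n)%N -> (size (x * y)%R <= 4 * n)%N.
    move=> hx hy; apply: leq_trans (size_polyMleq _ _) _.
    by apply: leq_trans (leq_pred _) _; apply: leq_trans (leq_add hx hy) _; rewrite addnn -mul2n leq_mul2r orbT.
  rewrite /det2; apply: leq_trans (size_polyD _ _) _; rewrite geq_max size_polyN.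
  by rewrite !szM.
have Qb : 1 <= `|(det2 Q).[b]|.
  have [_ e1 _ e2] := frame_inv dab.
  by rewrite hQ /Ft /Gt e1 e2 mulmx0 add0r -det2E det1 normr1.
have := sublevel_count tt01 spacing th0 th1 ltr01 sQ b01 Qb N0.
rewrite -/la2; set S1 := [set j | _]%SET => h1.
apply: (@le_trans _ _ #|S1|%:R); last by rewrite q0E; apply: le_trans h1 _; rewrite lerDr.
rewrite ler_nat; apply: subset_leq_card.
apply/fintype.subsetP => s; rewrite !inE /last_ok.
by have [-> -> -> ->] := updl s; rewrite hab /= -leNgt hQ.
Qed.

Lemma bad_count :
  #|T|%:R * #|[set tau | ~~ good_tuple tau]%SET|%:R <=
  (#|J|%:R ^+ 2 + 1) * q0 * #|T|%:R ^+ #|J|.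
Proof.
have cov : #|[set tau | ~~ good_tuple tau]%SET|%:R <=
    \sum_i \sum_j #|[set tau | bad_pair i j tau]%SET|%:R + #|[set tau | ~~ last_ok tau]%SET|%:R :> R.
  rewrite !(card_natr R).
  have -> : \sum_(i : J) \sum_(j : J) #|[set tau | bad_pair i j tau]%SET|%:R =
     \sum_tau \sum_i \sum_j (bad_pair i j tau)%:R :> R.
    rewrite [RHS]exchange_big; apply: eq_bigr => i _; rewrite [RHS]exchange_big.
    by apply: eq_bigr => j _; rewrite (card_natr R).
  rewrite -big_split /=; apply: ler_sum => tau _.
  have s0 : 0 <= \sum_i \sum_j (bad_pair i j tau)%:R :> R by apply: sumr_ge0 => i _; apply: sumr_ge0.
  rewrite /good_tuple negb_and; case: (boolP (last_ok tau)) => _; last first.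
    by rewrite orbT lerDr.
  rewrite orbF addr0; case: (boolP (tame _ _ _ _ _)) => //.
  rewrite /tame negb_forall => /existsP[i]; rewrite negb_forall => /existsP[j].
  rewrite negb_imply => /andP[ij hij].
  rewrite (bigD1 i) //= (bigD1 j) //= /bad_pair ij !ltNge -negb_and hij -addrA lerDl.
  by apply: addr_ge0; apply: sumr_ge0 => // k _; apply: sumr_ge0.
have T0 : 0 <= #|T|%:R :> R by [].
apply: le_trans (ler_wpM2l T0 cov) _.
rewrite mulrDr mulr_sumr !mulrDl mul1r; apply: lerD; last exact: bad_last_count.
apply: (@le_trans _ _ (\sum_(i : J) \sum_(j : J) q0 * #|T|%:R ^+ #|J|)).
  by apply: ler_sum => i _; rewrite mulr_sumr; apply: ler_sum => j _; apply: bad_pair_count.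
by rewrite !sumr_const -[leLHS]mulr_natl -[X in _ * X <= _]mulr_natl expr2 !mulrA.
Qed.

End core.

(** [selection] provides a good tuple whose sets meet in mass at least [b / 4] and which has at most
    [nf] far quadruples; [tuple_bound] is applied to [nu] normalised on this intersection. *)
Lemma core_ineq (R : realType) (Bp : 'M[{poly R}]_(4, 2)) (n : nat) (CB : R)
    (T : finType) (tt : T -> R) (N : R) (c0 th la c1 mu K : R) (M mc mm CL : nat)
    (W : finType) (nu : W -> R) (pt : W -> 'rV[R]_4) (E : T -> {set W}) (ka : R)
    (lab : T -> W -> nat) (q : nat) (d S h g V F1 F2 nf : R) :
  let Nn := (4 * n).+1 in
  let m := (3 + Nn)%N in
  let la2 := 1 / 2 * (th / 3) ^+ (4 * n) in
  let b := (ka / 2) ^+ m.+1 / 2 in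
  let c := 2 * h + ln (((2 * M + 3) ^ 4)%N%:R * F1 / (b / 4)) in
  let c' := (Nn.-1)%:R * (9 * c + V) in
  let P := (2 * c + c' + V) / g in
  let Qc := mm.+1%:R ^+ 2 *
    (2 * (16 * K ^+ 3 * (4 * M + 3)%:R / (mc%:R * mu)) * N + 2) ^+ 2 in
  (0 < n)%N -> 1 <= CB -> (forall i j, pb n CB (Bp i j)) ->
  (forall j, 0 <= tt j <= 1) ->
  (forall c L, 0 <= L -> #|[set j | `|tt j - c| <= L]%SET|%:R <= 2 * L * N + 2) ->
  0 <= N -> 0 < c0 -> 0 < th -> th <= 1 -> 0 < la -> la <= 1 ->
  la <= c0 / 2 * (th / 3) ^+ (4 * n) ->
  (forall b, 0 <= b <= 1 -> exists2 t, 0 <= t <= 1 & c0 <= `|\det (frame Bp t b)|) ->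
  0 < c1 ->
  (forall a b (e v : 'rV[R]_2), 0 <= a <= 1 -> 0 <= b <= 1 ->
    \det (frame Bp a b) != 0 -> `|e| = 1 -> `|v| = 1 ->
    exists2 t, 0 <= t <= 1 & c1 <= `|(wedge (map_mx polyC e) (rp Bp a b v)).[t]|) ->
  1 <= K ->
  (forall a b, 0 <= a <= 1 -> 0 <= b <= 1 -> la <= `|\det (frame Bp a b)| ->
    [/\ [/\ forall t, 0 <= t <= 1 -> `|(Dp Bp a b).[t]| <= K,
         forall (v : 'rV[R]_2) t, `|v| <= 1 -> 0 <= t <= 1 -> `|ev t (rp Bp a b v)| <= K &
         forall (v : 'rV[R]_2) s s', `|v| <= 1 -> 0 <= s <= 1 -> 0 <= s' <= 1 ->
           `|(Dp Bp a b).[s'] *: ev s (ap Bp a b v) -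
             (Dp Bp a b).[s] *: ev s' (ap Bp a b v) -
             (s - s') *: ev s' (rp Bp a b v)| <= K * (s - s') ^+ 2],
        forall t, 0 <= t <= 1 -> la <= `|\det (frame Bp t b)| ->
          [/\ det2 (Ft Bp a b t) != 0, `|phi Bp a b t| <= K &
              `|(det2 (Ft Bp a b t))^-1 *: adj2 (Ft Bp a b t)| <= K],
        forall t, 0 <= t <= 1 -> la <= `|\det (frame Bp a t)| ->
          det2 (Gt Bp a b t) != 0 /\ `|phi' Bp a b t| <= K &
        forall x : 'rV[R]_4, `|x| <= K * (`|x *m ev a Bp| + `|x *m ev b Bp|)]) ->
  mu = (c1 / 2 * (th / 3) ^+ Nn) ^+ 2 / 2 -> 8 * K ^+ 2 <= mu * mm%:R ->
  6 * K <= M%:R -> Nn%:R * K <= M%:R -> Nn%:R * K ^+ 2 / la2 <= M%:R ->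
  (0 < mm)%N -> (0 < mc)%N -> 0 < d ->
  (forall w, 0 <= nu w) -> \sum_w nu w = 1 ->
  0 < F1 -> 0 < F2 ->
  (forall z, \sum_(w | disc d (pt w) == z) nu w <= F1) ->
  (forall z, \sum_(w | disc (mc%:R * d) (pt w) == z) nu w <= F2) ->
  0 < ka -> (forall t, ka <= \sum_(w in E t) nu w) ->
  (forall t w, w \in E t -> (lab t w < q)%N) ->
  (forall t w w', w \in E t -> w' \in E t -> lab t w = lab t w' ->
     `|pt w *m ev (tt t) Bp - pt w' *m ev (tt t) Bp| <= CL%:R * d) ->
  (q * (2 * CL + 3) ^ 2)%N%:R <= S -> 0 < S ->
  (0 < #|T|)%N ->
  (m%:R ^+ 2 + 1) * ((1 + 4 * n%:R) * (2 * th * N + 2)) <= b * #|T|%:R ->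
  ln S + 2 * ln (2 * M + 3)%:R <= h ->
  26 * ln (2 * (8 * M + 4) + 3)%:R + ln 2 +
    2 * ln ((2 * ((4 * M + 3) * (2 * M)) + 3) ^ 2)%N%:R +
    ln ((2 * (6 * M + 3) + 3) ^ 2)%N%:R <= V ->
  0 <= c -> 0 < g ->
  2 * (Nn%:R ^+ 2 * (S ^+ 4 * Qc) / #|T|%:R ^+ 2) / b <= nf -> 1 <= nf ->
  ln nf <= 3 * h - g ->
  - ln (((2 * M + 3) ^ 4)%N%:R * F2 / (b / 4)) <= 2 * (c + c' + V + P * h).
Proof.
move=> Nn m la2 b c c' P Qc n0 CB1 pbB tt01 spacing N0 c00 th0 th1 la0 la1 hla frl
  c10 rpl K1 HK hmu hmm KM NnKM hpsi mm0 mc0 d0 nu0 nu1 F10 F20 hF1 hF2 ka0 hE hq hl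
  hS S0 T0 big hh HV cc0 g0 hnf nf1 lnf.
pose J : finType := ('I_3 + 'I_Nn)%type.
have cJ : #|J| = m by rewrite card_sum !card_ord.
have K0 : 0 < K by apply: lt_le_trans K1.
have Tr0 : 0 < #|T|%:R :> R by rewrite ltr0n.
have la20 : 0 < la2 by rewrite mulr_gt0 // exprn_gt0 // divr_gt0.
have mu0 : 0 < mu.
  by rewrite hmu divr_gt0 // exprn_gt0 // mulr_gt0 ?divr_gt0 // exprn_gt0 // divr_gt0.
have b0 : 0 < b by rewrite divr_gt0 // exprn_gt0 // divr_gt0.
have /choice[A HA] : forall t, exists At : seq 'rV[int]_2,
    (size At <= q * (2 * CL + 3) ^ 2)%N /\
    forall w, w \in E t -> disc d (pt w *m ev (tt t) Bp) \in At.
  move=> t; have [At h1 h2] := disc_values_size d0 (hq t) (hl t).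
  by exists At.
have AS t : (size (A t))%:R <= S.
  by apply: le_trans hS; rewrite ler_nat; have [] := HA t.
have dab0 x y : la <= `|\det (frame Bp x y)| -> \det (frame Bp x y) != 0.
  by move=> hxy; rewrite -normr_gt0; apply: lt_le_trans hxy.
have szrp a b' (v : 'rV[R]_2) j : 0 <= a <= 1 -> 0 <= b' <= 1 ->
    la <= `|\det (frame Bp a b')| -> `|v| <= 1 -> (size (rp Bp a b' v 0 j)%R <= 4 * n)%N.
  by move=> a01 b01 hab v1; have [] := rp_pb n0 CB1 pbB a01 b01 la0 la1 hab j v1.
have HK1 a b' : 0 <= a <= 1 -> 0 <= b' <= 1 -> la <= `|\det (frame Bp a b')| ->
    [/\ forall t, 0 <= t <= 1 -> `|(Dp Bp a b').[t]| <= K,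
      forall (v : 'rV[R]_2) t, `|v| <= 1 -> 0 <= t <= 1 -> `|ev t (rp Bp a b' v)| <= K &
      forall (v : 'rV[R]_2) s s', `|v| <= 1 -> 0 <= s <= 1 -> 0 <= s' <= 1 ->
        `|(Dp Bp a b').[s'] *: ev s (ap Bp a b' v) -
          (Dp Bp a b').[s] *: ev s' (ap Bp a b' v) -
          (s - s') *: ev s' (rp Bp a b' v)| <= K * (s - s') ^+ 2].
  by move=> a01 b01 hab; have [] := HK a b' a01 b01 hab.
have Dn0 a b' t : 0 <= a <= 1 -> 0 <= b' <= 1 -> 0 <= t <= 1 ->
    la <= `|\det (frame Bp a b')| -> la <= `|\det (frame Bp t b')| -> (Dp Bp a b').[t] != 0.
  move=> a01 b01 t01 hab htb; have [_ h1 _ _] := HK a b' a01 b01 hab.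
  by rewrite Dp_horner; have [] := h1 t t01 htb.
have nNn : (4 * n <= Nn)%N by [].
have fc := far_count tt01 spacing N0 M th0 th1 mu0 K1 mc0 mm0 hmm nNn c10 la0 hmu
  AS rpl szrp HK1 Dn0.
rewrite -/Qc cJ in fc.
have bc := bad_count n0 CB1 pbB tt01 spacing N0 c00 th0 th1 la0 hla frl.
rewrite cJ in bc.
pose Sa := Nn%:R ^+ 2 * (S ^+ 4 * Qc) / #|T|%:R ^+ 2.
have Qc0 : 0 < Qc.
  apply: mulr_gt0; apply: exprn_gt0 => //.
  have : 0 <= 2 * (16 * K ^+ 3 * (4 * M + 3)%:R / (mc%:R * mu)) * N; last by lra.
  apply: mulr_ge0 => //; apply: mulr_ge0 => //; apply: divr_ge0.
    by apply: mulr_ge0 => //; apply: mulr_ge0 => //; apply: exprn_ge0; apply: ltW.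
  by apply: mulr_ge0 => //; apply: ltW.
have Sa0 : 0 < Sa.
  apply: divr_gt0; last exact: exprn_gt0.
  apply: mulr_gt0; first exact: exprn_gt0.
  by apply: mulr_gt0 => //; apply: exprn_gt0.
pose G := good_tuple Bp (n := n) tt th la.
pose gg tau : R := (count (far_pair Bp tt M mc tau) (quads (Nn := Nn) A tau))%:R.
have gg0 tau : 0 <= gg tau by [].
have hbad : #|[set tau | ~~ G tau]%SET|%:R <= b * #|T|%:R ^+ #|J|.
  rewrite -(ler_pM2l Tr0) cJ; apply: le_trans bc _.
  rewrite [leRHS]mulrA [#|T|%:R * b]mulrC; apply: ler_wpM2r; last exact: big.
  exact: exprn_ge0.
have hgood : \sum_(tau | G tau) gg tau <= Sa * #|T|%:R ^+ #|J|.
  apply: (@le_trans _ _ (\sum_(tau : {ffun J -> T} | tame Bp tt th la tau) gg tau)).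
    rewrite big_mkcond [leRHS]big_mkcond; apply: ler_sum => tau _.
    by rewrite /G /good_tuple; case: (tame _ _ _ _ _) => //=; case: ifP.
  rewrite -(ler_pM2l (exprn_gt0 2 Tr0)) cJ; apply: le_trans fc _.
  by rewrite /Sa le_eqVlt; apply/orP; left; apply/eqP; field; rewrite gt_eqF.
have := selection nu0 nu1 ka0 hE T0 Sa0 gg0; rewrite cJ in hbad hgood * => /(_ _ hbad hgood).
rewrite -/b => -[tau /andP[tmt lst] [hNE hgg]].
set NE := \sum_(w in _) _ in hNE.
have NE0 : 0 < NE by apply: lt_le_trans hNE; apply: divr_gt0.
pose p w := if w \in Einter E tau then nu w / NE else 0.
have p0 w : 0 <= p w by rewrite /p; case: ifP => // _; rewrite divr_ge0 // ltW.
have p1 : \sum_w p w = 1.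
  by rewrite /p -big_mkcond /= -mulr_suml mulfV // gt_eqF.
have pE w : p w != 0 -> forall j, w \in E (tau j).
  by rewrite /p; case: ifP => [|_]; rewrite ?eqxx // inE => /forallP.
have b40 : 0 < b / 4 by apply: divr_gt0.
have pnu w : p w <= nu w / (b / 4).
  rewrite /p; case: ifP => _; last by rewrite divr_ge0 // ltW.
  by apply: ler_wpM2l => //; rewrite lef_pV2 // posrE.
set a1 := tt (tau (ja Nn)); set b1 := tt (tau (jb Nn)); set o1 := tt (tau (jo Nn)).
pose tl i := tt (tau (inr i : J)).
have cond (i j : J) : i != j -> th <= `|tt (tau i) - tt (tau j)| /\
    la <= `|\det (frame Bp (tt (tau i)) (tt (tau j)))|.
  by move=> ij; have /forallP/(_ i)/forallP/(_ j) := tmt; rewrite ij => /andP[].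
(* [tuple_bound] indexes the lists of cells by parameters; the coordinates of a tame tuple have
   distinct parameters, so the coordinate can be recovered. *)
pose js (s : R) : J := odflt (ja Nn) [pick j : J | tt (tau j) == s].
have jsE (j : J) : js (tt (tau j)) = j.
  rewrite /js; case: pickP => [i /eqP ij|/(_ j)]; last by rewrite eqxx.
  apply/eqP; apply: contraTT th0 => /cond[+ _]; rewrite /= ij subrr normr0.
  by rewrite -leNgt.
have hab : la <= `|\det (frame Bp a1 b1)| by have [] := cond (ja Nn) (jb Nn) isT.
have [HKa HKb HKc HKd] := HK a1 b1 (tt01 _) (tt01 _) hab.
have Hs s : s = o1 \/ (exists i, s = tl i) -> exists2 j : J, s = tt (tau j) & j != jb Nn.
  by case=> [->|[i ->]]; [exists (jo Nn)|exists (inr i)].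
pose Psi := \sum_(i < Nn) phi Bp a1 b1 (tl i).
pose l : 'I_Nn := ord_max.
have [Dl phil _] : [/\ det2 (Ft Bp a1 b1 (tl l)) != 0, `|phi Bp a1 b1 (tl l)| <= K &
              `|(det2 (Ft Bp a1 b1 (tl l)))^-1 *: adj2 (Ft Bp a1 b1 (tl l))| <= K].
  by apply: HKb; [apply: tt01|have [] := cond (inr l) (jb Nn) isT].
have PsiF : Psi *m Ft Bp a1 b1 (tl l) =
    Psi_init Bp tt tau *m Ft Bp a1 b1 (tl l) + Gt Bp a1 b1 (tl l).
  rewrite /Psi (bigD1 l) //= mulmxDl addrC; congr (_ + _).
  by rewrite /phi -scalemxAl -mulmxA adj2_mul mul_mx_scalar scalerA mulVf // scale1r.
have lst' : la2 < `|det2 Psi * det2 (Ft Bp a1 b1 (tl l))|.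
  by rewrite -det2M PsiF; move: lst; rewrite /last_ok hab.
have DK : `|det2 (Ft Bp a1 b1 (tl l))| <= K.
  by rewrite -Dp_horner; have [h1 _ _] := HKa; apply: h1; apply: tt01.
have dPsi : la2 / K <= `|det2 Psi|.
  rewrite ler_pdivrMr //; apply: le_trans (ltW lst') _; rewrite normrM.
  exact: ler_wpM2l.
have dPsi0 : 0 < `|det2 Psi| by apply: lt_le_trans dPsi; apply: divr_gt0.
have allphi i : `|phi Bp a1 b1 (tl i)| <= K.
  have [] // := HKb (tl i) (tt01 _) _.
  by have [] := cond (inr i) (jb Nn) isT.
have PsiK : `|Psi| <= Nn%:R * K.
  apply: le_trans (ler_norm_sum _ _ _) _.
  apply: (@le_trans _ _ (\sum_(i < Nn) K)); first exact: ler_sum.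
  by rewrite sumr_const card_ord -[leLHS]mulr_natl.
pose psi' := (det2 Psi)^-1 *: adj2 Psi.
have psi'K : `|psi'| <= M%:R.
  apply: le_trans hpsi; rewrite /psi' normrZ normfV.
  have -> : Nn%:R * K ^+ 2 / la2 = (la2 / K)^-1 * (Nn%:R * K).
    by field; rewrite !gt_eqF.
  apply: ler_pM => //; last exact: le_trans (adj2_norm _) PsiK.
  by rewrite lef_pV2 // posrE divr_gt0.
have PsiI : Psi *m psi' = 1%:M.
  by rewrite /psi' -scalemxAr mul_adj2 scale_scalar_mx mulVf // -normr_gt0.
pose lf := [seq x <- quads A tau | far_pair Bp tt M mc tau x].
(* The maximum with 1 covers the case of no far quadruple, where the count must still be
   positive. *)
have nf_ge : (maxn (size lf) 1)%:R <= nf.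
  rewrite natr_max ge_max nf1 andbT size_filter; exact: le_trans hgg hnf.
have lnf' : ln (maxn (size lf) 1)%:R <= 3 * h - g.
  by apply: le_trans lnf; rewrite ler_ln ?posrE ?ltr0n ?leq_max ?orbT // (lt_le_trans _ nf1).
have := @tuple_bound R Bp Nn a1 b1 o1 tl K M mc psi' W p nu pt d S h g V F1 F2 (b / 4)
  (fun s => A (tau (js s))) (maxn (size lf) 1) lf.
rewrite -/Psi -/c -/c' -/P; apply => //.
- exact: dab0.
- move=> s /Hs[j -> jb']; apply: HKb; first exact: tt01.
  by have [] := cond j (jb Nn) jb'.
- by have [] := HKc o1 (tt01 _) (cond (ja Nn) (jo Nn) isT).2.
- by have [] := HKc o1 (tt01 _) (cond (ja Nn) (jo Nn) isT).2.
- by rewrite -(ltr0n R); apply: lt_le_trans KM; rewrite mulr_gt0.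
- exact: ltW.
- move=> s hs; have [j ->] : exists j : J, s = tt (tau j).
    by case: hs => [->|->|->|[i ->]]; [exists (ja Nn)|exists (jb Nn)|exists (jo Nn)|exists (inr i)].
  rewrite jsE; split => // w /pE/(_ j) wE; have [_] := HA (tau j); exact.
- by rewrite leq_max leqnn orbT.
- by rewrite leq_max leqnn.
rewrite !jsE => x1 x2 y1 y2 hx1 hx2 hy1 hy2 f1 f2.
rewrite mem_filter; apply/andP; split; first exact/andP.
apply/allpairsP; exists ((x1, y1), (x2, y2)); split => //=.
  by apply/allpairsP; exists (x1, y1).
by apply/allpairsP; exists (x2, y2).
Qed.

(** * The finite projection theorem *)

Section growth.
Variable R : realType.
Implicit Types f g : R -> R.

(** Polynomial growth, stable under the operations that build the parameters; it makes their
    logarithms linear in [ln x] without tracking exponents. *)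
Definition pgrow f := exists (C : R) (p : nat), forall x, 1 <= x -> 0 <= f x <= C * x ^+ p.

Lemma pgrow_const c : 0 <= c -> pgrow (fun=> c).
Proof. by move=> c0; exists c, 0%N => x _; rewrite expr0 mulr1 c0 lexx. Qed.

Lemma pgrow_id : pgrow id.
Proof. by exists 1, 1%N => x x1; rewrite expr1 mul1r lexx (le_trans _ x1). Qed.

Lemma pgrow_mul f g : pgrow f -> pgrow g -> pgrow (fun x => f x * g x).
Proof.
move=> [C [p hf]] [D [r hg]]; exists (C * D), (p + r)%N => x x1.
have /andP[f0 fC] := hf x x1; have /andP[g0 gC] := hg x x1.
rewrite mulr_ge0 //=; apply: le_trans (ler_pM f0 g0 fC gC) _.
by rewrite exprD mulrACA.
Qed.

Lemma pgrow_add f g : pgrow f -> pgrow g -> pgrow (fun x => f x + g x).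
Proof.
move=> [C [p hf]] [D [r hg]]; exists (C + D), (p + r)%N => x x1.
have /andP[f0 fC] := hf x x1; have /andP[g0 gC] := hg x x1.
have [/andP[f1 f2] /andP[g1 g2]] := (hf 1 (lexx _), hg 1 (lexx _)).
rewrite expr1n mulr1 in f2; rewrite expr1n mulr1 in g2; have C0 := le_trans f1 f2; have D0 := le_trans g1 g2.
rewrite addr_ge0 //= mulrDl; apply: lerD.
  apply: le_trans fC _; apply: ler_wpM2l; first exact: C0.
  by apply: ler_weXn2l => //; apply: leq_addr.
apply: le_trans gC _; apply: ler_wpM2l; first exact: D0.
by apply: ler_weXn2l => //; apply: leq_addl.
Qed.

Lemma pgrow_exp f p : pgrow f -> pgrow (fun x => f x ^+ p).
Proof.
move=> hf; elim: p => [|p IH]; first exact: pgrow_const.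
have [C [r H]] := pgrow_mul hf IH; exists C, r => x /H; by rewrite exprS.
Qed.

Lemma pgrow_truncn f : pgrow f -> pgrow (fun x => (Num.truncn (f x)).+1%:R).
Proof.
move=> hf; have [C [p H]] := pgrow_add hf (pgrow_const ler01); exists C, p => x x1.
have /andP[h1 h2] := H x x1; rewrite ler0n /=; apply: le_trans h2.
rewrite -natr1 lerD2r truncn_le; have [D [r hf']] := hf.
by have /andP[] := hf' x x1.
Qed.

Lemma pgrow_ln f : pgrow f -> exists2 C : R * R, 0 <= C.1 /\ 0 <= C.2 &
  forall x, 1 <= x -> ln (f x) <= C.1 + C.2 * ln x.
Proof.
move=> [C [p H]]; have /andP[a1 a2] := H 1 (lexx _); rewrite expr1n mulr1 in a2.
have C0 : 0 <= C := le_trans a1 a2.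
exists (ln (1 + C), p%:R) => /= [|x x1].
  by rewrite ler0n ln_ge0 // lerDl.
have x0 : 0 < x by apply: lt_le_trans x1.
have /andP[h1 h2] := H x x1.
have lx : 0 <= ln x by apply: ln_ge0.
have lC : 0 <= ln (1 + C) by rewrite ln_ge0 // lerDl.
have [f0|] := ltP 0 (f x); last first.
  by move=> f0; rewrite ln0 // addr_ge0 // mulr_ge0.
have -> : ln (1 + C) + p%:R * ln x = ln ((1 + C) * x ^+ p).
  by rewrite lnM ?posrE ?exprn_gt0 ?ltr_wpDr // lnXn // mulr_natl.
have xp : 0 < x ^+ p by apply: exprn_gt0.
rewrite ler_ln ?posrE // ?mulr_gt0 ?ltr_wpDr //; apply: le_trans h2 _.
by apply: ler_wpM2r; [exact: ltW|rewrite lerDr].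
Qed.
End growth.

(** [Lam] stands for [k * ln 2] and [D] for [e * Lam]. Since [h] is at most [2 * Lam] and [g] at
    least [Lam / 4], the quotient [h / g] is at most 8, and every error stays a multiple of [D]:
    [q1] for [c], [q2] for the loss of the sum, [q3] for the numerator over [g], [q4] for the
    total. *)
Lemma bootstrap_numerics (R : realFieldType) (Lam D Q nn h c g V : R) :
  let q1 := 8 + 3 * Q in let q2 := nn * (9 * q1 + Q) in
  let q3 := 2 * q1 + q2 + Q in let q4 := 2 * (q1 + q2 + Q + 8 * q3) in
  0 <= Q -> 0 <= nn -> 0 <= D -> 0 < Lam ->
  0 <= h -> h <= Lam + (3 + Q) * D -> 0 <= c -> c <= q1 * D -> 0 <= V -> V <= Q * D ->
  Lam / 2 - (3 + 2 * Q) * D <= g -> (q4 + 1 + Q) * D <= Lam / 8 ->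
  2 * (c + nn * (9 * c + V) + V + (2 * c + nn * (9 * c + V) + V) / g * h) <= q4 * D.
Proof.
move=> q1 q2 q3 q4 Q0 nn0 D0 L0 h0 hh c0 hc V0 hV hg small.
have QD := mulr_ge0 Q0 D0; have nQ := mulr_ge0 nn0 Q0.
have nQD := mulr_ge0 nQ D0; have nD := mulr_ge0 nn0 D0.
have g4 : Lam / 4 <= g by rewrite /q4 /q3 /q2 /q1 in small; lra.
have g0 : 0 < g by apply: lt_le_trans g4; apply: divr_gt0.
have h2 : h <= 2 * Lam by rewrite /q4 /q3 /q2 /q1 in small; lra.
have s1 : nn * (9 * c + V) <= q2 * D.
  by rewrite /q2 -mulrA; apply: ler_wpM2l => //; lra.
have s10 : 0 <= nn * (9 * c + V) by apply: mulr_ge0 => //; lra.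
have s2 : 2 * c + nn * (9 * c + V) + V <= q3 * D by rewrite /q3; lra.
have q3D : 0 <= q3 * D by apply: le_trans s2; lra.
have s3 : (2 * c + nn * (9 * c + V) + V) / g * h <= 8 * (q3 * D).
  rewrite mulrAC ler_pdivrMr //.
  have a1 : (2 * c + nn * (9 * c + V) + V) * h <= q3 * D * (2 * Lam).
    by apply: ler_pM => //; lra.
  by apply: le_trans a1 _; have := ler_wpM2l q3D g4; lra.
by rewrite /q4; lra.
Qed.

(** * The parameters as functions of the inverse mass *)

Section parameters.
Variables (R : realType) (n : nat) (c0 c1 C : R).
Hypotheses (c00 : 0 < c0) (c0le1 : c0 <= 1) (c10 : 0 < c1) (C1 : 1 <= C).

Let Nn := (4 * n).+1.
Let m := (3 + Nn)%N.

(* Every parameter of [core_ineq] is, up to rounding, a polynomial in the inverse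
   [x] of the mass of the sets [E t]. *)
Definition par_b (x : R) := 2 * (2 * x) ^+ m.+1.
Definition par_c : R := 4 * ((m%:R ^+ 2 + 1) * (1 + 4 * n%:R)).
Definition par_th x := par_c * (par_b x * x).
Definition par_la x := 2 / c0 * (3 * par_th x) ^+ (4 * n).
Definition par_l2 x := 2 * (3 * par_th x) ^+ (4 * n).
Definition par_K x := C * par_la x ^+ 4.
Definition par_mu x := 2 * (2 / c1 * (3 * par_th x) ^+ Nn) ^+ 2.
Definition par_mm x := (Num.truncn (8 * par_K x ^+ 2 * par_mu x)).+1.
Definition par_M x :=
  (Num.truncn (6 * par_K x + Nn%:R * par_K x + Nn%:R * par_K x ^+ 2 * par_l2 x)).+1.
Definition par_Y x := 32 * par_K x ^+ 3 * (4 * (par_M x)%:R + 3) * par_mu x.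
Definition par_U x := 1 + 2 * (Nn%:R ^+ 2 * ((par_mm x).+1%:R ^+ 2 * (par_Y x + 2) ^+ 2)) *
  par_b x * x ^+ 2.
Definition par_V x : R := 26 * ln (2 * (8 * par_M x + 4) + 3)%:R + ln 2 +
    2 * ln ((2 * ((4 * par_M x + 3) * (2 * par_M x)) + 3) ^ 2)%N%:R +
    ln ((2 * (6 * par_M x + 3) + 3) ^ 2)%N%:R.
Definition par_B x : R := 4 * (2 * (par_M x)%:R + 3) ^+ 4 * par_b x.

Lemma par_c_ge4 : 4 <= par_c.
Proof.
have m1 : 1 <= m%:R ^+ 2 + 1 :> R by rewrite lerDr sqr_ge0.
have m2 : 1 <= 1 + 4 * n%:R :> R by rewrite lerDl mulr_ge0.
have := mulr_ege1 m1 m2; rewrite /par_c; move: (_ * _) => y; lra.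
Qed.

Lemma par_growth : exists2 Q : R, 0 <= Q & exists2 D0 : R, 0 <= D0 &
  forall x, 1 <= x -> D0 <= ln x ->
    [/\ ln (par_th x) <= Q * ln x, 2 * ln (2 * par_M x + 3)%:R <= Q * ln x,
        ln (par_B x) <= Q * ln x, ln (par_U x) <= Q * ln x & par_V x <= Q * ln x].
Proof.
have Cc c : 0 <= c -> pgrow (fun=> c : R) := @pgrow_const R c.
have C20 := par_c_ge4.
have gid := @pgrow_id R.
have gbi : pgrow par_b by apply: pgrow_mul; [apply: Cc|apply: pgrow_exp; apply: pgrow_mul; [apply: Cc|]].
have gthi : pgrow par_th by apply: pgrow_mul; [apply: Cc; apply: le_trans C20|apply: pgrow_mul].
have g3 p : pgrow (fun x => (3 * par_th x) ^+ p) by apply: pgrow_exp; apply: pgrow_mul => //; apply: Cc.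
have glai : pgrow par_la by apply: pgrow_mul => //; apply: Cc; rewrite divr_ge0 // ltW.
have gl2i : pgrow par_l2 by apply: pgrow_mul => //; apply: Cc.
have gK : pgrow par_K by apply: pgrow_mul; [apply: Cc; apply: le_trans C1|apply: pgrow_exp].
have gmui : pgrow par_mu.
  apply: pgrow_mul; [exact: Cc|apply: pgrow_exp; apply: pgrow_mul => //].
  by apply: Cc; rewrite divr_ge0 // ltW.
have gmm : pgrow (fun x => (par_mm x)%:R).
  by apply: pgrow_truncn; apply: pgrow_mul => //; apply: pgrow_mul; [apply: Cc|apply: pgrow_exp].
have gM : pgrow (fun x => (par_M x)%:R).
  apply: pgrow_truncn; apply: pgrow_add; first by apply: pgrow_add; apply: pgrow_mul => //; apply: Cc.
  by apply: pgrow_mul => //; apply: pgrow_mul; [apply: Cc|apply: pgrow_exp].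
have gMl (a b : R) : 0 <= a -> 0 <= b -> pgrow (fun x => a * (par_M x)%:R + b).
  by move=> a0 b0; apply: pgrow_add; [apply: pgrow_mul => //; apply: Cc|apply: Cc].
have gY : pgrow par_Y.
  apply: pgrow_mul => //; apply: pgrow_mul; last exact: gMl.
  by apply: pgrow_mul; [apply: Cc|apply: pgrow_exp].
have gU : pgrow par_U.
  apply: pgrow_add; first exact: Cc.
  apply: pgrow_mul; last exact: pgrow_exp.
  apply: pgrow_mul => //; apply: pgrow_mul; first exact: Cc.
  apply: pgrow_mul; first by apply: Cc; apply: sqr_ge0.
  apply: pgrow_mul; apply: pgrow_exp.
    have [D [p H]] := pgrow_add gmm (Cc 1 ler01).
    by exists D, p => x /H; rewrite natr1.
  by apply: pgrow_add => //; exact: Cc.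
have [A1 [A10 A11] H1] := pgrow_ln gthi.
have gM1 : pgrow (fun x => (2 * par_M x + 3)%:R).
  have [D [p H]] := gMl 2 3 (ler0n _ 2) (ler0n _ 3); exists D, p => x /H.
  by rewrite natrD natrM.
have [A2 [A20 A21] H2] := pgrow_ln gM1.
have g5 : pgrow par_B.
  apply: pgrow_mul => //; apply: pgrow_mul; first exact: Cc.
  by apply: pgrow_exp; apply: gMl.
have [A3 [A30 A31] H3] := pgrow_ln g5.
have [A4 [A40 A41] H4] := pgrow_ln gU.
have g6 : pgrow (fun x => (2 * (8 * par_M x + 4) + 3)%:R).
  have [D [p H]] := gMl 16 11 (ler0n _ 16) (ler0n _ 11); exists D, p => x /H.
  have -> : (2 * (8 * par_M x + 4) + 3)%:R = 16 * (par_M x)%:R + 11 :> R; last by [].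
  by rewrite !(natrD, natrM); ring.
have [A5 [A50 A51] H5] := pgrow_ln g6.
have g7 : pgrow (fun x => ((2 * ((4 * par_M x + 3) * (2 * par_M x)) + 3) ^ 2)%N%:R).
  have g70 : pgrow (fun x => (2 * ((4 * (par_M x)%:R + 3) * (2 * (par_M x)%:R)) + 3) ^+ 2).
    apply: pgrow_exp; apply: pgrow_add; last exact: Cc.
    apply: pgrow_mul; first exact: Cc.
    by apply: pgrow_mul; [apply: gMl|apply: pgrow_mul => //; apply: Cc].
  have [D [p H]] := g70; exists D, p => x /H.
  by rewrite !(natrX, natrD, natrM).
have [A6 [A60 A61] H6] := pgrow_ln g7.
have g8 : pgrow (fun x => ((2 * (6 * par_M x + 3) + 3) ^ 2)%N%:R).
  have g80 : pgrow (fun x => (12 * (par_M x)%:R + 9) ^+ 2) by apply: pgrow_exp; apply: gMl.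
  have [D [p H]] := g80; exists D, p => x /H.
  have -> : ((2 * (6 * par_M x + 3) + 3) ^ 2)%:R = (12 * (par_M x)%:R + 9) ^+ 2 :> R; last by [].
  by rewrite natrX; congr (_ ^+ 2); rewrite !(natrD, natrM); ring.
have [A7 [A70 A71] H7] := pgrow_ln g8.
have l2 : 0 <= ln 2 :> R by rewrite ln_ge0 // ler1n.
move: A1 A2 A3 A4 A5 A6 A7 A10 A11 A20 A21 A30 A31 A40 A41 A50 A51 A60 A61 A70 A71
  H1 H2 H3 H4 H5 H6 H7 => [a1 b1] [a2 b2] [a3 b3] [a4 b4] [a5 b5] [a6 b6] [a7 b7] /=.
move=> A10 A11 A20 A21 A30 A31 A40 A41 A50 A51 A60 A61 A70 A71 H1 H2 H3 H4 H5 H6 H7.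
pose Q1 := a1 + 2 * a2 + a3 + a4 + 26 * a5 + ln 2 + 2 * a6 + a7.
pose Q2 := b1 + 2 * b2 + b3 + b4 + 26 * b5 + 2 * b6 + b7.
exists (1 + Q2); first by rewrite /Q2; clear -A11 A21 A31 A41 A51 A61 A71; lra.
exists Q1; first by rewrite /Q1; clear -A10 A20 A30 A40 A50 A60 A70 l2; lra.
move=> x x1 lx1; have lx : 0 <= ln x by apply: ln_ge0.
have {}H1 := H1 x x1; have {}H2 := H2 x x1; have {}H3 := H3 x x1; have {}H4 := H4 x x1.
have {}H5 := H5 x x1; have {}H6 := H6 x x1; have {}H7 := H7 x x1.
have m1 := mulr_ge0 A11 lx; have m2 := mulr_ge0 A21 lx; have m3 := mulr_ge0 A31 lx.
have m4 := mulr_ge0 A41 lx; have m5 := mulr_ge0 A51 lx; have m6 := mulr_ge0 A61 lx.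
have m7 := mulr_ge0 A71 lx.
rewrite /Q1 in lx1; rewrite /par_V /Q2; split.
- clear -lx1 H1 m1 m2 m3 m4 m5 m6 m7 A10 A20 A30 A40 A50 A60 A70 l2; lra.
- clear -lx1 H2 m1 m2 m3 m4 m5 m6 m7 A10 A20 A30 A40 A50 A60 A70 l2; lra.
- clear -lx1 H3 m1 m2 m3 m4 m5 m6 m7 A10 A20 A30 A40 A50 A60 A70 l2; lra.
- clear -lx1 H4 m1 m2 m3 m4 m5 m6 m7 A10 A20 A30 A40 A50 A60 A70 l2; lra.
- clear -lx1 H5 H6 H7 m1 m2 m3 m4 m5 m6 m7 A10 A20 A30 A40 A50 A60 A70 l2; lra.
Qed.

Section at_x.
Variable x : R.
Hypothesis x1 : 1 <= x.

Let x0 : 0 < x. Proof. exact: lt_le_trans x1. Qed.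

Lemma par_b_ge1 : 1 <= par_b x.
Proof.
have x2 : 1 <= 2 * x by have t := x1; lra.
by rewrite /par_b mulr_ege1 ?ler1n // exprn_ege1.
Qed.

Lemma par_th_ge1 : 1 <= par_th x.
Proof.
have h := par_b_ge1; have c4 := par_c_ge4.
apply: mulr_ege1; first by apply: le_trans c4; rewrite ler1n.
exact: mulr_ege1.
Qed.

Lemma par_th3_ge1 p : 1 <= (3 * par_th x) ^+ p.
Proof. by apply: exprn_ege1; have h := par_th_ge1; apply: mulr_ege1 => //; rewrite ler1n. Qed.

Let t30 p : 0 < (3 * par_th x) ^+ p.
Proof. by apply: lt_le_trans (par_th3_ge1 p). Qed.

Lemma par_la_ge1 : 1 <= par_la x.
Proof.
apply: mulr_ege1 (par_th3_ge1 _); rewrite ler_pdivlMr // mul1r.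
by apply: le_trans c0le1 _; rewrite ler1n.
Qed.

Lemma par_K_ge1 : 1 <= par_K x.
Proof. by apply: mulr_ege1 => //; apply: exprn_ege1; exact: par_la_ge1. Qed.

Let K0 : 0 < par_K x. Proof. by apply: lt_le_trans par_K_ge1. Qed.

Lemma par_l2_gt0 : 0 < par_l2 x. Proof. by apply: mulr_gt0. Qed.

Lemma par_mu_gt0 : 0 < par_mu x.
Proof. by apply: mulr_gt0 => //; apply: exprn_gt0; apply: mulr_gt0 => //; apply: divr_gt0. Qed.

Let tr (y : R) : 0 <= y -> y <= (Num.truncn y).+1%:R.
Proof. by move=> y0; apply: ltW; have /andP[] := truncn_itv y0. Qed.

Lemma par_mm_ge : 8 * par_K x ^+ 2 <= (par_mu x)^-1 * (par_mm x)%:R.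
Proof.
rewrite [leRHS]mulrC ler_pdivlMr ?par_mu_gt0 //; apply: tr.
by apply: mulr_ge0; [apply: mulr_ge0 => //; apply: sqr_ge0|apply: ltW; exact: par_mu_gt0].
Qed.

Lemma par_M_ge : [/\ 6 * par_K x <= (par_M x)%:R, Nn%:R * par_K x <= (par_M x)%:R &
  Nn%:R * par_K x ^+ 2 * par_l2 x <= (par_M x)%:R].
Proof.
have h1 : 0 <= 6 * par_K x by rewrite mulr_ge0 // ltW.
have h2 : 0 <= Nn%:R * par_K x by rewrite mulr_ge0 // ltW.
have h3 : 0 <= Nn%:R * par_K x ^+ 2 * par_l2 x.
  apply: mulr_ge0; last by apply: ltW; exact: par_l2_gt0.
  by apply: mulr_ge0 => //; apply: sqr_ge0.
have := tr (addr_ge0 (addr_ge0 h1 h2) h3); rewrite -/(par_M x).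
have aux (a b c M : R) : 0 <= a -> 0 <= b -> 0 <= c -> a + b + c <= M ->
    [/\ a <= M, b <= M & c <= M] by move=> *; split; lra.
exact: aux.
Qed.

Lemma par_Y_ge0 : 0 <= par_Y x.
Proof.
apply: mulr_ge0; last by apply: ltW; exact: par_mu_gt0.
apply: mulr_ge0; last by rewrite addr_ge0 // mulr_ge0.
by apply: mulr_ge0 => //; apply: exprn_ge0; exact: ltW.
Qed.

Lemma par_U_gt1 : 1 < par_U x.
Proof.
rewrite ltrDl; apply: mulr_gt0; last exact: exprn_gt0.
apply: mulr_gt0; last by apply: lt_le_trans par_b_ge1.
apply: mulr_gt0 => //; apply: mulr_gt0; first exact: exprn_gt0.
apply: mulr_gt0; apply: exprn_gt0 => //.
by apply: ltr_wpDl => //; exact: par_Y_ge0.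
Qed.

Lemma par_B_ge1 : 1 <= par_B x.
Proof.
apply: mulr_ege1 par_b_ge1; apply: mulr_ege1; first by rewrite ler1n.
apply: exprn_ege1; rewrite -natrM -natrD ler1n addn_gt0 orbT //.
Qed.

Lemma par_thE p : ((par_th x)^-1 / 3) ^+ p = ((3 * par_th x) ^+ p)^-1.
Proof. by rewrite -exprVn [(3 * _)^-1]invfM mulrC. Qed.

Lemma par_bE : (x^-1 / 2) ^+ m.+1 / 2 = (par_b x)^-1.
Proof.
have -> : x^-1 / 2 = (2 * x)^-1 by rewrite invfM mulrC.
by rewrite exprVn /par_b [RHS]invfM mulrC.
Qed.

Lemma par_laE : (par_la x)^-1 = c0 / 2 * ((par_th x)^-1 / 3) ^+ (4 * n).
Proof. by rewrite par_thE /par_la invfM invf_div. Qed.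

Lemma par_muE : (par_mu x)^-1 = (c1 / 2 * ((par_th x)^-1 / 3) ^+ Nn) ^+ 2 / 2.
Proof.
rewrite par_thE; set y := _ ^+ Nn.
have -> : c1 / 2 / y = (2 / c1 * y)^-1 by rewrite invfM invf_div.
by rewrite exprVn /par_mu -/y [LHS]invfM mulrC.
Qed.

Lemma par_l2E : 1 / 2 * ((par_th x)^-1 / 3) ^+ (4 * n) = (par_l2 x)^-1.
Proof. by rewrite par_thE /par_l2 invfM mul1r. Qed.

(** The origin of [par_th]: the bad values of a coordinate, of order [N / par_th x], must be at most
    a fraction [1 / par_b x] of the [N / x] available directions, with room for the number of
    conditions. *)
Lemma par_sep (N t : R) : par_th x <= N -> N / x <= t ->
  (m%:R ^+ 2 + 1) * ((1 + 4 * n%:R) * (2 * (par_th x)^-1 * N + 2)) <= (par_b x)^-1 * t.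
Proof.
move=> hN ht; have b0 : 0 < par_b x by apply: lt_le_trans par_b_ge1.
have th0 : 0 < par_th x by apply: lt_le_trans par_th_ge1.
apply: (@le_trans _ _ ((par_b x)^-1 * (N / x))); last first.
  by apply: ler_wpM2l => //; rewrite invr_ge0 ltW.
have -> : (m%:R ^+ 2 + 1) * ((1 + 4 * n%:R) * (2 * (par_th x)^-1 * N + 2)) =
  (2 * (N / par_th x) + 2) * (par_c / 4) by rewrite /par_c; field; rewrite gt_eqF.
have -> : (par_b x)^-1 * (N / x) = par_c * (N / par_th x).
  by rewrite /par_th; field; rewrite !gt_eqF //; apply: lt_le_trans par_c_ge4.
have h : 1 <= N / par_th x by rewrite ler_pdivlMr // mul1r.
have c4 := par_c_ge4; have := ler_wpM2l (le_trans (ler0n _ 4) c4) h; lra.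
Qed.
End at_x.
End parameters.

(** The order of the quantifiers matters: [e] depends on the family and serves all sets, whereas
    [CF] will depend on the set and is absorbed by [k0], as [ln CF] is below [e * (k%:R * ln 2)] for
    large [k]. Too many directions would contradict the Frostman condition at a scale of about
    2^(-k/4). *)
Lemma core (R : realType) (Bp : 'M[{poly R}]_(4, 2)) (n : nat) (CB : R) (CL : nat) :
  (0 < n)%N -> 1 <= CB -> (forall i j, pb n CB (Bp i j)) ->
  (forall x y : 'rV[R]_4, (forall a b : R, a *: x + b *: y = 0 -> a = 0 /\ b = 0) ->
    pw Bp x y != 0) ->
  (forall b, 0 <= b <= 1 -> \rank (ev b Bp) = 2%N) ->
  exists2 e : R, 0 < e <= 1 & forall CF : R, 1 <= CF -> exists k0 : nat,
    forall k : nat, (k0 <= k)%N ->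
    forall (T : finType) (tt : T -> R) (W : finType) (nu : W -> R)
      (pt : W -> 'rV[R]_4) (E : T -> {set W}) (lab : T -> W -> nat) (q : nat),
    (forall j, 0 <= tt j <= 1) ->
    (forall c L, 0 <= L ->
      #|[set j | `|tt j - c| <= L]%SET|%:R <= 2 * L * 2 ^+ k + 2) ->
    (forall w, 0 <= nu w) -> \sum_w nu w = 1 ->
    (forall j, (j <= k)%N -> forall z,
      \sum_(w | disc (2 ^- j) (pt w) == z) nu w <= CF * expR (- ((2 - e) * (j%:R * ln 2)))) ->
    (forall t, expR (- (e * (k%:R * ln 2))) <= \sum_(w in E t) nu w) ->
    (forall t w, w \in E t -> (lab t w < q)%N) ->
    q%:R <= expR ((1 + 2 * e) * (k%:R * ln 2)) ->
    (forall t w w', w \in E t -> w' \in E t -> lab t w = lab t w' ->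
       `|pt w *m ev (tt t) Bp - pt w' *m ev (tt t) Bp| <= CL%:R * 2 ^- k) ->
    #|T|%:R < expR (- (e * (k%:R * ln 2))) * 2 ^+ k.
Proof.
move=> n0 CB1 pbB nondeg rk2.
have [c0' c0'0 frl'] := frame_lower n0 pbB nondeg rk2.
have [c1 c10 rpl] := rp_lower n0 CB1 pbB nondeg.
have [C C1 HC] := coords_bounds n0 CB1 pbB.
pose c0 := Num.min c0' 1.
have c00 : 0 < c0 by rewrite lt_min c0'0 ltr01.
have c0le1 : c0 <= 1 by rewrite ge_min lexx orbT.
have frl b : 0 <= b <= 1 -> exists2 t, 0 <= t <= 1 & c0 <= `|\det (frame Bp t b)|.
  by move=> /frl'[t t01 ht]; exists t => //; apply: le_trans ht; rewrite ge_min lexx.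
have [Q Q0 [D0 D00 HQ]] := par_growth n c00 c10 C1.
pose nn : R := (4 * n)%:R.
pose q1 := 8 + 3 * Q; pose q2 := nn * (9 * q1 + Q).
pose q3 := 2 * q1 + q2 + Q; pose q4 := 2 * (q1 + q2 + Q + 8 * q3).
have nn0 : 0 <= nn by [].
have q20 : 0 <= q2 by apply: mulr_ge0 => //; rewrite /q1; lra.
have q40 : 0 <= q4 by rewrite /q4 /q3 /q1; lra.
(* With this [e] all losses together are an eighth of [k * ln 2], whereas the Frostman condition
   demands about a quarter at the coarse scale. *)
have [e e0 [e1 eE]] : exists2 e : R, 0 < e & e <= 1 /\ (q4 + 1 + Q) * e = 8^-1.
  have q4p : 0 < 8 * (q4 + 1 + Q) by lra.
  exists (8 * (q4 + 1 + Q))^-1; first by rewrite invr_gt0.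
  split; first by rewrite invf_le1 //; lra.
  by field; move: q4p; rewrite pmulr_rgt0 // => /gt_eqF ->.
exists e; first by rewrite e0.
move=> CF CF1.
have ln2 : 0 < ln 2 :> R by rewrite ln_gt0 // ltr1n.
pose LL : R := ln ((2 * CL + 3) ^ 2)%N%:R.
pose KK := (D0 + ln CF + LL) / (e * ln 2).
(* Rounding [k / 4] down loses at most [3 / 4 * ln 2], which must stay below [k * ln 2 / 8]: any [k]
   above 6 would do. *)
exists (Num.truncn KK + 9)%N => k hk T tt W nu pt E lab q tt01 spacing nu0 nu1 frost mass hq ql hl.
rewrite ltNge; apply/negP => Tbig.
pose Lam : R := k%:R * ln 2; pose D := e * Lam; pose x := expR D.
have k9 : 9%:R <= k%:R :> R by rewrite ler_nat; apply: leq_trans hk; apply: leq_addl.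
have Lam9 : 9 * ln 2 <= Lam by apply: ler_wpM2r => //; apply: ltW.
have Lam0 : 0 < Lam by apply: lt_le_trans Lam9; apply: mulr_gt0.
have Dp : 0 <= D by apply: mulr_ge0; apply: ltW.
have x1 : 1 <= x by apply: le_trans (expR_ge1Dx D); rewrite lerDl.
have x0 : 0 < x by apply: expR_gt0.
have lnx : ln x = D by rewrite expRK.
have lnCF : 0 <= ln CF by apply: ln_ge0.
have lnCL : 0 <= LL by rewrite /LL ln_ge0 // ler1n expn_gt0 addn_gt0 orbT.
have KKD : D0 + ln CF + LL <= D.
  have el : 0 < e * ln 2 by apply: mulr_gt0.
  have KK0 : 0 <= KK by rewrite divr_ge0 ?addr_ge0 // ltW.
  have KKk : KK <= k%:R.
    apply: ltW; rewrite -truncn_lt_nat //; apply: leq_trans hk.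
    by rewrite -addn1 leq_add2l.
  by move: KKk; rewrite /KK ler_pdivrMr // /D /Lam mulrCA.
have DD0 : D0 <= ln x.
  by rewrite lnx; apply: le_trans KKD; rewrite -addrA lerDl addr_ge0.
have [Hthi HM HB HU HV] := HQ x x1 DD0; rewrite lnx in Hthi HM HB HU HV.
have smallD : (q4 + 1 + Q) * D = Lam / 8.
  have -> : (q4 + 1 + Q) * D = (q4 + 1 + Q) * e * Lam by rewrite mulrA.
  by rewrite eE mulrC.
have QD := mulr_ge0 Q0 Dp.
pose N : R := 2 ^+ k.
have NE : N = expR Lam by rewrite /Lam expRM_natl lnK ?posrE.
have N0 : 0 < N by rewrite NE expR_gt0.
pose K := par_K n c0 C x; pose M := par_M n c0 C x.
pose th := (par_th n x)^-1; pose la := (par_la n c0 x)^-1; pose mu := (par_mu n c1 x)^-1.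
pose b : R := (x^-1 / 2) ^+ (3 + (4 * n).+1).+1 / 2.
have bE : b = (par_b n x)^-1 := par_bE n x.
pose S : R := expR ((1 + 2 * e) * Lam) * ((2 * CL + 3) ^ 2)%N%:R.
have CL0 : 0 < ((2 * CL + 3) ^ 2)%N%:R :> R by rewrite ltr0n expn_gt0 addn_gt0 orbT.
have S0 : 0 < S by rewrite mulr_gt0 // expR_gt0.
have lnS : ln S = (1 + 2 * e) * Lam + LL.
  by rewrite lnM ?posrE ?expR_gt0 // expRK.
pose LM : R := 2 * ln (2 * M + 3)%:R.
pose h : R := ln S + LM.
have lnM0 : 0 <= LM by rewrite mulr_ge0 // ln_ge0 // ler1n addn_gt0 orbT.
pose U := par_U n c0 c1 C x.
have U1 : 1 < U by apply: par_U_gt1.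
have U0 : 0 < U by apply: lt_trans U1.
have lnU0 : 0 <= ln U by apply: ln_ge0; apply: ltW.
(* There are about S^4 2^(-2(k - j)) far quadruples with j close to k/4: their logarithm is at most
   [4 * h - 3 / 2 * Lam + ln U], and this is [3 * h - g]. *)
pose g := 3 / 2 * Lam - h - ln U.
pose j := (k %/ 4)%N; pose mc := (2 ^ (k - j))%N; pose d : R := 2 ^- k.
have jk : (j <= k)%N by apply: leq_div.
have d0 : 0 < d by rewrite invr_gt0 exprn_gt0.
have mcd : mc%:R * d = 2 ^- j.
  have p0 : (2 : R) ^+ (k - j) != 0 by apply: expf_neq0; rewrite pnatr_eq0.
  by rewrite /mc natrX /d -[in 2 ^- k](subnK jk) exprD invfM mulrA mulfV // mul1r.
pose F1 := CF * expR (- ((2 - e) * Lam)).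
pose F2 := CF * expR (- ((2 - e) * (j%:R * ln 2))).
have CF0 : 0 < CF by apply: lt_le_trans CF1.
have F10 : 0 < F1 by rewrite mulr_gt0 // expR_gt0.
have F20 : 0 < F2 by rewrite mulr_gt0 // expR_gt0.
pose Lb := ln (par_B n c0 C x).
have B1 : 1 <= par_B n c0 C x by apply: par_B_ge1.
have B0 : 0 < par_B n c0 C x by apply: lt_le_trans B1.
have Lb0 : 0 <= Lb by apply: ln_ge0.
have lnF y : ln (((2 * M + 3) ^ 4)%N%:R * (CF * expR (- y)) / (b / 4)) = ln CF - y + Lb.
  have -> : ((2 * M + 3) ^ 4)%N%:R * (CF * expR (- y)) / (b / 4) =
     CF * (expR (- y) * par_B n c0 C x).
    by rewrite bE natrX natrD natrM invf_div invrK /par_B -/M; move: (M%:R) => z; ring.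
  have ey := expR_gt0 (- y).
  have eB : 0 < expR (- y) * par_B n c0 C x by apply: mulr_gt0.
  by rewrite lnM // lnM // expRK addrA.
have [KM NnKM hpsi] : [/\ 6 * K <= M%:R, (4 * n).+1%:R * K <= M%:R &
    (4 * n).+1%:R * K ^+ 2 * par_l2 n x <= M%:R] by apply: par_M_ge.
pose c := 2 * h + ln (((2 * M + 3) ^ 4)%N%:R * F1 / (b / 4)).
have cE : c = 2 * h + (ln CF - (2 - e) * Lam + Lb) by rewrite /c /F1 lnF.
have hE : h = Lam + 2 * D + LL + LM.
  by rewrite /h lnS /D; move: (e) (Lam) (LL) (LM) => *; ring.
have cE' : c = 5 * D + 2 * LL + 2 * LM + ln CF + Lb.
  by rewrite cE hE /D; move: (e) (Lam) (LL) (LM) (ln CF) (Lb) => *; ring.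
pose V := par_V n c0 C x.
have V0 : 0 <= V.
  have lnN (i : nat) : 0 <= ln i%:R :> R.
    by case: i => [|i]; [rewrite ln0|rewrite ln_ge0 // ler1n].
  by apply: addr_ge0 (lnN _); apply: addr_ge0; [apply: addr_ge0 (lnN 2%N)|]; apply: mulr_ge0.
have hh : h <= Lam + (3 + Q) * D.
  rewrite hE; move: HM KKD lnCF D00; rewrite -/M -/LM.
  by move: (Lam) (LL) (LM) (ln CF) (D) => *; lra.
have h0 : 0 <= h by rewrite hE addr_ge0 ?addr_ge0 ?(ltW Lam0) // mulr_ge0.
have cc0 : 0 <= c by rewrite cE' !addr_ge0 // mulr_ge0.
have hc : c <= q1 * D.
  rewrite cE' /q1; move: Dp HM HB KKD lnCF D00; rewrite -/M -/LM -/Lb.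
  by move: (LL) (LM) (ln CF) (D) (Lb) => *; lra.
have hg : Lam / 2 - (3 + 2 * Q) * D <= g.
  rewrite /g; move: HU hh; rewrite -/U.
  by move: (Lam) (h) (ln U) (D) => *; lra.
have smallD' : (q4 + 1 + Q) * D <= Lam / 8 by rewrite smallD.
have BN := bootstrap_numerics Q0 nn0 Dp Lam0 h0 hh cc0 hc V0 HV hg smallD'.
have g0 : 0 < g.
  apply: lt_le_trans hg; move: smallD Lam0 Dp QD (mulr_ge0 q40 Dp).
  by move: (Lam) (D) (q4) => *; lra.
have jL : Lam <= 4 * (j%:R * ln 2) + 3 * ln 2.
  rewrite mulrA -mulrDl; apply: ler_wpM2r; first exact: ltW.
  rewrite -natrM -natrD ler_nat {1}(divn_eq k 4) mulnC leq_add2l.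
  by rewrite -ltnS ltn_mod.
have jL4 : 4 * (j%:R * ln 2) <= Lam.
  rewrite mulrA; apply: ler_wpM2r; first exact: ltW.
  by rewrite -natrM ler_nat mulnC leq_trunc_div.
have H : - ln (((2 * M + 3) ^ 4)%N%:R * F2 / (b / 4)) <=
    2 * (c + nn * (9 * c + V) + V + (2 * c + nn * (9 * c + V) + V) / g * h).
  have th1g := par_th_ge1 n x1; have la1g : 1 <= par_la n c0 x by apply: par_la_ge1.
  have K1 : 1 <= K by apply: par_K_ge1.
  have b0 : 0 < par_b n x by apply: lt_le_trans (par_b_ge1 n x1).
  have th0 : 0 < th by rewrite invr_gt0; apply: lt_le_trans th1g.
  have th1 : th <= 1 by rewrite invf_le1 //; apply: lt_le_trans th1g.
  have la0 : 0 < la by rewrite invr_gt0; apply: lt_le_trans la1g.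
  have la1 : la <= 1 by rewrite invf_le1 //; apply: lt_le_trans la1g.
  have xD : expR (- D) = x^-1 by rewrite expRN.
  have T0 : 0 < #|T|%:R :> R by apply: lt_le_trans Tbig; rewrite -/Lam -/D -/N mulr_gt0 // expR_gt0.
  have TN : N / x <= #|T|%:R by move: Tbig; rewrite -/Lam -/D -/N xD mulrC.
  have thN : par_th n x <= N.
    have t0 : 0 < par_th n x by apply: lt_le_trans th1g.
    rewrite NE -[leLHS]lnK ?posrE // ler_expR; apply: le_trans Hthi _.
    by move: smallD Lam0 Dp QD (mulr_ge0 q40 Dp); move: (Lam) (D) (q4) => *; lra.
  have x20 : 0 < x ^+ 2 by apply: exprn_gt0.
  pose nf := U * S ^+ 4 * expR (- (3 / 2 * Lam)).
  have ex0 := expR_gt0 (- (3 / 2 * Lam)).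
  have S40 : 0 < S ^+ 4 by apply: exprn_gt0.
  have lnnf : ln nf = ln U + 4 * ln S - 3 / 2 * Lam.
    have US : 0 < U * S ^+ 4 by apply: mulr_gt0.
    by rewrite lnM // lnM // expRK lnXn // -[ln S *+ 4]mulr_natl.
  have nf0 : 0 < nf by apply: mulr_gt0 => //; apply: mulr_gt0.
  have lnnf0 : 0 <= ln nf.
    rewrite lnnf lnS; have : 0 <= 8 * D by apply: mulr_ge0.
    rewrite /D; move: lnU0 lnCL Lam0; move: (ln U) (LL) (Lam) (e) => *; lra.
  have nf1 : 1 <= nf by rewrite -(lnK (x := nf)) ?posrE // -expR0 ler_expR.
  have lnf : ln nf <= 3 * h - g.
    by rewrite lnnf /g /h; move: lnM0 lnU0; move: (ln U) (ln S) (LM) (Lam) => *; lra.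
  have hE' (t : T) : x^-1 <= \sum_(w in E t) nu w by rewrite -xD.
  have hnf : 2 * ((4 * n).+1%:R ^+ 2 * (S ^+ 4 * ((par_mm n c0 c1 C x).+1%:R ^+ 2 *
      (2 * (16 * K ^+ 3 * (4 * M + 3)%:R / (mc%:R * mu)) * N + 2) ^+ 2)) / #|T|%:R ^+ 2) / b <= nf.
    have N1 : N != 0 by rewrite gt_eqF.
    have mcp : mc%:R != 0 :> R by rewrite pnatr_eq0 -lt0n expn_gt0.
    pose J : R := 2 ^+ j.
    have NJ : N = mc%:R * J.
      by apply: (@mulIf _ d); rewrite ?gt_eqF // mulrAC mcd /J mulVf ?expf_neq0 ?pnatr_eq0 // mulfV.
    have J1 : 1 <= J by apply: exprn_ege1; rewrite ler1n.
    pose y := par_Y n c0 c1 C x.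
    have y0 : 0 <= y by apply: par_Y_ge0.
    have mu0 : par_mu n c1 x != 0 by rewrite gt_eqF // par_mu_gt0.
    have -> : 2 * (16 * K ^+ 3 * (4 * M + 3)%:R / (mc%:R * mu)) * N = y * J.
      rewrite NJ /mu /y /par_Y natrD natrM -/K -/M; move: (M%:R) (K) (par_mu n c1 x) mu0 => z u v v0.
      by field; rewrite v0 mcp.
    have yJ : (y * J + 2) ^+ 2 <= ((y + 2) * J) ^+ 2.
      have yJ0 := mulr_ge0 y0 (le_trans ler01 J1).
      by rewrite lerXn2r ?nnegrE ?addr_ge0 // mulrDl; move: J1 yJ0; move: (J) (y * J) => *; lra.
    have JJ : (J / N) ^+ 2 <= expR (- (3 / 2 * Lam)).
      have -> : J = expR (j%:R * ln 2) by rewrite expRM_natl lnK ?posrE.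
      rewrite NE -expRN -expRD -expRM_natl ler_expR.
      by move: jL4; move: (_ * ln 2) (Lam) => *; lra.
    have xT : (#|T|%:R ^+ 2)^-1 <= ((N / x) ^+ 2)^-1.
      have Nx : 0 < N / x by apply: divr_gt0.
      by rewrite lef_pV2 ?posrE ?exprn_gt0 // lerXn2r ?nnegrE // ltW.
    set mm2 : R := (par_mm n c0 c1 C x).+1%:R ^+ 2.
    have mm20 : 0 <= mm2 by apply: sqr_ge0.
    have bi0 : 0 <= b^-1 by rewrite bE invrK ltW.
    apply: (@le_trans _ _ (2 * ((4 * n).+1%:R ^+ 2 * (S ^+ 4 * (mm2 * ((y + 2) * J) ^+ 2)) *
        ((N / x) ^+ 2)^-1) / b)).
      apply: ler_wpM2r => //; apply: ler_wpM2l => //.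
      apply: ler_pM => //.
        by apply: mulr_ge0; [exact: sqr_ge0|apply: mulr_ge0; [exact: ltW|apply: mulr_ge0 => //; exact: sqr_ge0]].
      apply: ler_wpM2l; first exact: sqr_ge0.
      apply: ler_wpM2l; first exact: ltW.
      exact: ler_wpM2l.
    have -> : 2 * ((4 * n).+1%:R ^+ 2 * (S ^+ 4 * (mm2 * ((y + 2) * J) ^+ 2)) * ((N / x) ^+ 2)^-1) / b =
        (U - 1) * S ^+ 4 * (J / N) ^+ 2.
      rewrite /U /par_U bE invrK -/mm2 -/y; move: (par_b n x) (mm2) (S ^+ 4) ((4 * n).+1%:R) (y) => *.
      by field; rewrite N1 gt_eqF.
    apply: ler_pM => //; first by apply: mulr_ge0; [rewrite subr_ge0 ltW|exact: ltW].
      exact: sqr_ge0.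
    by apply: ler_wpM2r; [exact: ltW|rewrite lerBlDr lerDl].
  apply: (@core_ineq R Bp n CB T tt N c0 th la c1 mu K M mc (par_mm n c0 c1 C x) CL
    W nu pt E x^-1 lab q d S h g V F1 F2 nf) => //.
  - exact: ltW.
  - by rewrite -par_laE.
  - move=> a b' a01 b01 hab; have := HC a b' la a01 b01 la0 la1 hab.
    by rewrite /la invrK.
  - exact: par_muE.
  - exact: par_mm_ge.
  - by rewrite par_l2E invrK.
  - by rewrite expn_gt0.
  - exact: (frost k (leqnn k)).
  - rewrite mcd; exact: (frost j jk).
  - by rewrite invr_gt0.
  - by rewrite natrM; apply: ler_wpM2r => //; exact: ltW.
  - by rewrite -(ltr0n R).
  - by rewrite -/b bE; exact: par_sep.
rewrite /F2 lnF in H; have HH := le_trans H BN.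
have ej : j%:R * ln 2 <= (2 - e) * (j%:R * ln 2).
  rewrite -[leLHS]mul1r; apply: ler_wpM2r; first by rewrite mulr_ge0 // ltW.
  by move: e1; move: (e) => *; lra.
move: HH ej jL smallD HB KKD Lam9 lnCF D00 lnCL ln2 QD; rewrite -/Lb -/q4.
by move: (LL) (ln CF) (Lb) (Lam) (j%:R * ln 2) (D) ((2 - e) * _) => *; lra.
Qed.

(** * Frostman measures and dyadic contents *)

Section dyadic.
Variable R : realType.

(** Dyadic cells are nested: the floor at the coarser scale is the integer quotient of the finer
    floor. *)
Lemma disc_coarser (n i j : nat) (u v : 'rV[R]_n) : (i <= j)%N ->
  disc (2 ^- j) u = disc (2 ^- j) v -> disc (2 ^- i) u = disc (2 ^- i) v.
Proof.
move=> ij E; apply/rowP => l; have := congr1 (fun x : 'rV[int]_n => x 0 l) E.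
rewrite !mxE !invrK => {}E.
pose D : int := 2 ^+ (j - i).
have floorE (x : R) : Num.floor (x * 2 ^+ i) = (Num.floor (x * 2 ^+ j) %/ D)%Z.
  set y := x * 2 ^+ j.
  have D0 : 0 < D by rewrite exprn_gt0.
  have Dr : D%:~R = 2 ^+ (j - i) :> R by rewrite rmorphXn /=.
  have Dr0 : 0 < D%:~R :> R by rewrite ltr0z.
  have yE : x * 2 ^+ i = y / D%:~R.
    by rewrite /y Dr -[in 2 ^+ j](subnK ij) exprD mulrCA mulrAC mulfV ?mul1r // ?expf_neq0 ?pnatr_eq0.
  rewrite yE; apply: floor_def.
  have h1 := floor_le y; have h2 := floorD1_gt y.
  have m1 := divz_eq (Num.floor y) D.
  have m2 := ltz_pmod (Num.floor y) D0; have m3 := modz_ge0 (Num.floor y) (lt0r_neq0 D0).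
  rewrite ler_pdivlMr // ltr_pdivrMr //; apply/andP; split.
    apply: le_trans h1; rewrite -intrM ler_int [leRHS]m1 lerDl //.
  apply: lt_le_trans h2 _; rewrite -intrM ler_int mulrDl mul1r {1}m1.
  by rewrite -addrA lerD2l lezD1.
by rewrite !floorE E.
Qed.
End dyadic.

Section frostman.
Variables (R : realType) (n : nat) (W : finType) (pt : W -> 'rV[R]_n) (k : nat)
  (cap : nat -> R).
Hypothesis cap_gt0 : forall j, 0 < cap j.

Let cell j (w : W) := disc (2 ^- j) (pt w).
Let mass (mu : W -> R) j z := \sum_(w | cell j w == z) mu w.

Let ok (mu : W -> R) := (forall w, 0 <= mu w) /\
  forall j, (j <= k)%N -> forall z, mass mu j z <= cap j.

Let saturated (mu : W -> R) w := exists2 j : 'I_k.+1, true & mass mu j (cell j w) = cap j.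

Let greedy (ws : seq W) :
  exists mu, ok mu /\ forall w, w \in ws -> saturated mu w.
Proof.
elim: ws => [|w0 ws [mu [[mu0 muc] sat]]].
  exists (fun=> 0); split=> //; split=> // j _ z; rewrite /mass big1 //; exact: ltW.
pose slack (j : 'I_k.+1) := cap j - mass mu j (cell j w0).
have slack0 j : 0 <= slack j by rewrite subr_ge0 muc // -ltnS.
have [j0 _ jmin] : exists2 j0 : 'I_k.+1, true & forall j, slack j0 <= slack j.
  by case: (@arg_minP _ _ 'I_k.+1 ord0 xpredT slack) => // j0 _ h; exists j0 => // j; apply: h.
pose mu' w := mu w + (w == w0)%:R * slack j0.
have massE j z : mass mu' j z = mass mu j z + (cell j w0 == z)%:R * slack j0.
  rewrite /mass big_split /=; congr (_ + _); rewrite -mulr_suml; congr (_ * _).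
  rewrite big_mkcond (bigD1 w0) //= eqxx big1 ?addr0; first by case: ifP.
  by move=> w /negbTE ->; case: ifP.
have muc' j : (j <= k)%N -> forall z, mass mu' j z <= cap j.
  move=> jk z; rewrite massE; case: eqP => [<-|_]; last by rewrite mul0r addr0 muc.
  have jk' : (j < k.+1)%N by [].
  by have := jmin (Ordinal jk'); rewrite mul1r /slack /= => h; rewrite addrC -lerBrDr.
have mu'0 w : 0 <= mu' w by rewrite addr_ge0 // mulr_ge0.
exists mu'; split=> // w; rewrite inE => /orP[/eqP ->|/sat[j _ hj]].
  by exists j0 => //; rewrite massE eqxx mul1r /slack addrC subrK.
exists j => //; apply/eqP; rewrite eq_le; apply/andP; split.
  by apply: muc'; rewrite -ltnS.
by rewrite massE hj lerDl mulr_ge0.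
Qed.

(** Mass is added at each point until some cell around it reaches its cap, so that every point ends
    up in a saturated cell. The coarsest saturated cells around the points are disjoint and contain
    all points; hence their caps sum to the total mass. *)
Lemma frostman_finite : exists mu : W -> R, exists jj : W -> nat,
  [/\ forall w, 0 <= mu w,
      forall j, (j <= k)%N -> forall z, \sum_(w | disc (2 ^- j) (pt w) == z) mu w <= cap j,
      forall w, (jj w <= k)%N &
      \sum_(q <- undup [seq (jj w, disc (2 ^- jj w) (pt w)) | w <- enum W]) cap q.1 =
      \sum_w mu w].
Proof.
have [mu [[mu0 muc] sat]] := greedy (enum W).
pose satb w (j : 'I_k.+1) := mass mu j (cell j w) == cap j.
have satP w : exists j, satb w j.
  by have [|j _ hj] := sat w; rewrite ?mem_enum //; exists j; apply/eqP.
have /choice[jm Hjm] : forall w, exists j : 'I_k.+1, satb w j /\ forall i, satb w i -> (j <= i)%N.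
  move=> w; have [j hj] := satP w.
  by case: (@arg_minnP _ j (satb w) (fun i => i : nat) hj) => i hi hm; exists i.
pose jj w : nat := jm w; pose q w := (jj w, cell (jj w) w).
have qE w w' : cell (jj w) w' = cell (jj w) w -> q w' = q w.
  move=> E; have [h1 h2] := Hjm w; have [h1' h2'] := Hjm w'.
  have le1 : (jm w' <= jm w)%N by apply: h2'; rewrite /satb E.
  have E' : cell (jm w') w' = cell (jm w') w by apply: disc_coarser le1 E.
  have le2 : (jm w <= jm w')%N by apply: h2; rewrite /satb -E'.
  have ee : jj w' = jj w by apply/eqP; rewrite eqn_leq le1 le2.
  by rewrite /q ee E.
exists mu, jj; split; [exact: mu0|exact: muc|by move=> w; rewrite -ltnS; exact: ltn_ord|].
set qs := undup _.
have qsP w : q w \in qs by rewrite mem_undup; apply/mapP; exists w; rewrite ?mem_enum.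
transitivity (\sum_(z <- qs) \sum_(w | q w == z) mu w); last first.
  rewrite (exchange_big_dep xpredT) //=; apply: eq_bigr => w _.
  rewrite -big_filter (_ : [seq z <- qs | q w == z] = [:: q w]) ?big_seq1 //.
  rewrite -(eq_filter (a1 := pred1 (q w))); last by move=> z /=; rewrite eq_sym.
  by rewrite filter_pred1_uniq ?undup_uniq // qsP.
rewrite big_seq [RHS]big_seq; apply: eq_bigr => z; rewrite mem_undup => /mapP[w0 _ ->] /=.
have [/eqP <- _] := Hjm w0; rewrite /mass; apply: eq_bigl => w.
by apply/eqP/eqP => [/qE //|[-> ->]].
Qed.
End frostman.

(** * Dyadic content and its continuity along increasing sequences *)

Section content.
Variables (R : realType) (n : nat) (cap : nat -> R).
Hypothesis cap_ge0 : forall j, 0 <= cap j.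

Notation cube := (nat * 'rV[int]_n)%type.
Implicit Types (E : set 'rV[R]_n) (D C : set cube).

Definition in_cube (q : cube) (x : 'rV[R]_n) := disc (2 ^- q.1) x = q.2.

Definition covers E : set (set cube) :=
  [set D | forall x, E x -> exists2 q, D q & in_cube q x].

Definition tot D : \bar R := \esum_(q in D) (cap q.1)%:E.

Definition content E : \bar R := ereal_inf [set tot D | D in covers E].

Let cap0 (q : cube) : (0 <= (cap q.1)%:E)%E. Proof. by rewrite lee_fin. Qed.

Lemma tot_ge0 D : (0 <= tot D)%E.
Proof. by apply: esum_ge0 => q _. Qed.

Lemma tot_sub D C : D `<=` C -> (tot D <= tot C)%E.
Proof.
move=> DC; rewrite {2}/tot (esumID D) // setIC (setIidl DC) leeDl //.
exact: esum_ge0.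
Qed.

Lemma tot_setU D C : (tot (D `|` C) <= tot D + tot C)%E.
Proof.
rewrite {1}/tot (esumID D) //; apply: leeD.
  by apply: tot_sub => q [].
by apply: tot_sub => q [[]].
Qed.

Lemma content_ge0 E : (0 <= content E)%E.
Proof. by apply: le_ereal_inf_tmp => _ [D _ <-]; apply: tot_ge0. Qed.

Lemma content_le E D : covers E D -> (content E <= tot D)%E.
Proof. by move=> h; apply: ereal_inf_lbound; exists D. Qed.

Lemma content_sub E E' : E `<=` E' -> (content E <= content E')%E.
Proof.
move=> EE; apply: le_ereal_inf_tmp => _ [D h <-]; apply: content_le => x /EE; exact: h.
Qed.

Definition below (q q' : cube) := (q'.1 <= q.1)%N /\ forall x, in_cube q x -> in_cube q' x.

Lemma in_cube_nested q q' x : in_cube q x -> in_cube q' x -> (q'.1 <= q.1)%N -> below q q'.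
Proof.
move=> h h' le; split=> // y hy; rewrite /in_cube -h'; apply: disc_coarser le _.
by rewrite [LHS]hy h.
Qed.

(* Cubes of [D] lying in a cube of [C] are discarded, as are the cubes of [C]
   lying in a remaining cube of [D]. *)
Definition kept D C : set cube := [set q | D q /\ forall c, C c -> ~ below q c].
Definition absorbed D C : set cube := [set c | C c /\ exists2 q, kept D C q & below c q].
Definition merge D C := kept D C `|` (C `\` absorbed D C).

(** Around a given point cubes only grow under merging; this makes the covers in
    [content_increasing] stabilise. *)
Lemma merge_up D C q x : D q -> in_cube q x ->
  exists2 q', merge D C q' & in_cube q' x /\ (q'.1 <= q.1)%N.
Proof.
move=> Dq qx; have [k|nk] := pselect (kept D C q); first by exists q => //; left.
have [c Cc [cq hc]] : exists2 c, C c & below q c.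
  by apply: contra_notP nk => h; split=> // c Cc b; apply: h; exists c.
have [a|na] := pselect (absorbed D C c).
  have [_ [q' kq' [le h]]] := a.
  by exists q'; [left|split; [apply: h; apply: hc|apply: leq_trans cq]].
by exists c; [right|split; [apply: hc|]].
Qed.

Lemma merge_covers E D C : covers E C -> covers E (merge D C).
Proof.
move=> h x /h[c Cc cx]; have [a|na] := pselect (absorbed D C c).
  by have [_ [q kq [_ hq]]] := a; exists q; [left|apply: hq].
by exists c => //; right.
Qed.

Lemma merge_tot E E' D C (g de t : R) : E `<=` E' -> covers E D -> covers E' C ->
  (g%:E <= content E)%E -> (tot D <= (g + de)%:E)%E -> (tot C <= t%:E)%E ->
  (tot (merge D C) <= (t + de)%:E)%E.
Proof.
move=> EE hD hC hg tD tC.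
have fin A (r : R) : (tot A <= r%:E)%E -> exists2 v : R, tot A = v%:E & v <= r.
  have := tot_ge0 A; case: (tot A) => // v _; rewrite lee_fin => vr; by exists v.
pose K := kept D C; pose B := absorbed D C.
have KD : K `<=` D by move=> q [].
have BC : B `<=` C by move=> q [].
have cov : covers E ((D `\` K) `|` B).
  move=> x Ex; have [q Dq qx] := hD x Ex; have [k|nk] := pselect (K q); last by exists q => //; left.
  have [c Cc cx] := hC x (EE x Ex); case: (leqP q.1 c.1) => le.
    by exists c => //; right; split=> //; exists q => //; apply: in_cube_nested cx qx le.
  by have [_ /(_ c Cc)] := k; case; apply: in_cube_nested qx cx (ltnW le).
have sD : tot D = (tot K + tot (D `\` K))%E.
  by rewrite {1}/tot (esumID K) // setIC (setIidl KD).
have sC : tot C = (tot B + tot (C `\` B))%E.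
  by rewrite {1}/tot (esumID B) // setIC (setIidl BC).
have [dk dkE _] := fin K _ (le_trans (tot_sub KD) tD).
have [dd ddE _] := fin (D `\` K) _ (le_trans (tot_sub (@subDsetl _ D K)) tD).
have [cb cbE _] := fin B _ (le_trans (tot_sub BC) tC).
have [cc ccE _] := fin (C `\` B) _ (le_trans (tot_sub (@subDsetl _ C B)) tC).
rewrite sD dkE ddE -EFinD lee_fin in tD; rewrite sC cbE ccE -EFinD lee_fin in tC.
have := le_trans hg (le_trans (content_le cov) (tot_setU _ _)).
rewrite ddE cbE -EFinD lee_fin => h.
by apply: le_trans (tot_setU _ _) _; rewrite -/K -/B dkE ccE -EFinD lee_fin; lra.
Qed.

Lemma tot_le_seq D (t : R) : (tot D <= t%:E)%E ->
  forall X : seq cube, uniq X -> (forall q, q \in X -> D q) -> \sum_(q <- X) cap q.1 <= t.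
Proof.
move=> h X uX XD; rewrite -lee_fin; apply: le_trans h.
rewrite -sumEFin; apply: esum_ge; exists [set` X].
  by split=> [|q]; [exact: finite_seq|exact: XD].
by rewrite -fsbig_seq.
Qed.

Lemma tot_le_fin D (t : R) :
  (forall X : seq cube, uniq X -> (forall q, q \in X -> D q) -> \sum_(q <- X) cap q.1 <= t) ->
  (tot D <= t%:E)%E.
Proof.
move=> h; apply: ge_ereal_sup => _ [X [finX XD] <-].
have [Y0 YE0] := (finite_seqP X).1 finX; pose Y := undup Y0.
have YE : X = [set` Y] by rewrite YE0; apply/seteqP; split=> q /=; rewrite mem_undup.
rewrite YE -fsbig_seq ?undup_uniq // sumEFin lee_fin; apply: h; first exact: undup_uniq.
by move=> q qY; apply: XD; rewrite YE.
Qed.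

(** Near-optimal covers of the [E i] are merged one after the other with errors of sum below [ep].
    The level of a cube around a fixed point can only decrease, so the cubes belonging to all late
    covers cover the union, and any finitely many of them lie in a single [D j]. *)
Lemma content_increasing (E : nat -> set 'rV[R]_n) (c : R) :
  (forall i, E i `<=` E i.+1) -> (forall i, (content (E i) <= c%:E)%E) ->
  (content (\bigcup_i E i) <= c%:E)%E.
Proof.
move=> Einc hc; apply/lee_addgt0Pr => ep ep0.
have fin i : content (E i) \is a fin_num.
  by rewrite ge0_fin_numE ?content_ge0 //; apply: le_lt_trans (hc i) _; rewrite ltry.
pose g i := fine (content (E i)).
have gE i : content (E i) = (g i)%:E by rewrite fineK.
have gc i : g i <= c by rewrite -lee_fin -gE.
have /choice[C HC] : forall i, exists C, covers (E i) C /\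
    (tot C <= (g i + ep / 2 ^+ i.+1)%:E)%E.
  move=> i; have e0 : 0 < ep / 2 ^+ i.+1 by rewrite divr_gt0 // exprn_gt0.
  have [_ [C hC <-] lt] := lb_ereal_inf_adherent e0 (fin i).
  by exists C; split=> //; apply: ltW; move: lt; rewrite -/(content _) gE.
pose D := fix D i := if i is j.+1 then merge (D j) (C j.+1) else C 0%N.
have HD i : covers (E i) (D i) /\ (tot (D i) <= (g i + ep * (1 - 2 ^- i.+1))%:E)%E.
  elim: i => [|i [IH1 IH2]].
    have [h1 h2] := HC 0%N; split=> //; apply: le_trans h2 _; rewrite lee_fin lerD2l expr1.
    lra.
  have [h1 h2] := HC i.+1; split; first exact: merge_covers.
  have gi : ((g i)%:E <= content (E i))%E by rewrite gE.
  apply: le_trans (merge_tot (Einc i) IH1 h1 gi IH2 h2) _; rewrite lee_fin -addrA lerD2l.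
  have e2 : 2 ^- i.+2 = 2^-1 * 2 ^- i.+1 :> R by rewrite [2 ^+ i.+2]exprS invfM.
  rewrite !e2; move: (2 ^- i.+1) => y; lra.
have Emono i j : (i <= j)%N -> E i `<=` E j.
  by move=> /subnK <-; elim: (j - i)%N => // l IH x /IH; rewrite addSn; apply: Einc.
pose Doo : set cube := [set q | exists i, forall j, (i <= j)%N -> D j q].
have cov : covers (\bigcup_i E i) Doo.
  move=> x [i0 _ Ex].
  (* The least level met around [x] from stage [i0] on: each later cover contains a cube around [x]
     at least as large, and none is larger, so it contains this very cube. *)
  pose P l := `[< exists2 i, (i0 <= i)%N & D i (l, disc (2 ^- l) x) >].
  have exP : exists l, P l.
    have [q Dq qx] := (HD i0).1 x Ex; exists q.1; apply/asboolP; exists i0 => //.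
    by rewrite [disc _ _]qx -surjective_pairing.
  have [l /asboolP[i1 i01 Dl] lmin] := ex_minnP exP.
  exists (l, disc (2 ^- l) x) => //; exists i1 => j.
  have up : (i1 <= j)%N -> exists2 q, D j q & in_cube q x /\ (q.1 <= l)%N.
    move=> /subnK <-; elim: (j - i1)%N => [|m [q Dq [qx ql]]].
      by exists (l, disc (2 ^- l) x).
    rewrite addSn; have [q' Dq' [qx' ql']] := merge_up (C (m + i1).+1) Dq qx.
    by exists q' => //; split=> //; apply: leq_trans ql.
  move=> i1j; have [[m z] Dq [qx ql]] := up i1j; rewrite /in_cube /= in qx ql.
  have lm : (l <= m)%N.
    by apply: lmin; apply/asboolP; exists j; [apply: leq_trans i1j|rewrite qx].
  have -> : l = m by apply/eqP; rewrite eqn_leq lm ql.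
  by rewrite qx.
apply: le_trans (content_le cov) _; apply: tot_le_fin => X uX XD.
have [j hj] : exists j, forall i, (j <= i)%N -> forall q, q \in X -> D i q.
  elim: X XD {uX} => [|q X IH] XD; first by exists 0%N.
  have [q' q'X|j1 hj1] := IH; first by apply: XD; rewrite inE q'X orbT.
  have [j2 hj2] := XD q (mem_head _ _).
  exists (maxn j1 j2) => i; rewrite geq_max => /andP[i1 i2] q'; rewrite inE.
  by case/orP => [/eqP ->|/(hj1 i i1)//]; apply: hj2.
have [_ h2] := HD j; apply: le_trans (tot_le_seq h2 uX (hj j (leqnn j))) _.
have y0 : 0 <= 2 ^- j.+1 :> R by rewrite invr_ge0 exprn_ge0.
have := mulr_ge0 (ltW ep0) y0; have := gc j; move: (2 ^- _) => y; lra.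
Qed.
End content.

(** * Analytic sets *)

Lemma truncn_inv_lt (R : realType) (e : R) : 0 < e -> (Num.truncn e^-1).+1%:R^-1 < e.
Proof.
move=> e0; rewrite invf_plt ?posrE //.
by have /andP[] : (Num.truncn e^-1)%:R <= e^-1 < (Num.truncn e^-1).+1%:R
  by apply: truncn_itv; rewrite invr_ge0 ltW.
Qed.

Section analytic.
Variables (R : realType) (n : nat).
Notation X := 'rV[R]_n.
Implicit Types (A : set X) (C : X -> (nat -> nat) -> Prop).

(* Closedness in X * (nat -> nat), with the product of discrete topologies on
   the second factor. *)
Definition approx_closed C := forall x s,
  (forall N : nat, exists x' s', [/\ C x' s', `|x' - x| < N.+1%:R^-1 &
     forall i, (i < N)%N -> s' i = s i]) -> C x s.

Definition analytic A := exists2 C, approx_closed C & forall x, A x <-> exists s, C x s.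

Lemma analytic_closed A :
  (forall x, (forall N : nat, exists2 x', A x' & `|x' - x| < N.+1%:R^-1) -> A x) ->
  analytic A.
Proof.
move=> h; exists (fun x _ => A x) => [x s H|x].
  by apply: h => N; have [x' [_ [Ax' d _]]] := H N; exists x'.
by split=> [Ax|[]//]; exists id.
Qed.

Lemma analytic_bigcup (F : nat -> set X) : (forall i, analytic (F i)) ->
  analytic (\bigcup_i F i).
Proof.
move=> h; have /choice[C HC] : forall i, exists C, approx_closed C /\
    forall x, F i x <-> exists s, C x s by move=> i; have [C] := h i; exists C.
exists (fun x s => C (s 0%N) x (fun i => s i.+1)) => [x s H|x].
  have [hC _] := HC (s 0%N); apply: hC => N.
  have [x' [s' [h1 h2 h3]]] := H N.+1; exists x', (fun i => s' i.+1).
  split; [by rewrite -(h3 0%N)|apply: lt_le_trans h2 _|by move=> i iN; apply: h3].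
  by rewrite lef_pV2 ?posrE ?ltr0n // ler_nat.
split=> [[i _ /(HC i).2[s hs]]|[s /= hs]].
  by exists (fun j => if j is l.+1 then s l else i).
by exists (s 0%N) => //; apply/(HC (s 0%N)).2; exists (fun i => s i.+1).
Qed.

(** One sequence encodes countably many through [pickle]. For the [i]-th of them to agree on [N]
    entries, the code must agree beyond the codes of these entries, whence [N']. *)
Lemma analytic_bigcap (F : nat -> set X) : (forall i, analytic (F i)) ->
  analytic (\bigcap_i F i).
Proof.
move=> h; have /choice[C HC] : forall i, exists C, approx_closed C /\
    forall x, F i x <-> exists s, C x s by move=> i; have [C] := h i; exists C.
exists (fun x s => forall i, C i x (fun j => s (pickle (i, j)))) => [x s H i|x].
  have [hC _] := HC i; apply: hC => N.
  pose N' := (N + \max_(j < N) (pickle (i, j : nat)).+1)%N.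
  have [x' [s' [h1 h2 h3]]] := H N'; exists x', (fun j => s' (pickle (i, j))).
  split; [exact: h1|apply: lt_le_trans h2 _|].
    by rewrite lef_pV2 ?posrE ?ltr0n // ler_nat ltnS leq_addr.
  move=> j jN; apply: h3; apply: leq_trans (leq_addl _ _).
  exact: (@leq_bigmax _ (fun j : 'I_N => (pickle (i, j : nat)).+1) (Ordinal jN)).
split=> [Fx|[s hs] i _]; last by apply/(HC i).2; exists (fun j => s (pickle (i, j))).
have /choice[s hs] : forall i, exists s, C i x s by move=> i; apply/(HC i).2; apply: Fx.
exists (fun k => if unpickle k is Some (i, j) then s i j else 0%N) => i.
by rewrite (_ : (fun j => _) = s i) //; apply/funext => j; rewrite pickleK.
Qed.

Lemma analytic_closed_set A : closed A -> analytic A.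
Proof.
move=> cA; apply: analytic_closed => x H; apply: cA => B /nbhs_ballP[e /= e0 he].
have [N hN] : exists N : nat, N.+1%:R^-1 < e.
  by exists (Num.truncn e^-1); exact: truncn_inv_lt.
have [x' Ax' d] := H N; exists x'; split=> //; apply: he.
by rewrite -ball_normE /= distrC; apply: lt_trans hN.
Qed.

Lemma analytic_open A : open A -> analytic A.
Proof.
move=> oA; pose F N := [set x : X | forall y, `|y - x| < N.+1%:R^-1 -> A y].
have -> : A = \bigcup_N F N.
  apply/seteqP; split=> [x Ax|x [N _ h]]; last first.
    by apply: h; rewrite subrr normr0 invr_gt0.
  have /nbhs_ballP[e /= e0 he] := open_nbhs_nbhs (conj oA Ax).
  exists (Num.truncn e^-1) => // y hy; apply: he; rewrite -ball_normE /= distrC.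
  by apply: lt_trans hy _; exact: truncn_inv_lt.
apply: analytic_bigcup => N; apply: analytic_closed => x H y hy.
pose e := N.+1%:R^-1 - `|y - x|; have e0 : 0 < e by rewrite subr_gt0.
have [x' Fx' d] := H (Num.truncn e^-1); apply: Fx'.
have d' : `|x' - x| < e.
  by apply: lt_trans d _; exact: truncn_inv_lt.
have -> : y - x' = (y - x) - (x' - x) by rewrite opprB addrA subrK.
by apply: le_lt_trans (ler_normB _ _) _; rewrite -ltrBrDl.
Qed.

(** Analytic sets are not stable under complement, but the sets that are analytic together with
    their complement form a sigma-algebra containing the open sets. *)
Lemma borel_analytic A : borel_set A -> analytic A.
Proof.
move=> bA; suff [] : analytic A /\ analytic (~` A) by [].
apply: (@smallest_sub _ (sigma_algebra setT) _
  [set A : set X | analytic A /\ analytic (~` A)]) bA; last first.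
  move=> U oU; split; first exact: analytic_open.
  by apply: analytic_closed_set; apply: open_closedC.
split.
- by rewrite /= setC0; split; apply: analytic_open; [exact: open0|exact: openT].
- by move=> B [h1 h2]; rewrite /= setTD setCK.
- move=> F hF; split; first by apply: analytic_bigcup => i; have [] := hF i.
  by rewrite setC_bigcup; apply: analytic_bigcap => i; have [] := hF i.
Qed.

(** Choquet's capacitability argument: the entries of the witness sequences are bounded one after
    the other, the content staying above [c] by [content_increasing]. Bounded entries and bounded
    points have limits, so points of [Am m] outside [V m] for all [m] would accumulate at a point of
    [A]. *)
Lemma analytic_capacity (cap : nat -> R) A (c : R) :
  (forall j, 0 <= cap j) -> analytic A -> (c%:E < content cap A)%E ->
  exists Am : nat -> set X,
    [/\ forall m, Am m.+1 `<=` Am m, forall m, Am m `<=` A,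
        exists r : R, forall m x, Am m x -> `|x| <= r,
        forall m, (c%:E < content cap (Am m))%E &
        forall V : nat -> set X, (forall m, open (V m)) -> (forall m, V m `<=` V m.+1) ->
          A `<=` \bigcup_m V m -> exists m, Am m `<=` V m].
Proof.
move=> cap0 [C hC AC] hc.
have inc (E : nat -> set X) : (forall i, E i `<=` E i.+1) ->
    (c%:E < content cap (\bigcup_i E i))%E -> exists i, (c%:E < content cap (E i))%E.
  move=> Ei h; apply: contrapT => no; move: h; rewrite ltNge => /negP; apply.
  apply: content_increasing => // i; rewrite leNgt; apply/negP => h; apply: no; by exists i.
pose Box (r : nat) : set X := [set x | A x /\ `|x| <= r%:R].
have [r hr] : exists r : nat, (c%:E < content cap (Box r))%E.
  apply: inc => [i x [Ax xi]|]; first by split=> //; apply: le_trans xi _; rewrite ler_nat.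
  apply: lt_le_trans hc _; apply: content_sub => x Ax.
  exists (Num.truncn `|x|).+1 => //; split=> //; apply: ltW.
  by have /andP[] := truncn_itv (normr_ge0 x).
pose B (hs : seq nat) : set X := [set x | `|x| <= r%:R /\
  exists2 s, C x s & forall i, (i < size hs)%N -> (s i <= nth 0%N hs i)%N].
have /choice[f Hf] : forall hs, exists h, (c%:E < content cap (B hs))%E ->
    (c%:E < content cap (B (rcons hs h)))%E.
  move=> hs; have [h|nh] := pselect (c%:E < content cap (B hs))%E; last by exists 0%N => /nh.
  suff [h' hh'] : exists h', (c%:E < content cap (B (rcons hs h')))%E by exists h'.
  apply: inc.
    move=> i x [xr [s Cs hs']]; split=> //; exists s => // j.
    rewrite size_rcons => hj; have := hs' j; rewrite size_rcons => /(_ hj).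
    rewrite !nth_rcons; case: ifP => // _; case: ifP => // _ /leq_trans; apply; exact: leqnSn.
  apply: lt_le_trans h _; apply: content_sub => x [xr [s Cs hs']].
  exists (s (size hs)) => //; split=> //; exists s => // j.
  rewrite size_rcons ltnS leq_eqVlt => /orP[/eqP ->|hj].
    by rewrite nth_rcons ltnn eqxx.
  by rewrite nth_rcons hj; apply: hs'.
pose hs := fix hs m := if m is k.+1 then rcons (hs k) (f (hs k)) else [::].
have szh m : size (hs m) = m by elim: m => // m IH; rewrite /= size_rcons IH.
have hBs m : (c%:E < content cap (B (hs m)))%E.
  elim: m => [|m IH]; last exact: Hf.
  apply: lt_le_trans hr _; apply: content_sub => x [Ax xr]; split=> //.
  by have [s hs'] := (AC x).1 Ax; exists s.
have Bdec m : B (hs m.+1) `<=` B (hs m).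
  move=> x [xr [s Cs H]]; split=> //; exists s => // i im.
  have := H i; rewrite /= size_rcons nth_rcons im => -> //; exact: ltnW.
pose hi i := nth 0%N (hs i.+1) i.
have hiE m i : (i < m)%N -> nth 0%N (hs m) i = hi i.
  elim: m => // m IH; rewrite ltnS leq_eqVlt => /orP[/eqP -> //|im].
  by rewrite /= nth_rcons szh im; exact: IH.
exists (fun m => B (hs m)); split=> //.
- by move=> m x [_ [s Cs _]]; apply/AC; exists s.
- by exists r%:R => m x [].
move=> V oV incV AV; apply: contrapT => no.
have /choice[x Hx] : forall m, exists x, B (hs m) x /\ ~ V m x.
  move=> m; apply: contrapT => no'; apply: no; exists m => x Bx.
  by apply: contrapT => nV; apply: no'; exists x.
have /choice[s Hs] : forall m, exists s, C (x m) s /\ forall i, (i < m)%N -> (s i <= hi i)%N.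
  move=> m; have [[_ [s Cs H]] _] := Hx m; exists s; split=> // i im.
  by rewrite -(hiE m) //; apply: H; rewrite szh.
have xr m : `|x m| <= r%:R by have [[]] := Hx m.
(* Along an ultrafilter every bounded entry [s m i] is constant on a large set of [m], for all [i]
   simultaneously, without extracting subsequences. *)
have [U [uU evU]] := @ultraFilterLemma nat \oo _.
have Ub i : forall b, U [set m | (s m i <= b)%N] -> exists v, U [set m | s m i = v].
  elim=> [|b IH] h; first by exists 0%N; apply: filterS h => m /=; rewrite leqn0 => /eqP.
  have [h1|h1] := in_ultra_setVsetC [set m | s m i = b.+1] uU; first by exists b.+1.
  apply: IH; apply: filterS (filterI h h1) => m [/= h2 /eqP h3].
  by rewrite -ltnS ltn_neqAle h3.
have /choice[sg Hsg] : forall i, exists v, U [set m | s m i = v].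
  move=> i; apply: (Ub i (hi i)); apply: evU; exists i.+1 => // m /= im.
  by have [_] := Hs m; apply.
pose K := [set y : X | `|y| <= r%:R].
have cK : compact K.
  apply: bounded_closed_compact; last first.
    apply: (@preimage_closed _ _ (fun y : X => `|y|) [set z : R | z <= r%:R]).
      by move=> y _; exact: norm_continuous.
    exact: closed_le.
  exists r%:R; split; first exact: num_real.
  by move=> M M1 y /= /le_trans; apply; apply: ltW.
have FK : U (x @^-1` K) by apply: filterS filterT => m _; exact: xr.
have [p [Kp clp]] := cK (x @ U) _ FK.
have near_p (e : R) : 0 < e -> U [set m | `|x m - p| < e].
  move=> e0; have [//|h] := in_ultra_setVsetC [set m | `|x m - p| < e] uU.
  have [y []] := clp [set y | ~ (`|y - p| < e)] (ball p e) h (nbhsx_ballx p e e0).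
  by rewrite -ball_normE /= distrC.
have Cp : C p sg.
  apply: hC => N.
  have U1 : U [set m | forall i, (i < N)%N -> s m i = sg i].
    elim: N => [|N IH]; first by apply: filterS filterT.
    apply: filterS (filterI IH (Hsg N)) => m [/= h1 h2] i.
    by rewrite ltnS leq_eqVlt => /orP[/eqP ->|/h1].
  have N0 : 0 < N.+1%:R^-1 :> R by rewrite invr_gt0.
  have [m [/= h1 h2]] := filter_ex (filterI U1 (near_p _ N0)).
  by exists (x m), (s m); split=> //; have [] := Hs m.
have [m0 _ Vp] : (\bigcup_m V m) p by apply: AV; apply/AC; exists sg.
have /nbhs_ballP[e /= e0 he] := open_nbhs_nbhs (conj (oV m0) Vp).
have Um : U [set m | (m0 <= m)%N] by apply: evU; exists m0.
have [m [/= h1 h2]] := filter_ex (filterI (near_p e e0) Um).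
have [_] := Hx m; apply.
have Vm0 : V m0 (x m) by apply: he; rewrite -ball_normE /= distrC.
have Vinc k : V m0 `<=` V (k + m0)%N.
  by elim: k => // k IH; rewrite addSn => y /IH; exact: incV.
by have := Vinc (m - m0)%N; rewrite subnK //; apply.
Qed.
End analytic.

(** * Hausdorff measures *)

Section hausdorff.
Variable R : realType.

Definition pcap (s : R) (j : nat) : R := expR (- (s * (j%:R * ln 2))).

Lemma pcap_gt0 s j : 0 < pcap s j. Proof. exact: expR_gt0. Qed.

Lemma ln2_gt0 : 0 < ln 2 :> R. Proof. by rewrite ln_gt0 // ltr1n. Qed.

Lemma half_powR s j : (2 ^- j) `^ s = pcap s j.
Proof.
rewrite /powR gt_eqF ?invr_gt0 ?exprn_gt0 //.
by rewrite lnV ?posrE ?exprn_gt0 // lnXn // mulrN -[ln 2 *+ j]mulr_natl.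
Qed.

Lemma pcap_le s (j : nat) (eta : R) : 0 < s -> 0 < eta -> pcap s j <= eta `^ s -> 2 ^- j <= eta.
Proof.
move=> s0 eta0; rewrite -half_powR /powR !gt_eqF ?invr_gt0 ?exprn_gt0 //.
by rewrite ler_expR ler_pM2l // ler_ln ?posrE ?invr_gt0 ?exprn_gt0.
Qed.

Lemma esum_sub (I : choiceType) (A B : set I) (a : I -> \bar R) :
  (forall i, 0 <= a i)%E -> A `<=` B -> (\esum_(i in A) a i <= \esum_(i in B) a i)%E.
Proof.
move=> a0 AB; rewrite [leRHS](esumID A) // setIC (setIidl AB) leeDl //.
exact: esum_ge0.
Qed.

Lemma enorm_ge (n : nat) (v : 'rV[R]_n) : `|v| <= enorm v.
Proof.
apply: mx_norm_le => [|i j]; first exact: sqrtr_ge0.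
rewrite (ord1 i) -sqrtr_sqr ler_sqrt; last by apply: sumr_ge0 => k _; exact: sqr_ge0.
rewrite (bigD1 j) //= lerDl; apply: sumr_ge0 => k _; exact: sqr_ge0.
Qed.

Lemma enorm_le (v : 'rV[R]_4) (c : R) : 0 <= c -> `|v| <= c -> enorm v <= 2 * c.
Proof.
move=> c0 h; rewrite -(ger0_norm (mulr_ge0 (ler0n R 2) c0)) -sqrtr_sqr ler_sqrt ?sqr_ge0 //.
apply: (@le_trans _ _ (\sum_(i < 4) c ^+ 2)).
  apply: ler_sum => i _; rewrite -[leLHS]real_normK ?num_real // lerXn2r ?nnegrE //.
  exact: le_trans (mx_coord_le v 0 i) h.
rewrite sumr_const card_ord -[leLHS]mulr_natl exprMn; lra.
Qed.

Lemma diam_le (E : set 'rV[R]_4) (c : R) :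
  (forall x y, E x -> E y -> enorm (x - y) <= c) -> (diam E <= c%:E)%E.
Proof. by move=> h; apply: ge_ereal_sup => _ [x Ex [y Ey <-]]; rewrite lee_fin h. Qed.

Lemma diam_ge0 (E : set 'rV[R]_4) : E !=set0 -> (0 <= diam E)%E.
Proof.
move=> [x Ex]; apply: ereal_sup_ubound; exists x => //; exists x => //.
by rewrite subrr /enorm big1 ?sqrtr0 // => i _; rewrite mxE expr0n.
Qed.

Lemma premeasure_ge0 s de (A : set 'rV[R]_4) : (0 <= hausdorff_premeasure s de A)%E.
Proof.
by apply: le_ereal_inf_tmp => _ [F _ <-]; apply: nneseries_ge0 => k _ _; exact: poweR_ge0.
Qed.

(** In a cover of small total cap each single cap is small, so all its cubes are small and the cover
    is admissible for any [delta]. The factor [p2] accounts for the Euclidean diameter of a cell, at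
    most twice its side in dimension 4. *)
Lemma hausdorff_content (s : R) (A : set 'rV[R]_4) : 0 < s ->
  content (pcap s) A = 0%E -> hausdorff_measure s A = 0%E.
Proof.
move=> s0 c0; apply/eqP; rewrite eq_le; apply/andP; split; last first.
  apply: le_trans (premeasure_ge0 s 1 A) _; apply: ereal_sup_ubound.
  by exists 1 => //; exact: ltr01.
apply: ge_ereal_sup => _ [de /= de0 <-]; apply/lee_addgt0Pr => ep ep0; rewrite add0e.
pose p2 : R := 2 `^ s; have p20 : 0 < p2 by apply: powR_gt0.
pose eta := Num.min (ep / p2) ((de / 2) `^ s).
have eta0 : 0 < eta by rewrite lt_min divr_gt0 //= powR_gt0 // divr_gt0.
have cap0 j : 0 <= pcap s j by apply: ltW; exact: pcap_gt0.
have [_ [D hD <-] Deta] : exists2 y, [set tot (pcap s) D | D in covers A] y & (y < eta%:E)%E.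
  by apply: ereal_inf_lt; rewrite -/(content _ _) c0 lte_fin.
have small q : D q -> pcap s q.1 <= eta.
  move=> Dq; have := tot_le_seq (ltW Deta) (X := [:: q]) isT; rewrite big_seq1; apply.
  by move=> q'; rewrite inE => /eqP ->.
pose cell (q : nat * 'rV[int]_4) : set 'rV[R]_4 := [set x | in_cube q x].
have dcell q : (diam (cell q) <= (2 * 2 ^- q.1)%:E)%E.
  have d0 : 0 < 2 ^- q.1 :> R by rewrite invr_gt0 exprn_gt0.
  apply: diam_le => x y hx hy; apply: enorm_le; first exact: ltW.
  by apply: disc_eq_dist => //; rewrite [LHS]hx [RHS]hy.
pose F (k : nat) := if @pickle_inv (nat * 'rV[int]_4)%type k is Some q then [set x | D q /\ cell q x] else set0.
have FE k : F k !=set0 -> exists2 q, D q & @pickle_inv (nat * 'rV[int]_4)%type k = Some q /\ F k = cell q.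
  rewrite /F; case: (@pickle_inv (nat * 'rV[int]_4)%type k) => [q [x [Dq _]]|[]//].
  by exists q => //; split=> //; apply/seteqP; split=> [y []//|y].
apply: (@le_trans _ _ (\sum_(k <oo | F k != set0) poweR (diam (F k)) s)%E).
  apply: ereal_inf_lbound; exists F => //; split.
    move=> x /hD[q Dq qx]; exists (pickle q) => //; by rewrite /F pickleK_inv.
  move=> k; have [->|/set0P/FE[q Dq [_ ->]]] := eqVneq (F k) set0.
    by apply: diam_le.
  apply: le_trans (dcell q) _; rewrite lee_fin.
  have h : pcap s q.1 <= (de / 2) `^ s.
    by apply: le_trans (small q Dq) _; rewrite ge_min lexx orbT.
  have d2 : 0 < de / 2 by apply: divr_gt0.
  have := pcap_le s0 d2 h; lra.
rewrite nneseries_esum; last by move=> k _; exact: poweR_ge0.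
pose w2 (j : nat) := p2 * pcap s j.
have w20 j : 0 <= w2 j by apply: mulr_ge0; [exact: ltW|].
pose val k : \bar R := if @pickle_inv (nat * 'rV[int]_4)%type k is Some q then (w2 (q : nat * 'rV[int]_4).1)%:E else 0%E.
have val0 k : (0 <= val k)%E by rewrite /val; case: (@pickle_inv (nat * 'rV[int]_4)%type k) => // q; rewrite lee_fin.
apply: (@le_trans _ _ (\esum_(k in [set k | F k != set0]) val k)).
  apply: le_esum => k /= /set0P Fk; have [q Dq [kq Fq]] := FE k Fk.
  rewrite /val kq Fq; have := diam_ge0 Fk; rewrite Fq => d0.
  have -> : (w2 q.1)%:E = poweR (2 * 2 ^- q.1)%:E s.
    by rewrite poweR_EFin powRM ?half_powR // invr_ge0 exprn_ge0.
  have e0 : 0 <= 2 * 2 ^- q.1 :> R by rewrite mulr_ge0 // invr_ge0 exprn_ge0.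
  apply: gt0_ler_poweR; rewrite ?(ltW s0) // ?in_itv /= ?d0 ?leey //.
  by rewrite lee_fin e0.
have sub : [set k | F k != set0] `<=` pickle @` D.
  move=> k /= /set0P/FE[q Dq [kq _]]; exists q => //.
  by have := @pickle_invK (nat * 'rV[int]_4)%type k; rewrite kq.
apply: le_trans (esum_sub val0 sub) _.
rewrite esum_image; last first.
  by move=> q q' _ _ /(congr1 (@pickle_inv (nat * 'rV[int]_4)%type)); rewrite !pickleK_inv => -[].
have -> : (\esum_(q in D) val (pickle q) = tot w2 D)%E.
  by apply: eq_esum => q _; rewrite /val pickleK_inv.
apply: tot_le_fin => X uX XD; rewrite -mulr_sumr.
have : \sum_(q <- X) pcap s q.1 <= ep / p2.
  by apply: le_trans (tot_le_seq (ltW Deta) uX XD) _; rewrite ge_min lexx.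
by rewrite ler_pdivlMr // mulrC.
Qed.

Lemma hausdorff_measure_neq0 (s : R) (A : set 'rV[R]_4) : 0 <= s ->
  (s%:E < hausdorff_dim A)%E -> hausdorff_measure s A <> 0%E.
Proof.
move=> s0 + h; apply/negP; rewrite -leNgt; apply: ereal_inf_lbound; exists s => //.
Qed.

Lemma pcap_small (s a : R) : 0 < s -> 0 < a -> exists k0, forall k, (k0 <= k)%N -> pcap s k <= a.
Proof.
move=> s0 a0; pose y := - ln a / (s * ln 2).
exists (Num.truncn `|y|).+1 => k hk.
rewrite -[leRHS]lnK ?posrE // ler_expR lerNl -[_ * (_ * _)]mulrCA.
have yl : y <= k%:R.
  apply: le_trans (ler_norm _) _; apply: (@le_trans _ _ (Num.truncn `|y|).+1%:R).
    by apply: ltW; have /andP[] := truncn_itv (normr_ge0 y).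
  by rewrite ler_nat.
by move: yl; rewrite /y ler_pdivrMr // mulr_gt0 // ln2_gt0.
Qed.

(** A positive diameter is rounded up to a power of 2, which costs the factor [2 ^ s1], and the
    exponent may be lowered to [s0] because [d] is at most 1. Diameter 0 has no natural scale: it
    gets a deep one, paid for by [a]. *)
Lemma scale_of_diam (s0 s1 a d : R) (k0 : nat) :
  0 <= s0 -> s0 < s1 -> 0 < a -> 0 <= d -> d <= 2 ^- k0 ->
  exists l, [/\ (k0 <= l)%N, d <= 2 ^- l & pcap s1 l <= 2 `^ s1 * d `^ s0 + a].
Proof.
move=> s00 s01 a0 d0 dk; have s10 : 0 < s1 by apply: le_lt_trans s01.
have dd0 : 0 <= 2 `^ s1 * d `^ s0 by rewrite mulr_ge0 ?powR_ge0.
have [->|dn0] := eqVneq d 0.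
  have [k1 hk1] := pcap_small s10 a0.
  exists (maxn k0 k1); split; [exact: leq_maxl|by rewrite invr_ge0 exprn_ge0|].
  by apply: le_trans (hk1 _ (leq_maxr _ _)) _; rewrite lerDr mulr_ge0 ?powR_ge0.
have dp : 0 < d by rewrite lt_def dn0.
pose P l := d <= 2 ^- l.
have exP : exists l, P l by exists k0.
have bP l : P l -> (l <= Num.truncn d^-1)%N.
  rewrite /P => h; have h1 : 2 ^+ l <= d^-1.
    by rewrite -[leLHS]invrK lef_pV2 ?posrE // invr_gt0 exprn_gt0.
  have l2 : l%:R <= 2 ^+ l :> R by rewrite -natrX ler_nat ltnW // ltn_expl.
  by rewrite truncn_ge_nat ?invr_ge0 //; exact: le_trans l2 h1.
have [l Pl lmax] := ex_maxnP exP bP.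
exists l; split=> //; first exact: lmax.
have lt : 2 ^- l.+1 < d by rewrite ltNge; apply/negP => /lmax; rewrite ltnn.
have d1 : d <= 1.
  apply: le_trans dk _; rewrite invf_le1 ?exprn_gt0 //; by rewrite exprn_ege1 // ler1n.
rewrite -[leLHS]addr0; apply: lerD; last exact: ltW.
have -> : pcap s1 l = 2 `^ s1 * (2 ^- l.+1) `^ s1.
  rewrite -powRM ?invr_ge0 ?exprn_ge0 // exprS invfM mulrA mulfV ?mul1r ?half_powR //.
apply: ler_wpM2l; first exact: powR_ge0.
apply: (@le_trans _ _ (d `^ s1)).
  by apply: ge0_ler_powR; rewrite ?nnegrE ?invr_ge0 ?exprn_ge0 // ltW.
rewrite /powR gt_eqF // ler_expR; apply: ler_wnM2r; last exact: ltW.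
by apply: ln_le0.
Qed.

(** Covers are taken at an exponent [s0] below [s1] where the measure vanishes. The choice of [eta]
    makes the rounded part at most 1/2, and the slacks [2 ^- k.+2] add at most another 1/2. *)
Lemma small_cover (s1 : R) (B : set 'rV[R]_4) (k0 : nat) : 0 < s1 ->
  (hausdorff_dim B < s1%:E)%E ->
  exists (F : nat -> set 'rV[R]_4) (l : nat -> nat),
    [/\ B `<=` \bigcup_i F i, forall i, (k0 <= l i)%N,
        forall i x y, F i x -> F i y -> `|x - y| <= 2 ^- l i &
        forall m, \sum_(i < m) pcap s1 (l i) <= 1].
Proof.
move=> s10 /ereal_inf_lt[_ [s0 [s00 Hs0] <-]]; rewrite lte_fin => s01.
pose eta := (2 * 2 `^ s1)^-1; have p20 : 0 < 2 `^ s1 by apply: powR_gt0.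
have eta0 : 0 < eta by rewrite invr_gt0 mulr_gt0.
have d0 : 0 < 2 ^- k0 :> R by rewrite invr_gt0 exprn_gt0.
have [_ [F [BF dF] <-] Feta] : exists2 y, [set (\sum_(k <oo | F k != set0) poweR (diam (F k)) s0)%E
    | F in [set F : (set 'rV[R]_4)^nat | B `<=` \bigcup_k F k /\
       forall k, (diam (F k) <= (2 ^- k0)%:E)%E]] y & (y < eta%:E)%E.
  apply: ereal_inf_lt; apply: (@le_lt_trans _ _ 0%E); last by rewrite lte_fin.
  have : (hausdorff_premeasure s0 (2 ^- k0) B <= hausdorff_measure s0 B)%E.
    by apply: ereal_sup_ubound; exists (2 ^- k0); [exact: d0|].
  by rewrite Hs0.
pose a k : R := if F k == set0 then 0 else fine (poweR (diam (F k)) s0).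
have fd k : F k !=set0 -> exists2 d : R, diam (F k) = d%:E & 0 <= d <= 2 ^- k0.
  move=> Fk; have := dF k; have := diam_ge0 Fk; case: (diam (F k)) => // d.
  by rewrite !lee_fin => h1 h2; exists d => //; rewrite h1.
have aE k : F k !=set0 -> poweR (diam (F k)) s0 = (a k)%:E.
  move=> Fk; rewrite /a ifN; last exact/set0P.
  by have [d -> _] := fd k Fk; rewrite poweR_EFin.
have a0 k : 0 <= a k by rewrite /a; case: ifP => // _; rewrite fine_ge0 // poweR_ge0.
have /choice[l Hl] : forall k, exists l, [/\ (k0 <= l)%N,
    forall x y, F k x -> F k y -> `|x - y| <= 2 ^- l &
    pcap s1 l <= 2 `^ s1 * a k + 2 ^- k.+2].
  move=> k; have e0 : 0 < 2 ^- k.+2 :> R by rewrite invr_gt0 exprn_gt0.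
  have [F0|/set0P Fk] := eqVneq (F k) set0.
    have s2 : 0 < s1 / 2 by apply: divr_gt0.
    have s21 : s1 / 2 < s1 by lra.
    have [l [h1 _ h3]] := scale_of_diam (ltW s2) s21 e0 (lexx 0) (ltW d0).
    exists l; split=> // [x y|]; first by rewrite F0.
    by apply: le_trans h3 _; rewrite powR0 ?gt_eqF // mulr0 add0r lerDr mulr_ge0 // ltW.
  have [d dE /andP[dd0 dk]] := fd k Fk.
  have [l [h1 h2 h3]] := scale_of_diam s00 s01 e0 dd0 dk.
  exists l; split=> //; last by move: (aE k Fk); rewrite dE poweR_EFin => -[<-].
  move=> x y Fx Fy; apply: le_trans (enorm_ge _) _; apply: le_trans h2.
  by rewrite -lee_fin -dE; apply: ereal_sup_ubound; exists x => //; exists y.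
exists F, l; split=> //.
- by move=> k; have [] := Hl k.
- by move=> k x y; have [_ h _] := Hl k; exact: h.
move=> m; apply: (@le_trans _ _ (\sum_(i < m) (2 `^ s1 * a i + 2 ^- i.+2))).
  by apply: ler_sum => i _; have [] := Hl i.
rewrite big_split /= -mulr_sumr.
have geo : \sum_(i < m) 2 ^- i.+2 <= 2^-1 :> R.
  have -> : \sum_(i < m) 2 ^- i.+2 = 2^-1 - 2 ^- m.+1 :> R.
    elim: m => [|m IH]; first by rewrite big_ord0 expr1 subrr.
    rewrite big_ord_recr IH /= [2 ^+ m.+2]exprS invfM; move: (2 ^- m.+1) => y; lra.
  by rewrite lerBlDr lerDl invr_ge0 exprn_ge0.
have suma : \sum_(i < m) a i <= eta.
  rewrite -lee_fin; apply: le_trans (ltW Feta).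
  apply: le_trans (nneseries_lim_ge m _); last by move=> k _ _; exact: poweR_ge0.
  rewrite -sumEFin big_mkord [leRHS]big_mkcond; apply: lee_sum => i _.
  case: ifPn => [/set0P/aE -> //|]; rewrite negbK => F0.
  by rewrite /a F0.
have := ler_wpM2l (ltW p20) suma.
have -> : 2 `^ s1 * eta = 2^-1 by rewrite /eta invfM mulrCA mulfV ?mulr1 // gt_eqF.
lra.
Qed.
End hausdorff.

(** * Exceptional directions *)

Section labels.
Variable R : realType.
Notation X := 'rV[R]_4.

(* [S] splits into pieces of scale [2^-j], [k0 <= j <= M], whose images under [B]
   are pieces of that scale, with few pieces at every scale. *)
Definition labelled (s : R) (CL : nat) (S : set X) (k0 M : nat) (B : 'M[R]_(4, 2)) :=
  exists (lev lab : X -> nat) (q : nat -> nat),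
    [/\ forall x, S x -> (k0 <= lev x <= M)%N /\ (lab x < q (lev x))%N,
        forall j, (q j)%:R <= expR (s * (j%:R * ln 2)) &
        forall x y, S x -> S y -> lev x = lev y -> lab x = lab y ->
          `|x *m B - y *m B| <= CL%:R * 2 ^- lev x].

(** The preimages of open neighbourhoods of the covering pieces cover [A], so finitely many of them,
    hence finitely many scales, suffice for the late [Am m]. As the caps sum to at most 1, level [j]
    has at most 2^(s j) pieces. The factor 3 counts the diameter of a piece and the two distances to
    it. *)
Lemma labelled_of_dim (s C : R) (CL : nat) (A : set X) (Am : nat -> set X)
    (P : 'M[R]_4) (B : 'M[R]_(4, 2)) (k0 : nat) :
  0 < s -> (hausdorff_dim [set (x *m P : X) | x in A] < s%:E)%E ->
  (forall x y : X, `|x *m B - y *m B| <= C * `|x *m P - y *m P|) -> 0 <= C -> 3 * C <= CL%:R ->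
  (forall m, Am m.+1 `<=` Am m) -> (forall m, Am m `<=` A) ->
  (forall V : nat -> set X, (forall m, open (V m)) -> (forall m, V m `<=` V m.+1) ->
    A `<=` \bigcup_m V m -> exists m, Am m `<=` V m) ->
  exists M0, forall M, (M0 <= M)%N -> labelled s CL (Am M) k0 M B.
Proof.
move=> s0 hdim hB C0 hCL dec AmA cpt.
have [F [l [cov lk0 Fd lsum]]] := small_cover k0 s0 hdim.
pose near i : set X := \bigcup_(y in F i) [set x | `|x *m P - y| < 2 ^- l i].
have d0 j : 0 < 2 ^- j :> R by rewrite invr_gt0 exprn_gt0.
have oN i : open (near i).
  rewrite openE => x [y Fy /= hxy].
  pose g := 2 ^- l i - `|x *m P - y|; have g0 : 0 < g by rewrite subr_gt0.
  have P1 : 0 < 4 * (`|P| + 1) by rewrite mulr_gt0 // ltr_wpDl.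
  apply/nbhs_ballP; exists (g / (4 * (`|P| + 1))); first exact: divr_gt0.
  move=> x'; rewrite -ball_normE /= ltr_pdivlMr // => hx'; exists y => //=.
  have -> : x' *m P - y = (x *m P - y) - (x - x') *m P.
    by rewrite mulmxBl; move: (x *m P) (x' *m P) => u v; apply/rowP => j; rewrite !mxE; ring.
  apply: le_lt_trans (ler_normB _ _) _; rewrite -ltrBrDl -/g.
  apply: le_lt_trans hx'; apply: le_trans (norm_mulmx _ _) _.
  by have := normr_ge0 (x - x'); have := normr_ge0 P; move: (`|_|) (`|P|) => u v *; lra.
pose V m := \bigcup_(i in [set i | (i < m)%N]) near i.
have [m hm] : exists m, Am m `<=` V m.
  apply: cpt => [m|m x [i im h]|x Ax].
  - by apply: bigcup_open => i _; exact: oN.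
  - by exists i => //; exact: ltnW.
  have [i _ Fi] := cov (x *m P) (ex_intro2 _ _ x Ax erefl).
  by exists i.+1 => //; exists i => //=; exists (x *m P) => //=; rewrite subrr normr0.
exists (m + \max_(i < m) l i)%N => M hM.
have AMm : Am M `<=` V m.
  have hmM : (m <= M)%N by apply: leq_trans hM; exact: leq_addr.
  apply: subset_trans hm; rewrite -(subnK hmM).
  by elim: (M - m)%N => [//|k IH] x; rewrite addSn => /dec; exact: IH.
have /choice[ix Hix] : forall x, exists i, Am M x -> (i < m)%N /\ near i x.
  move=> x; have [Ax|nA] := pselect (Am M x); last by exists 0%N => /nA.
  by have [i im h] := AMm x Ax; exists i.
pose fam j := [seq i <- iota 0 m | l i == j].
have mem x : Am M x -> ix x \in fam (l (ix x)).
  by move=> /Hix[im _]; rewrite mem_filter eqxx mem_iota.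
exists (fun x => l (ix x)), (fun x => index (ix x) (fam (l (ix x)))), (fun j => size (fam j)).
split=> [x Ax|j|x y Ax Ay lxy ixy].
- rewrite index_mem mem // lk0 /=; split=> //; apply: leq_trans hM.
  have [im _] := Hix x Ax; apply: leq_trans (leq_addl _ _).
  exact: (@leq_bigmax _ (fun i : 'I_m => l i) (Ordinal im)).
- rewrite -[leRHS]invrK -expRN -/(pcap s j) -[leRHS]mul1r ler_pdivlMr ?pcap_gt0 //.
  apply: le_trans (lsum m); rewrite -(big_mkord xpredT (fun i => pcap s (l i))).
  rewrite /index_iota subn0 [leRHS](bigID (fun i => l i == j)) /= -[leLHS]addr0.
  apply: lerD; last by apply: sumr_ge0 => i _; apply: ltW; exact: pcap_gt0.
  rewrite -big_filter -/(fam j) -sum1_size natr_sum mulr_suml !big_seq.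
  apply: ler_sum => i; rewrite mem_filter => /andP[/eqP -> _]; by rewrite mul1r.
have e1 : ix x = ix y.
  rewrite -(nth_index 0%N (mem x Ax)) ixy lxy; exact: nth_index (mem y Ay).
have [_ [a Fa ha]] := Hix x Ax; have [_ [b Fb hb]] := Hix y Ay.
rewrite -e1 in Fb hb; have dab := Fd _ _ _ Fa Fb.
apply: le_trans (hB x y) _; apply: le_trans (ler_wpM2r (ltW (d0 _)) hCL).
rewrite -mulrA mulrCA; apply: ler_wpM2l => //.
have -> : x *m P - y *m P = (x *m P - a) - (y *m P - b) + (a - b).
  by apply/rowP => j; rewrite !mxE; ring.
apply: le_trans (ler_normD _ _) _.
have h1 := ler_normB (x *m P - a) (y *m P - b).
rewrite /= in ha hb; move: (2 ^- _) ha hb dab h1 => z *; lra.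
Qed.
End labels.

Lemma spacing_of_floor (R : realType) (T : finType) (tt : T -> R) (N : R) (idx : T -> nat) :
  injective idx -> 0 < N -> (forall j, (idx j)%:R <= tt j * N < (idx j).+1%:R) ->
  forall c L, 0 <= L -> #|[set j | `|tt j - c| <= L]%SET|%:R <= 2 * L * N + 2.
Proof.
move=> inj N0 hidx c L L0; set S := [set j | _]%SET.
have LN := mulr_ge0 L0 (ltW N0).
have [S0|[j0 j0S]] := set_0Vmem S; first by rewrite S0 cards0; lra.
have [j1 j1S jmin] : exists2 j1, j1 \in S & forall j, j \in S -> (idx j1 <= idx j)%N.
  by case: (@arg_minnP _ j0 (mem S) idx j0S) => j1 h1 h2; exists j1.
have bd j : j \in S -> (c - L) * N - 1 < (idx j)%:R /\ (idx j)%:R <= (c + L) * N.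
  rewrite inE ler_norml => /andP[h1 h2]; have /andP[h3 h4] := hidx j.
  have h5 : (c - L) * N <= tt j * N by apply: ler_wpM2r; [exact: ltW|lra].
  have h6 : tt j * N <= (c + L) * N by apply: ler_wpM2r; [exact: ltW|lra].
  by rewrite -natr1 in h4; split; lra.
pose K := Num.truncn (2 * (L * N) + 1).
have K1 : 0 <= 2 * (L * N) + 1 by lra.
have sub : {subset [seq idx j | j <- enum S] <= iota (idx j1) K.+1}.
  move=> v /mapP[j]; rewrite mem_enum => jS ->; rewrite mem_iota jmin //=.
  rewrite addnS ltnS -leq_subLR /K truncn_ge_nat // natrB ?jmin //.
  by have [a1 a2] := bd j jS; have [b1 b2] := bd j1 j1S; lra.
have uq : uniq [seq idx j | j <- enum S] by rewrite map_inj_uniq ?enum_uniq.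
have := uniq_leq_size uq sub; rewrite size_map size_iota -cardE => hc.
apply: (@le_trans _ _ K.+1%:R); first by rewrite ler_nat.
by rewrite -natr1; have := truncn_le (2 * (L * N) + 1); rewrite K1 -/K => h; lra.
Qed.

Lemma lebesgue_bigsetU_le (R : realType) (I : Type) (r : seq I) (F : I -> set R) (a : R) :
  (forall i, measurable (F i)) -> (forall i, (lebesgue_measure (F i) <= a%:E)%E) ->
  (lebesgue_measure (\big[setU/set0]_(i <- r) F i) <= ((size r)%:R * a)%:E)%E.
Proof.
move=> mF hF; elim: r => [|i r IH]; first by rewrite big_nil measure0 mul0r.
have mB : measurable (\big[setU/set0]_(j <- r) F j).
  by apply: bigsetU_measurable => j _; exact: mF.
have h := measureU2 (@lebesgue_measure R) (mF i) mB.
rewrite big_cons; apply: le_trans h _.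
rewrite /= -natr1 mulrDl mul1r addrC EFinD; apply: leeD => //; exact: IH.
Qed.

(** * Covering the exceptional directions *)

Section cover.
Variables (R : realType) (Bp : 'M[{poly R}]_(4, 2)) (CL : nat) (e CF : R) (k0 : nat).
Hypothesis hcore : forall k : nat, (k0 <= k)%N ->
    forall (T : finType) (tt : T -> R) (W : finType) (nu : W -> R)
      (pt : W -> 'rV[R]_4) (E : T -> {set W}) (lab : T -> W -> nat) (q : nat),
    (forall j, 0 <= tt j <= 1) ->
    (forall c L, 0 <= L ->
      #|[set j | `|tt j - c| <= L]%SET|%:R <= 2 * L * 2 ^+ k + 2) ->
    (forall w, 0 <= nu w) -> \sum_w nu w = 1 ->
    (forall j, (j <= k)%N -> forall z,
      \sum_(w | disc (2 ^- j) (pt w) == z) nu w <= CF * expR (- ((2 - e) * (j%:R * ln 2)))) ->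
    (forall t, expR (- (e * (k%:R * ln 2))) <= \sum_(w in E t) nu w) ->
    (forall t w, w \in E t -> (lab t w < q)%N) ->
    q%:R <= expR ((1 + 2 * e) * (k%:R * ln 2)) ->
    (forall t w w', w \in E t -> w' \in E t -> lab t w = lab t w' ->
       `|pt w *m ev (tt t) Bp - pt w' *m ev (tt t) Bp| <= CL%:R * 2 ^- k) ->
    #|T|%:R < expR (- (e * (k%:R * ln 2))) * 2 ^+ k.

Section at_level.
Variables (W : finType) (nu : W -> R) (pt : W -> 'rV[R]_4) (M : nat).
Hypotheses (nu0 : forall w, 0 <= nu w) (nu1 : \sum_w nu w = 1).
Hypothesis frost : forall j, (j <= M)%N -> forall z,
  \sum_(w | disc (2 ^- j) (pt w) == z) nu w <= CF * pcap (2 - e) j.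

Definition bad_at (k : nat) (t : R) := 0 <= t <= 1 /\
  exists (E : {set W}) (lab : W -> nat) (q : nat),
    [/\ pcap e k <= \sum_(w in E) nu w, forall w, w \in E -> (lab w < q)%N,
        q%:R <= expR ((1 + 2 * e) * (k%:R * ln 2)) &
        forall w w', w \in E -> w' \in E -> lab w = lab w' ->
          `|pt w *m ev t Bp - pt w' *m ev t Bp| <= CL%:R * 2 ^- k].

(** One bad direction is chosen in every dyadic interval of length 2^-k that contains any. These
    directions meet the spacing condition, so [hcore] bounds the number of intervals. *)
Lemma bad_at_cover k : (k0 <= k <= M)%N ->
  exists U : set R, [/\ measurable U, (lebesgue_measure U <= (pcap e k)%:E)%E &
    forall t, bad_at k t -> U t].
Proof.
move=> /andP[k0k kM].
pose Nk := (2 ^ k)%N; have Nk0 : 0 < 2 ^+ k :> R by rewrite exprn_gt0.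
pose ix (t : R) : nat := Num.truncn (t * 2 ^+ k).
have ixP t : 0 <= t -> (ix t)%:R <= t * 2 ^+ k < (ix t).+1%:R.
  by move=> t0; apply: truncn_itv; rewrite mulr_ge0 // ltW.
have ixlt t : 0 <= t <= 1 -> (ix t < Nk.+1)%N.
  move=> /andP[t0 t1]; rewrite ltnS -(ler_nat R); have /andP[h _] := ixP t t0.
  apply: le_trans h _; rewrite natrX -[leRHS]mul1r; apply: ler_wpM2r => //; exact: ltW.
pose Q (i : 'I_Nk.+1) := `[< exists2 t, bad_at k t & ix t = i >].
pose T : finType := {i | Q i}.
have /choice[tt Htt] : forall j : T, exists t, bad_at k t /\ ix t = val j.
  by move=> [i Qi]; have /asboolP[t h1 h2] := Qi; exists t.
have tt01 j : 0 <= tt j <= 1 by have [[]] := Htt j.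
have /choice[E HE] : forall j : T, exists E : {set W}, exists (lab : W -> nat) (q : nat),
    [/\ pcap e k <= \sum_(w in E) nu w, forall w, w \in E -> (lab w < q)%N,
        q%:R <= expR ((1 + 2 * e) * (k%:R * ln 2)) &
        forall w w', w \in E -> w' \in E -> lab w = lab w' ->
          `|pt w *m ev (tt j) Bp - pt w' *m ev (tt j) Bp| <= CL%:R * 2 ^- k].
  by move=> j; have [[]] := Htt j.
have /choice[lab Hlab] := HE.
(* A single label bound for all directions is required; the largest admissible integer serves. *)
pose q := Num.truncn (expR ((1 + 2 * e) * (k%:R * ln 2))).
have q0 := expR_ge0 ((1 + 2 * e) * (k%:R * ln 2)).
have hT : #|T|%:R < expR (- (e * (k%:R * ln 2))) * 2 ^+ k.
  apply: (@hcore k k0k T tt W nu pt E lab q) => //.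
  - apply: (spacing_of_floor (idx := fun j : T => val (val j) : nat)) => // [i j /val_inj/val_inj //|j].
    have [_ ixj] := Htt j; have /andP[tj0 _] := tt01 j.
    by have := ixP _ tj0; rewrite ixj.
  - by move=> j jk z; apply: frost; apply: leq_trans kM.
  - by move=> j; have [q' []] := Hlab j.
  - move=> j w wE; have [q' [_ h1 h2 _]] := Hlab j; apply: leq_trans (h1 w wE) _.
    by rewrite /q truncn_ge_nat.
  - by rewrite /q truncn_le.
  - by move=> j w w' h1 h2; have [q' [_ _ _ h]] := Hlab j; apply: h.
pose Iv (j : T) : set R := `[(val (val j))%:R / 2 ^+ k, (val (val j)).+1%:R / 2 ^+ k]%classic.
exists (\big[setU/set0]_(j <- enum T) Iv j); split.
- by apply: bigsetU_measurable => j _; exact: measurable_itv.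
- have lI j : (lebesgue_measure (Iv j) <= (2 ^- k)%:E)%E.
    rewrite /Iv lebesgue_measure_itv /= lte_fin ltr_pM2r ?invr_gt0 // ltr_nat ltnSn.
    by rewrite -EFinB lee_fin -mulrBl -natr1 addrAC subrr add0r mul1r.
  apply: le_trans (lebesgue_bigsetU_le _ _ lI) _; first by move=> j; exact: measurable_itv.
  rewrite lee_fin -cardE -ler_pdivlMr ?invr_gt0 // invrK; exact: ltW.
- move=> t bt; have [t01 _] := bt; have t0 := andP t01.
  have Qt : Q (Ordinal (ixlt t t01)) by apply/asboolP; exists t.
  rewrite (big_rem (exist (fun i => Q i) (Ordinal (ixlt t t01)) Qt : T)) ?mem_enum //=; left.
  have /andP[h1 h2] := ixP t t0.1.
  by rewrite /Iv /= in_itv /= ler_pdivrMr // ler_pdivlMr // h1 ltW.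
Qed.
End at_level.

(** [U] comes from a Frostman measure on one point per occupied cell of side 2^-M, before any [t] is
    considered. For a labelled [t] the levels partition these points; as the thresholds [pcap e k]
    sum to less than 1, some level reaches its threshold, and [t] is bad at that scale. *)
Lemma labelled_cover (S : set 'rV[R]_4) (r c : R) (M : nat) :
  0 < c -> c^-1 <= CF -> (forall x, S x -> `|x| <= r) ->
  (c%:E < content (pcap (2 - e)) S)%E -> \sum_(k0 <= k < M.+1) pcap e k < 1 ->
  exists U : set R, [/\ measurable U,
    (lebesgue_measure U <= (\sum_(k0 <= k < M.+1) pcap e k)%:E)%E &
    forall t, 0 <= t <= 1 -> labelled (1 + 2 * e) CL S k0 M (ev t Bp) -> U t].
Proof.
move=> c0 hCF Sr hc tail.
have dM : 0 < 2 ^- M :> R by rewrite invr_gt0 exprn_gt0.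
have [zs _ hzs] := @disc_near R 4 (2 ^- M) (Num.truncn (r * 2 ^+ M)).+1 0 dM.
have Szs x : S x -> disc (2 ^- M) x \in zs.
  move=> Sx; apply: hzs; rewrite subr0; apply: le_trans (Sr x Sx) _.
  have r0 : 0 <= r by apply: le_trans (Sr x Sx).
  rewrite ler_pdivlMr ?exprn_gt0 //; apply: ltW.
  by have /andP[] : (Num.truncn (r * 2 ^+ M))%:R <= r * 2 ^+ M < (Num.truncn (r * 2 ^+ M)).+1%:R
    by apply: truncn_itv; rewrite mulr_ge0 // exprn_ge0.
pose Q (i : 'I_(size zs)) := `[< exists2 x, S x & disc (2 ^- M) x = nth 0 zs i >].
pose W : finType := {i | Q i}.
have /choice[pt Hpt] : forall w : W, exists x, S x /\ disc (2 ^- M) x = nth 0 zs (val w).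
  by move=> [i Qi]; have /asboolP[x h1 h2] := Qi; exists x.
have Wx x : S x -> exists w : W, disc (2 ^- M) (pt w) = disc (2 ^- M) x.
  move=> Sx; have iz : (index (disc (2 ^- M) x) zs < size zs)%N by rewrite index_mem Szs.
  have Qi : Q (Ordinal iz) by apply/asboolP; exists x => //; rewrite nth_index ?Szs.
  exists (exist (fun i => Q i) (Ordinal iz) Qi); have [_ ->] := Hpt (exist (fun i => Q i) _ Qi).
  by rewrite nth_index ?Szs.
have cap0 := pcap_gt0 (2 - e).
have [mu [jj [mu0 mucap jjM musum]]] := frostman_finite pt M cap0.
set tot_mu := \sum_w mu w in musum; set qs := undup _ in musum.
have mu_c : c < tot_mu.
  have cov : covers S [set` qs].
    move=> x Sx; have [w ww] := Wx x Sx.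
    exists (jj w, disc (2 ^- jj w) (pt w)).
      by rewrite /= mem_undup; apply/mapP; exists w; rewrite ?mem_enum.
    by rewrite /in_cube /=; apply: esym; apply: disc_coarser (jjM w) ww.
  rewrite -lte_fin; apply: lt_le_trans hc _; apply: le_trans (content_le _ cov) _.
  have fq : finite_set [set` qs] by exact: finite_seq.
  rewrite -musum /tot (esum_fset fq); last by move=> q _; rewrite lee_fin ltW.
  by rewrite -fsbig_seq ?undup_uniq // sumEFin.
have tm0 : 0 < tot_mu by apply: lt_trans mu_c.
pose nu w := mu w / tot_mu.
have nu0 w : 0 <= nu w by rewrite divr_ge0 // ltW.
have nu1 : \sum_w nu w = 1 by rewrite -mulr_suml mulfV // gt_eqF.
have frost j : (j <= M)%N -> forall z,
    \sum_(w | disc (2 ^- j) (pt w) == z) nu w <= CF * pcap (2 - e) j.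
  move=> jM z; rewrite -mulr_suml mulrC; apply: ler_pM; rewrite ?invr_ge0 ?(ltW tm0) //.
  - by apply: sumr_ge0.
  - by apply: le_trans hCF; rewrite lef_pV2 ?posrE // ltW.
  - exact: mucap.
have /choice[U HU] : forall k, exists U : set R, (k0 <= k <= M)%N ->
    [/\ measurable U, (lebesgue_measure U <= (pcap e k)%:E)%E &
      forall t, bad_at nu pt k t -> U t].
  move=> k; have [h|nh] := boolP (k0 <= k <= M)%N; last by exists set0.
  by have [U hU] := bad_at_cover nu0 nu1 frost h; exists U.
pose UU := \big[setU/set0]_(k0 <= k < M.+1) (if (k0 <= k <= M)%N then U k else set0).
have mU k : measurable (if (k0 <= k <= M)%N then U k else set0).
  by case: ifP => [/HU[]//|_]; exact: measurable0.
exists UU; split; first by apply: bigsetU_measurable => k _; exact: mU.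
  rewrite /UU; have : forall k, k \in index_iota k0 M.+1 -> (k0 <= k <= M)%N.
    by move=> k; rewrite mem_index_iota ltnS.
  elim: (index_iota k0 M.+1) => [|k s IH] hs; first by rewrite !big_nil measure0.
  have hk := hs k (mem_head _ _).
  have mB : measurable (\big[setU/set0]_(j <- s) (if (k0 <= j <= M)%N then U j else set0)).
    by apply: bigsetU_measurable => j _; exact: mU.
  rewrite !big_cons hk; have [mUk lUk _] := HU k hk.
  apply: le_trans (measureU2 (@lebesgue_measure R) mUk mB) _.
  rewrite EFinD; apply: leeD => //; apply: IH => j js; apply: hs.
  by rewrite inE js orbT.
move=> t t01 [lev [lab [q [h1 h2 h3]]]].
have [k kM [hk bk]] : exists2 k, (k0 <= k <= M)%N & (k0 <= k <= M)%N /\ bad_at nu pt k t.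
  pose Ek (k : nat) : {set W} := [set w | lev (pt w) == k]%SET.
  have Spt w : S (pt w) by have [] := Hpt w.
  have levM w : (k0 <= lev (pt w) <= M)%N by have [] := h1 _ (Spt w).
  have [k hk mk] : exists2 k, (k0 <= k <= M)%N & pcap e k <= \sum_(w in Ek k) nu w.
    apply: contrapT => no.
    have lt k : (k0 <= k <= M)%N -> \sum_(w in Ek k) nu w <= pcap e k.
      by move=> hk; rewrite leNgt; apply/negP => /ltW h; apply: no; exists k.
    have : \sum_w nu w <= \sum_(k0 <= k < M.+1) pcap e k.
      have -> : \sum_w nu w = \sum_(k0 <= k < M.+1) \sum_(w in Ek k) nu w.
        rewrite (exchange_big_dep xpredT) //=; apply: eq_bigr => w _.
        rewrite (big_rem (lev (pt w))) /=; last by rewrite mem_index_iota ltnS levM.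
        rewrite inE eqxx big_seq_cond big1 ?addr0 // => k /andP[].
        rewrite mem_rem_uniq ?iota_uniq // inE => /andP[kn _]; rewrite inE => /eqP kE.
        by rewrite kE eqxx in kn.
      by rewrite !big_seq; apply: ler_sum => k; rewrite mem_index_iota ltnS; exact: lt.
    by rewrite nu1 leNgt tail.
  exists k => //; split=> //; split=> //; exists (Ek k), (fun w => lab (pt w)), (q k); split=> //.
  - by move=> w; rewrite inE => /eqP <-; have [] := h1 _ (Spt w).
  - move=> w w'; rewrite !inE => /eqP e1 /eqP e2 el; rewrite -e1.
    by apply: h3 => //; rewrite e1 e2.
have [_ _ hU] := HU k hk; have := hU t bk.
rewrite /UU (big_rem k) /=; last by rewrite mem_index_iota ltnS.
by rewrite hk; left.
Qed.
End cover.

(** * Orthogonal projections *)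

Section orthoproj.
Variable R : realType.

Lemma mul_tr_eq0 (n : nat) (u : 'rV[R]_n) : u *m u^T = 0 -> u = 0.
Proof.
move=> h; apply/rowP => j; rewrite mxE.
have := congr1 (fun M : 'M[R]_1 => M 0 0) h; rewrite !mxE => /eqP.
rewrite psumr_eq0; last by move=> i _; rewrite mxE -expr2 sqr_ge0.
by move=> /allP/(_ j (mem_index_enum _)); rewrite mxE mulf_eq0 orbb => /eqP.
Qed.

Lemma sub_tr_eq0 (m n : nat) (U : 'M[R]_(m, n)) (u : 'rV[R]_n) :
  (u <= U)%MS -> u *m U^T = 0 -> u = 0.
Proof.
by move=> /submxP[z uE] h; apply: mul_tr_eq0; rewrite {2}uE trmx_mul mulmxA h mul0mx.
Qed.

Lemma orthomx_mul_tr (m n : nat) (U : 'M[R]_(m, n)) (u : 'rV[R]_n) :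
  (u <= orthomx idfun 1%:M U)%MS -> u *m U^T = 0.
Proof. by move=> /sub_kermxP; rewrite mul1mx map_mx_id. Qed.

Lemma orthoproj_compl (m n : nat) (U : 'M[R]_(m, n)) (x : 'rV[R]_n) :
  (x - x *m orthoproj U) *m U^T = 0.
Proof.
apply: orthomx_mul_tr; apply: proj_mx_compl_sub; apply: submx_full.
set W := orthomx _ _ _.
have cap0 : (<<U>> :&: W)%MS = 0.
  apply/row_matrixP => i; rewrite row0; set u := row i _.
  have : (u <= <<U>> :&: W)%MS by apply: row_sub.
  rewrite sub_capmx genmxE => /andP[uU uW].
  exact: sub_tr_eq0 uU (orthomx_mul_tr uW).
rewrite -col_leq_rank -(leq_add2r (\rank (<<U>> :&: W)%MS)) mxrank_sum_cap cap0 mxrank0 addn0.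
rewrite mxrank_gen /W /orthomx mxrank_ker mul1mx map_mx_id //.
by rewrite mxrank_tr subnKC ?rank_leq_col.
Qed.

Lemma orthoproj_sub (m n : nat) (U : 'M[R]_(m, n)) (x : 'rV[R]_n) : (x *m orthoproj U <= U)%MS.
Proof. by rewrite -(genmxE U); apply: proj_mx_sub. Qed.

Section plane.
Variables b1 b2 : 'rV[R]_4.
Let Pi : 'M[R]_4 := (b1 + b2)%MS.
Definition frame2 : 'M[R]_(4, 2) := (col_mx b1 b2)^T.

Let PiE : (Pi :=: col_mx b1 b2)%MS. Proof. exact: addsmxE. Qed.

Lemma orthoproj_frame2 (x : 'rV[R]_4) : x *m frame2 = x *m orthoproj Pi *m frame2.
Proof.
apply/eqP; rewrite -subr_eq0 -mulmxBl; apply/eqP.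
have h : (col_mx b1 b2 <= Pi)%MS by rewrite PiE.
have [z zE] := submxP h.
by rewrite /frame2 zE trmx_mul mulmxA orthoproj_compl mul0mx.
Qed.

Lemma frame2_inj (x : 'rV[R]_4) : x *m frame2 = 0 -> x *m orthoproj Pi = 0.
Proof.
rewrite orthoproj_frame2 => h; apply: (sub_tr_eq0 (U := col_mx b1 b2)) h.
by rewrite -PiE; apply: orthoproj_sub.
Qed.

Lemma rank_frame2 : \rank frame2 = \rank Pi.
Proof. by rewrite mxrank_tr PiE. Qed.
End plane.

Lemma wedge_dep (u v : 'rV[R]_2) : wedge u v = 0 ->
  exists a b : R, (a != 0) || (b != 0) /\ a *: u + b *: v = 0.
Proof.
rewrite /wedge => w0.
have two (z : 'rV[R]_2) : z 0 0 = 0 -> z 0 1 = 0 -> z = 0.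
  move=> h0 h1; apply/rowP => j; rewrite mxE; case: (ord2P j) => ->; by [].
have [v0|v0] := eqVneq (v 0 0) 0.
  have [v1|v1] := eqVneq (v 0 1) 0.
    exists 0, 1; rewrite oner_eq0 orbT; split=> //.
    by rewrite scale0r add0r scale1r; apply: two.
  exists (v 0 1), (- u 0 1); rewrite v1; split=> //; apply: two; rewrite !mxE.
    by rewrite mulrC mulNr.
  by ring.
exists (v 0 0), (- u 0 0); rewrite v0; split=> //; apply: two; rewrite !mxE; first by ring.
by rewrite -[RHS]oppr0 -w0; ring.
Qed.

Lemma rank_addsmx2 (n : nat) (x y : 'rV[R]_n) :
  (forall a b : R, a *: x + b *: y = 0 -> a = 0 /\ b = 0) -> \rank (x + y)%MS = 2%N.
Proof.
move=> indep; rewrite addsmxE; apply/eqP; rewrite -[_ == _]/(row_free (col_mx x y)) -kermx_eq0.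
apply/eqP/row_matrixP => i; rewrite row0.
set u : 'rV[R]_(1 + 1) := row i _.
have : (u <= kermx (col_mx x y))%MS by apply: row_sub.
move=> /sub_kermxP; rewrite -[u]hsubmxK mul_row_col.
rewrite [lsubmx u]mx11_scalar [rsubmx u]mx11_scalar !mul_scalar_mx => /indep[-> ->].
by rewrite !raddf0 row_mx0.
Qed.
End orthoproj.

(** * Tail sums and null sets *)

Section measure0.
Variable R : realType.

Lemma pcap_tail (s a : R) (k1 : nat) : 0 < s -> 0 < a ->
  exists2 k0, (k1 <= k0)%N & forall M, \sum_(k0 <= k < M.+1) pcap s k <= a.
Proof.
move=> s0 a0; pose rho := pcap s 1.
have rE k : pcap s k.+1 = rho * pcap s k.
  by rewrite /rho /pcap -expRD -natr1; congr expR; ring.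
have r0 : 0 < rho := pcap_gt0 s 1.
have r1 : rho < 1.
  have p0 : 0 < s * (1%:R * ln 2) by rewrite mul1r mulr_gt0 // ln2_gt0.
  by rewrite /rho /pcap -[ltRHS]expR0 ltr_expR oppr_lt0.
have r10 : 0 < 1 - rho by rewrite subr_gt0.
have [k2 hk2] := pcap_small s0 (mulr_gt0 a0 r10).
exists (maxn k1 k2) => [|M]; first exact: leq_maxl.
set k0 := maxn k1 k2.
have tel m : (1 - rho) * \sum_(k0 <= k < m + k0) pcap s k = pcap s k0 - pcap s (m + k0).
  elim: m => [|m IH]; first by rewrite big_geq // mulr0 subrr.
  by rewrite addSn big_nat_recr ?leq_addl //= mulrDr IH rE; ring.
have [Mk|kM] := leqP M.+1 k0; first by rewrite big_geq ?(ltW a0).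
rewrite -(subnK (ltnW kM)) -(ler_pM2l r10) tel.
apply: (@le_trans _ _ (pcap s k0)); first by rewrite lerBlDr lerDl ltW // pcap_gt0.
by rewrite mulrC; apply: hk2; exact: leq_maxr.
Qed.

(** [Z] lies in the lower limit of the [U M], the increasing union of the intersections of their
    tails. Each intersection has measure at most [a], and continuity from below passes this to the
    union. *)
Lemma negligible_liminf (Z : set R) :
  (forall a : R, 0 < a -> exists U : nat -> set R,
    [/\ forall M, measurable (U M), forall M, (lebesgue_measure (U M) <= a%:E)%E &
        forall t, Z t -> exists M0, forall M, (M0 <= M)%N -> U M t]) ->
  lebesgue_measure.-negligible Z.
Proof.
move=> h.
have step (a : R) : 0 < a -> exists V : set R,
    [/\ measurable V, (lebesgue_measure V <= a%:E)%E & Z `<=` V].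
  move=> /h[U [mU lU ZU]].
  pose V m := \bigcap_(M in [set M | (m <= M)%N]) U M.
  have mV m : measurable (V m).
    apply: bigcap_measurable => [|M _]; last exact: mU.
    by exists m; exact: leqnn.
  have mVV : measurable (\bigcup_m V m) by apply: bigcupT_measurable.
  have Vinc : {homo V : n m / (n <= m)%N >-> (n <= m)%O}.
    by move=> i j ij; apply/subsetPset => t ht M /= jM; apply: ht; apply: leq_trans jM.
  exists (\bigcup_m V m); split=> //; last first.
    by move=> t /ZU[M0 hM]; exists M0 => // M; exact: hM.
  have cv := nondecreasing_cvg_mu (mu := @lebesgue_measure R) mV mVV Vinc.
  rewrite -(cvg_lim _ cv) //; apply: lime_le; first by apply/cvg_ex; eexists; exact: cv.
  apply: nearW => m /=; apply: le_trans (lU m); apply: le_measure.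
  - by rewrite inE; exact: mV.
  - by rewrite inE; exact: mU.
  - by move=> t h'; apply: (h' m); exact: leqnn.
have /choice[V HV] : forall n : nat, exists V : set R,
    [/\ measurable V, (lebesgue_measure V <= (n.+1%:R^-1)%:E)%E & Z `<=` V].
  by move=> n; apply: step; rewrite invr_gt0.
have mI : measurable (\bigcap_n V n) by apply: bigcapT_measurable => n; have [] := HV n.
exists (\bigcap_n V n); split=> //; last first.
  by move=> t Zt n _; have [_ _ ZV] := HV n; exact: ZV.
apply/eqP; rewrite eq_le measure_ge0 andbT; apply/lee_addgt0Pr => ep ep0; rewrite add0e.
have [mV lV _] := HV (Num.truncn ep^-1).
apply: (@le_trans _ _ (lebesgue_measure (V (Num.truncn ep^-1)))).
  by apply: le_measure; rewrite ?inE // => t h'; exact: (h' _ I).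
by apply: le_trans lV _; rewrite lee_fin ltW // truncn_inv_lt.
Qed.
End measure0.

(** * From the rank hypothesis to the theorem *)

Section family.
Variable R : realType.

Lemma pb_exists (m k : nat) (A : 'M[{poly R}]_(m, k)) :
  exists n CB, [/\ (0 < n)%N, 1 <= CB & forall i j, pb n CB (A i j)].
Proof.
pose n := (\max_(ij : 'I_m * 'I_k) size (A ij.1 ij.2)).+1.
pose CB : R := 1 + \sum_(ij : 'I_m * 'I_k) \sum_(l < n) `|(A ij.1 ij.2)`_l|.
have S0 (ij : 'I_m * 'I_k) : 0 <= \sum_(l < n) `|(A ij.1 ij.2)`_l| by apply: sumr_ge0.
have CB1 : 1 <= CB by rewrite lerDl; apply: sumr_ge0.
exists n, CB; split=> // i j.
have sz : (size (A i j) <= n)%N.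
  by apply: leqW; exact: (@leq_bigmax _ (fun ij : 'I_m * 'I_k => size (A ij.1 ij.2)) (i, j)).
split=> // l; have [ln|nl] := ltnP l n; last first.
  by rewrite nth_default ?normr0 ?(le_trans ler01) //; apply: leq_trans nl.
rewrite /CB (bigD1 (i, j)) //= (bigD1 (Ordinal ln)) //= addrA addrAC addrA.
have h1 : 0 <= \sum_(i0 < n | i0 != Ordinal ln) `|(A i j)`_i0| by apply: sumr_ge0.
have h2 : 0 <= \sum_(ij | ij != (i, j)) \sum_(l < n) `|(A ij.1 ij.2)`_l| by apply: sumr_ge0.
by move: (\sum_(_ < n | _) _) (\sum_(_ | _) _) (`|_|) h1 h2 => u v z *; lra.
Qed.

Lemma unit_itv_infinite : infinite_set [set t : R | t \in `[0, 1]].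
Proof.
move=> fin; pose f (n : nat) : R := n.+1%:R^-1.
have inj : injective f by move=> i j /invr_inj /eqP; rewrite eqr_nat eqSS => /eqP.
apply: (@infinite_nat); apply: (sub_finite_set (B := f @^-1` [set t : R | t \in `[0, 1]])).
  move=> n _ /=; rewrite in_itv /= /f invr_ge0 ler0n /= invf_le1 // ler1n //.
by apply: finite_preimage fin => i j _ _; exact: inj.
Qed.

Variables b1 b2 : R -> 'rV[R]_4.
Variable Bp : 'M[{poly R}]_(4, 2).
Hypothesis evB : forall t, t \in `[0, 1] -> ev t Bp = frame2 (b1 t) (b2 t).
Let Pi (t : R) := (b1 t + b2 t)%MS.
Let P (t : R) := orthoproj (Pi t).
Hypothesis rankPi : forall t, t \in `[0, 1] -> \rank (Pi t) = 2%N.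
Hypothesis transversal : forall V : 'M[R]_4,
    finite_set [set t : R | t \in `[0, 1] /\
                            \rank (V *m P t)%R <> minn (\rank V) 2].

(** The unit interval is infinite, so some [t] is not exceptional for the plane of [x] and [y],
    which then meets the kernel of [P t] trivially. If [pw] were zero, a nonzero vector would lie in
    both. *)
Lemma pw_neq0 (x y : 'rV[R]_4) :
  (forall a b : R, a *: x + b *: y = 0 -> a = 0 /\ b = 0) -> pw Bp x y != 0.
Proof.
move=> indep; apply/negP => /eqP p0.
pose V : 'M[R]_4 := (x + y)%MS.
have rV : \rank V = 2%N by apply: rank_addsmx2.
have [t t01 rt] : exists2 t, t \in `[0, 1] & \rank (V *m P t) = 2%N.
  apply: contrapT => no; apply: unit_itv_infinite; apply: sub_finite_set (transversal V).
  by move=> t t01; split=> // h; apply: no; exists t => //; rewrite h rV.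
have w0 : wedge (x *m ev t Bp) (y *m ev t Bp) = 0 by rewrite -pw_horner p0 horner0.
have [a [b [ab0 h]]] := wedge_dep w0.
pose u := a *: x + b *: y.
have uP : u *m P t = 0.
  by apply: frame2_inj; rewrite -evB // mulmxDl -!scalemxAl.
have uV : (u <= V)%MS.
  by apply: addmx_sub; apply: scalemx_sub; [exact: addsmxSl|exact: addsmxSr].
have cap0 : (V :&: kermx (P t))%MS = 0.
  apply/eqP; rewrite -mxrank_eq0 -(eqn_add2l (\rank (V *m P t))) mxrank_mul_ker rt rV.
  by [].
have : (u <= V :&: kermx (P t))%MS.
  by rewrite sub_capmx uV; apply/sub_kermxP.
rewrite cap0 submx0 => /eqP/indep[a0 b0].
by rewrite a0 b0 eqxx in ab0.
Qed.

(** The level [M] from which [Am M] is labelled depends on [t], so no single [U M] contains all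
    exceptional directions; they lie in the lower limit of the [U M], whose measures share one
    bound. *)
Lemma projections_ae : exists2 eps : R, 0 < eps &
    forall A : set 'rV[R]_4,
      borel_set A -> hausdorff_dim A = 2%:E ->
      {ae lebesgue_measure, forall t : R, t \in `[0, 1] ->
        ((1 + eps)%:E < hausdorff_dim [set x *m P t | x in A])%E}.
Proof.
have [n [CB [n0 CB1 pbB]]] := pb_exists Bp.
pose be := 4 * (n%:R * CB).
have be0 : 0 <= be by rewrite mulr_ge0 // mulr_ge0 // (le_trans ler01).
pose CL := (Num.truncn (3 * be)).+1.
have CLb : 3 * be <= CL%:R.
  apply: ltW; have b3 : 0 <= 3 * be by rewrite mulr_ge0.
  by have /andP[] := truncn_itv b3.
have rk b : 0 <= b <= 1 -> \rank (ev b Bp) = 2%N.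
  by move=> b01; rewrite evB ?in_itv //= rank_frame2; apply: rankPi; rewrite in_itv.
have [e /andP[e0 e1] hcore] := core CL n0 CB1 pbB pw_neq0 rk.
exists e => // A bA dimA.
have s0 : 0 < 2 - e by lra.
have cA : (0 < content (pcap (2 - e)) A)%E.
  rewrite lt_def content_ge0 ?andbT; last by move=> j; apply: ltW; exact: pcap_gt0.
  apply/eqP => c0; apply: (hausdorff_measure_neq0 (A := A) (ltW s0)).
    by rewrite dimA lte_fin; lra.
  exact: hausdorff_content c0.
have [c c0 hc] : exists2 c : R, 0 < c & (c%:E < content (pcap (2 - e)) A)%E.
  case: (content _ _) cA => // [r|_]; last by exists 1 => //; rewrite ltry.
  by rewrite lte_fin => r0; exists (r / 2); [lra|rewrite lte_fin; lra].
have cap0 j : 0 <= pcap (2 - e) j by apply: ltW; exact: pcap_gt0.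
have [Am [dec AmA [r Amr] Amc cpt]] := analytic_capacity cap0 (borel_analytic bA) hc.
pose CF := Num.max 1 c^-1.
have CF1 : 1 <= CF by rewrite le_max lexx.
have CFc : c^-1 <= CF by rewrite le_max lexx orbT.
have [k1 {}hcore] := hcore CF CF1.
pose Z := [set t : R | t \in `[0, 1] /\ (hausdorff_dim [set (x *m P t : 'rV[R]_4) | x in A] <= (1 + e)%:E)%E].
have nZ : lebesgue_measure.-negligible Z.
  apply: negligible_liminf => a a0.
  (* The scales start so late that the exceptional intervals have total length at most [a]; the
     bound 1/2 keeps the sum of the thresholds below the total mass 1 in [labelled_cover]. *)
  have a1 : 0 < Num.min a (1 / 2) by rewrite lt_min a0; lra.
  have [k0 k10 hk0] := pcap_tail k1 e0 a1.
  have /choice[U HU] : forall M, exists U : set R, [/\ measurable U,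
      (lebesgue_measure U <= (\sum_(k0 <= k < M.+1) pcap e k)%:E)%E &
      forall t, 0 <= t <= 1 -> labelled (1 + 2 * e) CL (Am M) k0 M (ev t Bp) -> U t].
    move=> M; apply: (@labelled_cover R Bp CL e CF k0 _ (Am M) r c M c0 CFc (Amr M) (Amc M)).
      by move=> k hk; apply: hcore; apply: leq_trans hk.
    by apply: le_lt_trans (hk0 M) _; rewrite gt_min; apply/orP; right; lra.
  exists U; split.
  - by move=> M; have [] := HU M.
  - move=> M; have [_ h _] := HU M; apply: le_trans h _; rewrite lee_fin.
    by apply: le_trans (hk0 M) _; rewrite ge_min lexx.
  move=> t [t01 dt].
  (* Labels are counted with exponent [1 + 2 * e], strictly above the dimension [1 + e] allowed in
     [Z]; the gap is what [small_cover] needs. *)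
  have s10 : 0 < 1 + 2 * e by lra.
  have dt' : (hausdorff_dim [set (x *m P t : 'rV[R]_4) | x in A] < (1 + 2 * e)%:E)%E.
    by apply: le_lt_trans dt _; rewrite lte_fin; lra.
  have t01' : 0 <= t <= 1 by move: t01; rewrite in_itv.
  have lip (x y : 'rV[R]_4) : `|x *m ev t Bp - y *m ev t Bp| <= be * `|x *m P t - y *m P t|.
    rewrite -mulmxBl evB // orthoproj_frame2 -evB // mulmxBl.
    apply: le_trans (norm_mulmx _ _) _; rewrite mulrA [leRHS]mulrC /be.
    have nB : `|ev t Bp| <= n%:R * CB.
      apply: mx_norm_le => [|i j]; first by rewrite mulr_ge0 // (le_trans ler01).
      by rewrite mxE; apply: pb_horner.
    have := ler_wpM2l (normr_ge0 (x *m P t - y *m P t)) nB; rewrite -/(Pi t) -/(P t); lra.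
  have [M0 hM0] := labelled_of_dim k0 s10 dt' lip be0 CLb dec AmA cpt.
  by exists M0 => M hM; have [_ _ h] := HU M; apply: h => //; exact: hM0.
apply: negligibleS nZ => t /= /not_implyP[t01 /negP]; rewrite -leNgt => h; by split.
Qed.
End family.

Theorem theorem1p7 (R : realType) (b1 b2 : R -> 'rV[R]_4)
    (hb1 : forall i, polynomial_on `[0, 1] (fun t => b1 t 0 i))
    (hb2 : forall i, polynomial_on `[0, 1] (fun t => b2 t 0 i)) :
  let Pi (t : R) := (b1 t + b2 t)%MS in
  let P (t : R) := orthoproj (Pi t) in
  (forall t, t \in `[0, 1] -> \rank (Pi t) = 2%N) ->
  (forall V : 'M[R]_4,
    finite_set [set t : R | t \in `[0, 1] /\
                            \rank (V *m P t)%R <> minn (\rank V) 2]) ->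
  exists2 eps : R, 0 < eps &
    forall A : set 'rV[R]_4,
      borel_set A -> hausdorff_dim A = 2%:E ->
      {ae lebesgue_measure, forall t : R, t \in `[0, 1] ->
        ((1 + eps)%:E < hausdorff_dim [set x *m P t | x in A])%E}.
Proof.
move=> Pi P rankPi transversal.
have /choice[p Hp] := hb1; have /choice[q Hq] := hb2.
pose Bp : 'M[{poly R}]_(4, 2) := \matrix_(i, j) (if j == 0 then p i else q i).
have evB t : t \in `[0, 1] -> ev t Bp = frame2 (b1 t) (b2 t).
  move=> t01; apply/matrixP => i j; rewrite [LHS]mxE [RHS]mxE /horner_eval [Bp i j]mxE.
  case: (ord2P j) => -> /=.
    rewrite -(Hp i t t01); have -> : 0 = lshift 1 0 :> 'I_(1 + 1) by exact: val_inj.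
    by rewrite col_mxEu.
  rewrite -(Hq i t t01); have -> : 1 = rshift 1 0 :> 'I_(1 + 1) by exact: val_inj.
  by rewrite col_mxEd.
exact: projections_ae evB rankPi transversal.
Qed.
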